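(* Let $n=2m+1\ge3$, let $A_0,\dots,A_{2m}>0$, $\phi_0\in\mathbb R$, and let $(p_0,\ldots,p_{2m},q)$ be real numbers with $$\sum_{a=0}^{2m}p_a=1,\qquad\sum_{a=0}^{2m}p_a^2+q^2=1,\qquad\chi_r:=1+p_0-p_{2r-1}-p_{2r}>0\quad(1\le r\le m).$$ Define $$\kappa_r=\frac{A_0}{A_{2r-1}A_{2r}},\qquad F_r(\tau)=1+\frac{\kappa_r^2}{4\chi_r^2}e^{2\chi_r\tau}.$$ For all $\tau\in\mathbb R$, the metric $g=-N^2\mathrm d\tau^2+\sum_{a=0}^{2m}a_a^2(\omega^a)^2$ on $\mathbb R_\tau\times H_{2m+1}$ and the function $\phi$ given by $$a_0=A_0e^{p_0\tau}\prod_{r=1}^mF_r^{-1/2},\quad a_{2r-1}=A_{2r-1}e^{p_{2r-1}\tau}F_r^{1/2},\quad a_{2r}=A_{2r}e^{p_{2r}\tau}F_r^{1/2},$$ $$N=e^\tau\prod_{r=1}^mF_r^{1/2},\qquad\phi=q\tau+\phi_0$$ solve $\operatorname{Ric}(g)=\mathrm d\phi\otimes\mathrm d\phi$ and $\Box_g\phi=0$. Their proper-time range is $(0,\infty)$, and every discrete left quotient is future timelike and null geodesically complete. If some horizontal exponent $p_i<0$ ($1\le i\le2m$), every such quotient is globally $C^0$-inextendible. The case $q=0$ is vacuum.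
   Context: $H_{2m+1}$ is the simply connected Heisenberg group with left-invariant coframe $\omega^0,\dots,\omega^{2m}$ satisfying $\mathrm d\omega^0=-\sum_{r=1}^m\omega^{2r-1}\wedge\omega^{2r}$, $\mathrm d\omega^i=0$ for $1\le i\le2m$. Proper time is $t=\int_{-\infty}^\tau N$. $\partial_\tau$ is future directed. A discrete left quotient is $\Gamma\backslash H_{2m+1}$ with $\Gamma$ a discrete subgroup (possibly trivial), with descended metric. Future timelike and null geodesically complete: every future-directed timelike or null geodesic extends to infinite affine parameter. Globally $C^0$-inextendible: there is no connected Hausdorff second-countable smooth manifold of the same dimension with a continuous Lorentzian metric admitting a smooth isometric embedding of the spacetime onto a proper open subset. *)

(* Defs.v *)
From HB Require Import structures.
From mathcomp Require Import all_boot all_order all_algebra.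
From mathcomp Require Import all_classical all_reals all_analysis.
From mathcomp Require Import ring.

Set Implicit Arguments.
Unset Strict Implicit.
Unset Printing Implicit Defensive.

Import Order.TTheory GRing.Theory Num.Theory.
Import numFieldNormedType.Exports.

Local Open Scope classical_set_scope.
Local Open Scope ring_scope.

Section calculus.
Context {R : realType} {d : nat}.

Definition partial {V : normedModType R} (f : 'rV[R]_d -> V) (i : 'I_d) :
  'rV[R]_d -> V := fun x => 'D_(delta_mx 0 i) f x.

(* [U] is meant to be open, so that the junk values of [partial f i] outside
   [U] play no role. *)
Fixpoint Ck (k : nat) {V : normedModType R} (U : set 'rV[R]_d)
    (f : 'rV[R]_d -> V) : Prop :=
  (forall x, U x -> {for x, continuous f}) /\
  (if k is k'.+1 then
     forall i, (forall x, U x -> derivable f x (delta_mx 0 i)) /\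
               Ck k' U (partial f i)
   else True).

Definition smooth_on {V : normedModType R} (U : set 'rV[R]_d)
    (f : 'rV[R]_d -> V) := forall k, Ck k U f.

(* Linear algebra of one tangent space: bilinear forms are Gram matrices acting
   on row vectors. *)
Definition pairing (G : 'M[R]_d) (u v : 'rV[R]_d) : R := (u *m G *m v^T) 0 0.

Definition minkowski : 'M[R]_d :=
  diag_mx (\row_i (if i == 0%N :> nat then -1 else 1)).

(* Symmetric of signature (-,+,...,+); the symmetry is implied. *)
Definition lorentzian (G : 'M[R]_d) :=
  exists2 P : 'M[R]_d, P \in unitmx & G = P^T *m minkowski *m P.

Section levi_civita.
Variable g : 'rV[R]_d -> 'M[R]_d.

(* Gamma^k_{ij} *)
Definition christoffel (k i j : 'I_d) (x : 'rV[R]_d) : R :=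
  2^-1 * \sum_l invmx (g x) k l *
    (partial (fun y => g y j l) i x + partial (fun y => g y i l) j x
     - partial (fun y => g y i j) l x).

(* R_{ij} = R^k_{ikj}, the convention in which round spheres have positive
   Ricci curvature. *)
Definition ricci (i j : 'I_d) (x : 'rV[R]_d) : R :=
  \sum_k (partial (christoffel k i j) k x - partial (christoffel k i k) j x
          + \sum_l (christoffel k k l x * christoffel l i j x
                    - christoffel k j l x * christoffel l i k x)).

Definition box (f : 'rV[R]_d -> R) (x : 'rV[R]_d) : R :=
  \sum_i \sum_j invmx (g x) i j *
    (partial (partial f j) i x - \sum_k christoffel k i j x * partial f k x).

End levi_civita.

Definition solves_einstein_scalar (g : 'rV[R]_d -> 'M[R]_d)
    (phi : 'rV[R]_d -> R) :=
  [/\ smooth_on setT g /\ (forall x, lorentzian (g x)),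
      smooth_on setT phi,
      forall x i j, ricci g i j x = partial phi i x * partial phi j x
    & forall x, box g phi x = 0].

End calculus.

(* A topological space with an indexed family of charts of dimension [d].  A
   chart is recorded with both of its directions: the parametrization [par c] of
   the patch, defined on the open set [dom c] of R^d, and the coordinates
   [coord c], which matter only on the patch. *)
Record atlas (R : realType) (d : nat) := Atlas {
  carrier :> topologicalType;
  chart : Type;
  dom : chart -> set 'rV[R]_d;
  par : chart -> 'rV[R]_d -> carrier;
  coord : chart -> carrier -> 'rV[R]_d
}.
Arguments chart {R d}.
Arguments dom {R d} [_] _.
Arguments par {R d} [_] _.
Arguments coord {R d} [_] _.

Section manifolds.
Context {R : realType} {d : nat}.
Implicit Types X Y : atlas R d.

Definition patch X (c : chart X) : set X := par c @` dom c.

Definition in_charts X Y (f : X -> Y) (c : chart X) (c' : chart Y) :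
  'rV[R]_d -> 'rV[R]_d := fun x => coord c' (f (par c x)).

Definition smooth_map X Y (f : X -> Y) :=
  continuous f /\
  forall (c : chart X) (c' : chart Y),
    smooth_on (dom c `&` [set x | patch c' (f (par c x))]) (in_charts f c c').

(* Each chart is a homeomorphism between an open set of X and an open set of
   R^d, and the last clause says that the transition maps are smooth. *)
Definition smooth_manifold X :=
  [/\ hausdorff_space X,
      @second_countable X,
      forall p : X, exists c : chart X, patch c p,
      forall c : chart X,
        [/\ open (dom c),
            forall x, dom c x -> coord c (par c x) = x,
            forall x, dom c x -> {for x, continuous (par c)}
          & forall U, open U -> U `<=` dom c -> open (par c @` U)]
    & smooth_map (id : X -> X)].

(* A metric is given by its Gram matrix in every chart. *)
Definition metric_on X := chart X -> 'rV[R]_d -> 'M[R]_d.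

Definition vector_field_on X := chart X -> 'rV[R]_d -> 'rV[R]_d.

(* f^* h = g; [jacobian] acts on row vectors, from the right. *)
Definition isometric X Y (g : metric_on X) (h : metric_on Y) (f : X -> Y) :=
  forall (c : chart X) (c' : chart Y) x,
    dom c x -> patch c' (f (par c x)) ->
    let F := in_charts f c c' in
    let J := jacobian F x in
    g c x = J *m h c' (F x) *m J^T.

(* The last clause is the transformation law between charts. *)
Definition continuous_lorentzian_metric X (g : metric_on X) :=
  [/\ forall (c : chart X) x, dom c x -> {for x, continuous (g c)},
      forall (c : chart X) x, dom c x -> lorentzian (g c x)
    & isometric g g (id : X -> X)].

Definition embedding X Y (f : X -> Y) :=
  [/\ injective f, smooth_map f
    & forall U : set X, open U ->
        exists2 V : set Y, open V & f @` U = V `&` range f].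

Definition C0_extendible X (g : metric_on X) :=
  exists (Y : atlas R d) (h : metric_on Y) (f : X -> Y),
    [/\ smooth_manifold Y /\ connected [set: Y],
        continuous_lorentzian_metric h,
        embedding f /\ isometric g h f
      & open (range f) /\ range f <> setT].

Definition C0_inextendible X (g : metric_on X) := ~ C0_extendible g.

Section curves.
Variables (X : atlas R d) (g : metric_on X) (T : vector_field_on X).

Definition geodesic (I : set R) (gamma : R -> X) :=
  forall s, I s ->
    {for s, continuous gamma} /\
    forall c : chart X, patch c (gamma s) ->
      let x := coord c \o gamma in
      [/\ \forall t \near s, derivable x t 1,
          derivable (derive1 x) s 1
        & forall k, derive1 (derive1 x) s 0 k
            + \sum_i \sum_j christoffel (g c) k i j (x s)
                            * derive1 x s 0 i * derive1 x s 0 j = 0].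

Definition velocity_prop (P : 'M[R]_d -> 'rV[R]_d -> Prop) (I : set R)
    (gamma : R -> X) :=
  forall s, I s -> forall c : chart X, patch c (gamma s) ->
    let x := coord c \o gamma in P (g c (x s)) (derive1 x s).

Definition timelike :=
  velocity_prop (fun G v => pairing G v v < 0).

Definition null_curve :=
  velocity_prop (fun G v => v != 0 /\ pairing G v v = 0).

(* [T] is the timelike vector field fixing the time orientation. *)
Definition future_directed (I : set R) (gamma : R -> X) :=
  forall s, I s -> forall c : chart X, patch c (gamma s) ->
    let x := coord c \o gamma in
    pairing (g c (x s)) (derive1 x s) (T c (x s)) < 0.

Definition future_complete_for (causal : set R -> (R -> X) -> Prop) :=
  forall (a b : R) (gamma : R -> X), a < b ->
    geodesic `]a, b[%classic gamma -> causal `]a, b[%classic gamma ->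
    future_directed `]a, b[%classic gamma ->
    exists2 gamma' : R -> X, geodesic `]a, +oo[%classic gamma' &
      forall s, `]a, b[%classic s -> gamma' s = gamma s.

Definition future_timelike_null_complete :=
  future_complete_for timelike /\ future_complete_for null_curve.

End curves.
End manifolds.

(* The Heisenberg group in the polarized coordinates (x_0, x_1, ..., x_{2m}):
   x_0 is central and (x_{2r-1}, x_{2r}) is the r-th conjugate pair. *)
Definition heisenberg (R : realType) (m : nat) : Type := 'rV[R]_(m.*2.+1).

(* For r : 'I_m, counted from 0, these are 2(r+1)-1 and 2(r+1). *)
Definition odd_ix (m : nat) (r : 'I_m) : 'I_(m.*2.+1) := inord r.*2.+1.
Definition even_ix (m : nat) (r : 'I_m) : 'I_(m.*2.+1) := inord r.*2.+2.

Section heisenberg_group.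
Context {R : realType} {m : nat}.
Local Notation H := (heisenberg R m).
Implicit Types x y z : 'rV[R]_(m.*2.+1).

HB.instance Definition _ := Topological.on H.
HB.instance Definition _ := Choice.on H.

Definition heis_cocycle x y : R :=
  \sum_(r < m) x 0 (odd_ix r) * y 0 (even_ix r).

Definition heis_mul (x y : H) : H :=
  (x : 'rV__) + y + heis_cocycle x y *: delta_mx 0 0.

Definition heis_inv (x : H) : H :=
  - (x : 'rV__) + heis_cocycle x x *: delta_mx 0 0.

Definition heis_one : H := 0 : 'rV_(m.*2.+1).

Lemma odd_ix_neq0 (r : 'I_m) : (odd_ix r == 0) = false.
Proof.
by rewrite -val_eqE /= inordK // ltnS ltn_double.
Qed.

Lemma even_ix_neq0 (r : 'I_m) : (even_ix r == 0) = false.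
Proof. by rewrite -val_eqE /= inordK // ltnS -doubleS leq_double. Qed.


Lemma heis_cocycleDl x y z :
  heis_cocycle (x + y) z = heis_cocycle x z + heis_cocycle y z.
Proof.
by rewrite -big_split; apply: eq_bigr => r _; rewrite mxE mulrDl.
Qed.

Lemma heis_cocycleDr x y z :
  heis_cocycle x (y + z) = heis_cocycle x y + heis_cocycle x z.
Proof.
by rewrite -big_split; apply: eq_bigr => r _; rewrite mxE mulrDr.
Qed.

Lemma heis_cocycleZl a x y : heis_cocycle (a *: x) y = a * heis_cocycle x y.
Proof. by rewrite mulr_sumr; apply: eq_bigr => r _; rewrite mxE mulrA. Qed.

Lemma heis_cocycleZr a x y : heis_cocycle x (a *: y) = a * heis_cocycle x y.
Proof. by rewrite mulr_sumr; apply: eq_bigr => r _; rewrite mxE mulrCA. Qed.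

Lemma heis_cocycle_centerl x : heis_cocycle (delta_mx 0 0) x = 0.
Proof. by apply: big1 => r _; rewrite mxE odd_ix_neq0 mul0r. Qed.

Lemma heis_cocycle_centerr x : heis_cocycle x (delta_mx 0 0) = 0.
Proof. by apply: big1 => r _; rewrite mxE even_ix_neq0 mulr0. Qed.

Lemma heis_cocycleNl x y : heis_cocycle (- x) y = - heis_cocycle x y.
Proof. by rewrite -scaleN1r heis_cocycleZl mulN1r. Qed.

Lemma heis_cocycleNr x y : heis_cocycle x (- y) = - heis_cocycle x y.
Proof. by rewrite -scaleN1r heis_cocycleZr mulN1r. Qed.

Definition heis_cocycleE := (heis_cocycleDl, heis_cocycleDr, heis_cocycleZl,
  heis_cocycleZr, heis_cocycle_centerl, heis_cocycle_centerr,
  heis_cocycleNl, heis_cocycleNr, mulr0, addr0, add0r).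

Lemma heis_mulA : associative heis_mul.
Proof.
move=> x y z; rewrite /heis_mul !heis_cocycleE.
by apply/rowP => k; rewrite !mxE; ring.
Qed.

Lemma heis_mul1 : left_id heis_one heis_mul.
Proof.
by move=> x; rewrite /heis_mul /heis_one -[0](scale0r x) heis_cocycleE mul0r
  !scale0r add0r addr0.
Qed.

Lemma heis_mulr1 : right_id heis_one heis_mul.
Proof.
by move=> x; rewrite /heis_mul /heis_one -[0](scale0r x) heis_cocycleE mul0r
  !scale0r !addr0.
Qed.

Lemma heis_mulV : left_inverse heis_one heis_inv heis_mul.
Proof.
move=> x; rewrite /heis_mul /heis_inv !heis_cocycleE.
by apply/rowP => k; rewrite !mxE; ring.
Qed.

Lemma heis_mulrV : right_inverse heis_one heis_inv heis_mul.
Proof.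
move=> x; rewrite /heis_mul /heis_inv !heis_cocycleE.
by apply/rowP => k; rewrite !mxE; ring.
Qed.

HB.instance Definition _ := isGroup.Build H
  heis_mulA heis_mul1 heis_mulr1 heis_mulV heis_mulrV.

(* Row [a] of [coframe x] lists the components of the 1-form omega^a at x:
     omega^0 = dx_0 - \sum_r x_{2r-1} dx_{2r},
     omega^i = dx_i  for i > 0. *)
Definition coframe (x : H) : 'M[R]_(m.*2.+1) :=
  \matrix_(a, j) ((a == j)%:R - (a == 0)%:R *
    \sum_(r < m) (x : 'rV__) 0 (odd_ix r) * (j == even_ix r)%:R).

Lemma derive_affine (V W : normedModType R) (f : V -> W) (u v : V) (w : W) :
  (forall h : R, f (h *: v + u) = h *: w + f u) -> 'D_v f u = w.
Proof.
move=> fE; apply: cvg_lim => //; apply: cvg_near_cst.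
near=> h; rewrite /= fE addrK scalerA mulVf ?scale1r //.
by near: h; exact: nbhs_dnbhs_neq.
Unshelve. all: by end_near. Qed.

Lemma coframe_mul (x : H) (v : 'rV[R]_(m.*2.+1)) a :
  (coframe x *m v^T) a 0 = v 0 a - (a == 0)%:R * heis_cocycle x v.
Proof.
rewrite mxE (eq_bigr (fun j => (a == j)%:R * v 0 j - (a == 0)%:R *
  \sum_(r < m) x 0 (odd_ix r) * (j == even_ix r)%:R * v 0 j)); last first.
  by move=> j _; rewrite !mxE mulrBl -mulrA mulr_suml.
rewrite sumrB -mulr_sumr exchange_big /=; congr (_ - _ * _).
  rewrite (bigD1 a) //= eqxx mul1r big1 ?addr0 // => j.
  by rewrite eq_sym => /negPf->; rewrite mul0r.
apply: eq_bigr => r _; rewrite (bigD1 (even_ix r)) //= eqxx mulr1.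
by rewrite big1 ?addr0 // => j /negPf->; rewrite mulr0 mul0r.
Qed.

(* 'D_v (heis_mul a) x is the image of v under the left translation by a. *)
Lemma coframe_left_invariant (a x : H) (v : 'rV[R]_(m.*2.+1)) :
  coframe (a * x)%g *m ('D_v (heis_mul a : 'rV__ -> 'rV__) x)^T
  = coframe x *m v^T.
Proof.
rewrite (@derive_affine _ _ _ _ _ (v + heis_cocycle a v *: delta_mx 0 0)).
  apply/colP => k; rewrite !coframe_mul -[(a * x)%g]/(heis_mul a x).
  rewrite /heis_mul.
  by rewrite !heis_cocycleE !mxE eqxx /=; ring.
by move=> h; rewrite /heis_mul !heis_cocycleE; apply/rowP => k; rewrite !mxE; ring.
Qed.

(* d omega^a (e_i, e_j) = e_i (omega^a_j) - e_j (omega^a_i) *)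
Lemma coframe_structure (x : 'rV[R]_(m.*2.+1)) (a i j : 'I_(m.*2.+1)) :
  let w b k := coframe x b k in
  partial (fun y => coframe y a j) i x - partial (fun y => coframe y a i) j x
  = - (a == 0)%:R * \sum_(r < m) (w (odd_ix r) i * w (even_ix r) j
                                 - w (odd_ix r) j * w (even_ix r) i).
Proof.
have dw k l : partial (fun y => coframe y a l) k x =
    - (a == 0)%:R * \sum_(r < m) (k == odd_ix r)%:R * (l == even_ix r)%:R.
  apply: derive_affine => h; rewrite !mxE.
  under eq_bigr do rewrite !mxE mulrDl eqxx /= -mulrA (eq_sym _ k).
  by rewrite big_split -mulr_sumr /=; rewrite /GRing.scale /=; ring.
rewrite /= !dw -mulrBr -sumrB; congr (_ * _); apply: eq_bigr => r _.
rewrite !mxE odd_ix_neq0 even_ix_neq0 !mul0r !subr0.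
by rewrite ![_ == i]eq_sym ![_ == j]eq_sym.
Qed.

End heisenberg_group.

(* Points of R_tau x H. *)
Section spacetime.
Context {R : realType} {m : nat}.
Local Notation H := (heisenberg R m).
Local Notation M := 'rV[R]_(1 + m.*2.+1).

Definition tau (x : M) : R := lsubmx x 0 0.

Definition space (x : M) : H := rsubmx x.

Definition time_field : M := row_mx (const_mx 1) 0.

Definition act (a : H) (x : M) : M := row_mx (lsubmx x) (a * space x)%g.

Definition discrete_subgroup (G : set H) :=
  [/\ G 1%g, forall a b, G a -> G b -> G (a * b)%g,
      forall a, G a -> G a^-1%g & G `<=` isolated G].

Section quotient.
Variable G : set H.

Definition orbit (x : M) : set M := [set act a x | a in G].

(* For a subgroup [G], being in the same orbit. *)
Definition same_orbit (x y : M) : bool := `[< orbit x = orbit y >].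

Lemma same_orbit_refl : reflexive same_orbit.
Proof. by move=> x; apply/asboolP. Qed.

Lemma same_orbit_sym : symmetric same_orbit.
Proof. by move=> x y; apply/asboolP/asboolP => ->. Qed.

Lemma same_orbit_trans : transitive same_orbit.
Proof. by move=> y x z /asboolP xy /asboolP yz; apply/asboolP; rewrite xy. Qed.

Canonical same_orbit_equiv :=
  EquivRel same_orbit same_orbit_refl same_orbit_sym same_orbit_trans.

Definition orbit_space : topologicalType :=
  quotient_topology {eq_quot same_orbit}%qT.

Definition to_orbit (x : M) : orbit_space :=
  (\pi_({eq_quot same_orbit}%qT) x)%qT.

(* The charts are the local inverses of the projection M -> G \ M, one for each
   open set on which it is injective. *)
Definition left_quotient : atlas R (1 + m.*2.+1) := {|
  carrier := orbit_space;
  chart := {U : set M | open U /\ {in U &, injective to_orbit}};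
  dom := fun U => sval U;
  par := fun _ => to_orbit;
  coord := fun U p => xget 0 [set x | sval U x /\ to_orbit x = p]
|}.

(* [g] is meant to be invariant under [act a] for a in [G]. *)
Definition descend (g : M -> 'M[R]_(1 + m.*2.+1)) : metric_on left_quotient :=
  fun _ => g.

Definition quotient_time_field : vector_field_on left_quotient :=
  fun _ _ => time_field.

End quotient.
End spacetime.
Arguments descend {R m} G g.
Arguments quotient_time_field {R m} G.

Section solution.
Context {R : realType} {m : nat}.
Variables A p : 'I_(m.*2.+1) -> R.

Definition chi (r : 'I_m) : R := 1 + p 0 - p (odd_ix r) - p (even_ix r).

Definition kappa (r : 'I_m) : R := A 0 / (A (odd_ix r) * A (even_ix r)).

Definition bounce (r : 'I_m) (t : R) : R :=
  1 + kappa r ^+ 2 / (4 * chi r ^+ 2) * expR (2 * chi r * t).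

Definition scale0 (t : R) : R :=
  A 0 * expR (p 0 * t) * \prod_(r < m) (Num.sqrt (bounce r t))^-1.

(* a_{2r-1} and a_{2r} are the cases [i = odd_ix r] and [i = even_ix r]. *)
Definition scale (r : 'I_m) (i : 'I_(m.*2.+1)) (t : R) : R :=
  A i * expR (p i * t) * Num.sqrt (bounce r t).

Definition lapse (t : R) : R := expR t * \prod_(r < m) Num.sqrt (bounce r t).

Definition metric (x : 'rV[R]_(1 + m.*2.+1)) : 'M[R]_(1 + m.*2.+1) :=
  let sq a := (row a (coframe (space x)))^T *m row a (coframe (space x)) in
  let t := tau x in
  block_mx (- lapse t ^+ 2)%:M 0 0
    (scale0 t ^+ 2 *: sq 0
     + \sum_(r < m) (scale r (odd_ix r) t ^+ 2 *: sq (odd_ix r)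
                     + scale r (even_ix r) t ^+ 2 *: sq (even_ix r))).

Definition proper_time (t : R) : \bar R :=
  (\int[lebesgue_measure]_(s in `]-oo, t]) (lapse s)%:E)%E.

End solution.

Definition scalar_field {R : realType} {m : nat} (q phi0 : R)
  (x : 'rV[R]_(1 + m.*2.+1)) : R := q * tau x + phi0.

(* Main.v *)
(* Left translations of the Heisenberg group act by affine isometries, so the curvature need only
   be computed over the unit element, where the coframe is the coordinate coframe.  There the field
   equations reduce to (log F_r)'' = N^2 a_0^2 / (a_{2r-1} a_{2r})^2 and to linear and quadratic
   relations between the log-derivatives of N and of the scale factors.

   Completeness: in the time variable tau the frame momenta of a geodesic satisfy a globally
   Lipschitz system, and its energy is at most a constant times N for tau -> +oo, so that affine
   parameter diverges; the horizontal momenta are compared with N a_i, using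
   p_i > -1 and a_{2r-1} a_{2r} ~ e^{(1 + p_0 + chi_r) tau}.

   Inextendibility: only the local isometry R x H -> Y onto a proper open subset is used.  In a chart
   of Y around a boundary point, some timelike coordinate segment lifts to a curve c that escapes,
   and tau must tend to +oo or -oo along c; at either end some horizontal scale factor a_i tends to
   infinity.  The slices {tau = const} through c are complete, hence Lipschitz graphs over a fixed
   coordinate disc, and x_i varies by O(1/a_i) over them.  The translates of c s by h e_i thus leave
   the disc for some small h = u(s), over a point e(s).  Translating by u(s) the past of c s shows
   that the slice of c s lies above the exit point over e(s); translating back the vertical line over
   e(s) shows that every earlier slice lies below it.  At a cluster point of e(s) the two statements
   contradict each other. *)

From Pilot Require Import Defs.
From HB Require Import structures.
From mathcomp Require Import all_boot all_order all_algebra.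
From mathcomp Require Import all_classical all_reals all_analysis.
From mathcomp Require Import measurable_realfun.
From mathcomp Require Import ring lra zify.

Set Implicit Arguments.
Unset Strict Implicit.
Unset Printing Implicit Defensive.

Import Order.TTheory GRing.Theory Num.Theory.
Import numFieldNormedType.Exports.

Local Open Scope classical_set_scope.
Local Open Scope ring_scope.

(** The metric of an extension Y is only continuous: Y has no connection and no geodesics, and only
    the light cones of a small coordinate box are at hand. In a box where the metric is close to
    Minkowski's, with T its first coordinate and E the others, causal vectors obey |dE| <= L |dT|
    and the remaining ones |dT| <= L |dE|, with one constant L = 2(2m + 1) for all boxes. Everything
    else comes from R x H: tau is strictly monotone along timelike curves, and translations preserve
    tau and the metric. The map into Y is a local diffeomorphism, neither injective nor a covering
    of the box, so paths and homotopies are lifted; what replaces properness is that the part lying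
    over a smaller closed ball is closed. The boxes are sheared so that the segment leading out of
    the image is vertical.

    For completeness, the geodesic equation is quadratic in the velocity and admits no direct global
    Lipschitz bound. With tau as the variable only the horizontal momenta have to be solved for;
    position and affine parameter follow by quadrature, and inverting the latter returns the
    geodesic. *)

Local Notation space := Pilot.Defs.space.

(** * Differentiability of maps between spaces of matrices *)

Lemma is_diff_eps (R : realType) (V W : normedModType R) (f : V -> W) x
    (df : {linear V -> W}) :
  continuous df ->
  (forall e : R, 0 < e ->
    \forall h \near 0, `|f (h + x) - f x - df h| <= e * `|h|) ->
  is_diff x f df.
Proof.
move=> dfc dfe.
have fE : f \o shift x = cst (f x) + df +o_ 0 id.
  apply/eqaddoP => e e0 /=; apply: filterS (dfe e e0) => h.
  by rewrite !fctE /= opprD addrA.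
have dE := diff_unique dfc fE.
split=> //; apply/diff_locallyP; split; first by rewrite dE.
by rewrite dE.
Qed.

Lemma differentiable_eps (R : realType) (V W : normedModType R) (f : V -> W) x :
  differentiable f x -> forall e : R, 0 < e ->
    \forall h \near 0, `|f (h + x) - f x - 'd f x h| <= e * `|h|.
Proof.
move=> /diff_locally /eqaddoP fo e e0; apply: filterS (fo e e0) => h.
by rewrite !fctE /= opprD addrA.
Qed.

Lemma mx_norm_coord (R : realType) m n (M : 'M[R]_(m, n)) i j :
  `|M i j| <= `|M|.
Proof.
rewrite [leRHS]/Num.Def.normr/= mx_normrE.
by rewrite (le_bigmax _ (fun ij => `|M ij.1 ij.2|) (i, j)).
Qed.

Lemma mx_norm_leP (R : realType) m n (M : 'M[R]_(m, n)) (e : R) : 0 <= e ->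
  (forall i j, `|M i j| <= e) -> `|M| <= e.
Proof.
move=> e0 Me; rewrite [leLHS]/Num.Def.normr/= mx_normrE.
by apply: bigmax_le => // -[i j] _; exact: Me.
Qed.

Lemma cvg_mxP (R : realType) (T : Type) (F : set_system T) (FF : Filter F)
    m n (f : T -> 'M[R]_(m, n)) (l : 'M[R]_(m, n)) :
  f @ F --> l <-> forall i j, (fun x => f x i j) @ F --> l i j.
Proof.
split=> [fl i j|fl].
  by apply: (cvg_comp f (fun M : 'M[R]_(m, n) => M i j) fl); exact: coord_continuous.
apply/cvgrPdist_le => e e0; near=> x; apply: mx_norm_leP (ltW e0) _.
near: x; apply: filter_forall => i; apply: filter_forall => j.
have /cvgrPdist_le/(_ _ e0) := fl i j.
by apply: filterS => x; rewrite !mxE.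
Unshelve. all: end_near. Qed.

Lemma differentiable_mxP (R : realType) (V : normedModType R) m n
    (f : V -> 'M[R]_(m, n)) x :
  differentiable f x <-> forall i j, differentiable (fun y => f y i j) x.
Proof.
split=> [df i j|df].
  apply: (@differentiable_comp _ _ _ _ f (fun M : 'M[R]_(m, n) => M i j)) => //.
  exact: differentiable_coord.
pose d h := \matrix_(i < m, j < n) 'd (fun y => f y i j) x h.
have d_lin : linear d.
  by move=> a u v; apply/matrixP => i j; rewrite !mxE linearP.
pose dM := GRing.isLinear.Build _ _ _ _ _ d_lin.
pose dL : {linear _ -> _} := HB.pack d dM.
suff : is_diff x f dL by case.
apply: is_diff_eps => [y|e e0].
  apply/cvg_mxP => i j; rewrite [X in _ --> X]mxE.
  rewrite (_ : (fun z => dL z i j) = 'd (fun y => f y i j) x); last first.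
    by apply/funext => z; rewrite mxE.
  exact: diff_continuous.
near=> h; apply: mx_norm_leP; first by rewrite mulr_ge0 // ltW.
near: h; apply: filter_forall => i; apply: filter_forall => j.
have := differentiable_eps (df i j) e0.
by apply: filterS => h; rewrite !mxE.
Unshelve. all: end_near. Qed.

Lemma is_derive_line (R : realType) (V W : normedModType R) (f : V -> W)
    (y v : V) (t : R) :
  derivable f (t *: v + y) v ->
  is_derive t 1 (fun h => f (h *: v + y)) ('D_v f (t *: v + y)).
Proof.
have E : (fun h : R => h^-1 *: (f ((h *: 1 + t) *: v + y) - f (t *: v + y)))
   = (fun h : R => h^-1 *: (f (h *: v + (t *: v + y)) - f (t *: v + y))).
  by apply/funext => h; rewrite [_ *: 1]mulr1 scalerDl addrA.
move=> fd; split; first by rewrite /derivable /= E.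
by rewrite /derive /= E.
Qed.

Lemma is_derive_lineP (R : realType) (V W : normedModType R) (f : V -> W)
    (x v : V) (df : W) :
  is_derive x v f df <-> is_derive (0 : R) 1 (fun h : R => f (h *: v + x)) df.
Proof.
have E : (fun h : R => h^-1 *: (f ((h *: (1 : R) + (0 : R)) *: v + x) - f ((0 : R) *: v + x)))
   = (fun h : R => h^-1 *: (f (h *: v + x) - f x)).
  by apply/funext => h; rewrite [_ *: 1]mulr1 addr0 scale0r add0r.
by split=> -[fd fE]; split; move: fd fE; rewrite /derivable /derive /= E.
Qed.

Lemma MVT_line (R : realType) (V : normedModType R) (f : V -> R) (y v : V) (a : R) :
  (forall t : R, `|t| <= `|a| -> derivable f (t *: v + y) v) ->
  exists2 c : R, `|c| <= `|a| & f (a *: v + y) - f y = a * 'D_v f (c *: v + y).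
Proof.
move=> fd; pose g (t : R) := f (t *: v + y).
have gd (t : R) : `|t| <= `|a| -> is_derive t 1 g ('D_v f (t *: v + y)).
  by move=> ta; apply: is_derive_line; exact: fd.
have g0 : g 0 = f y by rewrite /g scale0r add0r.
have [a0|a0] := leP 0 a.
  have [||c] := @MVT_segment _ g (fun t => 'D_v f (t *: v + y)) 0 a a0.
  - move=> t /itvP tI; apply: gd.
    by rewrite ger0_norm ?tI // ger0_norm // tI.
  - apply: derivable_within_continuous => t /itvP tI.
    have := gd t; rewrite !ger0_norm ?tI // => /(_ isT); case=> //.
  - move=> /itvP cI; rewrite subr0 g0 => gE; exists c; first by rewrite !ger0_norm ?cI.
    by rewrite -/(g a) gE mulrC.
have [||c] := @MVT_segment _ g (fun t => 'D_v f (t *: v + y)) a 0 (ltW a0).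
- move=> t /itvP tI; apply: gd.
  by rewrite ler0_norm ?tI // ler0_norm ?(ltW a0) // lerN2 tI.
- apply: derivable_within_continuous => t /itvP tI.
  have := gd t; rewrite !ler0_norm ?(ltW a0) ?tI // lerN2 tI => /(_ isT); case=> //.
- move=> /itvP cI; rewrite sub0r g0 => gE; exists c.
    by rewrite !ler0_norm ?(ltW a0) ?cI // lerN2 cI.
  by rewrite -/(g a) -[LHS]opprB gE mulrN opprK mulrC.
Qed.

Lemma cvg_sumr (R : realType) (T : Type) (F : set_system T) (FF : Filter F)
    (I : Type) (r : seq I) (P : pred I) (f : I -> T -> R) (l : I -> R) :
  (forall i, P i -> f i @ F --> l i) ->
  (fun x => \sum_(i <- r | P i) f i x) @ F --> \sum_(i <- r | P i) l i.
Proof.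
move=> fl; elim: r => [|i r IH].
  rewrite big_nil (_ : (fun _ => _) = fun=> 0); first exact: cvg_cst.
  by apply/funext => x; rewrite big_nil.
rewrite big_cons (_ : (fun _ => _) = (fun x => if P i then
    f i x + \sum_(i <- r | P i) f i x else \sum_(i <- r | P i) f i x)).
  by case: ifP => // Pi; apply: cvgD => //; exact: fl.
by apply/funext => x; rewrite big_cons; case: ifP.
Qed.

(** The increment is split into steps parallel to the axes, and on each step the mean value theorem
    replaces the difference by a partial derivative at a point close to [x]. *)
Lemma C1_is_diff (R : realType) n (f : 'rV[R]_n -> R) (x : 'rV[R]_n) :
  (\forall y \near x, forall i, derivable f y (delta_mx 0 i)) ->
  (forall i, {for x, continuous (partial f i)}) ->
  differentiable f x /\
  forall h, 'd f x h = \sum_i h 0 i * partial f i x.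
Proof.
move=> fd fc.
pose d (h : 'rV[R]_n) := \sum_i h 0 i * partial f i x.
have d_lin : linear d.
  move=> a u v; rewrite /d [X in _ = X + _]mulr_sumr -big_split /=; apply: eq_bigr => i _.
  by rewrite !mxE mulrDl mulrA.
pose dM := GRing.isLinear.Build _ _ _ _ _ d_lin.
pose dL : {linear _ -> R^o} := HB.pack d dM.
suff : is_diff x f dL by case=> fd1 fd2; split => // h; rewrite fd2.
apply: is_diff_eps => [y|e e0].
  rewrite /continuous_at /= -[X in _ --> X]/(d y) /d.
  by apply: (@cvg_sumr R _ (nbhs y) (nbhs_filter y)) => i _; exact: (cvgM (@coord_continuous _ _ _ 0 i y) (@cst_continuous _ _ (partial f i x) y)).
have n1_gt0 : (0 : R) < n.+1%:R by rewrite ltr0n.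
(* Dividing by n + 1 instead of n covers the case n = 0 as well. *)
have e1_gt0 : 0 < e / n.+1%:R by rewrite divr_gt0.
have /nbhs_normP[r /= r0 rP] : \forall y \near x,
    (forall i, derivable f y (delta_mx 0 i)) /\
    (forall i, `|partial f i x - partial f i y| <= e / n.+1%:R).
  apply: filterI; first exact: fd.
  apply: (@filter_forall _ _ _ (nbhs x) (nbhs_filter x)) => i.
  by have /cvgrPdist_le/(_ _ e1_gt0) := fc i.
apply/nbhs_normP; exists r => //= h; rewrite /ball_ /= sub0r normrN => hr.
(* [hk k] keeps the first [k] coordinates of [h], so that [hk k] and [hk k.+1] differ in a single
   coordinate and the increments telescope. *)
pose hk k : 'rV[R]_n := \row_j (if (j < k)%N then h 0 j else 0).
have hk0 : hk 0%N = 0 by apply/rowP => j; rewrite !mxE.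
have hkn : hk n = h by apply/rowP => j; rewrite !mxE ltn_ord.
have hkS (k : 'I_n) : hk k.+1 = h 0 k *: delta_mx 0 k + hk k.
  apply/rowP => j; rewrite !mxE eqxx /= ltnS leq_eqVlt -(inj_eq val_inj) /=.
  by case: ltngtP => //= jk; rewrite ?mulr0 ?add0r // mulr1 addr0; congr (h 0 _);
     exact: val_inj.
have small (k : 'I_n) (c : R) : `|c| <= `|h 0 k| -> `|c *: delta_mx 0 k + hk k| <= `|h|.
  move=> ch; apply: mx_norm_leP => // i j; rewrite ord1 !mxE eqxx /=.
  case: (ltngtP j k) => [jk|jk|/val_inj jk].
  - by rewrite -(inj_eq val_inj) /= ltn_eqF // mulr0 add0r mx_norm_coord.
  - by rewrite -(inj_eq val_inj) /= gtn_eqF // mulr0 add0r normr0.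
  - by rewrite jk eqxx mulr1 addr0 (le_trans ch) // mx_norm_coord.
have fE : f (h + x) - f x = \sum_(k < n) (f (hk k.+1 + x) - f (hk k + x)).
  rewrite -(big_mkord xpredT (fun k => f (hk k.+1 + x) - f (hk k + x))).
  by rewrite telescope_sumr // hk0 hkn add0r.
rewrite fE /= /d -sumrB.
apply: (le_trans (ler_norm_sum _ _ _)).
apply: (@le_trans _ _ (\sum_(k < n) (e / n.+1%:R * `|h|))); last first.
  rewrite sumr_const card_ord -[_ *+ n]mulr_natr.
  rewrite (_ : _ * n%:R = (e * `|h|) * (n%:R / n.+1%:R)); last by ring.
  rewrite ler_piMr ?mulr_ge0 ?(ltW e0) // ler_pdivrMr // mul1r.
  by rewrite ler_nat.
apply: ler_sum => k _.
have inr (c : R) : `|c| <= `|h 0 k| -> ball_ Num.norm x r (c *: delta_mx 0 k + (hk k + x)).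
  move=> ch; rewrite /ball_ /= addrA opprD addrCA subrr addr0 normrN.
  by rewrite (le_lt_trans (small _ _ ch)).
have [t th|c ch] := @MVT_line _ _ f (hk k + x) (delta_mx 0 k) (h 0 k).
  by apply: (rP _ (inr _ th)).1.
move=> fk; rewrite hkS -[X in f X - f _]addrA fk -mulrBr normrM [leRHS]mulrC.
apply: ler_pM => //; first exact: mx_norm_coord.
by rewrite distrC; apply: (rP _ (inr _ ch)).2.
Qed.

Lemma is_derive_comp_diff (R : realType) (V W : normedModType R) (f : V -> W)
    (g : R -> V) (s : R) (v : V) :
  differentiable f (g s) -> is_derive s 1 g v -> is_derive s 1 (f \o g) ('d f (g s) v).
Proof.
move=> df [dg gv].
have dg' : differentiable g s by apply/derivable1_diffP.
have dfg : differentiable (f \o g) s by exact: differentiable_comp.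
split; first exact/derivable1_diffP.
by rewrite deriveE // diff_comp //= -gv deriveE.
Qed.

Lemma is_derive_comp_diff_eq (R : realType) (V W : normedModType R) (f : V -> W)
    (g : R -> V) (s : R) (v : V) (w : W) :
  differentiable f (g s) -> is_derive s 1 g v -> 'd f (g s) v = w ->
  is_derive s 1 (f \o g) w.
Proof. by move=> df dg <-; exact: is_derive_comp_diff. Qed.

Lemma is_derive_comp_real (R : realType) (V : normedModType R) (f : V -> R)
    (g : R -> R) (x v : V) (df dg : R) :
  is_derive x v f df -> is_derive (f x) 1 g dg ->
  is_derive x v (fun y => g (f y)) (dg * df).
Proof.
move=> /is_derive_lineP fd [gd gE]; apply/is_derive_lineP.
have fx : f (0 *: v + x) = f x by rewrite scale0r add0r.
have gd' : differentiable g (f (0 *: v + x)) by rewrite fx; exact/derivable1_diffP.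
apply: (is_derive_comp_diff_eq gd' fd).
by rewrite diff1E // fx derive1E gE mulrC.
Qed.

Lemma is_derive_mxP (R : realType) (V : normedModType R) m n
    (f : V -> 'M[R]_(m, n)) (x v : V) (df : 'M[R]_(m, n)) :
  is_derive x v f df <-> forall i j, is_derive x v (fun y => f y i j) (df i j).
Proof.
split=> [[fd <-] i j|fd].
  split; first exact: (derivable_mxP f x v).1.
  by rewrite derive_mx // mxE.
have fdv : derivable f x v by apply/derivable_mxP => i j; case: (fd i j).
split=> //; rewrite derive_mx //; apply/matrixP => i j; rewrite mxE.
by case: (fd i j).
Qed.

(** * Closure properties of smooth functions *)

Section Ck_closure.
Context {R : realType} {d : nat}.
Implicit Types f g : 'rV[R]_d -> R.

Lemma CkW (V : normedModType R) k (f : 'rV[R]_d -> V) :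
  Ck k.+1 setT f -> Ck k setT f.
Proof.
elim: k f => [|k IH] f [fc fk]; split => // i.
have [fd fp] := fk i; split => //; exact: IH.
Qed.

Lemma Ck_derivable (V : normedModType R) k (f : 'rV[R]_d -> V) i x :
  Ck k.+1 setT f -> derivable f x (delta_mx 0 i).
Proof. by move=> [_ /(_ i) [fd _]]; exact: fd. Qed.

Lemma Ck_partial (V : normedModType R) k (f : 'rV[R]_d -> V) i :
  Ck k.+1 setT f -> Ck k setT (partial f i).
Proof. by move=> [_ /(_ i) []]. Qed.

Lemma Ck_cts (V : normedModType R) k (f : 'rV[R]_d -> V) (x : 'rV[R]_d) :
  Ck k setT f -> {for x, continuous f}.
Proof. by case: k => [|k] [fc _]; exact: fc. Qed.

Lemma Ck_cst k (c : R) : Ck k setT (fun _ : 'rV[R]_d => c).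
Proof.
elim: k c => [|k IH] c; first by split=> // x _; exact: cst_continuous.
split=> [x _|i]; first exact: cst_continuous.
split=> [x _|]; first exact: derivable_cst.
rewrite (_ : partial _ _ = fun=> 0) //.
by apply/funext => x; rewrite /partial; exact: derive_cst.
Qed.

Lemma CkD k f g : Ck k setT f -> Ck k setT g -> Ck k setT (f \+ g).
Proof.
elim: k f g => [|k IH] f g fk gk.
  by split=> // x _; exact: (continuousD (Ck_cts fk) (Ck_cts gk)).
split=> [x _|i].
  exact: (continuousD (Ck_cts fk) (Ck_cts gk)).
have fd := fun x => @Ck_derivable _ k f i x fk; have gd := fun x => @Ck_derivable _ k g i x gk.
split=> [x _|]; first exact: derivableD.
rewrite (_ : partial _ _ = partial f i \+ partial g i).
  by apply: IH; exact: Ck_partial.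
by apply/funext => x; rewrite /partial /= deriveD.
Qed.

Lemma CkM k f g : Ck k setT f -> Ck k setT g -> Ck k setT (f \* g).
Proof.
elim: k f g => [|k IH] f g fk gk.
  by split=> // x _; exact: (continuousM (Ck_cts fk) (Ck_cts gk)).
split=> [x _|i].
  exact: (continuousM (Ck_cts fk) (Ck_cts gk)).
have fd := fun x => @Ck_derivable _ k f i x fk; have gd := fun x => @Ck_derivable _ k g i x gk.
split=> [x _|]; first exact: derivableM.
rewrite (_ : partial _ _ = (f \* partial g i) \+ (g \* partial f i)).
  by apply: CkD; apply: IH; (exact: Ck_partial || exact: CkW).
by apply/funext => x; rewrite /partial /= deriveM.
Qed.

Lemma Ck_sum k (I : Type) (r : seq I) (P : pred I) (F : I -> 'rV[R]_d -> R) :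
  (forall i, P i -> Ck k setT (F i)) -> Ck k setT (fun x => \sum_(i <- r | P i) F i x).
Proof.
move=> Fk; elim: r => [|i r IH].
  rewrite (_ : (fun _ => _) = fun=> 0); first exact: Ck_cst.
  by apply/funext => x; rewrite big_nil.
rewrite (_ : (fun _ => _) = if P i then F i \+ (fun x => \sum_(i <- r | P i) F i x)
   else (fun x => \sum_(i <- r | P i) F i x)).
  by case: ifPn => // Pi; apply: CkD => //; exact: Fk.
by apply/funext => x; rewrite big_cons; case: ifP.
Qed.

Lemma Ck_prod k (I : Type) (r : seq I) (P : pred I) (F : I -> 'rV[R]_d -> R) :
  (forall i, P i -> Ck k setT (F i)) -> Ck k setT (fun x => \prod_(i <- r | P i) F i x).
Proof.
move=> Fk; elim: r => [|i r IH].
  rewrite (_ : (fun _ => _) = fun=> 1); first exact: Ck_cst.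
  by apply/funext => x; rewrite big_nil.
rewrite (_ : (fun _ => _) = if P i then F i \* (fun x => \prod_(i <- r | P i) F i x)
   else (fun x => \prod_(i <- r | P i) F i x)).
  by case: ifPn => // Pi; apply: CkM => //; exact: Fk.
by apply/funext => x; rewrite big_cons; case: ifP.
Qed.

Lemma CkZ k c f : Ck k setT f -> Ck k setT (fun x => c * f x).
Proof. by move=> fk; exact: (@CkM k (fun=> c) f (Ck_cst k c) fk). Qed.

Lemma CkN k f : Ck k setT f -> Ck k setT (fun x => - f x).
Proof.
move=> fk; rewrite (_ : (fun _ => _) = (fun x => (-1) * f x)); first exact: CkZ.
by apply/funext => x; rewrite mulN1r.
Qed.

Lemma CkB k f g : Ck k setT f -> Ck k setT g -> Ck k setT (fun x => f x - g x).
Proof. by move=> fk gk; exact: (CkD fk (CkN gk)). Qed.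

Lemma CkX k n f : Ck k setT f -> Ck k setT (fun x => f x ^+ n).
Proof.
move=> fk; elim: n => [|n IH].
  rewrite (_ : (fun _ => _) = fun=> 1); first exact: Ck_cst.
  by apply/funext => x; rewrite expr0.
rewrite (_ : (fun _ => _) = f \* (fun x => f x ^+ n)); first exact: CkM.
by apply/funext => x; rewrite exprS.
Qed.

Lemma CkV k f : (forall x, f x != 0) -> Ck k setT f -> Ck k setT (fun x => (f x)^-1).
Proof.
move=> f0; elim: k f f0 => [|k IH] f f0 fk.
  by split=> // x _; rewrite /continuous_at; exact: (continuousV (f0 x) (Ck_cts fk)).
split=> [x _|i]; first by exact: (continuousV (f0 x) (Ck_cts fk)).
have fd := fun x => @Ck_derivable _ k f i x fk.
split=> [x _|]; first exact: derivableV.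
rewrite (_ : partial _ _ = (fun x => - ((f x)^-1 ^+ 2 * partial f i x))).
  by apply: CkN; apply: CkM; [apply: CkX; apply: IH => //; exact: CkW|exact: Ck_partial].
by apply/funext => x; rewrite /partial deriveV // /GRing.scale /= mulNr exprVn.
Qed.

Lemma Ck_coord k i : Ck k setT (fun x : 'rV[R]_d => x 0 i).
Proof.
have fd x j : is_derive x (delta_mx 0 j) (fun x : 'rV[R]_d => x 0 i) ((i == j)%:R).
  have := is_derive_id x (delta_mx 0 j : 'rV[R]_d).
  by move=> /is_derive_mxP/(_ 0 i); rewrite mxE eqxx.
case: k => [|k]; first by split=> // x _; rewrite /continuous_at; exact: coord_continuous.
split=> [x _|j]; first exact: coord_continuous.
split=> [x _|]; first by case: (fd x j).
rewrite (_ : partial _ _ = (fun=> (i == j)%:R : R)); first exact: Ck_cst.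
by apply/funext => x; rewrite /partial; case: (fd x j).
Qed.

Lemma Ck_expR k f : Ck k setT f -> Ck k setT (fun x => expR (f x)).
Proof.
elim: k f => [|k IH] f fk.
  by split=> // x _; rewrite /continuous_at; exact: (continuous_comp (Ck_cts fk) (@continuous_expR R (f x))).
split=> [x _|i].
  by exact: (continuous_comp (Ck_cts fk) (@continuous_expR R (f x))).
have fd x : is_derive x (delta_mx 0 i) (fun x => expR (f x)) (expR (f x) * partial f i x).
  have df : derivable f x (delta_mx 0 i) by exact: (@Ck_derivable _ k).
  exact: is_derive_comp_real (derivableP df) (is_derive_expR (f x)).
split=> [x _|]; first by case: (fd x).
rewrite (_ : partial _ _ = (fun x => expR (f x)) \* partial f i).
  by apply: CkM; [apply: IH; exact: CkW|exact: Ck_partial].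
by apply/funext => x; rewrite /partial; case: (fd x).
Qed.

Lemma Ck_mx k m n (f : 'rV[R]_d -> 'M[R]_(m, n)) :
  (forall i j, Ck k setT (fun x => f x i j)) -> Ck k setT f.
Proof.
elim: k f => [|k IH] f fk.
  by split=> // x _; rewrite /continuous_at; apply/(@cvg_mxP _ _ _ (nbhs_filter x)) => i j; exact: (Ck_cts (fk i j)).
split=> [x _|l]; first by apply/(@cvg_mxP _ _ _ (nbhs_filter x)) => i j; exact: (Ck_cts (fk i j)).
have fd x : derivable f x (delta_mx 0 l).
  by apply/derivable_mxP => i j; exact: (@Ck_derivable _ k _ l x (fk i j)).
split=> [x _|]; first exact: fd.
apply: IH => i j; rewrite (_ : (fun _ => _) = partial (fun x => f x i j) l).
  exact: Ck_partial.
by apply/funext => x; rewrite /partial derive_mx // mxE.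
Qed.

Lemma Ck_is_diff k f x : Ck k.+1 setT f ->
  differentiable f x /\ forall h, 'd f x h = \sum_i h 0 i * partial f i x.
Proof.
move=> fk; apply: C1_is_diff; first by apply: (@filterE _ _ (nbhs_filter x)) => y i; exact: Ck_derivable fk.
by move=> i; exact: (Ck_cts (Ck_partial i fk)).
Qed.

End Ck_closure.

(** * Frame metrics *)

Section indices.
Variable m : nat.
Local Notation n := (m.*2.+1).

Definition ti : 'I_(1 + n) := lshift n (0 : 'I_1).
Definition si (a : 'I_n) : 'I_(1 + n) := rshift 1 a.

Lemma ti_si a : (ti == si a) = false.
Proof. by rewrite /ti /si eq_lrshift. Qed.

Lemma si_ti a : (si a == ti) = false.
Proof. by rewrite eq_sym ti_si. Qed.

Lemma si_si a b : (si a == si b) = (a == b).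
Proof. by rewrite /si eq_rshift. Qed.

Lemma ti_or_si (i : 'I_(1 + n)) : i = ti \/ exists a, i = si a.
Proof.
case: (splitP i) => j ij; [left|right; exists j]; apply: val_inj => //=.
by rewrite ij ord1.
Qed.

Lemma val_odd_ix (r : 'I_m) : odd_ix r = r.*2.+1 :> nat.
Proof. by rewrite /odd_ix inordK // ltnS ltn_double. Qed.

Lemma val_even_ix (r : 'I_m) : even_ix r = r.*2.+2 :> nat.
Proof. by rewrite /even_ix inordK // ltnS -doubleS leq_double. Qed.

Lemma odd_ix_inj : injective (@odd_ix m).
Proof.
by move=> r s /(congr1 val) /=; rewrite !val_odd_ix => -[] /double_inj/val_inj.
Qed.

Lemma even_ix_inj : injective (@even_ix m).
Proof.
by move=> r s /(congr1 val) /=; rewrite !val_even_ix => -[] /double_inj/val_inj.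
Qed.

Lemma odd_even_ix (r s : 'I_m) : (odd_ix r == even_ix s) = false.
Proof.
apply/negP => /eqP/(congr1 val)/=; rewrite val_odd_ix val_even_ix => /(congr1 odd).
by rewrite /= !odd_double.
Qed.

Lemma even_odd_ix (r s : 'I_m) : (even_ix r == odd_ix s) = false.
Proof. by rewrite eq_sym odd_even_ix. Qed.

Lemma sum_pairs (V : nmodType) (F : 'I_n -> V) :
  \sum_a F a = F 0 + \sum_(r < m) (F (odd_ix r) + F (even_ix r)).
Proof.
rewrite big_ord_recl; congr (_ + _).
have E (f : nat -> V) k : \sum_(0 <= i < k.*2) f i
    = \sum_(0 <= r < k) (f r.*2 + f r.*2.+1).
  elim: k => [|k IH]; first by rewrite !big_geq.
  by rewrite doubleS !big_nat_recr //= IH addrA.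
rewrite (eq_bigr (fun i : 'I_m.*2 => F (inord i.+1))); last first.
  by move=> i _; congr (F _); apply: val_inj; rewrite /= inordK // ltnS.
by rewrite -(big_mkord xpredT (fun i => F (inord i.+1))) E big_mkord.
Qed.

Lemma sum_ti_si (V : nmodType) (F : 'I_(1 + n) -> V) :
  \sum_i F i = F ti + \sum_a F (si a).
Proof. by rewrite big_split_ord /= big_ord1. Qed.

Lemma ix_cases (a : 'I_n) :
  a = 0 \/ exists r : 'I_m, a = odd_ix r \/ a = even_ix r.
Proof.
case: a => -[|k] kn; [by left; apply: val_inj|right].
have k2 : (k./2 < m)%N by rewrite -ltn_double; have := odd_double_half k; lia.
exists (Ordinal k2); have := odd_double_half k; case: (odd k) => /= kE.
  by right; apply: val_inj => /=; rewrite val_even_ix /= -[in LHS]kE.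
by left; apply: val_inj => /=; rewrite val_odd_ix /= -[in LHS]kE.
Qed.

End indices.
Arguments ti {m}.

Section frame.
Context {R : realType} {m : nat}.
Local Notation n := (m.*2.+1).
Implicit Types (x : 'rV[R]_(1 + n)) (y u v : 'rV[R]_n).

Lemma tauE x : tau x = x 0 ti.
Proof. by rewrite /tau mxE. Qed.

Lemma spaceE x a : (space x : 'rV[R]_n) 0 a = x 0 (si a).
Proof. by rewrite /space mxE. Qed.

(** The columns form the dual frame. The coframe is 1 - Q, where Q is supported in row 0 and has
    zero column 0; hence Q^2 = 0 and the inverse is 1 + Q, that is 2 minus the coframe. *)
Definition frame (y : 'rV[R]_n) : 'M[R]_n := 2%:M - coframe y.

Lemma coframeE y a b : coframe y a b =
  (a == b)%:R - (a == 0)%:R * \sum_(r < m) y 0 (odd_ix r) * (b == even_ix r)%:R.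
Proof. by rewrite mxE. Qed.

Lemma frameE y a b : frame y a b =
  (a == b)%:R + (a == 0)%:R * \sum_(r < m) y 0 (odd_ix r) * (b == even_ix r)%:R.
Proof. by rewrite !mxE; case: (a == b) => /=; ring. Qed.

Lemma coframe_frame y : coframe y *m frame y = 1%:M.
Proof.
have -> : coframe y = 1%:M - (1%:M - coframe y) by rewrite opprB addrC subrK.
have -> : frame y = 1%:M + (1%:M - coframe y).
  by rewrite /frame addrA; congr (_ - _); rewrite -raddfD.
set Q := 1%:M - coframe y.
have Q2 : Q *m Q = 0.
  have QE a b : Q a b = (a == 0)%:R * \sum_(r < m) y 0 (odd_ix r) * (b == even_ix r)%:R.
    by rewrite !mxE opprB addrC subrK.
  have Q0 a : Q a 0 = 0.
    by rewrite QE big1 ?mulr0 // => r _; rewrite eq_sym even_ix_neq0 mulr0.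
  apply/matrixP => a b; rewrite !mxE big1 // => c _.
  have [->|/negPf c0] := eqVneq c 0; first by rewrite Q0 mul0r.
  by rewrite [Q c b]QE c0 mul0r mulr0.
by rewrite mulmxDr mulmx1 mulmxBl mul1mx Q2 subr0 subrK.
Qed.

Lemma frame_coframe y : frame y *m coframe y = 1%:M.
Proof. exact: mulmx1C (coframe_frame y). Qed.

Lemma coframe0 : coframe (0 : 'rV[R]_n) = 1%:M.
Proof.
apply/matrixP => a b; rewrite coframeE mxE.
by rewrite big1 ?mulr0 ?subr0 // => r _; rewrite mxE mul0r.
Qed.

End frame.

Section general_metric.
Context {R : realType} {m : nat}.
Local Notation n := (m.*2.+1).
Variables (nu : R -> R) (w : 'I_n -> R -> R).

(** [nu] and [w a] are the squares of the lapse and of the scale factors, which keeps square roots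
    out of the curvature computation. *)
Definition gmetric (x : 'rV[R]_(1 + n)) : 'M[R]_(1 + n) :=
  block_mx (- nu (tau x))%:M 0 0
    ((coframe (space x))^T *m diag_mx (\row_a w a (tau x)) *m coframe (space x)).

Definition ginv (x : 'rV[R]_(1 + n)) : 'M[R]_(1 + n) :=
  block_mx (- (nu (tau x))^-1)%:M 0 0
    (frame (space x) *m diag_mx (\row_a (w a (tau x))^-1) *m (frame (space x))^T).

Lemma mul_diag_sum (A B : 'M[R]_n) (d : 'rV[R]_n) i j :
  (A *m diag_mx d *m B) i j = \sum_a d 0 a * A i a * B a j.
Proof.
by rewrite mxE; apply: eq_bigr => a _; rewrite mul_mx_diag mxE [A i a * _]mulrC.
Qed.

Lemma gmetric_tt x : gmetric x ti ti = - nu (tau x).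
Proof. by rewrite /gmetric block_mxEul mxE eqxx mulr1n. Qed.
Lemma gmetric_ts x a : gmetric x ti (si a) = 0.
Proof. by rewrite /gmetric block_mxEur mxE. Qed.
Lemma gmetric_st x a : gmetric x (si a) ti = 0.
Proof. by rewrite /gmetric block_mxEdl mxE. Qed.
Lemma gmetric_ss x a b : gmetric x (si a) (si b) =
  \sum_c w c (tau x) * coframe (space x) c a * coframe (space x) c b.
Proof.
rewrite /gmetric block_mxEdr mul_diag_sum; apply: eq_bigr => c _.
by rewrite !mxE.
Qed.

Lemma ginv_tt x : ginv x ti ti = - (nu (tau x))^-1.
Proof. by rewrite /ginv block_mxEul mxE eqxx mulr1n. Qed.
Lemma ginv_ts x a : ginv x ti (si a) = 0.
Proof. by rewrite /ginv block_mxEur mxE. Qed.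
Lemma ginv_st x a : ginv x (si a) ti = 0.
Proof. by rewrite /ginv block_mxEdl mxE. Qed.
Lemma ginv_ss x a b : ginv x (si a) (si b) =
  \sum_c (w c (tau x))^-1 * frame (space x) a c * frame (space x) b c.
Proof.
rewrite /ginv block_mxEdr mul_diag_sum; apply: eq_bigr => c _.
by rewrite !mxE.
Qed.

Hypothesis nu_gt0 : forall t, 0 < nu t.
Hypothesis w_gt0 : forall a t, 0 < w a t.

Lemma gmetric_ginv x : gmetric x *m ginv x = 1%:M.
Proof.
rewrite /gmetric /ginv mulmx_block !mulmx0 !mul0mx !addr0 !add0r.
rewrite -[RHS]submxK; congr block_mx.
- rewrite -scalar_mxM mulrNN divff ?gt_eqF //.
  by apply/matrixP => i j; rewrite !ord1 !mxE.
- by apply/matrixP => i j; rewrite ord1 !mxE eq_lrshift.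
- by apply/matrixP => i j; rewrite ord1 !mxE eq_rlshift.
- rewrite -!mulmxA (mulmxA (coframe _) (frame _)) coframe_frame mul1mx.
  rewrite (mulmxA (diag_mx _) (diag_mx _)) mulmx_diag.
  rewrite (_ : (\row_i _) = const_mx 1); last first.
    by apply/rowP => a; rewrite !mxE divff // gt_eqF.
  rewrite diag_const_mx mul1mx -trmx_mul frame_coframe trmx1.
  by apply/matrixP => a b; rewrite !mxE eq_rshift.
Qed.

Lemma gmetric_unit x : gmetric x \in unitmx.
Proof. exact: (mulmx1_unit (gmetric_ginv x)).1. Qed.

Lemma invmx_gmetric x : invmx (gmetric x) = ginv x.
Proof.
by rewrite -[LHS]mulmx1 -(gmetric_ginv x) mulmxA mulVmx ?mul1mx // gmetric_unit.
Qed.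

Lemma gmetric_tr x : (gmetric x)^T = gmetric x.
Proof.
rewrite /gmetric tr_block_mx !trmx0 tr_scalar_mx; congr block_mx.
by rewrite !trmx_mul trmxK tr_diag_mx mulmxA.
Qed.

(** The matrix congruent to Minkowski's is the coframe whose rows are scaled by the lapse and the
    scale factors. *)
Lemma gmetric_lorentzian x : lorentzian (gmetric x).
Proof.
pose d : 'rV[R]_(1 + n) := row_mx (const_mx (Num.sqrt (nu (tau x))))
   (\row_a Num.sqrt (w a (tau x))).
pose W : 'M[R]_(1 + n) := block_mx 1%:M 0 0 (coframe (space x)).
have sqd (z : R) : 0 < z -> Num.sqrt z * Num.sqrt z = z.
  by move=> z0; rewrite -expr2 sqr_sqrtr // ltW.
have dt : d 0 ti = Num.sqrt (nu (tau x)) by rewrite /d row_mxEl mxE.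
have ds a : d 0 (si a) = Num.sqrt (w a (tau x)) by rewrite /d row_mxEr mxE.
clearbody d; exists (diag_mx d *m W).
  rewrite unitmx_mul; apply/andP; split.
    rewrite unitmxE det_diag unitfE; apply/prodf_neq0 => i _.
    by have [->|[a ->]] := ti_or_si i; rewrite ?dt ?ds sqrtr_eq0 -ltNge.
  have : W *m block_mx 1%:M 0 0 (frame (space x)) = 1%:M.
    rewrite /W mulmx_block !mulmx0 !mul0mx !addr0 !add0r mulmx1 coframe_frame.
    by rewrite -scalar_mx_block.
  by move/mulmx1_unit => [].
rewrite trmx_mul tr_diag_mx -!mulmxA (mulmxA _ (diag_mx d) W) (mulmxA (diag_mx d) _ W).
have -> : diag_mx d *m (Defs.minkowski *m diag_mx d) =
   block_mx (- nu (tau x))%:M 0 0 (diag_mx (\row_a w a (tau x))).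
  rewrite /Defs.minkowski !mulmx_diag; apply/matrixP => i j.
  have [->|[a ->]] := ti_or_si i; have [->|[b ->]] := ti_or_si j.
  - by rewrite block_mxEul !mxE !eqxx !mulr1n /= dt mulN1r mulrN sqd.
  - by rewrite block_mxEur !mxE ti_si mulr0n.
  - by rewrite block_mxEdl !mxE si_ti mulr0n.
  - by rewrite block_mxEdr !mxE si_si ds /= mul1r sqd.
rewrite /W tr_block_mx !trmx0 trmx1 !mulmx_block.
by rewrite !(mulmx0, mul0mx, addr0, add0r, mul1mx, mulmx1) /gmetric mulmxA.
Qed.

(** The value of the form omega^a on the tangent vector [v] at [x]; only the central form depends on
    the point. *)
Definition omega (x v : 'rV[R]_(1 + n)) (a : 'I_n) : R :=
  v 0 (si a) - (a == 0)%:R * \sum_(r < m) x 0 (si (odd_ix r)) * v 0 (si (even_ix r)).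

Lemma omegaE x v a :
  omega x v a = \sum_b coframe (space x) a b * v 0 (si b).
Proof.
rewrite /omega; under [RHS]eq_bigr do rewrite coframeE mulrBl.
rewrite sumrB; congr (_ - _).
  by rewrite (bigD1 a) //= eqxx mul1r big1 ?addr0 // => b; rewrite eq_sym => /negPf->;
    rewrite mul0r.
under [RHS]eq_bigr do rewrite -mulrA mulr_suml.
rewrite -mulr_sumr exchange_big /=; congr (_ * _); apply: eq_bigr => r _.
rewrite (bigD1 (even_ix r)) //= eqxx mulr1 big1 ?addr0 => [|b /negPf->].
  by rewrite spaceE.
by rewrite mulr0 mul0r.
Qed.

Lemma pairing_gmetric x u v : pairing (gmetric x) u v =
  - nu (tau x) * u 0 ti * v 0 ti
  + \sum_a w a (tau x) * omega x u a * omega x v a.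
Proof.
have -> : pairing (gmetric x) u v = \sum_i \sum_j u 0 i * gmetric x i j * v 0 j.
  rewrite /pairing mxE exchange_big /=; apply: eq_bigr => j _.
  by rewrite mxE mulr_suml; apply: eq_bigr => i _; rewrite !mxE.
rewrite sum_ti_si; congr (_ + _).
  rewrite sum_ti_si gmetric_tt [X in _ + X]big1 ?addr0 => [|a _].
    by rewrite [u 0 ti * _]mulrC.
  by rewrite gmetric_ts mulr0 mul0r.
under eq_bigr do rewrite sum_ti_si gmetric_st mulr0 mul0r add0r.
under eq_bigr do under eq_bigr do rewrite gmetric_ss mulr_sumr mulr_suml.
under [RHS]eq_bigr do rewrite !omegaE -mulrA [X in _ * X]mulr_suml mulr_sumr.
rewrite [RHS]exchange_big /=; apply: eq_bigr => a _.
rewrite exchange_big /=; apply: eq_bigr => c _.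
rewrite !mulr_sumr; apply: eq_bigr => b _; ring.
Qed.

End general_metric.

(** * Covariance of the Ricci tensor *)

Section partial_rules.
Context {R : realType} {d : nat}.
Implicit Types f g : 'rV[R]_d -> R.

Lemma partial_sum (I : Type) (r : seq I) (F : I -> 'rV[R]_d -> R) j x :
  (forall i, derivable (F i) x (delta_mx 0 j)) ->
  partial (fun y => \sum_(i <- r) F i y) j x = \sum_(i <- r) partial (F i) j x.
Proof.
move=> Fd; rewrite /partial; suff [] : is_derive x (delta_mx 0 j : 'rV[R]_d)
  (fun y => \sum_(i <- r) F i y) (\sum_(i <- r) 'D_(delta_mx 0 j) (F i) x) by [].
elim: r => [|i r IH].
  rewrite big_nil (_ : (fun _ => _) = fun=> 0); first exact: is_derive_cst.
  by apply/funext => y; rewrite big_nil.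
rewrite big_cons (_ : (fun _ => _) = F i \+ (fun y => \sum_(i <- r) F i y)).
  by apply: is_deriveD; exact: derivableP.
by apply/funext => y; rewrite big_cons.
Qed.

Lemma partialZ c f j x : derivable f x (delta_mx 0 j) ->
  partial (fun y => c * f y) j x = c * partial f j x.
Proof. by move=> fd; rewrite /partial; exact: (deriveZ c fd). Qed.

Lemma partial_cst c j x : partial (fun _ : 'rV[R]_d => c : R) j x = 0.
Proof. exact: derive_cst. Qed.

Lemma partial_sum3 (c : 'I_d -> 'I_d -> 'I_d -> R)
    (F : 'I_d -> 'I_d -> 'I_d -> 'rV[R]_d -> R) l x :
  (forall i j k, Ck 1 setT (F i j k)) ->
  partial (fun z => \sum_i \sum_j \sum_k c i j k * F i j k z) l x =
  \sum_i \sum_j \sum_k c i j k * partial (F i j k) l x.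
Proof.
move=> FC.
have FD i j k z : derivable (F i j k) z (delta_mx 0 l) by exact: (@Ck_derivable _ _ _ 0).
rewrite partial_sum => [|i].
  apply: eq_bigr => i _; rewrite partial_sum => [|j].
    apply: eq_bigr => j _; rewrite partial_sum => [|k].
      by apply: eq_bigr => k _; rewrite partialZ.
    by apply: (@Ck_derivable _ _ _ 0); apply: CkZ.
  by apply: (@Ck_derivable _ _ _ 0); apply: Ck_sum => k _; apply: CkZ.
apply: (@Ck_derivable _ _ _ 0); apply: Ck_sum => j _.
by apply: Ck_sum => k _; apply: CkZ.
Qed.

Lemma exchange_sum5 (X : 'I_d -> 'I_d -> 'I_d -> 'I_d -> 'I_d -> R) :
  \sum_k \sum_k2 \sum_i \sum_j \sum_k1 X k k2 i j k1 =
  \sum_i \sum_j \sum_k2 \sum_k1 \sum_k X k k2 i j k1.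
Proof.
rewrite (eq_bigr _ (fun k _ => exchange_big _ _ _ _ _ _)) /=.
rewrite exchange_big /=; apply: eq_bigr => i _.
rewrite (eq_bigr _ (fun k _ => exchange_big _ _ _ _ _ _)) /=.
rewrite exchange_big /=; apply: eq_bigr => j _.
by rewrite exchange_big /=; apply: eq_bigr => k2 _; rewrite exchange_big.
Qed.

Lemma derive_affine_comp (A : 'M[R]_d) (b : 'rV[R]_d) f x v :
  'D_v (fun y => f (y *m A + b)) x = 'D_(v *m A) f (x *m A + b).
Proof.
rewrite /derive (_ : (fun h : R => _) = (fun h : R => h^-1 *:
   (f (h *: (v *m A) + (x *m A + b)) - f (x *m A + b)))) //.
by apply/funext => h; rewrite /= mulmxDl -scalemxAl addrA.
Qed.

Lemma partial_affine (A : 'M[R]_d) (b : 'rV[R]_d) f i x : Ck 1 setT f ->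
  partial (fun y => f (y *m A + b)) i x = \sum_j A i j * partial f j (x *m A + b).
Proof.
move=> fC; rewrite /partial derive_affine_comp.
have [fd fE] := Ck_is_diff (x *m A + b) fC.
rewrite deriveE // fE; apply: eq_bigr => j _; congr (_ * _).
by rewrite -rowE mxE.
Qed.

End partial_rules.

Section affine_covariance.
Context {R : realType} {d : nat}.
Variables (g : 'rV[R]_d -> 'M[R]_d) (A : 'M[R]_d) (b : 'rV[R]_d).
Hypothesis A_unit : A \in unitmx.
Hypothesis g_unit : forall x, g x \in unitmx.
Local Notation L := (fun y => y *m A + b).
Local Notation B := (invmx A).
Hypothesis gA : forall y, g y = A *m g (L y) *m A^T.
Hypothesis gC : forall i j, Ck 1 setT (fun x => g x i j).
Hypothesis GC : forall k i j, Ck 1 setT (christoffel g k i j).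

(** Twice the Christoffel symbol of the first kind. *)
Definition koszul (i j l : 'I_d) x :=
  partial (fun y => g y j l) i x + partial (fun y => g y i l) j x
     - partial (fun y => g y i j) l x.

Lemma partial_gA i j l y : partial (fun y => g y j l) i y =
  \sum_i' \sum_j' \sum_l' A i i' * A j j' * A l l' *
     partial (fun y => g y j' l') i' (L y).
Proof.
have -> : (fun y => g y j l) = (fun y => (fun z => \sum_j' \sum_l'
    A j j' * A l l' * g z j' l') (L y)).
  apply/funext => z; rewrite gA mxE [RHS]exchange_big /=; apply: eq_bigr => l' _.
  by rewrite !mxE mulr_suml; apply: eq_bigr => j' _; ring.
rewrite (partial_affine A b (f := fun z => \sum_j' \sum_l' A j j' * A l l' * g z j' l')).
  apply: eq_bigr => i' _; rewrite partial_sum => [|j'].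
    rewrite mulr_sumr; apply: eq_bigr => j' _; rewrite partial_sum => [|l'].
      rewrite mulr_sumr; apply: eq_bigr => l' _; rewrite partialZ ?mulrA //.
      exact: (@Ck_derivable _ _ _ 0).
    by apply: (@Ck_derivable _ _ _ 0); apply: CkZ; exact: gC.
  apply: (@Ck_derivable _ _ _ 0).
  by apply: Ck_sum => l' _; apply: CkZ; exact: gC.
by apply: Ck_sum => j' _; apply: Ck_sum => l' _; apply: CkZ; exact: gC.
Qed.

Lemma koszulA i j l y : koszul i j l y =
  \sum_i' \sum_j' \sum_l' A i i' * A j j' * A l l' * koszul i' j' l' (L y).
Proof.
rewrite /koszul !partial_gA.
rewrite [X in _ + X - _]exchange_big /= [X in _ - X]exchange_big /=.
rewrite -big_split -sumrB /=; apply: eq_bigr => i' _.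
rewrite [X in _ + _ - X = _]exchange_big /=.
rewrite -big_split -sumrB /=; apply: eq_bigr => j' _.
rewrite -big_split -sumrB /=; apply: eq_bigr => l' _; ring.
Qed.

(** The connection as one matrix per direction: the quadratic part of the Ricci tensor becomes a
    trace of matrix products, and a linear change of coordinates acts by conjugation. *)
Definition conn i x : 'M[R]_d := \matrix_(l, k) christoffel g k i l x.

Lemma connE i x l k : conn i x l k = christoffel g k i l x.
Proof. by rewrite mxE. Qed.

Lemma conn_koszul i x :
  conn i x = 2^-1 *: ((\matrix_(j, l) koszul i j l x) *m (invmx (g x))^T).
Proof.
apply/matrixP => j k; rewrite !mxE /christoffel; congr (_ * _).
by apply: eq_bigr => l _; rewrite !mxE mulrC.
Qed.

(** An affine map has no second derivatives, so the inhomogeneous term in the transformation law of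
    a connection is absent. *)
Lemma connA i y : conn i y = \sum_i' A i i' *: (A *m conn i' (L y) *m B).
Proof.
rewrite conn_koszul.
have -> : \matrix_(j, l) koszul i j l y =
    \sum_i' A i i' *: (A *m (\matrix_(j, l) koszul i' j l (L y)) *m A^T).
  apply/matrixP => j l; rewrite !mxE koszulA summxE; apply: eq_bigr => i' _.
  rewrite !mxE exchange_big mulr_sumr /=; apply: eq_bigr => l' _.
  rewrite !mxE mulr_suml mulr_sumr; apply: eq_bigr => j' _; rewrite !mxE; ring.
rewrite mulmx_suml scaler_sumr; apply: eq_bigr => i' _.
rewrite -scalemxAl scalerA mulrC -scalerA; congr (_ *: _).
rewrite conn_koszul -scalemxAr -scalemxAl; congr (_ *: _).
rewrite -!mulmxA; congr (_ *m (_ *m _)).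
apply: trmx_inj; rewrite !trmx_mul !trmxK.
apply: (can_inj (mulKmx (g_unit y))); rewrite mulKVmx // gA.
rewrite -!mulmxA (mulmxA A^T) -trmx_mul mulVmx // trmx1 mul1mx.
by rewrite mulmxV ?mulmx1.
Qed.

Lemma tr_connA i y : \tr (conn i y) = \sum_i' A i i' * \tr (conn i' (L y)).
Proof.
rewrite connA raddf_sum /=; apply: eq_bigr => i' _.
by rewrite mxtraceZ mxtrace_mulC mulmxA mulVmx // mul1mx.
Qed.

(** The upper index is contracted with the first lower one; [\tr (conn l x)] contracts it with the
    second. *)
Definition ctrace l x := \sum_k christoffel g k k l x.

Lemma ctraceA l y : ctrace l y = \sum_l' A l l' * ctrace l' (L y).
Proof.
transitivity (\sum_k' (A *m conn k' (L y) *m B *m A) l k').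
  transitivity (\sum_k \sum_k' A k k' * (A *m conn k' (L y) *m B) l k).
    apply: eq_bigr => k _; transitivity (conn k y l k); first by rewrite mxE.
    by rewrite connA summxE; apply: eq_bigr => k' _; rewrite mxE.
  rewrite exchange_big /=; apply: eq_bigr => k' _.
  by rewrite [RHS]mxE; apply: eq_bigr => k _; rewrite mulrC.
transitivity (\sum_k' \sum_l' A l l' * christoffel g k' k' l' (L y)).
  apply: eq_bigr => k' _; rewrite -[_ *m B *m A]mulmxA mulVmx // mulmx1 mxE.
  by apply: eq_bigr => l' _; rewrite mxE.
by rewrite exchange_big /=; apply: eq_bigr => l' _; rewrite mulr_sumr.
Qed.

(** Under affine changes of coordinates the connection is itself a tensor, so each of these four
    pieces is one separately. The covariance of the Ricci tensor is therefore proved piece by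
    piece. *)
Lemma ricci_conn i j x : ricci g i j x =
  \sum_k partial (christoffel g k i j) k x
  - \sum_k partial (christoffel g k i k) j x
  + \sum_l ctrace l x * christoffel g l i j x
  - \tr (conn j x *m conn i x).
Proof.
rewrite /ricci big_split sumrB /= -!addrA; congr (_ + (_ + _)).
rewrite (eq_bigr _ (fun k _ => sumrB _ _ _ _)) sumrB exchange_big /=; congr (_ - _).
  by apply: eq_bigr => l _; rewrite mulr_suml.
rewrite exchange_big; apply: eq_bigr => l _; rewrite mxE.
by apply: eq_bigr => k _; rewrite !mxE.
Qed.

Local Opaque christoffel partial conn ctrace.

Lemma christoffelA k i j y : christoffel g k i j y =
  \sum_i' \sum_j' \sum_k' A i i' * A j j' * B k' k * christoffel g k' i' j' (L y).
Proof.
transitivity (conn i y j k); first by rewrite connE.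
rewrite connA summxE; apply: eq_bigr => i' _.
rewrite mxE [(_ *m B) _ _]mxE [RHS]exchange_big mulr_sumr /=; apply: eq_bigr => k' _.
rewrite mxE mulr_suml mulr_sumr; apply: eq_bigr => j' _; rewrite connE; ring.
Qed.

Lemma div_christoffelA i j y : \sum_k partial (christoffel g k i j) k y =
  \sum_i' \sum_j' A i i' * A j j' * \sum_k partial (christoffel g k i' j') k (L y).
Proof.
transitivity (\sum_k \sum_k2 \sum_i' \sum_j' \sum_k' A k k2 *
   (A i i' * A j j' * B k' k * partial (christoffel g k' i' j') k2 (L y))).
  apply: eq_bigr => k _.
  rewrite (_ : christoffel g k i j = fun y => (fun z => \sum_i' \sum_j' \sum_k'
      A i i' * A j j' * B k' k * christoffel g k' i' j' z) (L y)); last first.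
    by apply/funext => z; exact: christoffelA.
  rewrite (partial_affine A b (f := fun z => \sum_i' \sum_j' \sum_k'
      A i i' * A j j' * B k' k * christoffel g k' i' j' z)).
    apply: eq_bigr => k2 _.
    refine (etrans (congr1 (fun z => A k k2 * z) (@partial_sum3 _ _
      (fun i' j' k' => A i i' * A j j' * B k' k)
      (fun i' j' k' => christoffel g k' i' j') k2 (y *m A + b)
      (fun i' j' k' => GC k' i' j'))) _).
    rewrite mulr_sumr; apply: eq_bigr => i' _.
    by rewrite mulr_sumr; apply: eq_bigr => j' _; rewrite mulr_sumr.
  apply: Ck_sum => i' _; apply: Ck_sum => j' _; apply: Ck_sum => k' _.
  exact: CkZ.
rewrite exchange_sum5; apply: eq_bigr => i' _; apply: eq_bigr => j' _.
rewrite mulr_sumr; apply: eq_bigr => k2 _.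
have BA k' : \sum_k B k' k * A k k2 = (k' == k2)%:R.
  by have := mulVmx A_unit => /matrixP/(_ k' k2); rewrite !mxE.
transitivity (\sum_k' (A i i' * A j j' * partial (christoffel g k' i' j') k2 (L y)) *
    \sum_k B k' k * A k k2).
  by apply: eq_bigr => k' _; rewrite mulr_sumr; apply: eq_bigr => k _; ring.
rewrite (bigD1 k2) //= BA eqxx mulr1 big1 ?addr0 // => k' /negPf k'k.
by rewrite BA k'k mulr0.
Qed.

Lemma partial_tr_conn i j x :
  \sum_k partial (christoffel g k i k) j x = partial (fun z => \tr (conn i z)) j x.
Proof.
rewrite (_ : (fun z => _) = fun z => \sum_k christoffel g k i k z).
  by rewrite partial_sum // => k; apply: (@Ck_derivable _ _ _ 0).
by apply/funext => z; apply: eq_bigr => k _; rewrite connE.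
Qed.

Lemma dtraceA i j y : \sum_k partial (christoffel g k i k) j y =
  \sum_i' \sum_j' A i i' * A j j' * \sum_k partial (christoffel g k i' k) j' (L y).
Proof.
have trC i0 : Ck 1 setT (fun z => \tr (conn i0 z)).
  rewrite (_ : (fun z => _) = fun z => \sum_k christoffel g k i0 k z).
    by apply: Ck_sum => k _.
  by apply/funext => z; apply: eq_bigr => k _; rewrite connE.
refine (etrans (partial_tr_conn i j y) _).
have -> : (fun z => \tr (conn i z)) =
   (fun y => (fun z => \sum_i' A i i' * \tr (conn i' z)) (L y)).
  by apply/funext => z; rewrite tr_connA.
rewrite (partial_affine A b (f := fun z => \sum_i' A i i' * \tr (conn i' z))); last first.
  by apply: Ck_sum => i' _; apply: CkZ.
rewrite [RHS]exchange_big /=; apply: eq_bigr => j' _.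
rewrite partial_sum => [|i']; last by apply: (@Ck_derivable _ _ _ 0); apply: CkZ.
rewrite mulr_sumr; apply: eq_bigr => i' _; rewrite partialZ; last first.
  by apply: (@Ck_derivable _ _ _ 0).
rewrite mulrA [A j j' * A i i']mulrC; congr (_ * _); exact: esym (partial_tr_conn i' j' (L y)).
Qed.

Lemma ctrace_christoffelA i j y : \sum_l ctrace l y * christoffel g l i j y =
  \sum_i' \sum_j' A i i' * A j j' *
    \sum_l ctrace l (L y) * christoffel g l i' j' (L y).
Proof.
transitivity (\sum_i' A i i' * \sum_l ctrace l y * (A *m conn i' (L y) *m B) j l).
  transitivity (\sum_l \sum_i' A i i' * (ctrace l y * (A *m conn i' (L y) *m B) j l)).
    apply: eq_bigr => l _; transitivity (ctrace l y * conn i y j l); first by rewrite connE.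
    rewrite connA summxE mulr_sumr; apply: eq_bigr => i' _; rewrite mxE; ring.
  by rewrite exchange_big; apply: eq_bigr => i' _; rewrite mulr_sumr.
apply: eq_bigr => i' _.
transitivity (A i i' * \sum_l' (A *m conn i' (L y) *m B *m A) j l' * ctrace l' (L y)).
  congr (_ * _).
  transitivity (\sum_l \sum_l' (A *m conn i' (L y) *m B) j l * A l l' * ctrace l' (L y)).
    by apply: eq_bigr => l _; rewrite ctraceA mulr_suml; apply: eq_bigr => l' _; ring.
  rewrite exchange_big /=; apply: eq_bigr => l' _.
  by rewrite [(_ *m A) j l']mxE mulr_suml.
rewrite -[_ *m B *m A]mulmxA mulVmx // mulmx1.
transitivity (A i i' * \sum_l' \sum_j' A j j' * (ctrace l' (L y) * christoffel g l' i' j' (L y))).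
  congr (_ * _); apply: eq_bigr => l' _; rewrite mxE mulr_suml.
  by apply: eq_bigr => j' _; rewrite connE; ring.
rewrite exchange_big mulr_sumr /=; apply: eq_bigr => j' _.
by rewrite -mulr_sumr mulrA.
Qed.

Lemma tr_conn_connA i j y : \tr (conn j y *m conn i y) =
  \sum_i' \sum_j' A i i' * A j j' * \tr (conn j' (L y) *m conn i' (L y)).
Proof.
rewrite [conn j y]connA mulmx_suml raddf_sum /= [RHS]exchange_big /=.
apply: eq_bigr => j' _; rewrite [conn i y]connA mulmx_sumr raddf_sum /=.
apply: eq_bigr => i' _; rewrite -scalemxAl -scalemxAr !mxtraceZ mulrA [A j j' * _]mulrC.
congr (_ * _); rewrite -!mulmxA (mulmxA B A) mulVmx // mul1mx.
by rewrite mxtrace_mulC -!mulmxA mulVmx // mulmx1.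
Qed.

Lemma ricciA i j y : ricci g i j y =
  \sum_i' \sum_j' A i i' * A j j' * ricci g i' j' (L y).
Proof.
have lin4 (a c e f a' c' e' f' : R) : a = a' -> c = c' -> e = e' -> f = f' ->
   a - c + e - f = a' - c' + e' - f' by move=> -> -> -> ->.
refine (etrans (ricci_conn i j y) (etrans (lin4 _ _ _ _ _ _ _ _
  (div_christoffelA i j y) (dtraceA i j y)
  (ctrace_christoffelA i j y) (tr_conn_connA i j y)) _)).
rewrite -sumrB -big_split -sumrB /=; apply: eq_bigr => i' _.
rewrite -sumrB -big_split -sumrB /=; apply: eq_bigr => j' _.
have mul4 (z a c e f : R) : z * a - z * c + z * e - z * f = z * (a - c + e - f) by ring.
by refine (etrans (mul4 _ _ _ _ _) (congr1 _ (esym (ricci_conn i' j' (L y))))).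
Qed.

End affine_covariance.

Section translation.
Context {R : realType} {m : nat}.
Local Notation n := (m.*2.+1).

(** Writing each coframe as 1 - Q, all products of two Q's vanish, so multiplication of coframes
    adds the odd coordinates. *)
Lemma coframeM (y z u : 'rV[R]_n) :
  (forall r, u 0 (odd_ix r) = y 0 (odd_ix r) + z 0 (odd_ix r)) ->
  coframe y *m coframe z = coframe u.
Proof.
move=> uE; pose Q (y : 'rV[R]_n) : 'M[R]_n := 1%:M - coframe y.
have QE (t : 'rV[R]_n) a b : Q t a b =
    (a == 0)%:R * \sum_(r < m) t 0 (odd_ix r) * (b == even_ix r)%:R.
  by rewrite !mxE opprB addrC subrK.
have QQ s t : Q s *m Q t = 0.
  apply/matrixP => a b; rewrite mxE [RHS]mxE big1 // => c _.
  have [->|/negPf c0] := eqVneq c 0; last by rewrite [Q t c b]QE c0 mul0r mulr0.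
  rewrite QE big1 ?mulr0 ?mul0r // => r _.
  by rewrite eq_sym even_ix_neq0 mulr0.
have WQ (t : 'rV[R]_n) : coframe t = 1%:M - Q t by rewrite /Q opprB addrC subrK.
clearbody Q; have -> : coframe y *m coframe z = 1%:M - (Q y + Q z).
  by rewrite (WQ y) (WQ z) mulmxBr mulmx1 mulmxBl mul1mx QQ subr0 opprD addrA.
rewrite (WQ u); congr (_ - _); apply/matrixP => a b; rewrite mxE !QE -mulrDr.
rewrite -big_split; congr (_ * _); apply: eq_bigr => r _.
by rewrite uE mulrDl.
Qed.

(* In the polarized coordinates the left translation by [xi^-1] is affine, with
   linear part [coframe xi]. *)
Definition shear (xi : 'rV[R]_n) : 'M[R]_(1 + n) := block_mx 1%:M 0 0 (coframe xi)^T.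

Definition shearV (xi : 'rV[R]_n) : 'M[R]_(1 + n) := block_mx 1%:M 0 0 (frame xi)^T.

Definition shift_to0 (xi : 'rV[R]_n) : 'rV[R]_(1 + n) := row_mx 0 (heis_inv xi).

Definition to0 xi (y : 'rV[R]_(1 + n)) := y *m shear xi + shift_to0 xi.

Lemma shearK xi : shear xi *m shearV xi = 1%:M.
Proof.
rewrite mulmx_block !(mulmx0, mul0mx, addr0, add0r, mulmx1) -trmx_mul.
by rewrite frame_coframe trmx1 -scalar_mx_block.
Qed.

Lemma shear_unit xi : shear xi \in unitmx.
Proof. exact: (mulmx1_unit (shearK xi)).1. Qed.

Lemma shear_tt xi : shear xi ti ti = 1.
Proof. by rewrite block_mxEul mxE eqxx. Qed.

Lemma shear_st xi a : shear xi (si a) ti = 0.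
Proof. by rewrite block_mxEdl mxE. Qed.

Lemma to0E xi y : to0 xi y = row_mx (lsubmx y)
  (rsubmx y *m (coframe xi)^T + heis_inv xi).
Proof.
rewrite /to0 /shear /shift_to0 -{1}[y]hsubmxK mul_row_block.
by rewrite !(mulmx0, mul0mx, addr0, add0r, mulmx1) add_row_mx addr0.
Qed.

Lemma tau_to0 xi y : tau (to0 xi y) = tau y.
Proof. by rewrite to0E /tau row_mxKl. Qed.

Lemma mul_coframeT xi (v : 'rV[R]_n) :
  v *m (coframe xi)^T = v - heis_cocycle xi v *: delta_mx 0 0.
Proof.
apply/rowP => a; transitivity ((coframe xi *m v^T) a 0).
  by rewrite -[v *m _]trmxK trmx_mul trmxK mxE.
by rewrite coframe_mul !mxE eqxx /= mulrC.
Qed.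

Lemma space_to0 xi y (r : 'I_m) : (space (to0 xi y) : 'rV[R]_n) 0 (odd_ix r) =
  (space y : 'rV[R]_n) 0 (odd_ix r) - xi 0 (odd_ix r).
Proof.
rewrite to0E /space row_mxKr mul_coframeT /heis_inv !mxE !odd_ix_neq0.
by rewrite andbF /= !mulr0 subr0 addr0.
Qed.

Definition pt (t : R) : 'rV[R]_(1 + n) := row_mx (const_mx t) 0.

Lemma to0_pt x : to0 (space x) x = pt (tau x).
Proof.
rewrite to0E /pt; congr row_mx.
  by apply/rowP => i; rewrite (ord1 i) [RHS]mxE.
rewrite mul_coframeT /heis_inv /space.
by apply/rowP => a; rewrite !mxE; ring.
Qed.

Lemma tau_pt t : tau (pt t) = t.
Proof. by rewrite /tau row_mxKl mxE. Qed.

Lemma space_pt t : space (pt t) = (0 : 'rV[R]_n).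
Proof. by rewrite /space row_mxKr. Qed.

Variables (nu : R -> R) (w : 'I_n -> R -> R).

Lemma gmetric_to0 xi y : gmetric nu w y =
  shear xi *m gmetric nu w (to0 xi y) *m (shear xi)^T.
Proof.
rewrite /gmetric tau_to0 /shear tr_block_mx !trmx0 trmx1 trmxK !mulmx_block.
rewrite !(mulmx0, mul0mx, addr0, add0r, mulmx1, mul1mx); congr block_mx.
have <- : coframe (space (to0 xi y)) *m coframe xi = coframe (space y).
  by apply: coframeM => r; rewrite space_to0 subrK.
by rewrite trmx_mul !mulmxA.
Qed.

End translation.

(** * Curvature over the unit element *)

Section smoothness.
Context {R : realType} {m : nat}.
Local Notation n := (m.*2.+1).
Variables (nu : R -> R) (w : 'I_n -> R -> R).
Hypothesis nuC : forall k, Ck k setT (fun x : 'rV[R]_(1 + n) => nu (tau x)).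
Hypothesis wC : forall k a, Ck k setT (fun x : 'rV[R]_(1 + n) => w a (tau x)).
Hypothesis nu_gt0 : forall t, 0 < nu t.
Hypothesis w_gt0 : forall a t, 0 < w a t.
Local Notation g := (gmetric nu w).

Lemma coframe_Ck k a b : Ck k setT (fun x : 'rV[R]_(1 + n) => coframe (space x) a b).
Proof.
rewrite (_ : (fun _ => _) = fun x : 'rV[R]_(1 + n) => (a == b)%:R - (a == 0)%:R *
   \sum_(r < m) (b == even_ix r)%:R * x 0 (si (odd_ix r))).
  apply: CkB; first exact: Ck_cst.
  by apply: CkZ; apply: Ck_sum => r _; apply: CkZ; exact: Ck_coord.
apply/funext => x; rewrite coframeE; congr (_ - _ * _); apply: eq_bigr => r _.
by rewrite spaceE mulrC.
Qed.

Lemma frame_Ck k a b : Ck k setT (fun x : 'rV[R]_(1 + n) => frame (space x) a b).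
Proof.
rewrite (_ : (fun _ => _) = fun x : 'rV[R]_(1 + n) => (2%:M : 'M[R]_n) a b - coframe (space x) a b).
  by apply: CkB; [exact: Ck_cst|exact: coframe_Ck].
by apply/funext => x; rewrite /frame [LHS]mxE [X in _ + X]mxE.
Qed.

Lemma gmetric_Ck k i j : Ck k setT (fun x => g x i j).
Proof.
have [->|[a ->]] := ti_or_si i; have [->|[b ->]] := ti_or_si j.
- rewrite (_ : (fun _ => _) = fun x : 'rV[R]_(1 + n) => - nu (tau x)); first exact: CkN.
  by apply/funext => x; rewrite gmetric_tt.
- rewrite (_ : (fun _ => _) = fun x : 'rV[R]_(1 + n) => 0); first exact: Ck_cst.
  by apply/funext => x; rewrite gmetric_ts.
- rewrite (_ : (fun _ => _) = fun x : 'rV[R]_(1 + n) => 0); first exact: Ck_cst.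
  by apply/funext => x; rewrite gmetric_st.
- rewrite (_ : (fun _ => _) = fun x : 'rV[R]_(1 + n) =>
    \sum_c w c (tau x) * coframe (space x) c a * coframe (space x) c b).
    apply: Ck_sum => c _; apply: CkM; last exact: coframe_Ck.
    by apply: CkM; [exact: wC|exact: coframe_Ck].
  by apply/funext => x; rewrite gmetric_ss.
Qed.

Lemma ginv_Ck k i j : Ck k setT (fun x => ginv nu w x i j).
Proof.
have [->|[a ->]] := ti_or_si i; have [->|[b ->]] := ti_or_si j.
- rewrite (_ : (fun _ => _) = fun x : 'rV[R]_(1 + n) => - (nu (tau x))^-1).
    by apply: CkN; apply: CkV => // x; rewrite gt_eqF.
  by apply/funext => x; rewrite ginv_tt.
- rewrite (_ : (fun _ => _) = fun x : 'rV[R]_(1 + n) => 0); first exact: Ck_cst.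
  by apply/funext => x; rewrite ginv_ts.
- rewrite (_ : (fun _ => _) = fun x : 'rV[R]_(1 + n) => 0); first exact: Ck_cst.
  by apply/funext => x; rewrite ginv_st.
- rewrite (_ : (fun _ => _) = fun x : 'rV[R]_(1 + n) =>
    \sum_c (w c (tau x))^-1 * frame (space x) a c * frame (space x) b c).
    apply: Ck_sum => c _; apply: CkM; last exact: frame_Ck.
    apply: CkM; last exact: frame_Ck.
    by apply: CkV => // x; rewrite gt_eqF.
  by apply/funext => x; rewrite ginv_ss.
Qed.

Lemma christoffel_koszul k i j x :
  christoffel g k i j x = 2^-1 * \sum_l ginv nu w x k l * koszul g i j l x.
Proof. by rewrite /christoffel invmx_gmetric. Qed.

Lemma koszul_Ck k i j l : Ck k setT (koszul g i j l).
Proof.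
by apply: CkB; first apply: CkD; apply: Ck_partial; exact: gmetric_Ck.
Qed.

Lemma gchristoffel_Ck c k i j : Ck c setT (christoffel g k i j).
Proof.
rewrite (_ : christoffel g k i j = fun x => 2^-1 *
  \sum_l ginv nu w x k l * koszul g i j l x).
  apply: CkZ; apply: Ck_sum => l _; apply: CkM; first exact: ginv_Ck.
  exact: koszul_Ck.
by apply/funext => x; rewrite christoffel_koszul.
Qed.

Lemma gmetric_smooth : smooth_on setT g.
Proof. by move=> k; apply: Ck_mx => i j; exact: gmetric_Ck. Qed.

Lemma gricci_to0 i j x : ricci g i j x =
  \sum_i' \sum_j' shear (space x) i i' * shear (space x) j j' *
     ricci g i' j' (pt (tau x)).
Proof.
refine (etrans (@ricciA _ _ g (shear (space x)) (shift_to0 (space x)) (shear_unit _)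
  (gmetric_unit nu_gt0 w_gt0) (gmetric_to0 nu w (space x)) (gmetric_Ck 1)
  (gchristoffel_Ck 1) i j x) _).
have E : x *m shear (space x) + shift_to0 (space x) = pt (tau x) := to0_pt x.
by rewrite E.
Qed.

End smoothness.

Lemma christoffel_shift (R : realType) d (g : 'rV[R]_d -> 'M[R]_d) (u : 'rV[R]_d) k i j x :
  (forall y, g (y + u) = g y) ->
  christoffel g k i j (x + u) = christoffel g k i j x.
Proof.
move=> gu.
have pE a b l : partial (fun y => g y a b) l (x + u) = partial (fun y => g y a b) l x.
  have := derive_affine_comp 1%:M u (fun y => g y a b) x (delta_mx 0 l).
  rewrite !mulmx1 /partial => <-.
  rewrite (_ : (fun y => g (y *m 1%:M + u) a b) = fun y => g y a b) //.
  by apply/funext => y; rewrite mulmx1 gu.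
by rewrite /christoffel gu; congr (_ * _); apply: eq_bigr => l _; rewrite !pE.
Qed.

Section ricci_at_origin.
Context {R : realType} {m : nat}.
Local Notation n := (m.*2.+1).
Variables (nu : R -> R) (w : 'I_n -> R -> R).
Hypothesis nuC : forall k, Ck k setT (fun x : 'rV[R]_(1 + n) => nu (tau x)).
Hypothesis wC : forall k a, Ck k setT (fun x : 'rV[R]_(1 + n) => w a (tau x)).
Hypothesis nu_gt0 : forall t, 0 < nu t.
Hypothesis w_gt0 : forall a t, 0 < w a t.
(** [L] and [H a] are the logarithmic derivatives of the lapse and of the scale factors, [nu] and
    [w a] being their squares. The hypothesis [harmonic] says that the lapse is a constant multiple
    of the product of all scale factors, that is, that tau is a harmonic function. *)
Variables (L L2 : R -> R) (H H2 : 'I_n -> R -> R).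
Hypothesis dnu : forall t : R, is_derive t 1 nu (2 * L t * nu t).
Hypothesis dL : forall t : R, is_derive t 1 L (L2 t).
Hypothesis dw : forall a (t : R), is_derive t 1 (w a) (2 * H a t * w a t).
Hypothesis dH : forall a (t : R), is_derive t 1 (H a) (H2 a t).
Hypothesis harmonic : forall t, L t = \sum_a H a t.
Local Notation g := (gmetric nu w).
Local Notation pt := (@pt R m).

Lemma is_derive_coord d (x : 'rV[R]_d) i j :
  is_derive x (delta_mx 0 j) (fun x : 'rV[R]_d => x 0 i) ((i == j)%:R : R).
Proof.
have := is_derive_id x (delta_mx 0 j : 'rV[R]_d).
by move=> /is_derive_mxP/(_ 0 i); rewrite mxE eqxx.
Qed.

Lemma is_derive_tau (f : R -> R) df (x : 'rV[R]_(1 + n)) i :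
  is_derive (tau x) 1 f df ->
  is_derive x (delta_mx 0 i) (fun x => f (tau x)) (df * (i == ti)%:R).
Proof.
move=> fd; apply: is_derive_comp_real fd; rewrite eq_sym.
rewrite (_ : tau = fun x : 'rV[R]_(1 + n) => x 0 ti); first exact: is_derive_coord.
by apply/funext => y; rewrite tauE.
Qed.

(* [Om i b] is the coefficient of [dx_i /\ dx_b] in [- d omega^0]. *)
Definition Om (i : 'I_(1 + n)) (b : 'I_n) : R :=
  \sum_(r < m) (i == si (odd_ix r))%:R * (b == even_ix r)%:R.

Lemma is_derive_coframe (x : 'rV[R]_(1 + n)) i a b :
  is_derive x (delta_mx 0 i) (fun x => coframe (space x) a b) (- ((a == 0)%:R * Om i b)).
Proof.
rewrite (_ : (fun _ => _) = fun x : 'rV[R]_(1 + n) => (a == b)%:R + (- (a == 0)%:R) *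
   \sum_(r < m) (b == even_ix r)%:R * x 0 (si (odd_ix r))); last first.
  apply/funext => y; rewrite coframeE mulNr; congr (_ - _ * _); apply: eq_bigr => r _.
  by rewrite spaceE mulrC.
have sumd (r : seq 'I_m) : is_derive x (delta_mx 0 i : 'rV[R]_(1 + n))
   (fun x : 'rV[R]_(1 + n) => \sum_(r <- r) (b == even_ix r)%:R * x 0 (si (odd_ix r)))
   (\sum_(r <- r) (i == si (odd_ix r))%:R * (b == even_ix r)%:R).
  elim: r => [|r s IH].
    rewrite big_nil (_ : (fun _ => _) = fun=> 0); first exact: is_derive_cst.
    by apply/funext => y; rewrite big_nil.
  rewrite big_cons (_ : (fun _ => _) =
    (fun y : 'rV[R]_(1 + n) => (b == even_ix r)%:R *: (y 0 (si (odd_ix r)) : R)) \+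
    (fun x : 'rV[R]_(1 + n) => \sum_(r <- s) (b == even_ix r)%:R * x 0 (si (odd_ix r)))).
    apply: is_deriveD; apply: is_derive_eq.
      by apply: is_deriveZ; exact: is_derive_coord.
    by rewrite /GRing.scale /= mulrC eq_sym.
  by apply/funext => y; rewrite big_cons.
apply: is_derive_eq.
by rewrite add0r /GRing.scale /= mulNr.
Qed.

Lemma is_derive_gss (x : 'rV[R]_(1 + n)) i a b :
  is_derive x (delta_mx 0 i) (fun x => g x (si a) (si b))
   ((i == ti)%:R * (\sum_c 2 * H c (tau x) * w c (tau x) * coframe (space x) c a *
         coframe (space x) c b)
    - w 0 (tau x) * (Om i a * coframe (space x) 0 b + coframe (space x) 0 a * Om i b)).
Proof.
rewrite (_ : (fun _ => _) = fun x => \sum_c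
    (w c (tau x) * (coframe (space x) c a * coframe (space x) c b))); last first.
  by apply/funext => y; rewrite gmetric_ss; apply: eq_bigr => c _; rewrite mulrA.
have term c : is_derive x (delta_mx 0 i : 'rV[R]_(1 + n))
   (fun x => w c (tau x) * (coframe (space x) c a * coframe (space x) c b))
   ((i == ti)%:R * (2 * H c (tau x) * w c (tau x) * coframe (space x) c a *
         coframe (space x) c b)
    - (c == 0)%:R * (w c (tau x) * (Om i a * coframe (space x) c b + coframe (space x) c a * Om i b))).
  apply: is_derive_eq.
    apply: is_deriveM; first exact: is_derive_tau (dw c (tau x)).
    by apply: is_deriveM; exact: is_derive_coframe.
  by rewrite /GRing.scale /=; ring.
have -> : (i == ti)%:R * (\sum_c 2 * H c (tau x) * w c (tau x) * coframe (space x) c a *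
         coframe (space x) c b)
    - w 0 (tau x) * (Om i a * coframe (space x) 0 b + coframe (space x) 0 a * Om i b)
  = \sum_c ((i == ti)%:R * (2 * H c (tau x) * w c (tau x) * coframe (space x) c a *
         coframe (space x) c b)
    - (c == 0)%:R * (w c (tau x) * (Om i a * coframe (space x) c b + coframe (space x) c a * Om i b))).
  rewrite sumrB mulr_sumr; congr (_ - _); rewrite (bigD1 0) //= mul1r.
  by rewrite big1 ?addr0 // => c /negPf->; rewrite mul0r.
elim: (index_enum _) => [|c s IH].
  rewrite big_nil (_ : (fun _ => _) = fun=> 0); first exact: is_derive_cst.
  by apply/funext => y; rewrite big_nil.
rewrite big_cons (_ : (fun _ => _) =
  (fun x => w c (tau x) * (coframe (space x) c a * coframe (space x) c b)) \+
  (fun x => \sum_(c <- s) w c (tau x) * (coframe (space x) c a * coframe (space x) c b))).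
  by apply: is_deriveD.
by apply/funext => y; rewrite big_cons.
Qed.

Lemma partial_gss i a b x : partial (fun x => g x (si a) (si b)) i x =
   (i == ti)%:R * (\sum_c 2 * H c (tau x) * w c (tau x) * coframe (space x) c a *
         coframe (space x) c b)
    - w 0 (tau x) * (Om i a * coframe (space x) 0 b + coframe (space x) 0 a * Om i b).
Proof. by case: (is_derive_gss x i a b). Qed.

Lemma partial_gtt i x : partial (fun x => g x ti ti) i x =
  - ((i == ti)%:R * (2 * L (tau x) * nu (tau x))).
Proof.
rewrite (_ : (fun _ => _) = fun x => - nu (tau x)); last first.
  by apply/funext => y; rewrite gmetric_tt.
have [] : is_derive x (delta_mx 0 i : 'rV[R]_(1 + n)) (fun x => - nu (tau x))
    (- ((i == ti)%:R * (2 * L (tau x) * nu (tau x)))); last by [].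
by apply: is_deriveN; rewrite mulrC; exact: is_derive_tau.
Qed.

Lemma partial_gts i a x : partial (fun x => g x ti (si a)) i x = 0.
Proof.
rewrite (_ : (fun _ => _) = fun=> 0); first exact: partial_cst.
by apply/funext => y; rewrite gmetric_ts.
Qed.

Lemma partial_gst i a x : partial (fun x => g x (si a) ti) i x = 0.
Proof.
rewrite (_ : (fun _ => _) = fun=> 0); first exact: partial_cst.
by apply/funext => y; rewrite gmetric_st.
Qed.

Lemma Om_ti b : Om ti b = 0.
Proof. by rewrite /Om big1 // => r _; rewrite ti_si mul0r. Qed.
Lemma Om_0l b : Om (si 0) b = 0.
Proof. by rewrite /Om big1 // => r _; rewrite si_si eq_sym odd_ix_neq0 mul0r. Qed.
Lemma Om_0r i : Om i 0 = 0.
Proof. by rewrite /Om big1 // => r _; rewrite [0 == _]eq_sym even_ix_neq0 mulr0. Qed.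
Lemma Om_el s b : Om (si (even_ix s)) b = 0.
Proof. by rewrite /Om big1 // => r _; rewrite si_si even_odd_ix mul0r. Qed.
Lemma Om_or i s : Om i (odd_ix s) = 0.
Proof. by rewrite /Om big1 // => r _; rewrite odd_even_ix mulr0. Qed.
Lemma Om_oe r s : Om (si (odd_ix r)) (even_ix s) = (r == s)%:R.
Proof.
rewrite /Om (bigD1 r) //= big1 => [|t /negPf tr].
  by rewrite eqxx mul1r addr0 (inj_eq (@even_ix_inj m)) eq_sym.
by rewrite si_si (inj_eq (@odd_ix_inj m)) eq_sym tr mul0r.
Qed.

Lemma coframe_pt t a b : coframe (space (pt t)) a b = (a == b)%:R.
Proof. by rewrite space_pt coframe0 mxE. Qed.

Lemma pgss i a b t : partial (fun x => g x (si a) (si b)) i (pt t) =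
   (i == ti)%:R * ((a == b)%:R * (2 * H a t * w a t))
    - w 0 t * (Om i a * (b == 0)%:R + (a == 0)%:R * Om i b).
Proof.
rewrite partial_gss tau_pt !coframe_pt [0 == b]eq_sym [0 == a]eq_sym.
congr (_ * _ - _); rewrite (bigD1 a) //= big1 => [|c /negPf ca].
  by rewrite !coframe_pt eqxx mulr1 addr0 mulrC.
by rewrite !coframe_pt ca mulr0 mul0r.
Qed.

(** Over the unit the inverse metric is diagonal, so a single term of the contraction survives. *)
Lemma christoffel_pt k i j t : christoffel g k i j (pt t) =
  2^-1 * ginv nu w (pt t) k k * koszul g i j k (pt t).
Proof.
rewrite christoffel_koszul // -mulrA; congr (_ * _).
rewrite (bigD1 k) //= big1 ?addr0 // => l.
have [->|[a ->]] := ti_or_si k; have [->|[b ->]] := ti_or_si l.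
- by rewrite eqxx.
- by rewrite ginv_ts mul0r.
- by rewrite ginv_st mul0r.
- rewrite si_si => /negPf ba; rewrite ginv_ss big1 ?mul0r // => c _.
  rewrite /frame space_pt coframe0 !mxE.
  have [<-|_] := eqVneq a c; last by rewrite subr0 mulr0n mulr0 mul0r.
  by rewrite ba !mulr0n subr0 mulr0.
Qed.

Lemma ginv_tt_pt t : ginv nu w (pt t) ti ti = - (nu t)^-1.
Proof. by rewrite ginv_tt tau_pt. Qed.

Lemma ginv_ss_pt t a : ginv nu w (pt t) (si a) (si a) = (w a t)^-1.
Proof.
rewrite ginv_ss (bigD1 a) //= big1 => [|c /negPf ca].
  by rewrite tau_pt /frame space_pt coframe0 !mxE eqxx !mulr1n addr0; field; rewrite gt_eqF.
by rewrite /frame space_pt coframe0 !mxE eq_sym ca !mulr0n subr0 mulr0.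
Qed.

Let nu_neq0 t : nu t != 0. Proof. by rewrite gt_eqF. Qed.
Let w_neq0 a t : w a t != 0. Proof. by rewrite gt_eqF. Qed.

Lemma chr_t_tt t : christoffel g ti ti ti (pt t) = L t.
Proof.
rewrite christoffel_pt ginv_tt_pt /koszul !partial_gtt eqxx tau_pt /=.
by field.
Qed.

Lemma chr_t_ts t a : christoffel g ti ti (si a) (pt t) = 0.
Proof.
rewrite christoffel_pt /koszul partial_gst partial_gts partial_gtt si_ti.
by rewrite mul0r; ring.
Qed.

Lemma chr_t_st t a : christoffel g ti (si a) ti (pt t) = 0.
Proof.
rewrite christoffel_pt /koszul partial_gst partial_gtt si_ti.
by rewrite mul0r; ring.
Qed.

Lemma chr_t_ss t a b : christoffel g ti (si a) (si b) (pt t) =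
  (a == b)%:R * (H a t * w a t / nu t).
Proof.
rewrite christoffel_pt ginv_tt_pt /koszul !partial_gst pgss eqxx !Om_ti /=.
by field.
Qed.

Lemma chr_s_tt t c : christoffel g (si c) ti ti (pt t) = 0.
Proof.
rewrite christoffel_pt /koszul !partial_gts partial_gtt si_ti /=.
by ring.
Qed.

Lemma chr_s_ts t a c : christoffel g (si c) ti (si a) (pt t) = (c == a)%:R * H a t.
Proof.
rewrite christoffel_pt ginv_ss_pt /koszul pgss !partial_gts eqxx !Om_ti.
rewrite [a == c]eq_sym; have [->|_] := eqVneq c a; last by rewrite /=; ring.
by rewrite /=; field.
Qed.

Lemma chr_s_st t a c : christoffel g (si c) (si a) ti (pt t) = (c == a)%:R * H a t.
Proof.
rewrite christoffel_pt ginv_ss_pt /koszul pgss !partial_gts !partial_gst eqxx !Om_ti.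
rewrite [a == c]eq_sym; have [->|_] := eqVneq c a; last by rewrite /=; ring.
by rewrite /=; field.
Qed.

(** The purely spatial symbols Gamma^c_{ab} over the unit. They come from the structure constants
    [Om] alone, and at least one index has to be central. *)
Definition Gss t (c a b : 'I_n) : R := - (2^-1 * (w 0 t / w c t)) *
  ((c == 0)%:R * (Om (si a) b + Om (si b) a)
   + (b == 0)%:R * (Om (si a) c - Om (si c) a)
   + (a == 0)%:R * (Om (si b) c - Om (si c) b)).

Lemma chr_s_ss t a b c : christoffel g (si c) (si a) (si b) (pt t) = Gss t c a b.
Proof.
rewrite christoffel_pt ginv_ss_pt /koszul !pgss !si_ti /Gss /=; ring.
Qed.

(** A time derivative at [pt t] sees only the points [pt s], where the symbols have closed forms. *)
Lemma partial_ti (f : 'rV[R]_(1 + n) -> R) (F : R -> R) (t dF : R) :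
  (forall s, f (pt s) = F s) -> is_derive t 1 F dF -> partial f ti (pt t) = dF.
Proof.
move=> fF /is_derive_lineP dF1.
suff [] : is_derive (pt t) (delta_mx 0 ti : 'rV[R]_(1 + n)) f dF by [].
apply/is_derive_lineP; rewrite (_ : (fun h : R => _) = (fun h : R => F (h *: (1 : R) + t))) //.
apply/funext => h; rewrite -fF; congr f; apply/rowP => i; rewrite !mxE.
case: splitP => k ik; rewrite !mxE.
  have -> : i = ti by apply: val_inj; rewrite /= ik ord1.
  by rewrite !eqxx /= mulr1 [h *: _]mulr1.
have -> : i = si k by apply: val_inj.
by rewrite si_ti andbF mulr0 addr0.
Qed.

(** In the polarized coordinates the metric depends on tau and on the odd coordinates only. *)
Lemma gmetric_shift (c : 'I_n) (h : R) (y : 'rV[R]_(1 + n)) :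
  (forall r, c != odd_ix r) -> g (y + h *: delta_mx 0 (si c)) = g y.
Proof.
move=> co.
have tE : tau (y + h *: delta_mx 0 (si c)) = tau y.
  by rewrite !tauE !mxE ti_si andbF mulr0 addr0.
have cE : coframe (space (y + h *: delta_mx 0 (si c))) = coframe (space y).
  apply/matrixP => a b; rewrite !coframeE; congr (_ - _ * _).
  apply: eq_bigr => r _; have /negPf oc : odd_ix r != c by rewrite eq_sym co.
  by rewrite !spaceE !mxE si_si oc andbF mulr0 addr0.
by rewrite /gmetric tE cE.
Qed.

Lemma partial_chr_nonodd c i j t : (forall r, c != odd_ix r) ->
  partial (christoffel g (si c) i j) (si c) (pt t) = 0.
Proof.
move=> co; suff [] : is_derive (pt t) (delta_mx 0 (si c) : 'rV[R]_(1 + n))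
   (christoffel g (si c) i j) 0 by [].
apply/is_derive_lineP.
rewrite (_ : (fun h : R => _) = fun=> christoffel g (si c) i j (pt t)).
  exact: is_derive_cst.
apply/funext => h; rewrite addrC; apply: christoffel_shift => y.
exact: gmetric_shift.
Qed.

(** The divergence of the connection differentiates Gamma^c along x_c, and for spatial c this can be
    non-zero only for odd c. The odd rows of the inverse metric are diagonal at every point, not
    only over the unit, so these symbols are known in closed form off the unit and can be
    differentiated. *)
Lemma ginv_odd r x l : ginv nu w x (si (odd_ix r)) l =
  (l == si (odd_ix r))%:R * (w (odd_ix r) (tau x))^-1.
Proof.
have [->|[b ->]] := ti_or_si l; first by rewrite ginv_st ti_si mul0r.
rewrite ginv_ss si_si (bigD1 (odd_ix r)) //= big1 => [|c /negPf ca].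
  rewrite !frameE eqxx odd_ix_neq0 mul0r !addr0 mulr1 mulrC; congr (_ * _).
  by rewrite big1 ?mulr0 ?addr0 // => s _; rewrite odd_even_ix mulr0.
by rewrite frameE eq_sym ca odd_ix_neq0 !mul0r addr0 mulr0 mul0r.
Qed.

Lemma gmetric_odd r x l : g x l (si (odd_ix r)) =
  (l == si (odd_ix r))%:R * w (odd_ix r) (tau x).
Proof.
have [->|[b ->]] := ti_or_si l; first by rewrite gmetric_ts ti_si mul0r.
have cE c : coframe (space x) c (odd_ix r) = (c == odd_ix r)%:R.
  rewrite coframeE big1 ?mulr0 ?subr0 // => s _.
  by rewrite odd_even_ix mulr0.
rewrite gmetric_ss si_si (bigD1 (odd_ix r)) //= big1 => [|c /negPf ca].
  by rewrite cE eqxx coframeE odd_ix_neq0 mul0r subr0 addr0 mulr1 mulrC eq_sym.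
by rewrite cE ca mulr0.
Qed.

Lemma partial_godd r l i x : partial (fun x => g x l (si (odd_ix r))) i x =
  (l == si (odd_ix r))%:R * ((i == ti)%:R * (2 * H (odd_ix r) (tau x) * w (odd_ix r) (tau x))).
Proof.
rewrite (_ : (fun _ => _) = fun x => (l == si (odd_ix r))%:R * w (odd_ix r) (tau x)); last first.
  by apply/funext => y; rewrite gmetric_odd.
have dd := is_derive_tau i (dw (odd_ix r) (tau x)).
by rewrite partialZ; [congr (_ * _); rewrite /partial; case: dd => _ ->; rewrite mulrC|case: dd].
Qed.

Lemma christoffel_odd r i j x : christoffel g (si (odd_ix r)) i j x =
  ((j == si (odd_ix r))%:R * (i == ti)%:R + (i == si (odd_ix r))%:R * (j == ti)%:R)
      * H (odd_ix r) (tau x)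
  - 2^-1 * (w (odd_ix r) (tau x))^-1 * partial (fun x => g x i j) (si (odd_ix r)) x.
Proof.
rewrite christoffel_koszul // (bigD1 (si (odd_ix r))) //= big1 => [|l /negPf lo].
  rewrite ginv_odd eqxx addr0 /koszul !partial_godd /=.
  by field.
by rewrite ginv_odd lo !mul0r.
Qed.

Lemma partial_chr_odd r i j t (P : 'rV[R]_(1 + n) -> R) dP :
  (forall x, partial (fun x => g x i j) (si (odd_ix r)) x = P x) ->
  is_derive (pt t) (delta_mx 0 (si (odd_ix r)) : 'rV[R]_(1 + n)) P dP ->
  partial (christoffel g (si (odd_ix r)) i j) (si (odd_ix r)) (pt t) =
  - (2^-1 * (w (odd_ix r) t)^-1 * dP).
Proof.
move=> PE Pd.
have wd : is_derive t 1 (fun s => 2^-1 * (w (odd_ix r) s)^-1)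
    (2^-1 * (- (w (odd_ix r) t)^-2 * (2 * H (odd_ix r) t * w (odd_ix r) t))).
  have w0 := w_neq0 (odd_ix r) t.
  by apply: is_deriveZ; apply: is_deriveV.
have [] : is_derive (pt t) (delta_mx 0 (si (odd_ix r)) : 'rV[R]_(1 + n))
    (christoffel g (si (odd_ix r)) i j) (- (2^-1 * (w (odd_ix r) t)^-1 * dP)); last by [].
rewrite (_ : christoffel g _ i j = (fun x => ((j == si (odd_ix r))%:R * (i == ti)%:R
   + (i == si (odd_ix r))%:R * (j == ti)%:R) * H (odd_ix r) (tau x))
  - (fun x => (2^-1 * (w (odd_ix r) (tau x))^-1) * P x)); last first.
  by apply/funext => x; rewrite christoffel_odd PE.
apply: is_derive_eq.
  apply: is_deriveB.
    apply: is_deriveZ; apply: (is_derive_tau (df := H2 (odd_ix r) t)).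
    by rewrite tau_pt.
  by apply: is_deriveM; apply: (is_derive_tau (f := fun s => 2^-1 * (w (odd_ix r) s)^-1));
    rewrite tau_pt; exact: wd.
by rewrite si_ti /GRing.scale /= tau_pt; ring.
Qed.

Lemma dchr_ss c a b t :
  partial (christoffel g (si c) (si a) (si b)) (si c) (pt t) =
  - (w 0 t / w c t * (Om (si c) a * Om (si c) b)).
Proof.
have [[r ->]|co] := pselect (exists r, c = odd_ix r); last first.
  rewrite partial_chr_nonodd => [|r]; last by apply/eqP => cr; apply: co; exists r.
  have [->|[r [cr|->]]] := ix_cases c; first by rewrite Om_0l mul0r mulr0 oppr0.
    by case: co; exists r.
  by rewrite Om_el mul0r mulr0 oppr0.
have dcf a' := is_derive_coframe (pt t) (si (odd_ix r)) 0 a'.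
apply: (etrans (@partial_chr_odd r (si a) (si b) t (fun x => - (w 0 (tau x) *
   (Om (si (odd_ix r)) a * coframe (space x) 0 b
   + coframe (space x) 0 a * Om (si (odd_ix r)) b)))
   (2 * w 0 t * (Om (si (odd_ix r)) a * Om (si (odd_ix r)) b)) _ _)); last first.
- by field; rewrite w_neq0.
- apply: is_derive_eq.
    apply: is_deriveN; apply: is_deriveM.
      by apply: (is_derive_tau (df := 2 * H 0 t * w 0 t)); rewrite tau_pt.
  by rewrite si_ti tau_pt /GRing.scale /= !coframe_pt; ring.
- by move=> x; rewrite partial_gss si_ti /= mul0r add0r.
Qed.

Lemma dchr_0 c i j t : (i == ti) || (j == ti) ->
  partial (christoffel g (si c) i j) (si c) (pt t) = 0.
Proof.
move=> ij.
have [[r ->]|co] := pselect (exists r, c = odd_ix r); last first.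
  by apply: partial_chr_nonodd => r; apply/eqP => cr; apply: co; exists r.
rewrite (@partial_chr_odd r i j t (fun=> 0) 0).
- by rewrite mulr0 oppr0.
- move=> x; case/orP: ij => /eqP ->.
    have [->|[b ->]] := ti_or_si j; last exact: partial_gts.
    by rewrite partial_gtt si_ti mul0r oppr0.
  have [->|[b ->]] := ti_or_si i; last exact: partial_gst.
  by rewrite partial_gtt si_ti mul0r oppr0.
Qed.

Lemma Gss_ctr1 t a : \sum_c Gss t c a c = 0.
Proof.
rewrite big1 // => c _; rewrite /Gss subrr mulr0 addr0.
have [->|_] := eqVneq c 0; last by rewrite !mul0r addr0 mulr0.
by rewrite Om_0l Om_0r subrr addr0 !mulr0 addr0 mulr0.
Qed.

Lemma Gss_ctr2 t b : \sum_c Gss t c c b = 0.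
Proof.
rewrite big1 // => c _; rewrite /Gss subrr mulr0 addr0.
have [->|_] := eqVneq c 0; last by rewrite !mul0r addr0 mulr0.
by rewrite Om_0l Om_0r subrr addr0 !mulr0 addr0 mulr0.
Qed.

Lemma tr_conn_pt i t : \tr (conn g i (pt t)) = (i == ti)%:R * (2 * L t).
Proof.
transitivity (\sum_k christoffel g k i k (pt t)); first by apply: eq_bigr => k _; rewrite mxE.
rewrite sum_ti_si; have [->|[a ->]] := ti_or_si i.
  rewrite chr_t_tt eqxx mul1r mulr_natl mulr2n; congr (_ + _); rewrite harmonic.
  by apply: eq_bigr => c _; rewrite chr_s_ts eqxx mul1r.
rewrite chr_t_st si_ti mul0r add0r -[RHS](Gss_ctr1 t a).
by apply: eq_bigr => c _; rewrite chr_s_ss.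
Qed.

Lemma ctrace_pt l t : ctrace g l (pt t) = (l == ti)%:R * (2 * L t).
Proof.
rewrite /ctrace sum_ti_si; have [->|[a ->]] := ti_or_si l.
  rewrite chr_t_tt eqxx mul1r mulr_natl mulr2n; congr (_ + _); rewrite harmonic.
  by apply: eq_bigr => c _; rewrite chr_s_st eqxx mul1r.
rewrite chr_t_ts si_ti mul0r add0r -[RHS](Gss_ctr2 t a).
by apply: eq_bigr => c _; rewrite chr_s_ss.
Qed.

(** The trace is the differential of the logarithm of the volume density, which is 2 L dtau by
    [harmonic]. Its spatial derivatives require values off the unit; affine covariance carries the
    formula there. *)
Lemma tr_conn_all i x : \tr (conn g i x) = (i == ti)%:R * (2 * L (tau x)).
Proof.
refine (etrans (@tr_connA _ _ g (shear (space x)) (shift_to0 (space x)) (shear_unit _)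
  (gmetric_unit nu_gt0 w_gt0) (gmetric_to0 nu w (space x)) (gmetric_Ck nuC wC 1) i x) _).
have -> : x *m shear (space x) + shift_to0 (space x) = pt (tau x) := to0_pt x.
rewrite sum_ti_si tr_conn_pt big1 => [|c _]; last first.
  by rewrite tr_conn_pt si_ti mul0r mulr0.
rewrite eqxx mul1r addr0; have [->|[a ->]] := ti_or_si i; first by rewrite shear_tt eqxx.
by rewrite shear_st si_ti.
Qed.

Lemma dtrace_pt i j t : \sum_k partial (christoffel g k i k) j (pt t) =
  (i == ti)%:R * (j == ti)%:R * (2 * L2 t).
Proof.
refine (etrans (partial_tr_conn (gchristoffel_Ck nuC wC nu_gt0 w_gt0 1) i j (pt t)) _).
rewrite (_ : (fun z => _) = fun z => (i == ti)%:R * (2 * L (tau z))); last first.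
  by apply/funext => z; exact: tr_conn_all.
have [] : is_derive (pt t) (delta_mx 0 j : 'rV[R]_(1 + n))
   (fun z => (i == ti)%:R * (2 * L (tau z))) ((i == ti)%:R * (j == ti)%:R * (2 * L2 t)); last by [].
apply: is_derive_eq.
  apply: is_deriveZ; apply: is_deriveZ; apply: (is_derive_tau (df := L2 t)).
  by rewrite tau_pt.
by rewrite /GRing.scale /=; ring.
Qed.

Lemma div_tt t : \sum_k partial (christoffel g k ti ti) k (pt t) = L2 t.
Proof.
rewrite sum_ti_si big1 => [|c _]; last by rewrite dchr_0 ?eqxx.
rewrite addr0; apply: partial_ti (dL t) => s; exact: chr_t_tt.
Qed.

Lemma div_ts a t : \sum_k partial (christoffel g k ti (si a)) k (pt t) = 0.
Proof.
rewrite sum_ti_si big1 => [|c _]; last by rewrite dchr_0 ?eqxx.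
rewrite addr0; apply: (@partial_ti _ (fun=> 0)) => s; exact: chr_t_ts.
Qed.

Lemma div_st a t : \sum_k partial (christoffel g k (si a) ti) k (pt t) = 0.
Proof.
rewrite sum_ti_si big1 => [|c _]; last by rewrite dchr_0 ?eqxx ?orbT.
rewrite addr0; apply: (@partial_ti _ (fun=> 0)) => s; exact: chr_t_st.
Qed.

Lemma div_ss a b t : \sum_k partial (christoffel g k (si a) (si b)) k (pt t) =
  (a == b)%:R * ((H2 a t + 2 * H a t ^+ 2 - 2 * H a t * L t) * w a t / nu t)
  - w 0 t * \sum_c Om (si c) a * Om (si c) b / w c t.
Proof.
rewrite sum_ti_si; congr (_ + _).
  apply: (@partial_ti _ (fun s => (a == b)%:R * (H a s * w a s / nu s))).
    by move=> s; exact: chr_t_ss.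
  have n0 := nu_neq0 t.
  apply: is_derive_eq.
  by rewrite /GRing.scale /=; field.
rewrite mulr_sumr -sumrN; apply: eq_bigr => c _; rewrite dchr_ss; congr (- _).
by ring.
Qed.

Lemma tr4_tt t : \tr (conn g ti (pt t) *m conn g ti (pt t)) = L t ^+ 2 + \sum_a H a t ^+ 2.
Proof.
rewrite /mxtrace sum_ti_si; congr (_ + _).
  rewrite mxE sum_ti_si !mxE chr_t_tt big1 ?addr0 ?expr2 // => c _.
  by rewrite !mxE chr_s_tt mul0r.
apply: eq_bigr => a _; rewrite mxE sum_ti_si !mxE chr_t_ts mul0r add0r.
rewrite (bigD1 a) //= !mxE chr_s_ts eqxx mul1r big1 ?addr0 ?expr2 // => c /negPf ca.
by rewrite !mxE chr_s_ts ca !mul0r.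
Qed.

Lemma tr4_ts a t : \tr (conn g ti (pt t) *m conn g (si a) (pt t)) = 0.
Proof.
rewrite /mxtrace sum_ti_si mxE sum_ti_si !mxE chr_t_tt chr_t_st mulr0 add0r.
rewrite big1 ?add0r => [|c _]; last by rewrite !mxE chr_s_tt mul0r.
transitivity (\sum_c H c t * Gss t c a c).
  apply: eq_bigr => c _; rewrite mxE sum_ti_si !mxE chr_t_ts mul0r add0r.
  rewrite (bigD1 c) //= !mxE chr_s_ts eqxx mul1r chr_s_ss big1 ?addr0 // => d /negPf dc.
  by rewrite !mxE chr_s_ts dc !mul0r.
rewrite big1 // => c _; rewrite /Gss subrr mulr0 addr0.
have [->|_] := eqVneq c 0; last by rewrite !mul0r addr0 !mulr0.
by rewrite Om_0l Om_0r subrr addr0 !mulr0 addr0 !mulr0.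
Qed.

Lemma tr4_ss a b t : \tr (conn g (si b) (pt t) *m conn g (si a) (pt t)) =
  (a == b)%:R * (2 * H a t ^+ 2 * w a t / nu t)
  + \sum_c \sum_d Gss t d b c * Gss t c a d.
Proof.
rewrite /mxtrace sum_ti_si mxE sum_ti_si !mxE !chr_t_st mul0r add0r.
have -> : \sum_c (conn g (si b) (pt t)) ti (si c) * (conn g (si a) (pt t)) (si c) ti
    = (a == b)%:R * (H a t ^+ 2 * w a t / nu t).
  rewrite (bigD1 b) //= !mxE chr_s_st chr_t_ss eqxx mul1r big1 ?addr0 => [|c /negPf cb].
    by have [->|_] := eqVneq a b; rewrite ?mul0r ?mulr0 // !mul1r; ring.
  by rewrite !mxE chr_s_st cb !mul0r.
transitivity ((a == b)%:R * (H a t ^+ 2 * w a t / nu t) +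
   \sum_c ((c == b)%:R * ((a == b)%:R * (H a t ^+ 2 * w a t / nu t)) +
   \sum_d Gss t d b c * Gss t c a d)).
  congr (_ + _); apply: eq_bigr => c _; rewrite mxE sum_ti_si !mxE; congr (_ + _).
    rewrite chr_t_ss chr_s_st [b == c]eq_sym.
    have [->|_] := eqVneq c b; last by rewrite !mul0r.
    by rewrite [b == a]eq_sym; have [->|_] := eqVneq a b; rewrite /=; ring.
  by apply: eq_bigr => d _; rewrite !mxE !chr_s_ss.
rewrite big_split /= addrA; congr (_ + _).
rewrite (bigD1 b) //= eqxx mul1r big1 ?addr0 => [|c /negPf ->]; last by rewrite mul0r.
by ring.
Qed.

(** Of the nine products of terms, most vanish because [Om] is zero as soon as one of its indices is
    central. *)
Lemma Gss_Gss t a b c d : Gss t d b c * Gss t c a d =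
  w 0 t ^+ 2 / (4 * w c t * w d t) *
  ((c == 0)%:R * ((Om (si b) d - Om (si d) b) * (Om (si a) d + Om (si d) a))
  + (d == 0)%:R * ((Om (si b) c + Om (si c) b) * (Om (si a) c - Om (si c) a))
  - (a == 0)%:R * (b == 0)%:R * (Om (si c) d - Om (si d) c) ^+ 2).
Proof.
have nz : (w c t != 0) && (w d t != 0) by rewrite !w_neq0.
have -> : Gss t d b c * Gss t c a d = w 0 t ^+ 2 / (4 * w c t * w d t) * (
  ((d == 0)%:R * (Om (si b) c + Om (si c) b)
   + (c == 0)%:R * (Om (si b) d - Om (si d) b)
   + (b == 0)%:R * (Om (si c) d - Om (si d) c)) *
  ((c == 0)%:R * (Om (si a) d + Om (si d) a)
   + (d == 0)%:R * (Om (si a) c - Om (si c) a)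
   + (a == 0)%:R * (Om (si d) c - Om (si c) d))).
  by rewrite /Gss; field; rewrite ?w_neq0.
congr (_ * _).
have [->|_] := eqVneq c 0; have [->|_] := eqVneq d 0; rewrite ?Om_0l ?Om_0r /=; ring.
Qed.

Lemma sum_Gss t a b : \sum_c \sum_d Gss t d b c * Gss t c a d =
  2^-1 * w 0 t * (\sum_c (Om (si a) c * Om (si b) c - Om (si c) a * Om (si c) b) / w c t)
  - (a == 0)%:R * (b == 0)%:R * (4^-1 * w 0 t ^+ 2 *
     \sum_c \sum_d (Om (si c) d - Om (si d) c) ^+ 2 / (w c t * w d t)).
Proof.
under eq_bigr do under eq_bigr do rewrite Gss_Gss mulrBr mulrDr.
under eq_bigr do rewrite sumrB big_split /=.
rewrite sumrB big_split /=; congr (_ - _).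
  rewrite (bigD1 0) //= [X in _ + X + _]big1 ?addr0 => [|c /negPf c0]; last first.
    by rewrite big1 // => d _; rewrite c0 mul0r mulr0.
  have -> : \sum_c \sum_d w 0 t ^+ 2 / (4 * w c t * w d t) * ((d == 0)%:R *
      ((Om (si b) c + Om (si c) b) * (Om (si a) c - Om (si c) a))) =
     \sum_c w 0 t ^+ 2 / (4 * w c t * w 0 t) *
      ((Om (si b) c + Om (si c) b) * (Om (si a) c - Om (si c) a)).
    apply: eq_bigr => c _; rewrite (bigD1 0) //= mul1r big1 ?addr0 // => d /negPf->.
    by rewrite mul0r mulr0.
  rewrite -big_split mulr_sumr /=; apply: eq_bigr => c _.
  by field; rewrite !w_neq0.
rewrite 2!mulr_sumr; apply: eq_bigr => c _; rewrite 2!mulr_sumr.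
by apply: eq_bigr => d _; field; rewrite !w_neq0.
Qed.

Lemma ctrace_sum i j t :
  \sum_l ctrace g l (pt t) * christoffel g l i j (pt t) =
  2 * L t * christoffel g ti i j (pt t).
Proof.
rewrite sum_ti_si (ctrace_pt ti) eqxx mul1r big1 ?addr0 // => c _.
by rewrite (ctrace_pt (si c)) si_ti !mul0r.
Qed.

(** The contraction [ctrace] has only a time component, so the third piece of the Ricci tensor
    reduces to 2 L times one symbol. *)
Lemma ricci_parts i j t a c e f :
  \sum_k partial (christoffel g k i j) k (pt t) = a ->
  \sum_k partial (christoffel g k i k) j (pt t) = c ->
  christoffel g ti i j (pt t) = e ->
  \tr (conn g j (pt t) *m conn g i (pt t)) = f ->
  ricci g i j (pt t) = a - c + 2 * L t * e - f.
Proof.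
move=> <- <- <- <-; rewrite -ctrace_sum.
exact: ricci_conn.
Qed.

Lemma ricci_tt t : ricci g ti ti (pt t) = L t ^+ 2 - L2 t - \sum_a H a t ^+ 2.
Proof.
rewrite (ricci_parts (div_tt t) (dtrace_pt ti ti t) (chr_t_tt t) (tr4_tt t)).
by rewrite eqxx /=; ring.
Qed.

Lemma ricci_ts a t : ricci g ti (si a) (pt t) = 0.
Proof.
have tr0 := etrans (mxtrace_mulC _ _) (tr4_ts a t).
rewrite (ricci_parts (div_ts a t) (dtrace_pt ti (si a) t) (chr_t_ts t a) tr0).
by rewrite si_ti /=; ring.
Qed.

Lemma ricci_st a t : ricci g (si a) ti (pt t) = 0.
Proof.
rewrite (ricci_parts (div_st a t) (dtrace_pt (si a) ti t) (chr_t_st t a) (tr4_ts a t)).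
by rewrite si_ti /=; ring.
Qed.

Lemma ricci_ss a b t : ricci g (si a) (si b) (pt t) =
  (a == b)%:R * (H2 a t * w a t / nu t)
  - 2^-1 * w 0 t * (\sum_c (Om (si c) a * Om (si c) b + Om (si a) c * Om (si b) c) / w c t)
  + (a == 0)%:R * (b == 0)%:R * (4^-1 * w 0 t ^+ 2 *
     \sum_c \sum_d (Om (si c) d - Om (si d) c) ^+ 2 / (w c t * w d t)).
Proof.
rewrite (ricci_parts (div_ss a b t) (dtrace_pt (si a) (si b) t) (chr_t_ss t a b) (tr4_ss a b t)).
rewrite sum_Gss si_ti.
have -> : \sum_c (Om (si c) a * Om (si c) b + Om (si a) c * Om (si b) c) / w c t =
  \sum_c (Om (si a) c * Om (si b) c - Om (si c) a * Om (si c) b) / w c t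
  + 2 * \sum_c Om (si c) a * Om (si c) b / w c t.
  rewrite mulr_sumr -big_split /=; apply: eq_bigr => c _; ring.
set S1 := \sum_c _ / _; set S2 := \sum_c (_ - _) / _; set S3 := \sum_c \sum_d _.
by rewrite /=; field; rewrite nu_neq0.
Qed.

End ricci_at_origin.

(** * The field equations at an arbitrary point *)

Section einstein_general.
Context {R : realType} {m : nat}.
Local Notation n := (m.*2.+1).
Variables (nu : R -> R) (w : 'I_n -> R -> R).
Hypothesis nuC : forall k, Ck k setT (fun x : 'rV[R]_(1 + n) => nu (tau x)).
Hypothesis wC : forall k a, Ck k setT (fun x : 'rV[R]_(1 + n) => w a (tau x)).
Hypothesis nu_gt0 : forall t, 0 < nu t.
Hypothesis w_gt0 : forall a t, 0 < w a t.
Variables (L L2 : R -> R) (H H2 : 'I_n -> R -> R).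
Hypothesis dnu : forall t : R, is_derive t 1 nu (2 * L t * nu t).
Hypothesis dL : forall t : R, is_derive t 1 L (L2 t).
Hypothesis dw : forall a (t : R), is_derive t 1 (w a) (2 * H a t * w a t).
Hypothesis dH : forall a (t : R), is_derive t 1 (H a) (H2 a t).
Hypothesis harmonic : forall t, L t = \sum_a H a t.
Local Notation g := (gmetric nu w).
Local Notation pt := (@pt R m).

Definition twist (r : 'I_m) t : R := nu t * w 0 t / (w (odd_ix r) t * w (even_ix r) t).

Hypothesis H2_0 : forall t, H2 0 t = - (2^-1 * \sum_r twist r t).
Hypothesis H2_odd : forall r t, H2 (odd_ix r) t = 2^-1 * twist r t.
Hypothesis H2_even : forall r t, H2 (even_ix r) t = 2^-1 * twist r t.
Variable q : R.
Hypothesis energy : forall t, L t ^+ 2 - L2 t - \sum_a H a t ^+ 2 = q ^+ 2.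

Let nu_neq0 t : nu t != 0. Proof. by rewrite gt_eqF. Qed.
Let w_neq0 a t : w a t != 0. Proof. by rewrite gt_eqF. Qed.

Local Notation OmR := (@Om R m).

Definition OmE := (@Om_0l R m, @Om_0r R m, @Om_el R m, @Om_or R m, @Om_oe R m).

Lemma sum_delta (F : 'I_m -> R) s : \sum_r (r == s)%:R * F r = F s.
Proof. by rewrite (bigD1 s) //= eqxx mul1r big1 ?addr0 // => r /negPf->; rewrite mul0r. Qed.

Lemma sum_Om_sq t : \sum_c \sum_d (OmR (si c) d - OmR (si d) c) ^+ 2 / (w c t * w d t) =
  2 * \sum_r (w (odd_ix r) t * w (even_ix r) t)^-1.
Proof.
rewrite sum_pairs big1 ?add0r => [|d _]; last by rewrite !OmE subrr expr2 mul0r mul0r.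
rewrite mulr_sumr; apply: eq_bigr => r _.
rewrite !sum_pairs !OmE !subrr !expr2 !mul0r !add0r.
have -> : \sum_s ((OmR (si (odd_ix r)) (odd_ix s) - OmR (si (odd_ix s)) (odd_ix r)) ^+ 2
      / (w (odd_ix r) t * w (odd_ix s) t)
   + (OmR (si (odd_ix r)) (even_ix s) - OmR (si (even_ix s)) (odd_ix r)) ^+ 2
      / (w (odd_ix r) t * w (even_ix s) t)) =
   \sum_s (s == r)%:R * (w (odd_ix r) t * w (even_ix s) t)^-1.
  apply: eq_bigr => s _; rewrite !OmE !subr0 expr2 !mul0r add0r eq_sym.
  by case: (s == r); rewrite /= ?expr1n ?mul1r ?expr2 ?mul0r.
have -> : \sum_s ((OmR (si (even_ix r)) (odd_ix s) - OmR (si (odd_ix s)) (even_ix r)) ^+ 2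
      / (w (even_ix r) t * w (odd_ix s) t)
   + (OmR (si (even_ix r)) (even_ix s) - OmR (si (even_ix s)) (even_ix r)) ^+ 2
      / (w (even_ix r) t * w (even_ix s) t)) =
   \sum_s (s == r)%:R * (w (even_ix r) t * w (odd_ix s) t)^-1.
  apply: eq_bigr => s _; rewrite !OmE !sub0r oppr0 [0 ^+ 2]expr2 !mul0r addr0.
  by rewrite sqrrN; case: (s == r); rewrite /= ?expr1n ?mul1r ?expr2 ?mul0r.
by rewrite !sum_delta [w (even_ix r) t * _]mulrC mulr2n mulrDl !mul1r.
Qed.

Lemma sum_Om_l t a : \sum_c (OmR (si c) a * OmR (si c) 0 + OmR (si a) c * OmR (si 0) c) / w c t = 0.
Proof. by rewrite big1 // => c _; rewrite !OmE !mulr0 addr0 mul0r. Qed.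

Lemma sum_Om_oo t r s : \sum_c (OmR (si c) (odd_ix r) * OmR (si c) (odd_ix s)
   + OmR (si (odd_ix r)) c * OmR (si (odd_ix s)) c) / w c t = (r == s)%:R / w (even_ix r) t.
Proof.
rewrite sum_pairs !OmE !mulr0 addr0 mul0r add0r.
transitivity (\sum_k (k == r)%:R * ((k == s)%:R / w (even_ix k) t)); last exact: sum_delta.
apply: eq_bigr => k _; rewrite !OmE !mulr0 !addr0 mul0r add0r.
by rewrite [r == k]eq_sym [s == k]eq_sym add0r mulrA.
Qed.

Lemma sum_Om_ee t r s : \sum_c (OmR (si c) (even_ix r) * OmR (si c) (even_ix s)
   + OmR (si (even_ix r)) c * OmR (si (even_ix s)) c) / w c t = (r == s)%:R / w (odd_ix r) t.
Proof.
rewrite sum_pairs !OmE !mulr0 addr0 mul0r add0r.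
transitivity (\sum_k (k == r)%:R * ((k == s)%:R / w (odd_ix k) t)); last exact: sum_delta.
by apply: eq_bigr => k _; rewrite !OmE !mulr0 !addr0 mul0r addr0 mulrA.
Qed.

Lemma sum_Om_oe t r s : \sum_c (OmR (si c) (odd_ix r) * OmR (si c) (even_ix s)
   + OmR (si (odd_ix r)) c * OmR (si (even_ix s)) c) / w c t = 0.
Proof.
rewrite sum_pairs !OmE !mulr0 addr0 mul0r add0r big1 // => k _.
by rewrite !OmE !(mul0r, mulr0, addr0).
Qed.

Lemma sum_Om_eo t r s : \sum_c (OmR (si c) (even_ix r) * OmR (si c) (odd_ix s)
   + OmR (si (even_ix r)) c * OmR (si (odd_ix s)) c) / w c t = 0.
Proof.
refine (etrans _ (sum_Om_oe t s r)); apply: eq_bigr => c _; congr (_ / _).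
by congr (_ + _); rewrite mulrC.
Qed.

Lemma ricci_ss0 a b t : ricci g (si a) (si b) (pt t) = 0.
Proof.
rewrite (ricci_ss nuC wC nu_gt0 w_gt0 dnu dL dw dH harmonic).
have symS a' b' : \sum_c (OmR (si c) a' * OmR (si c) b' + OmR (si a') c * OmR (si b') c) / w c t
   = \sum_c (OmR (si c) b' * OmR (si c) a' + OmR (si b') c * OmR (si a') c) / w c t.
  by apply: eq_bigr => c _; rewrite [OmR _ a' * _]mulrC [OmR _ c * _]mulrC.
have [->|[r [->|->]]] := ix_cases a; have [->|[s [->|->]]] := ix_cases b; last first.
- rewrite (sum_Om_ee t r s) (inj_eq (@even_ix_inj m)) even_ix_neq0.
  have [->|_] := eqVneq r s; last by rewrite /=; ring.
  by rewrite H2_even /twist /=; field; rewrite !w_neq0 nu_neq0.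
- by rewrite (sum_Om_eo t r s) even_odd_ix even_ix_neq0 /=; ring.
- by rewrite (sum_Om_l t (even_ix r)) even_ix_neq0 /=; ring.
- by rewrite (sum_Om_oe t r s) odd_even_ix odd_ix_neq0 /=; ring.
- rewrite (sum_Om_oo t r s) (inj_eq (@odd_ix_inj m)) odd_ix_neq0.
  have [->|_] := eqVneq r s; last by rewrite /=; ring.
  by rewrite H2_odd /twist /=; field; rewrite !w_neq0 nu_neq0.
- by rewrite (sum_Om_l t (odd_ix r)) odd_ix_neq0 /=; ring.
- by rewrite (symS 0) (sum_Om_l t (even_ix s)) [0 == _]eq_sym even_ix_neq0 /=; ring.
- by rewrite (symS 0) (sum_Om_l t (odd_ix s)) [0 == _]eq_sym odd_ix_neq0 /=; ring.
- rewrite eqxx (sum_Om_l t 0) sum_Om_sq H2_0 /=.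
  have -> : \sum_r twist r t = nu t * w 0 t * \sum_r (w (odd_ix r) t * w (even_ix r) t)^-1.
    by rewrite mulr_sumr.
  by field.
Qed.

Lemma ricci_pt i j t : ricci g i j (pt t) = (i == ti)%:R * (j == ti)%:R * q ^+ 2.
Proof.
have [->|[a ->]] := ti_or_si i; have [->|[b ->]] := ti_or_si j.
- by rewrite (ricci_tt nuC wC nu_gt0 w_gt0 dnu dL dw dH harmonic) energy eqxx !mul1r.
- by rewrite (ricci_ts nuC wC nu_gt0 w_gt0 dnu dL dw dH harmonic) si_ti mulr0 mul0r.
- by rewrite (ricci_st nuC wC nu_gt0 w_gt0 dnu dL dw dH harmonic) si_ti !mul0r.
- by rewrite ricci_ss0 si_ti !mul0r.
Qed.

Lemma gricciE i j x : ricci g i j x = (i == ti)%:R * (j == ti)%:R * q ^+ 2.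
Proof.
rewrite (gricci_to0 nuC wC nu_gt0 w_gt0).
have shT k : shear (space x) k ti = (k == ti)%:R.
  by have [->|[a ->]] := ti_or_si k; rewrite ?shear_tt ?eqxx // shear_st si_ti.
transitivity (\sum_i' (i' == ti)%:R * \sum_j' (j' == ti)%:R *
   (shear (space x) i i' * shear (space x) j j' * q ^+ 2)).
  apply: eq_bigr => i' _; rewrite mulr_sumr; apply: eq_bigr => j' _.
  by rewrite ricci_pt; ring.
rewrite (bigD1 ti) //= [X in _ + X]big1 => [|k /negPf->]; last by rewrite mul0r.
rewrite ?eqxx mul1r addr0 (bigD1 ti) //= big1 => [|k /negPf->]; last by rewrite mul0r.
by rewrite ?eqxx mul1r addr0 !shT.
Qed.

Variable phi0 : R.
Local Notation phi := (@scalar_field R m q phi0).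

Lemma partial_phi i x : partial phi i x = q * (i == ti)%:R.
Proof.
rewrite /scalar_field; have [] : is_derive x (delta_mx 0 i : 'rV[R]_(1 + n))
  (fun x => q * tau x + phi0) (q * (i == ti)%:R); last by [].
apply: is_derive_eq.
  apply: is_deriveD; apply: is_deriveZ; exact: (is_derive_tau (f := id)).
by rewrite addr0 mul1r.
Qed.

Lemma phi_smooth : smooth_on setT phi.
Proof.
move=> k; rewrite (_ : phi = fun x => q * x 0 ti + phi0); last first.
  by apply/funext => x; rewrite /scalar_field tauE.
by apply: CkD; [apply: CkZ; exact: Ck_coord|exact: Ck_cst].
Qed.

Lemma chr_ti i j x : christoffel g ti i j x =
  - (2 * nu (tau x))^-1 * koszul g i j ti x.
Proof.
rewrite christoffel_koszul // sum_ti_si ginv_tt big1 => [|a _]; last first.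
  by rewrite ginv_ts mul0r.
by rewrite addr0; field.
Qed.

(** As [phi] is affine in tau, its wave operator is - q times the contraction of Gamma^tau_{ij} with
    the inverse metric. The spatial part of this contraction is sum_a H_a / nu, since frame and
    coframe are inverse to each other; the time part is - L / nu, and [harmonic] makes them
    cancel. *)
Lemma gbox x : box g phi x = 0.
Proof.
have ppE i j : partial (partial phi j) i x = 0.
  rewrite (_ : partial phi j = fun=> q * (j == ti)%:R); first exact: partial_cst.
  by apply/funext => y; exact: partial_phi.
transitivity (- q * \sum_i \sum_j ginv nu w x i j * christoffel g ti i j x).
  rewrite /box invmx_gmetric // mulr_sumr; apply: eq_bigr => i _.
  rewrite mulr_sumr; apply: eq_bigr => j _; rewrite ppE sub0r.
  rewrite sum_ti_si partial_phi eqxx big1 => [|a _]; last first.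
    by rewrite partial_phi si_ti !mulr0.
  by rewrite /=; ring.
suff -> : \sum_i \sum_j ginv nu w x i j * christoffel g ti i j x = 0 by rewrite mulr0.
rewrite sum_ti_si sum_ti_si [X in _ + X + _]big1 => [|a _]; last by rewrite ginv_ts mul0r.
under eq_bigr do rewrite sum_ti_si ginv_st mul0r add0r.
have -> : \sum_a \sum_b ginv nu w x (si a) (si b) * christoffel g ti (si a) (si b) x =
   (nu (tau x))^-1 * \sum_c H c (tau x).
  transitivity (\sum_a \sum_b \sum_e \sum_c (nu (tau x))^-1 *
    ((w e (tau x))^-1 * H c (tau x) * w c (tau x)
      * (coframe (space x) c a * frame (space x) a e)
      * (coframe (space x) c b * frame (space x) b e))).
    apply: eq_bigr => a _; apply: eq_bigr => b _.
    rewrite ginv_ss chr_ti /koszul. rewrite !(partial_gst) (partial_gss nu dw) eqxx !Om_ti /=.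
    rewrite mulr_suml; apply: eq_bigr => e _.
    rewrite !(mul0r, mulr0, addr0, subr0, mul1r, add0r, sub0r) mulrNN mulrA.
    by rewrite !mulr_sumr; apply: eq_bigr => c _; field; rewrite w_neq0 nu_neq0.
  have cf c e : \sum_a coframe (space x) c a * frame (space x) a e = (c == e)%:R.
    by have /matrixP/(_ c e) := coframe_frame (space x); rewrite !mxE.
  transitivity (\sum_e \sum_c (nu (tau x))^-1 * ((w e (tau x))^-1 * H c (tau x) * w c (tau x))
     * (c == e)%:R * (c == e)%:R).
    transitivity (\sum_a \sum_e \sum_c (nu (tau x))^-1 *
    ((w e (tau x))^-1 * H c (tau x) * w c (tau x)
      * (coframe (space x) c a * frame (space x) a e)
      * (c == e)%:R)).
      apply: eq_bigr => a _; rewrite exchange_big /=; apply: eq_bigr => e _.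
      rewrite exchange_big /=; apply: eq_bigr => c _.
      by rewrite -!mulr_sumr cf.
    rewrite exchange_big /=; apply: eq_bigr => e _.
    rewrite exchange_big /=; apply: eq_bigr => c _.
    by rewrite -mulr_sumr -mulr_suml -mulr_sumr cf !mulrA.
  rewrite exchange_big mulr_sumr /=; apply: eq_bigr => c _.
  rewrite (bigD1 c) //= eqxx big1 => [|e]; last by rewrite eq_sym => /negPf->; rewrite mulr0.
  by rewrite /=; field; rewrite ?w_neq0 ?nu_neq0.
rewrite -harmonic ginv_tt chr_ti /koszul !(partial_gtt w dnu) eqxx /=.
by field.
Qed.

End einstein_general.

(** * The bounce solution *)

Section log_derivative.
Context {R : realType}.

Lemma is_derive_prod_log (I : Type) (s : seq I) (P : pred I) (F : I -> R -> R)
    (l : I -> R) (t : R) :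
  (forall i, is_derive t 1 (F i) (l i * F i t)) ->
  is_derive t 1 (fun t => \prod_(i <- s | P i) F i t)
    ((\sum_(i <- s | P i) l i) * \prod_(i <- s | P i) F i t).
Proof.
move=> Fd; elim: s => [|i s IH].
  rewrite !big_nil mul0r (_ : (fun _ => _) = fun=> 1); first exact: is_derive_cst.
  by apply/funext => u; rewrite big_nil.
rewrite !big_cons; case: ifP => Pi.
  rewrite (_ : (fun _ => _) = F i \* (fun u => \prod_(i <- s | P i) F i u)).
    by apply: is_derive_eq; rewrite /GRing.scale /=; ring.
  by apply/funext => u; rewrite big_cons Pi.
rewrite (_ : (fun _ => _) = (fun u => \prod_(i <- s | P i) F i u)) //.
by apply/funext => u; rewrite big_cons Pi.
Qed.

End log_derivative.

Section bounce_solution.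
Context {R : realType} {m : nat}.
Local Notation n := (m.*2.+1).
Variables (A p : 'I_n -> R).
Hypothesis A_gt0 : forall a, 0 < A a.
Hypothesis chi_gt0 : forall r : 'I_m, 0 < chi p r.

(** Gives all horizontal indices one formula: a sum or product over the [r] with [in_pair a r] has
    exactly one term for horizontal [a]. *)
Definition in_pair (a : 'I_n) (r : 'I_m) := (a == odd_ix r) || (a == even_ix r).

Definition nuS (t : R) : R := expR (2 * t) * \prod_r bounce A p r t.

Definition wS (a : 'I_n) (t : R) : R := A a ^+ 2 * expR (2 * p a * t) *
  (if a == 0 then \prod_r (bounce A p r t)^-1
   else \prod_(r | in_pair a r) bounce A p r t).

(* [nuS] is N^2 and [wS a] is a_a^2; [flog r], [LS], [HS a] are the log-derivatives of F_r, N and a_a,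
   and [flog2 r], [L2S], [H2S a] their derivatives. *)
Definition flog (r : 'I_m) (t : R) : R := 2 * chi p r * (1 - (bounce A p r t)^-1).
Definition flog2 (r : 'I_m) (t : R) : R :=
  4 * chi p r ^+ 2 * (bounce A p r t - 1) / bounce A p r t ^+ 2.

Definition LS (t : R) : R := 1 + 2^-1 * \sum_r flog r t.
Definition L2S (t : R) : R := 2^-1 * \sum_r flog2 r t.
Definition HS (a : 'I_n) (t : R) : R := p a +
  (if a == 0 then - (2^-1 * \sum_r flog r t) else 2^-1 * \sum_(r | in_pair a r) flog r t).
Definition H2S (a : 'I_n) (t : R) : R :=
  (if a == 0 then - (2^-1 * \sum_r flog2 r t) else 2^-1 * \sum_(r | in_pair a r) flog2 r t).

Lemma bounce_ge1 r t : 1 <= bounce A p r t.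
Proof.
rewrite /bounce lerDl mulr_ge0 ?expR_ge0 // divr_ge0 ?sqr_ge0 //.
by rewrite mulr_ge0 ?sqr_ge0.
Qed.

Lemma bounce_gt0 r t : 0 < bounce A p r t.
Proof. exact: lt_le_trans ltr01 (bounce_ge1 r t). Qed.

Lemma bounce_neq0 r t : bounce A p r t != 0.
Proof. by rewrite gt_eqF // bounce_gt0. Qed.

Lemma nuS_gt0 t : 0 < nuS t.
Proof. by rewrite mulr_gt0 ?expR_gt0 // prodr_gt0 // => r _; exact: bounce_gt0. Qed.

Lemma wS_gt0 a t : 0 < wS a t.
Proof.
rewrite mulr_gt0 // ?mulr_gt0 ?expR_gt0 ?exprn_gt0 //.
by case: ifP => _; apply: prodr_gt0 => r _; rewrite ?invr_gt0 bounce_gt0.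
Qed.

Lemma in_pair_odd r s : in_pair (odd_ix r) s = (s == r).
Proof. by rewrite /in_pair odd_even_ix orbF (inj_eq (@odd_ix_inj m)) eq_sym. Qed.

Lemma in_pair_even r s : in_pair (even_ix r) s = (s == r).
Proof. by rewrite /in_pair even_odd_ix (inj_eq (@even_ix_inj m)) eq_sym. Qed.

Lemma wS_odd r t : wS (odd_ix r) t =
  A (odd_ix r) ^+ 2 * expR (2 * p (odd_ix r) * t) * bounce A p r t.
Proof.
rewrite /wS odd_ix_neq0 (eq_bigl (pred1 r)) ?big_pred1_eq // => s.
by rewrite in_pair_odd.
Qed.

Lemma wS_even r t : wS (even_ix r) t =
  A (even_ix r) ^+ 2 * expR (2 * p (even_ix r) * t) * bounce A p r t.
Proof.
rewrite /wS even_ix_neq0 (eq_bigl (pred1 r)) ?big_pred1_eq // => s.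
by rewrite in_pair_even.
Qed.

Lemma wS_0 t : wS 0 t = A 0 ^+ 2 * expR (2 * p 0 * t) * \prod_r (bounce A p r t)^-1.
Proof. by rewrite /wS eqxx. Qed.

Lemma sqr_expR (c t : R) : expR (c * t) ^+ 2 = expR (2 * c * t).
Proof. by rewrite expr2 -expRD; congr expR; ring. Qed.

Lemma sqr_sqrt_bounce r t : Num.sqrt (bounce A p r t) ^+ 2 = bounce A p r t.
Proof. by rewrite sqr_sqrtr // ltW // bounce_gt0. Qed.

Lemma lapse2 t : lapse A p t ^+ 2 = nuS t.
Proof.
rewrite /lapse /nuS exprMn -[expR t]/(expR t) -{1}[t]mul1r sqr_expR mulr1; congr (_ * _).
by rewrite -prodrXl; apply: eq_bigr => r _; rewrite sqr_sqrt_bounce.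
Qed.

Lemma scale02 t : scale0 A p t ^+ 2 = wS 0 t.
Proof.
rewrite /scale0 wS_0 !exprMn sqr_expR; congr (_ * _).
by rewrite -prodrXl; apply: eq_bigr => r _; rewrite exprVn sqr_sqrt_bounce.
Qed.

Lemma scale2_odd r t : scale A p r (odd_ix r) t ^+ 2 = wS (odd_ix r) t.
Proof. by rewrite /scale wS_odd !exprMn sqr_expR sqr_sqrt_bounce. Qed.

Lemma scale2_even r t : scale A p r (even_ix r) t ^+ 2 = wS (even_ix r) t.
Proof. by rewrite /scale wS_even !exprMn sqr_expR sqr_sqrt_bounce. Qed.

Lemma metric_gmetric : Defs.metric A p = gmetric nuS wS.
Proof.
apply/funext => x; rewrite /Defs.metric /gmetric lapse2; congr block_mx.
have rowE (c : R) (W : 'M[R]_n) a i j :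
    (c *: ((row a W)^T *m row a W)) i j = c * (W a i * W a j).
  by rewrite !mxE big_ord1 !mxE.
apply/matrixP => i j; rewrite mul_diag_sum sum_pairs [LHS]mxE.
rewrite [X in X + _ = _]rowE scale02; congr (_ + _); first by rewrite ?mxE; ring.
rewrite summxE; apply: eq_bigr => r _; rewrite [LHS]mxE.
by rewrite !rowE scale2_odd scale2_even; rewrite ?mxE; ring.
Qed.

Lemma is_derive_bounce r (t : R) :
  is_derive t 1 (bounce A p r) (2 * chi p r * (bounce A p r t - 1)).
Proof.
have ed : is_derive t 1 (fun t => expR (2 * chi p r * t)) (expR (2 * chi p r * t) * (2 * chi p r)).
  by apply: is_derive_eq; rewrite /GRing.scale /=; ring.
rewrite /bounce; apply: is_derive_eq.
by rewrite add0r [LHS]mulrA addrAC subrr add0r; ring.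
Qed.

Lemma is_derive_bounce_log r (t : R) :
  is_derive t 1 (bounce A p r) (flog r t * bounce A p r t).
Proof.
apply: is_derive_eq (is_derive_bounce r t) _.
by rewrite /flog; field; exact: bounce_neq0.
Qed.

Lemma is_derive_bounceV_log r (t : R) :
  is_derive t 1 (fun t => (bounce A p r t)^-1) (- flog r t * (bounce A p r t)^-1).
Proof.
have b0 := bounce_neq0 r t; have bd := is_derive_bounce_log r t.
by apply: is_derive_eq; rewrite /GRing.scale /=; field.
Qed.

Lemma is_derive_flog r (t : R) : is_derive t 1 (flog r) (flog2 r t).
Proof.
have b0 := bounce_neq0 r t; have bd := is_derive_bounceV_log r t.
rewrite /flog; apply: is_derive_eq.
by rewrite /flog2 /GRing.scale /flog /=; field.
Qed.

Lemma is_derive_exp_lin (c t : R) : is_derive t 1 (fun t => expR (c * t)) (c * expR (c * t)).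
Proof.
by apply: is_derive_eq; rewrite /GRing.scale /=; ring.
Qed.

Lemma is_derive_nuS (t : R) : is_derive t 1 nuS (2 * LS t * nuS t).
Proof.
have pd := is_derive_prod_log (index_enum 'I_m) xpredT (fun r => is_derive_bounce_log r t).
have ed := is_derive_exp_lin 2 t.
rewrite /nuS; apply: is_derive_eq.
by rewrite /LS /GRing.scale /=; field.
Qed.

Lemma is_derive_wS a (t : R) : is_derive t 1 (wS a) (2 * HS a t * wS a t).
Proof.
have ed := is_derive_exp_lin (2 * p a) t.
rewrite /wS /HS; case: (a == 0).
  have pd := is_derive_prod_log (index_enum 'I_m) xpredT (fun r => is_derive_bounceV_log r t).
  by apply: is_derive_eq; rewrite sumrN /GRing.scale /=; field.
have pd := is_derive_prod_log (index_enum 'I_m) (in_pair a) (fun r => is_derive_bounce_log r t).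
by apply: is_derive_eq; rewrite /GRing.scale /=; field.
Qed.

Lemma is_derive_sum_real (I : Type) (s : seq I) (P : pred I) (F : I -> R -> R)
    (l : I -> R) (t : R) :
  (forall i, is_derive t 1 (F i) (l i)) ->
  is_derive t 1 (fun t => \sum_(i <- s | P i) F i t) (\sum_(i <- s | P i) l i).
Proof.
move=> Fd; elim: s => [|i s IH].
  rewrite !big_nil (_ : (fun _ => _) = fun=> 0); first exact: is_derive_cst.
  by apply/funext => u; rewrite big_nil.
rewrite !big_cons; case: ifP => Pi.
  rewrite (_ : (fun _ => _) = F i \+ (fun u => \sum_(i <- s | P i) F i u)).
    by apply: is_deriveD.
  by apply/funext => u; rewrite big_cons Pi.
rewrite (_ : (fun _ => _) = (fun u => \sum_(i <- s | P i) F i u)) //.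
by apply/funext => u; rewrite big_cons Pi.
Qed.

Lemma is_derive_LS (t : R) : is_derive t 1 LS (L2S t).
Proof.
have sd := is_derive_sum_real (index_enum 'I_m) xpredT (fun r => is_derive_flog r t).
by rewrite /LS; apply: is_derive_eq; rewrite /L2S /GRing.scale /=; ring.
Qed.

Lemma is_derive_HS a (t : R) : is_derive t 1 (HS a) (H2S a t).
Proof.
rewrite /HS /H2S; case: (a == 0).
  have sd := is_derive_sum_real (index_enum 'I_m) xpredT (fun r => is_derive_flog r t).
  by apply: is_derive_eq; rewrite /GRing.scale /=; ring.
have sd := is_derive_sum_real (index_enum 'I_m) (in_pair a) (fun r => is_derive_flog r t).
by apply: is_derive_eq; rewrite /GRing.scale /=; ring.
Qed.

Lemma bounce_Ck k r : Ck k setT (fun x : 'rV[R]_(1 + n) => bounce A p r (tau x)).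
Proof.
rewrite /bounce; apply: CkD; first exact: Ck_cst.
apply: CkZ; apply: Ck_expR; apply: CkZ.
rewrite (_ : tau = fun x : 'rV[R]_(1 + n) => x 0 ti); first exact: Ck_coord.
by apply/funext => x; rewrite tauE.
Qed.

Lemma exp_Ck k c : Ck k setT (fun x : 'rV[R]_(1 + n) => expR (c * tau x)).
Proof.
apply: Ck_expR; apply: CkZ.
rewrite (_ : tau = fun x : 'rV[R]_(1 + n) => x 0 ti); first exact: Ck_coord.
by apply/funext => x; rewrite tauE.
Qed.

Lemma nuS_Ck k : Ck k setT (fun x : 'rV[R]_(1 + n) => nuS (tau x)).
Proof.
apply: CkM; first exact: exp_Ck.
by apply: Ck_prod => r _; exact: bounce_Ck.
Qed.

Lemma wS_Ck k a : Ck k setT (fun x : 'rV[R]_(1 + n) => wS a (tau x)).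
Proof.
rewrite /wS; apply: CkM; first by apply: CkZ; exact: exp_Ck.
case: (a == 0); apply: Ck_prod => r _; last exact: bounce_Ck.
by apply: CkV; [move=> x; exact: bounce_neq0|exact: bounce_Ck].
Qed.

(** The product of all F_s cancels between N^2 and a_0^2, leaving kappa_r^2 e^{2 chi_r tau} / F_r^2,
    since the exponents add up to 2 chi_r by its definition. The constant kappa_r^2 / (4 chi_r^2) in
    F_r is the one for which this equals (log F_r)''. *)
Lemma twistS r t : twist nuS wS r t = flog2 r t.
Proof.
rewrite /twist wS_0 wS_odd wS_even /nuS /flog2.
have b0 := bounce_neq0 r t.
have -> : bounce A p r t - 1 = kappa A r ^+ 2 / (4 * chi p r ^+ 2) * expR (2 * chi p r * t).
  by rewrite /bounce addrAC subrr add0r.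
have ex : expR (2 * chi p r * t) = expR (2 * t) * expR (2 * p 0 * t) /
   (expR (2 * p (odd_ix r) * t) * expR (2 * p (even_ix r) * t)).
  rewrite -!expRD -expRN -expRD; congr expR; rewrite /chi; ring.
have pE : \prod_r bounce A p r t * \prod_r (bounce A p r t)^-1 = 1.
  by rewrite -big_split big1 // => s _ /=; rewrite divff // bounce_neq0.
transitivity ((\prod_r bounce A p r t * \prod_r (bounce A p r t)^-1) *
  (A 0 ^+ 2 * (expR (2 * t) * expR (2 * p 0 * t)) /
   (A (odd_ix r) ^+ 2 * expR (2 * p (odd_ix r) * t) * bounce A p r t *
    (A (even_ix r) ^+ 2 * expR (2 * p (even_ix r) * t) * bounce A p r t)))).
  by ring.
rewrite pE mul1r ex /kappa; field.
by rewrite b0 !gt_eqF ?expR_gt0 ?A_gt0 ?chi_gt0.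
Qed.

Lemma HS_odd r t : HS (odd_ix r) t = p (odd_ix r) + 2^-1 * flog r t.
Proof.
rewrite /HS odd_ix_neq0 (eq_bigl (pred1 r)) ?big_pred1_eq // => s.
by rewrite in_pair_odd.
Qed.

Lemma HS_even r t : HS (even_ix r) t = p (even_ix r) + 2^-1 * flog r t.
Proof.
rewrite /HS even_ix_neq0 (eq_bigl (pred1 r)) ?big_pred1_eq // => s.
by rewrite in_pair_even.
Qed.

Lemma HS_0 t : HS 0 t = p 0 - 2^-1 * \sum_r flog r t.
Proof. by rewrite /HS eqxx. Qed.

Hypothesis sum_p : \sum_a p a = 1.

Lemma harmonicS t : LS t = \sum_a HS a t.
Proof.
have pE : \sum_a p a = p 0 + \sum_r (p (odd_ix r) + p (even_ix r)) by rewrite sum_pairs.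
rewrite sum_pairs HS_0 /LS.
have -> : \sum_r (HS (odd_ix r) t + HS (even_ix r) t) =
    \sum_r (p (odd_ix r) + p (even_ix r)) + \sum_r flog r t.
  rewrite -big_split; apply: eq_bigr => r _ /=.
  by rewrite HS_odd HS_even; field.
by rewrite -{1}sum_p pE; field.
Qed.

Variable q : R.
Hypothesis sum_p2 : (\sum_a p a ^+ 2) + q ^+ 2 = 1.

(** Writing f_r for (log F_r)', the Riccati identity f_r' = 2 chi_r f_r - f_r^2 expresses the second
    derivatives by f_r. The terms linear in f_r then cancel by the definition of chi_r, the
    quadratic ones cancel as well, and 1 - sum p_a^2 remains. *)
Lemma energyS t : LS t ^+ 2 - L2S t - \sum_a HS a t ^+ 2 = q ^+ 2.
Proof.
have -> : q ^+ 2 = 1 - \sum_a p a ^+ 2 by rewrite -sum_p2; ring.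
rewrite !sum_pairs HS_0 /LS /L2S; set S := \sum_r flog r t.
have -> : \sum_r flog2 r t = \sum_r (2 * chi p r * flog r t - flog r t ^+ 2).
  apply: eq_bigr => r _; by rewrite /flog2 /flog; field; exact: bounce_neq0.
have -> : \sum_r (HS (odd_ix r) t ^+ 2 + HS (even_ix r) t ^+ 2) =
  \sum_r (p (odd_ix r) ^+ 2 + p (even_ix r) ^+ 2) + (1 + p 0) * S
   - \sum_r (chi p r * flog r t - 2^-1 * flog r t ^+ 2).
  rewrite /S mulr_sumr -big_split -sumrB; apply: eq_bigr => r _ /=.
  by rewrite HS_odd HS_even /chi; field.
have -> : 2^-1 * \sum_r (2 * chi p r * flog r t - flog r t ^+ 2) =
  \sum_r (chi p r * flog r t - 2^-1 * flog r t ^+ 2).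
  by rewrite mulr_sumr; apply: eq_bigr => r _; field.
by field.
Qed.

Lemma H2S_0 t : H2S 0 t = - (2^-1 * \sum_r twist nuS wS r t).
Proof. by rewrite /H2S eqxx; congr (- (_ * _)); apply: eq_bigr => r _; rewrite twistS. Qed.

Lemma H2S_odd r t : H2S (odd_ix r) t = 2^-1 * twist nuS wS r t.
Proof.
rewrite /H2S odd_ix_neq0 twistS (eq_bigl (pred1 r)) ?big_pred1_eq // => s.
by rewrite in_pair_odd.
Qed.

Lemma H2S_even r t : H2S (even_ix r) t = 2^-1 * twist nuS wS r t.
Proof.
rewrite /H2S even_ix_neq0 twistS (eq_bigl (pred1 r)) ?big_pred1_eq // => s.
by rewrite in_pair_even.
Qed.

Lemma bounce_ricci i j x : ricci (Defs.metric A p) i j x = (i == ti)%:R * (j == ti)%:R * q ^+ 2.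
Proof.
rewrite metric_gmetric; exact: (gricciE nuS_Ck wS_Ck nuS_gt0 wS_gt0 is_derive_nuS
  is_derive_LS is_derive_wS is_derive_HS harmonicS H2S_0 H2S_odd H2S_even energyS).
Qed.

Lemma bounce_einstein phi0 :
  solves_einstein_scalar (Defs.metric A p) (scalar_field q phi0).
Proof.
split.
- split; rewrite metric_gmetric; first exact: gmetric_smooth nuS_Ck wS_Ck.
  by move=> x; apply: gmetric_lorentzian; [exact: nuS_gt0|exact: wS_gt0].
- exact: phi_smooth.
- by move=> x i j; rewrite bounce_ricci !partial_phi; ring.
- move=> x; rewrite metric_gmetric; exact: (gbox nuS_gt0 wS_gt0 is_derive_nuS
    is_derive_wS harmonicS).
Qed.

End bounce_solution.

(** * Proper time *)

Section proper_time_range.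
Context {R : realType}.
Local Notation mu := (@lebesgue_measure R).

Lemma is_derive_expRN (x : R) : is_derive x 1 (fun x => - expR (- x)) (expR (- x)).
Proof. by apply: is_derive_eq; rewrite /GRing.scale /=; ring. Qed.

(** The reflection s -> - s moves the integral to the half-line from - t to +oo, where - e^{-s} is a
    primitive. *)
Lemma integral_expR_Ny (t : R) :
  (\int[mu]_(s in `]-oo, t]) (expR s)%:E = (expR t)%:E)%E.
Proof.
have cE : continuous (@expR R) by exact: continuous_expR.
have cEN : continuous (fun x : R => expR (- x)).
  by move=> x; apply: continuous_comp; [exact: opp_continuous|exact: cE].
rewrite -[t in `]-oo, t]]opprK ge0_integration_by_substitutionNy; last 2 first.
- exact: continuous_subspaceT.
- by move=> x _; exact: expR_ge0.
rewrite (@ge0_continuous_FTC2y _ (fun x => expR (- x)) (fun x => - expR (- x)) (- t) 0).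
- by rewrite opprK sub0e EFinN oppeK.
- by move=> x _; exact: expR_ge0.
- exact: continuous_subspaceT.
- by rewrite -oppr0; apply: cvgN; exact: cvgr_expR.
- by move=> x _; case: (is_derive_expRN x).
- by apply: cvg_at_right_filter; apply: cvgN; exact: cEN.
- by move=> x _; rewrite derive1E; case: (is_derive_expRN x).
Qed.

Variable f : R -> R.
Hypothesis cf : continuous f.
Hypothesis expf : forall s, expR s <= f s.
Hypothesis fexp : forall T, exists C, forall s, s <= T -> f s <= C * expR s.

Let f_gt0 s : 0 < f s. Proof. exact: lt_le_trans (expR_gt0 s) (expf s). Qed.

Lemma exp_integrable_Ny C t : mu.-integrable `]-oo, t] (fun s => (C * expR s)%:E).
Proof.
have : mu.-integrable `]-oo, t] (fun s => C%:E * (expR s)%:E)%E.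
  apply: integrableZl => //; apply/integrableP; split.
    apply/measurable_EFinP; apply: measurable_funTS.
    by apply: continuous_measurable_fun; exact: continuous_expR.
  under eq_integral do rewrite /= ger0_norm ?expR_ge0 //.
  by rewrite integral_expR_Ny ltry.
by [].
Qed.

Lemma f_integrable_Ny t : mu.-integrable `]-oo, t] (EFin \o f).
Proof.
have [C fC] := fexp t.
apply: le_integrable (exp_integrable_Ny C t) => //.
  apply/measurable_EFinP; apply: measurable_funTS.
  exact: continuous_measurable_fun.
move=> s; rewrite /= in_itv /= => st.
rewrite lee_fin !ger0_norm ?fC //; last exact: ltW.
exact: le_trans (ltW (f_gt0 s)) (fC _ st).
Qed.

Let F t := (\int[mu]_(s in `]-oo, t]) f s)%R.

Lemma integral_NyE t : (\int[mu]_(s in `]-oo, t]) (f s)%:E)%E = (F t)%:E.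
Proof. by rewrite /F /Rintegral fineK //; exact: integrable_fin_num (f_integrable_Ny t). Qed.

(** The integral F lies between e^t and C e^t on every half-line bounded above, with C depending on
    its end. So F takes values below and above any positive y, and the intermediate value theorem
    applies. *)
Lemma range_integral_Ny :
  range (fun t : R => (\int[mu]_(s in `]-oo, t]) (f s)%:E)%E) =
  [set t%:E | t in `]0, +oo[%classic].
Proof.
have mE (t : R) : measurable_fun (`]-oo, t]%classic : set (measurableTypeR R)) (fun s : R => (expR s)%:E).
  apply/measurable_EFinP; apply: measurable_funTS.
  by apply: continuous_measurable_fun; exact: continuous_expR.
have mf (t : R) : measurable_fun (`]-oo, t]%classic : set (measurableTypeR R)) (fun s : R => (f s)%:E).
  apply/measurable_EFinP; apply: measurable_funTS.
  exact: continuous_measurable_fun.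
have F_ge t : expR t <= F t.
  rewrite -lee_fin -integral_NyE -integral_expR_Ny.
  by apply: ge0_le_integral => // s _; rewrite lee_fin ?expR_ge0 // ltW.
have F_le C T t : (forall s, s <= T -> f s <= C * expR s) -> t <= T -> F t <= C * expR t.
  move=> fC tT; rewrite -lee_fin -integral_NyE EFinM -integral_expR_Ny.
  rewrite -ge0_integralZl //.
  - apply: ge0_le_integral => //.
    + by move=> s _; rewrite lee_fin ltW.
    + by apply: measurable_funeM.
    + by move=> s; rewrite /= in_itv /= => st; rewrite lee_fin fC // (le_trans st).
  - rewrite lee_fin -(pmulr_lge0 _ (expR_gt0 T)).
    exact: le_trans (ltW (f_gt0 T)) (fC _ (lexx _)).
have cF : continuous F.
  move=> t; apply: differentiable_continuous; apply/derivable1_diffP.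
  have [] := @continuous_FTC1 R f -oo%O t (t + 1) _ (f_integrable_Ny _) _ (@cf t) => //.
    by rewrite ltrDl.
  by rewrite ltNyr.
apply/seteqP; split=> [_ [t _ <-]|z [y /=]].
  exists (F t); rewrite ?integral_NyE //= in_itv /= andbT.
  exact: lt_le_trans (expR_gt0 t) (F_ge t).
rewrite in_itv /= andbT => y0 <-.
have [C fC] := fexp (ln y).
have C1 : 1 <= C.
  by rewrite -(ler_pM2r (expR_gt0 (ln y))) mul1r (le_trans (expf _)) // fC.
have C0 : 0 < C := lt_le_trans ltr01 C1.
(* Chosen so that C e^{t1} = y, which gives F t1 <= y; on the other side y = e^{ln y} <= F (ln
   y). *)
pose t1 := ln y - ln C.
have t12 : t1 <= ln y by rewrite gerBl ln_ge0.
have F1 : F t1 <= y.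
  by rewrite (le_trans (F_le _ _ _ fC t12)) // /t1 expRB !lnK ?posrE // mulrC divfK ?gt_eqF.
have F2 : y <= F (ln y) by rewrite -{1}(lnK (x := y)) ?posrE.
have [] := @IVT R F t1 (ln y) y t12 _ _.
- exact: continuous_subspaceT.
- by rewrite ge_min F1 le_max F2 orbT.
by move=> t _ Ft; exists t; rewrite // integral_NyE Ft.
Qed.

End proper_time_range.

Section bounce_proper_time.
Context {R : realType} {m : nat}.
Local Notation n := (m.*2.+1).
Variables (A p : 'I_n -> R).
Hypothesis chi_gt0 : forall r : 'I_m, 0 < chi p r.

Lemma bounce_cont r : continuous (bounce A p r).
Proof.
by move=> t; apply: differentiable_continuous; apply/derivable1_diffP;
  case: (is_derive_bounce A p r t).
Qed.

Lemma sqrt_bounce_cont r : continuous (fun t => Num.sqrt (bounce A p r t)).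
Proof.
move=> t; apply: (@continuous_comp _ _ _ (bounce A p r) (@Num.sqrt R)).
  exact: bounce_cont.
exact: sqrt_continuous.
Qed.

Lemma lapse_continuous : continuous (lapse A p).
Proof.
move=> t; apply: continuousM; first exact: continuous_expR.
elim: (index_enum _) => [|r s IH].
  by rewrite (_ : (fun _ => _) = fun=> 1); [exact: cst_continuous|apply/funext => u; rewrite big_nil].
rewrite (_ : (fun _ => _) = (fun t => Num.sqrt (bounce A p r t)) \*
   (fun t => \prod_(i <- s) Num.sqrt (bounce A p i t))).
  by apply: continuousM => //; exact: sqrt_bounce_cont.
by apply/funext => u; rewrite big_cons.
Qed.

Lemma bounce_mono r s t : s <= t -> bounce A p r s <= bounce A p r t.
Proof.
move=> st; rewrite lerD2l ler_wpM2l //.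
  by rewrite divr_ge0 ?sqr_ge0 // mulr_ge0 ?sqr_ge0.
by rewrite ler_expR ler_wpM2l // mulr_ge0 // ltW.
Qed.

(** Every F_r is at least 1 and nondecreasing, so the lapse lies between e^tau and a constant
    multiple of e^tau on each half-line bounded above. *)
Lemma proper_time_range : range (proper_time A p) = [set t%:E | t in `]0, +oo[%classic].
Proof.
apply: range_integral_Ny lapse_continuous _ _.
- move=> s; rewrite /lapse ler_peMr ?expR_ge0 //.
  apply: (big_ind (fun x => 1 <= x)) => // [x y x1 y1|r _].
    by rewrite -[1]mulr1 ler_pM.
  by rewrite -[1]sqrtr1 ler_wsqrtr // bounce_ge1.
- move=> T; exists (\prod_r Num.sqrt (bounce A p r T)) => s sT.
  rewrite /lapse mulrC ler_wpM2r ?expR_ge0 //.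
  by apply: ler_prod => r _; rewrite sqrtr_ge0 /= ler_wsqrtr // bounce_mono.
Qed.

End bounce_proper_time.

(** * Ordinary differential equations *)

Section comparison.
Context {R : realType}.

Lemma is_derive_continuous (f : R -> R) (t df : R) :
  is_derive t 1 f df -> {for t, continuous f}.
Proof. by move=> [d _]; apply: differentiable_continuous; apply/derivable1_diffP. Qed.

Lemma derive_within_continuous (f df : R -> R) (a b : R) :
  (forall t : R, a <= t <= b -> is_derive t 1 f (df t)) ->
  {within `[a, b], continuous f}.
Proof.
move=> fd; apply: continuous_in_subspaceT => t /set_mem; rewrite /= in_itv /= => tab.
exact: is_derive_continuous (fd t tab).
Qed.

Lemma derive_ge0_nondecreasing (f df : R -> R) (a b : R) : a <= b ->
  (forall t : R, a <= t <= b -> is_derive t 1 f (df t)) ->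
  (forall t : R, a <= t <= b -> 0 <= df t) -> f a <= f b.
Proof.
rewrite le_eqVlt => /orP[/eqP -> //|ab] fd df0.
have [||c] := @MVT R f df a b ab.
- by move=> t; rewrite in_itv /= => /andP[at_ tb]; apply: fd; rewrite !ltW.
- exact: derive_within_continuous fd.
rewrite in_itv /= => /andP[ac cb] fE.
by rewrite -(subr_ge0 (f a)) fE mulr_ge0 ?df0 ?ltW // subr_gt0.
Qed.

Lemma derive_gt0_increasing (f df : R -> R) (a b : R) : a < b ->
  (forall t : R, a <= t <= b -> is_derive t 1 f (df t)) ->
  (forall t : R, a <= t <= b -> 0 < df t) -> f a < f b.
Proof.
move=> ab fd df0.
have [||c] := @MVT R f df a b ab.
- by move=> t; rewrite in_itv /= => /andP[at_ tb]; apply: fd; rewrite !ltW.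
- exact: derive_within_continuous fd.
rewrite in_itv /= => /andP[ac cb] fE.
by rewrite -(subr_gt0 (f a)) fE mulr_gt0 ?df0 ?subr_gt0 // !ltW.
Qed.

Lemma derive_norm_le (u v du dv : R -> R) (a b : R) : a <= b ->
  (forall t : R, a <= t <= b -> is_derive t 1 u (du t)) ->
  (forall t : R, a <= t <= b -> is_derive t 1 v (dv t)) ->
  (forall t : R, a <= t <= b -> `|du t| <= dv t) ->
  `|u a| <= v a -> `|u b| <= v b.
Proof.
move=> ab ud vd uv; rewrite !ler_norml => /andP[l r].
apply/andP; split.
- suff : v a + u a <= v b + u b by rewrite -subr_ge0 in l *; lra.
  apply: (derive_ge0_nondecreasing (f := fun t => v t + u t) (df := fun t => dv t + du t)) => //.
    by move=> t tab; have := ud t tab; have := vd t tab => *; apply: is_derive_eq.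
  by move=> t tab; have := uv t tab; rewrite ler_norml; lra.
- suff : v a - u a <= v b - u b by lra.
  apply: (derive_ge0_nondecreasing (f := fun t => v t - u t) (df := fun t => dv t - du t)) => //.
    by move=> t tab; have := ud t tab; have := vd t tab => *; apply: is_derive_eq.
  by move=> t tab; have := uv t tab; rewrite ler_norml; lra.
Qed.

Lemma derive0_const (f : R -> R) (a b : R) : a <= b ->
  (forall t : R, a <= t <= b -> is_derive t 1 f 0) -> f b = f a.
Proof.
move=> ab fd; apply/eqP; rewrite -subr_eq0 -normr_le0.
apply: (derive_norm_le (u := fun t => f t - f a) (v := fun=> 0) (du := fun=> 0) (dv := fun=> 0) ab).
- by move=> t tab; have := fd t tab => ?; apply: is_derive_eq; rewrite subr0.
- by move=> t _; rewrite normr0.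
- by rewrite subrr normr0.
Qed.

Lemma is_derive_expZ (K a t : R) :
  is_derive t 1 (fun t => expR (K * (t - a))) (K * expR (K * (t - a))).
Proof. by apply: is_derive_eq; rewrite /GRing.scale /=; ring. Qed.

(** The factor e^{-K (t - a)} turns the differential inequality into monotonicity. *)
Lemma gronwall0 (D dD : R -> R) (K a b : R) : a <= b ->
  (forall t : R, a <= t <= b -> is_derive t 1 D (dD t)) ->
  (forall t : R, a <= t <= b -> dD t <= K * D t) -> D a <= 0 -> D b <= 0.
Proof.
move=> ab Dd DK Da.
have : - D a <= - (expR (- K * (b - a)) * D b).
  rewrite -[D a]mul1r -(expR0 R) -[X in expR X](mulr0 (- K)) -(subrr a).
  apply: (derive_ge0_nondecreasing (f := fun t => - (expR (- K * (t - a)) * D t))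
    (df := fun t => - (expR (- K * (t - a)) * (dD t - K * D t))) ab).
    move=> t tab; have := Dd t tab; have := is_derive_expZ (- K) a t => *.
    by apply: is_derive_eq; rewrite /GRing.scale /=; ring.
  move=> t tab; rewrite -mulrN mulr_ge0 ?expR_ge0 //.
  by have := DK t tab; lra.
rewrite lerN2 => /le_trans/(_ Da).
by rewrite pmulr_rle0 // expR_gt0.
Qed.

Lemma primitive_exists (f : R -> R) (t0 : R) : continuous f ->
  exists F, F t0 = 0 /\ forall t : R, t0 <= t -> is_derive t 1 F (f t).
Proof.
move=> cf; pose mu := @lebesgue_measure R.
(* Integration starts at t0 - 1, so that t0 is an interior point and the derivative there is
   two-sided. *)
pose I x := (\int[mu]_(t in `[(t0 - 1)%R, x]) (f t))%R.
exists (fun t => I t - I t0); split; first by rewrite subrr.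
move=> t t0t.
have fi u : mu.-integrable `[t0 - 1, u] (EFin \o f).
  apply: continuous_compact_integrable; first exact: segment_compact.
  exact: continuous_subspaceT.
have [||dI I'] := @continuous_FTC1_closed R f (t0 - 1) t (t + 1) _ (fi _) _ (@cf t).
- by rewrite ltrDl.
- by rewrite ltrBlDr ltr_pwDr.
rewrite derive1E in I'; have Id : is_derive t 1 I (f t) := DeriveDef dI I'.
clearbody I.
by apply: is_derive_eq; rewrite subr0.
Qed.

(** Serves to return from tau to the affine parameter. The inverse has a two-sided derivative only
    beyond the initial value [f a], whence the strict inequality in the last clause. *)
Lemma inverse_exists (f df : R -> R) (a : R) :
  (forall t : R, a <= t -> is_derive t 1 f (df t)) ->
  (forall t : R, a <= t -> 0 < df t) ->
  (forall M, exists2 t, a <= t & M <= f t) ->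
  exists g, [/\ forall s, f a <= s -> a <= g s /\ f (g s) = s,
    forall t, a <= t -> g (f t) = t
    & forall s : R, f a < s -> a < g s /\ is_derive s 1 g (df (g s))^-1].
Proof.
move=> fd df0 fy.
have finc t u : a <= t -> t < u -> f t < f u.
  move=> at_ tu; apply: derive_gt0_increasing tu _ _ => v /andP[tv _].
    by apply: fd; exact: le_trans tv.
  by apply: df0; exact: le_trans tv.
have finj t u : a <= t -> a <= u -> f t = f u -> t = u.
  move=> at_ au e; have [tu|ut|//] := ltgtP t u.
    by have := finc _ _ at_ tu; rewrite e ltxx.
  by have := finc _ _ au ut; rewrite e ltxx.
have gP s : exists t, f a <= s -> a <= t /\ f t = s.
  have [as_|_] := leP (f a) s; last by exists 0.
  have [b ab sb] := fy s.
  have [||t] := @IVT R f a b s ab.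
  - by apply: derive_within_continuous => t /andP[at_ _]; exact: fd.
  - by rewrite ge_min as_ le_max sb orbT.
  by rewrite in_itv /= => /andP[at_ _] ft; exists t.
have [g gE] := choice gP.
have gf t : a <= t -> g (f t) = t.
  move=> at_; have fat : f a <= f t.
    by move: at_; rewrite le_eqVlt => /orP[/eqP -> //|at_]; apply: ltW; exact: finc.
  by have [ag fg] := gE _ fat; exact: finj.
exists g; split => // s as_.
have [ag fg] := gE _ (ltW as_).
have ags : a < g s.
  by rewrite lt_neqAle ag andbT; apply: contraTneq as_ => e; rewrite e fg ltxx.
split => //; rewrite -{1}fg; apply: is_derive_inverse.
- by apply: filterS (lt_nbhsr ags) => t at_; apply: gf; exact: ltW.
- apply: filterS (lt_nbhsr ags) => t at_; exact: is_derive_continuous (fd t (ltW at_)).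
- exact: fd.
- by rewrite gt_eqF // df0.
Qed.

End comparison.

(** * Picard iteration on a half-line *)

Section picard.
Context {R : realType} {k : nat}.
Variables (F : R -> 'rV[R]_k -> 'rV[R]_k) (t0 : R) (x0 : 'rV[R]_k).
Hypothesis Fc : forall x : R -> 'rV[R]_k, continuous x -> continuous (fun t => F t (x t)).
Hypothesis Flip : forall T, exists2 K, 0 < K &
  forall t x y, t0 <= t <= T -> `|F t x - F t y| <= K * `|x - y|.

Lemma coord_cont (x : R -> 'rV[R]_k) i : continuous x -> continuous (fun t => x t 0 i).
Proof.
move=> xc t; apply: (@continuous_comp _ _ _ x (fun M : 'rV[R]_k => M 0 i)).
  exact: xc.
exact: coord_continuous.
Qed.

Lemma primitive_vec (f : R -> 'rV[R]_k) : continuous f -> exists P : R -> 'rV[R]_k,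
  P t0 = x0 /\ forall t : R, t0 <= t -> forall i, is_derive t 1 (fun t => P t 0 i) (f t 0 i).
Proof.
move=> fc; have [P PE] := choice (fun i => primitive_exists t0 (coord_cont (i := i) fc)).
exists (fun t => \row_i (x0 0 i + P i t)); split.
  by apply/rowP => i; rewrite mxE; case: (PE i) => -> _; rewrite addr0.
move=> t tt0 i; rewrite (_ : (fun _ => _) = fun t => x0 0 i + P i t); last first.
  by apply/funext => u; rewrite mxE.
by have [_ /(_ t tt0) Pd] := PE i; apply: is_derive_eq; rewrite /GRing.scale /=; ring.
Qed.

(** Constant continuation to the left of [t0]: the iterates become continuous on the whole line,
    while the differential equation is stated for the unclamped primitives, which have two-sided
    derivatives at [t0]. *)
Let clamp (f : R -> 'rV[R]_k) : R -> 'rV[R]_k := fun t => f (Order.max t t0).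

Lemma clamp_continuous (f : R -> 'rV[R]_k) :
  (forall t, t0 <= t -> {for t, continuous f}) -> continuous (clamp f).
Proof.
move=> fc t; apply: (@continuous_comp _ _ _ (fun t => Order.max t t0) f).
  by apply: continuous_max => //; exact: cst_continuous.
by apply: fc; rewrite le_max lexx orbT.
Qed.

Lemma vec_continuous (f : R -> 'rV[R]_k) (t : R) (df : 'rV[R]_k) :
  (forall i, is_derive t 1 (fun t => f t 0 i) (df 0 i)) -> {for t, continuous f}.
Proof.
move=> fd; apply/(@cvg_mxP _ _ _ (nbhs_filter t)) => i j.
by rewrite ord1; exact: is_derive_continuous (fd j).
Qed.

Lemma picard_step (x : R -> 'rV[R]_k) : continuous x ->
  exists y, [/\ continuous y, y t0 = x0 & exists2 Y : R -> 'rV[R]_k,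
    (forall t, t0 <= t -> y t = Y t) &
    (forall t : R, t0 <= t -> forall i, is_derive t 1 (fun t => Y t 0 i) (F t (x t) 0 i))].
Proof.
move=> xc; have [Y [Y0 Yd]] := primitive_vec (Fc xc).
exists (clamp Y); split; first by apply: clamp_continuous => t tt; exact: vec_continuous (Yd t tt).
  by rewrite /clamp maxxx.
by exists Y => // t tt; rewrite /clamp; congr Y; apply/max_idPl.
Qed.

(** With the weight e^{2K (t - t0)} the Picard map contracts by 1/2 on an interval of any length,
    because integrating K e^{2K (t - t0)} produces a factor 1/2. *)
Lemma picard_compare (x x' y y' : R -> 'rV[R]_k) (K T c : R) : 0 < K -> t0 <= T -> 0 <= c ->
  (forall t x y, t0 <= t <= T -> `|F t x - F t y| <= K * `|x - y|) ->
  y t0 = y' t0 ->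
  (forall t : R, t0 <= t -> forall i, is_derive t 1 (fun t => y t 0 i) (F t (x t) 0 i)) ->
  (forall t : R, t0 <= t -> forall i, is_derive t 1 (fun t => y' t 0 i) (F t (x' t) 0 i)) ->
  (forall t, t0 <= t <= T -> `|x t - x' t| <= c * expR (2 * K * (t - t0))) ->
  forall t, t0 <= t <= T -> `|y t - y' t| <= c / 2 * expR (2 * K * (t - t0)).
Proof.
move=> K0 t0T c0 FK y0 yd y'd xx' t /andP[t0t tT].
have e0 : 0 <= c / 2 * expR (2 * K * (t - t0)).
  by rewrite mulr_ge0 ?expR_ge0 // divr_ge0.
apply: mx_norm_leP e0 _ => i j; rewrite ord1 !mxE.
apply: (derive_norm_le (u := fun t => y t 0 j - y' t 0 j)
  (v := fun t => c / 2 * expR (2 * K * (t - t0)))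
  (du := fun t => F t (x t) 0 j - F t (x' t) 0 j)
  (dv := fun t => c * (K * expR (2 * K * (t - t0)))) t0t).
- move=> u /andP[t0u ut]; have := yd u t0u j; have := y'd u t0u j => *.
  exact: is_derive_eq.
- move=> u _; have := is_derive_expZ (2 * K) t0 u => ?; apply: is_derive_eq.
  by rewrite /GRing.scale /=; field.
- move=> u /andP[t0u ut]; have uT : t0 <= u <= T by rewrite t0u (le_trans ut).
  have := mx_norm_coord (F u (x u) - F u (x' u)) 0 j; rewrite !mxE => /le_trans -> //.
  rewrite (le_trans (FK _ _ _ uT)) // mulrCA ler_pM2l //; exact: xx'.
- by rewrite y0 subrr normr0 mulr_ge0 ?expR_ge0 // divr_ge0.
Qed.

Lemma step_ex (x : R -> 'rV[R]_k) : exists y, continuous x ->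
  [/\ continuous y, y t0 = x0 & exists2 Y : R -> 'rV[R]_k,
    (forall t, t0 <= t -> y t = Y t) &
    (forall t : R, t0 <= t -> forall i, is_derive t 1 (fun t => Y t 0 i) (F t (x t) 0 i))].
Proof.
have [xc|nxc] := pselect (continuous x); last by exists x => /nxc.
by have [y yP] := picard_step xc; exists y.
Qed.

(** The contraction estimate holds on each [t0, T] with its own constants, but the iterates and
    their pointwise limit do not depend on T. This gives a solution on the whole half-line without
    any gluing. *)
Lemma picard_exists : exists x : R -> 'rV[R]_k, x t0 = x0 /\
  forall t : R, t0 <= t -> forall i, is_derive t 1 (fun t => x t 0 i) (F t (x t) 0 i).
Proof.
have [step stepP] := choice (fun x => step_ex x).
pose X n := iter n step (fun=> x0).
have Xc n : continuous (X n).
  by elim: n => [|n IH]; [exact: cst_continuous|case: (stepP _ IH)].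
have X0 n : X n t0 = x0 by case: n => //= n; case: (stepP _ (Xc n)).
have bound T : t0 <= T -> exists2 C, 0 <= C & forall n t, t0 <= t <= T ->
    `|X n.+1 t - X n t| <= C / 2 ^+ n.
  move=> t0T; have [K K0 FK] := Flip T.
  have [B B0 FB] : exists2 B, 0 <= B & forall t, t0 <= t <= T -> `|F t x0| <= B.
    have Fcst : continuous (fun t => F t x0).
      exact: (Fc (x := fun=> x0)) (@cst_continuous _ _ _).
    have [c _ cM] : exists2 c, c \in `[t0, T] & forall t, t \in `[t0, T] ->
        `|F t x0| <= `|F c x0|.
      apply: EVT_max t0T _; apply: continuous_subspaceT => t.
      by apply: (continuous_comp (Fcst t)); exact: norm_continuous.
    by exists `|F c x0| => // t tT; apply: cM; rewrite in_itv.
  (* Then c0 e^{2K (t - t0)} has derivative B e^{2K (t - t0)} >= B and dominates the first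
     increment. *)
  pose c0 := B / (2 * K).
  have c00 : 0 <= c0 by rewrite divr_ge0 // mulr_ge0 // ltW.
  have main n t : t0 <= t <= T ->
      `|X n.+1 t - X n t| <= c0 / 2 ^+ n * expR (2 * K * (t - t0)).
    elim: n t => [|n IH] t tT.
      have [_ y0 [Y YE Yd]] := stepP _ (Xc 0%N).
      have /andP[t0t tT'] := tT.
      have ce u : 0 <= c0 * expR (2 * K * (u - t0)) by rewrite mulr_ge0 ?expR_ge0.
      rewrite expr0 divr1; apply: mx_norm_leP (ce t) _ => i j; rewrite ord1 !mxE /= YE //.
      apply: (derive_norm_le (u := fun t => Y t 0 j - x0 0 j)
        (v := fun t => c0 * expR (2 * K * (t - t0)))
        (du := fun t => F t x0 0 j)
        (dv := fun t => B * expR (2 * K * (t - t0))) t0t).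
      - move=> u /andP[t0u ut]; have := Yd u t0u j => ?.
        by apply: is_derive_eq; rewrite subr0.
      - move=> u _; have := is_derive_expZ (2 * K) t0 u => ?; apply: is_derive_eq.
        by rewrite /c0 /GRing.scale /=; field; rewrite gt_eqF.
      - move=> u /andP[t0u ut]; rewrite (le_trans (mx_norm_coord _ _ _)) //.
        rewrite (le_trans (FB u _)) ?t0u ?(le_trans ut) // ler_peMr //.
        rewrite -(expR0 R) ler_expR !mulr_ge0 ?subr_ge0 //; exact: ltW.
      - by rewrite -YE // y0 subrr normr0 subrr mulr0 expR0 mulr1.
    have [_ y0 [Y YE Yd]] := stepP _ (Xc n).
    have [_ y'0 [Y' YE' Yd']] := stepP _ (Xc n.+1).
    have -> : X n.+2 t = Y' t by case/andP: tT => tt _; rewrite -YE'.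
    have -> : X n.+1 t = Y t by case/andP: tT => tt _; rewrite -YE.
    have -> : c0 / 2 ^+ n.+1 = c0 / 2 ^+ n / 2 by rewrite exprSr; field; rewrite expf_neq0.
    apply: (picard_compare (x := X n.+1) (x' := X n) K0 t0T _ FK _ Yd' Yd _ tT) => //.
      by rewrite divr_ge0 // exprn_ge0.
    by rewrite -YE // -YE' // y0 y'0.
  exists (c0 * expR (2 * K * (T - t0))); first by rewrite mulr_ge0 ?expR_ge0.
  move=> n t tT; apply: le_trans (main n t tT) _.
  rewrite mulrAC ler_wpM2r ?invr_ge0 ?exprn_ge0 // ler_wpM2l // ler_expR.
  by case/andP: tT => _ tT; rewrite ler_pM2l ?mulr_gt0 // lerD2r.
(* A single limit for all T; the factor 2 sums the geometric series of the increments. *)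
have [L LP] : exists L : R -> 'rV[R]_k, forall T C, t0 <= T ->
    (forall n t, t0 <= t <= T -> `|X n.+1 t - X n t| <= C / 2 ^+ n) ->
    forall n t, t0 <= t <= T -> `|X n t - L t| <= C * 2 / 2 ^+ n.
  pose u t i := fun n => X n t 0 i.
  exists (fun t => \row_i limn (u t i)) => T C t0T CX n t tT.
  have C0 : 0 <= C by have := CX 0%N t tT; rewrite expr0 divr1; exact: le_trans.
  have e0 : 0 <= C * 2 / 2 ^+ n by rewrite !mulr_ge0 ?invr_ge0 ?exprn_ge0.
  apply: mx_norm_leP e0 _ => a i; rewrite ord1 !mxE {a}.
  have step1 l : `|u t i l.+1 - u t i l| <= C / 2 ^+ l.
    have := mx_norm_coord (X l.+1 t - X l t) 0 i; rewrite !mxE => /le_trans; apply.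
    exact: CX.
  have stepd l d : `|u t i (l + d)%N - u t i l| <= C * 2 / 2 ^+ l * (1 - 2^-1 ^+ d).
    elim: d => [|d IH]; first by rewrite addn0 expr0 !subrr normr0 mulr0.
    rewrite addnS -[u t i _.+1](subrK (u t i (l + d)%N)) -addrA.
    rewrite (le_trans (ler_normD _ _)) // (le_trans (lerD (step1 _) IH)) //.
    rewrite exprD exprS exprVn le_eqVlt; apply/orP; left; apply/eqP; field.
    by rewrite !expf_neq0.
  have stepb l d : `|u t i (l + d)%N - u t i l| <= C * 2 / 2 ^+ l.
    rewrite (le_trans (stepd _ _)) // ler_piMr ?gerBl ?exprn_ge0 ?invr_ge0 //.
    by rewrite !mulr_ge0 ?invr_ge0 ?exprn_ge0.
  have uc : cvgn (u t i).
    apply/cauchy_cvgP; apply: cauchy_exP => e e_gt0.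
    have : (C * 2) * 2^-1 ^+ l @[l --> \oo] --> (0 : R).
      rewrite -[0](mulr0 (C * 2)); apply: cvgM; first exact: cvg_cst.
      by apply: cvg_expr; rewrite ger0_norm ?invr_ge0 // invf_lt1 ?ltr1n.
    move=> /cvgrPdist_lt/(_ e e_gt0) [N _ NP].
    have := NP N (leqnn N); rewrite sub0r normrN ger0_norm; last first.
      by rewrite !mulr_ge0 ?exprn_ge0 ?invr_ge0.
    rewrite exprVn => Ne; exists (u t i N); exists N => // l /= Nl.
    by rewrite -(subnKC Nl) -ball_normE /ball_ /= distrC (le_lt_trans (stepb _ _)).
  have {}uc : u t i l @[l --> \oo] --> limn (u t i) by [].
  apply/ler_addgt0Pr => e e_gt0.
  have /cvgrPdist_lt/(_ e e_gt0) [N _ NP] := uc.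
  have := NP (n + N)%N (leq_addl _ _); rewrite distrC => /ltW ule.
  rewrite -/(u t i n) -[u t i n](subrK (u t i (n + N)%N)) -addrA.
  by rewrite (le_trans (ler_normD _ _)) // lerD // distrC stepb.
have bound2 T : t0 <= T -> exists2 C, 0 <= C & forall n t, t0 <= t <= T ->
    `|X n t - L t| <= C / 2 ^+ n.
  move=> t0T; have [C C0 CX] := bound T t0T; exists (C * 2); first by rewrite mulr_ge0.
  exact: LP.
have half_to0 (C e : R) : 0 <= C -> 0 < e -> exists n, C / 2 ^+ n < e.
  move=> C0 e0; have : C * 2^-1 ^+ l @[l --> \oo] --> (0 : R).
    rewrite -[0](mulr0 C); apply: cvgM; first exact: cvg_cst.
    by apply: cvg_expr; rewrite ger0_norm ?invr_ge0 // invf_lt1 ?ltr1n.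
  move=> /cvgrPdist_lt/(_ e e0) [N _ NP]; exists N.
  have := NP N (leqnn N); rewrite sub0r normrN ger0_norm ?exprVn //.
  by rewrite !mulr_ge0 ?exprn_ge0 ?invr_ge0.
have Lc : continuous (clamp L).
  move=> t; apply/cvgrPdist_lt => e e0.
  pose T := Order.max t t0 + 1.
  have tT : t < T by rewrite ltr_pwDr // le_max lexx.
  have t0T : t0 < T by rewrite ltr_pwDr // le_max lexx orbT.
  have [C C0 CX] := bound2 T (ltW t0T).
  have e3 : 0 < e / 3 by rewrite divr_gt0.
  have [n nC] := half_to0 C (e / 3) C0 e3.
  have Xnc : continuous (clamp (X n)).
    by apply: clamp_continuous => u _; exact: Xc.
  have near_n u : u < T -> `|clamp (X n) u - clamp L u| < e / 3.
    move=> uT; apply: le_lt_trans nC; apply: CX.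
    by rewrite le_max lexx orbT /= ge_max !ltW.
  have /cvgrPdist_lt/(_ _ e3) := Xnc t.
  apply: filterS2 (lt_nbhsl tT) => u uT tu.
  have -> : clamp L t - clamp L u = (clamp L t - clamp (X n) t) +
     (clamp (X n) t - clamp (X n) u) + (clamp (X n) u - clamp L u).
    by rewrite !addrA !subrK.
  have -> : e = e / 3 + e / 3 + e / 3 by field.
  rewrite (le_lt_trans (ler_normD _ _)) // ltrD ?near_n //.
  by rewrite (le_lt_trans (ler_normD _ _)) // ltrD // distrC near_n.
have [y [yc y0 [Y YE Yd]]] := picard_step Lc.
have clampE t : t0 <= t -> clamp L t = L t by move=> tt; rewrite /clamp; congr L; apply/max_idPl.
(* [Y] is the Picard image of the limit, so the equation holds once [Y] is shown to be the limit
   itself. *)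
suff YL t : t0 <= t -> Y t = L t.
  exists Y; split; first by rewrite -YE.
  by move=> t tt i; have := Yd t tt i; rewrite clampE // -YL.
move=> t0t; apply/eqP; rewrite -subr_eq0 -normr_le0; apply/ler_addgt0Pr => e e0.
have [C C0 CX] := bound2 t t0t; have [K K0 FK] := Flip t.
pose c := C * expR (2 * K * (t - t0)) + C.
have c0 : 0 <= c by rewrite addr_ge0 ?mulr_ge0 ?expR_ge0.
have [n nC] := half_to0 c e c0 e0.
rewrite add0r (le_trans _ (ltW nC)) //.
have [_ y'0 [Y' YE' Yd']] := stepP _ (Xc n).
have tt : t0 <= t <= t by rewrite t0t lexx.
have b1 : `|Y t - Y' t| <= C / 2 ^+ n / 2 * expR (2 * K * (t - t0)).
  apply: (picard_compare (x := clamp L) (x' := X n) K0 t0t _ FK _ Yd Yd' _ tt).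
  - by rewrite divr_ge0 // exprn_ge0.
  - by rewrite -YE // -YE' // y0 y'0.
  - move=> u /[dup] ut /andP[t0u _]; rewrite clampE // distrC (le_trans (CX n u ut)) //.
    rewrite ler_peMr ?divr_ge0 ?exprn_ge0 // -(expR0 R) ler_expR.
    by rewrite !mulr_ge0 ?subr_ge0 // ltW.
have b2 : `|Y' t - L t| <= C / 2 ^+ n.+1 by rewrite -YE' //; exact: (CX n.+1 t tt).
have -> : Y t - L t = (Y t - Y' t) + (Y' t - L t) by rewrite addrA subrK.
rewrite (le_trans (ler_normD _ _)) // (le_trans (lerD b1 b2)) // /c [leRHS]mulrDl lerD //.
  rewrite [leRHS]mulrAC ler_wpM2r ?expR_ge0 // ler_piMr ?divr_ge0 ?exprn_ge0 //.
  by rewrite invf_le1 // ler1n.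
by rewrite ler_wpM2l // lef_pV2 ?posrE ?exprn_gt0 // exprS ler_peMl ?exprn_ge0 // ler1n.
Qed.

End picard.

(** * Geodesics *)

Section euler_lagrange.
Context {R : realType} {d : nat}.
Implicit Types (x : R -> 'rV[R]_d).

Lemma is_derive_Ck_comp (f : 'rV[R]_d -> R) x (v : 'rV[R]_d) (s : R) :
  Ck 1 setT f -> is_derive s 1 x v ->
  is_derive s 1 (fun t => f (x t)) (\sum_i v 0 i * partial f i (x s)).
Proof.
move=> fC xd; have [fd fdE] := Ck_is_diff (x s) fC.
by apply: (is_derive_comp_diff_eq fd xd); rewrite fdE.
Qed.

Lemma is_derive_sum (I : Type) (r : seq I) (F : I -> R -> R) (dF : I -> R) (s : R) :
  (forall i, is_derive s 1 (F i) (dF i)) ->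
  is_derive s 1 (fun t => \sum_(i <- r) F i t) (\sum_(i <- r) dF i).
Proof. exact: is_derive_sum_real. Qed.

Variable g : 'rV[R]_d -> 'M[R]_d.
Hypothesis gC : forall i j, Ck 1 setT (fun y => g y i j).
Hypothesis gS : forall y, (g y)^T = g y.
Hypothesis gU : forall y, g y \in unitmx.

Definition C2_at x (s : R) :=
  (\forall t \near s, derivable x t 1) /\ derivable (derive1 x) s 1.

Definition geodesic_eq x (s : R) :=
  forall k, derive1 (derive1 x) s 0 k
    + \sum_i \sum_j christoffel g k i j (x s)
                    * derive1 x s 0 i * derive1 x s 0 j = 0.

Definition momentum x l (t : R) := \sum_k g (x t) l k * derive1 x t 0 k.

Lemma derivable_is_derive1 (x : R -> 'rV[R]_d) (s : R) :
  derivable x s 1 -> is_derive s 1 x (derive1 x s).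
Proof. by move=> xd; rewrite derive1E; exact: derivableP. Qed.

Lemma C2_at_is_derive x s : C2_at x s -> is_derive s 1 x (derive1 x s).
Proof. by move=> [/nbhs_singleton xd _]; exact: derivable_is_derive1. Qed.

Lemma C2_at_is_derive2 x s : C2_at x s ->
  is_derive s 1 (derive1 x) (derive1 (derive1 x) s).
Proof. by move=> [_ xd]; exact: derivable_is_derive1. Qed.

Lemma is_derive_momentum x s l : C2_at x s ->
  is_derive s 1 (momentum x l)
   (\sum_k (g (x s) l k * derive1 (derive1 x) s 0 k +
     \sum_i derive1 x s 0 i * derive1 x s 0 k * partial (fun y => g y l k) i (x s))).
Proof.
move=> xC; apply: is_derive_sum => k.
have gd := is_derive_Ck_comp (gC l k) (C2_at_is_derive xC).
have /is_derive_mxP/(_ 0 k) vd := C2_at_is_derive2 xC.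
apply: is_derive_eq; rewrite /GRing.scale /= mulr_sumr; congr (_ + _).
by apply: eq_bigr => i _; ring.
Qed.

Lemma lower_christoffel l i j y : \sum_k g y l k * christoffel g k i j y =
  2^-1 * koszul g i j l y.
Proof.
rewrite /christoffel.
under eq_bigr do rewrite mulrCA mulr_sumr.
rewrite -mulr_sumr exchange_big /=; congr (_ * _).
transitivity (\sum_l' (l == l')%:R * koszul g i j l' y).
  apply: eq_bigr => l' _; rewrite -/(koszul g i j l' y).
  have /matrixP/(_ l l') := mulmxV (gU y); rewrite !mxE => <-.
  by rewrite mulr_suml; apply: eq_bigr => k _; rewrite mulrA.
rewrite (bigD1 l) //= eqxx mul1r big1 ?addr0 // => l'.
by rewrite eq_sym => /negPf ->; rewrite mul0r.
Qed.

Lemma gsym y i j : g y i j = g y j i.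
Proof. by rewrite -{1}gS mxE. Qed.

Lemma koszul_quadratic l y (v : 'rV[R]_d) :
  \sum_i \sum_j 2^-1 * koszul g i j l y * v 0 i * v 0 j =
  \sum_k \sum_i v 0 i * v 0 k * partial (fun y => g y l k) i y
  - 2^-1 * \sum_i \sum_j partial (fun y => g y i j) l y * v 0 i * v 0 j.
Proof.
have sy a b c : partial (fun y => g y a b) c y = partial (fun y => g y b a) c y.
  by congr (partial _ c y); apply/funext => z; exact: gsym.
transitivity (2^-1 * \sum_i \sum_j v 0 i * v 0 j * partial (fun y => g y j l) i y +
   2^-1 * \sum_i \sum_j v 0 i * v 0 j * partial (fun y => g y i l) j y -
   2^-1 * \sum_i \sum_j partial (fun y => g y i j) l y * v 0 i * v 0 j).
  rewrite !mulr_sumr -big_split -sumrB; apply: eq_bigr => i _ /=.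
  rewrite !mulr_sumr -big_split -sumrB; apply: eq_bigr => j _ /=.
  by rewrite /koszul; ring.
congr (_ - _).
have -> : \sum_i \sum_j v 0 i * v 0 j * partial (fun y => g y j l) i y =
   \sum_k \sum_i v 0 i * v 0 k * partial (fun y => g y l k) i y.
  by rewrite exchange_big /=; apply: eq_bigr => k _; apply: eq_bigr => i _; rewrite sy.
have -> : \sum_i \sum_j v 0 i * v 0 j * partial (fun y => g y i l) j y =
   \sum_k \sum_i v 0 i * v 0 k * partial (fun y => g y l k) i y.
  apply: eq_bigr => k _; apply: eq_bigr => i _.
  by rewrite sy [v 0 k * _]mulrC.
by rewrite -mulrDl; have -> : 2^-1 + 2^-1 = 1 :> R; [by field|rewrite mul1r].
Qed.

(** The Euler-Lagrange equations of half the squared speed. They contain neither the inverse metric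
    nor Christoffel symbols, and cyclic coordinates give conserved momenta at once. *)
Definition lagrange_eq x (s : R) := forall l, is_derive s 1 (momentum x l)
  (2^-1 * \sum_i \sum_j partial (fun y => g y i j) l (x s) * derive1 x s 0 i
          * derive1 x s 0 j).

Lemma lower_geodesic x s l : C2_at x s ->
  \sum_k g (x s) l k * (derive1 (derive1 x) s 0 k
    + \sum_i \sum_j christoffel g k i j (x s) * derive1 x s 0 i * derive1 x s 0 j) =
  'D_1 (momentum x l) s -
  2^-1 * \sum_i \sum_j partial (fun y => g y i j) l (x s) * derive1 x s 0 i
          * derive1 x s 0 j.
Proof.
move=> xC; have [_ ->] := is_derive_momentum l xC.
rewrite big_split /= -addrA -koszul_quadratic.
under [LHS] eq_bigr do rewrite mulrDr.
rewrite big_split /=; congr (_ + _).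
under eq_bigr do rewrite mulr_sumr.
rewrite exchange_big; apply: eq_bigr => i _ /=.
under eq_bigr do rewrite mulr_sumr.
rewrite exchange_big; apply: eq_bigr => j _ /=.
rewrite -lower_christoffel !mulr_suml; apply: eq_bigr => k _.
by rewrite !mulrA.
Qed.

Lemma geodesic_lagrange x s : C2_at x s -> geodesic_eq x s <-> lagrange_eq x s.
Proof.
move=> xC; split => [geo l|lag].
  have [pd _] := is_derive_momentum l xC; split => //.
  apply/eqP; rewrite -subr_eq0 -lower_geodesic //; apply/eqP.
  by apply: big1 => k _; rewrite geo mulr0.
pose E : 'cV[R]_d := \col_k (derive1 (derive1 x) s 0 k
    + \sum_i \sum_j christoffel g k i j (x s) * derive1 x s 0 i * derive1 x s 0 j).
have gE : g (x s) *m E = 0.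
  apply/colP => l; rewrite !mxE.
  have e := lower_geodesic l xC; have [_ dE] := lag l; rewrite dE subrr in e.
  rewrite -[RHS]e.
  by apply: eq_bigr => k _; rewrite mxE.
have E0 : E = 0 by rewrite -[E]mul1mx -(mulVmx (gU (x s))) -mulmxA gE mulmx0.
by move=> k; have /colP/(_ k) := E0; rewrite !mxE.
Qed.

End euler_lagrange.

Section momentum_equations.
Context {R : realType} {m : nat}.
Local Notation n := (m.*2.+1).
Variables (nu : R -> R) (w : 'I_n -> R -> R).
Hypothesis nuC : forall k, Ck k setT (fun x : 'rV[R]_(1 + n) => nu (tau x)).
Hypothesis wC : forall k a, Ck k setT (fun x : 'rV[R]_(1 + n) => w a (tau x)).
Hypothesis nu_gt0 : forall t, 0 < nu t.
Hypothesis w_gt0 : forall a t, 0 < w a t.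
Variables (L : R -> R) (H : 'I_n -> R -> R).
Hypothesis dnu : forall t : R, is_derive t 1 nu (2 * L t * nu t).
Hypothesis dw : forall a (t : R), is_derive t 1 (w a) (2 * H a t * w a t).
Local Notation g := (gmetric nu w).
Implicit Types x : R -> 'rV[R]_(1 + n).

Definition mom x a (t : R) := w a (tau (x t)) * omega (x t) (derive1 x t) a.

Definition time_mom x (t : R) := nu (tau (x t)) * derive1 x t 0 ti.

(** The central momentum is conserved and acts like an electric charge: each conjugate pair of
    horizontal momenta turns as in a magnetic field of that strength. *)
Definition momentum_eqs x (s : R) :=
  [/\ is_derive s 1 (time_mom x) (L (tau (x s)) * nu (tau (x s)) * derive1 x s 0 ti ^+ 2
        - \sum_a H a (tau (x s)) * w a (tau (x s)) * omega (x s) (derive1 x s) a ^+ 2),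
      is_derive s 1 (mom x 0) 0,
      forall r, is_derive s 1 (mom x (odd_ix r))
        (- mom x 0 s * derive1 x s 0 (si (even_ix r)))
    & forall r, is_derive s 1 (mom x (even_ix r))
        (mom x 0 s * derive1 x s 0 (si (odd_ix r)))].

Lemma omega_i (y v : 'rV[R]_(1 + n)) a : a != 0 -> omega y v a = v 0 (si a).
Proof. by move=> /negPf a0; rewrite /omega a0 mul0r subr0. Qed.

Lemma momentum_ti x t : momentum g x ti t = - time_mom x t.
Proof.
rewrite /momentum sum_ti_si gmetric_tt big1 ?addr0 => [|a _]; first by rewrite mulNr.
by rewrite gmetric_ts mul0r.
Qed.

Lemma momentum_si x a t : momentum g x (si a) t =
  \sum_c coframe (space (x t)) c a * mom x c t.
Proof.
rewrite /momentum sum_ti_si gmetric_st mul0r add0r.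
under eq_bigr do rewrite gmetric_ss mulr_suml.
rewrite exchange_big; apply: eq_bigr => c _ /=.
rewrite /mom omegaE !mulr_sumr; apply: eq_bigr => b _; ring.
Qed.

Lemma sum_coframe_0 (x : 'rV[R]_(1 + n)) (F : 'I_n -> R) : \sum_c coframe (space x) c 0 * F c = F 0.
Proof.
rewrite (bigD1 0) //= big1 => [|c /negPf c0]; rewrite coframeE ?c0.
  rewrite eqxx mul1r big1 => [|r _]; first by rewrite subr0 mul1r addr0.
  by rewrite [0 == _]eq_sym even_ix_neq0 mulr0.
by rewrite mul0r subr0 mul0r.
Qed.

Lemma sum_coframe_odd (x : 'rV[R]_(1 + n)) r (F : 'I_n -> R) :
  \sum_c coframe (space x) c (odd_ix r) * F c = F (odd_ix r).
Proof.
rewrite (bigD1 (odd_ix r)) //= big1 => [|c /negPf co]; rewrite coframeE ?co.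
  by rewrite odd_ix_neq0 eqxx mul0r subr0 mul1r addr0.
rewrite [in X in _ - X]big1 ?mulr0 ?subrr ?mul0r // => s _.
by rewrite odd_even_ix mulr0.
Qed.

Lemma sum_coframe_even (x : 'rV[R]_(1 + n)) r (F : 'I_n -> R) :
  \sum_c coframe (space x) c (even_ix r) * F c =
  F (even_ix r) - x 0 (si (odd_ix r)) * F 0.
Proof.
rewrite (bigD1 (even_ix r)) //= (bigD1 0) /=; last by rewrite eq_sym even_ix_neq0.
rewrite big1 => [|c /andP[/negPf ce /negPf c0]]; last first.
  by rewrite coframeE ce c0 mul0r subr0 mul0r.
rewrite !coframeE even_ix_neq0 !eqxx mul0r subr0 mul1r [0 == _]eq_sym even_ix_neq0.
rewrite (bigD1 r) //= eqxx mulr1 big1 => [|s sr]; last first.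
  by rewrite (inj_eq (@even_ix_inj m)) eq_sym (negPf sr) mulr0.
by rewrite spaceE; ring.
Qed.

Lemma partial_quadratic_ti y (v : 'rV[R]_(1 + n)) :
  2^-1 * \sum_i \sum_j partial (fun y => g y i j) ti y * v 0 i * v 0 j =
  - (L (tau y) * nu (tau y) * v 0 ti ^+ 2)
  + \sum_a H a (tau y) * w a (tau y) * omega y v a ^+ 2.
Proof.
rewrite sum_ti_si sum_ti_si (partial_gtt w dnu) eqxx big1 ?addr0 => [|b _]; last first.
  by rewrite partial_gts !mul0r.
rewrite mulrDr; congr (_ + _); first by rewrite mul1r; field.
under eq_bigr do rewrite sum_ti_si partial_gst !mul0r add0r.
transitivity (2^-1 * \sum_a \sum_b \sum_c 2 * H c (tau y) * w c (tau y) *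
    (coframe (space y) c a * v 0 (si a)) * (coframe (space y) c b * v 0 (si b))).
  congr (_ * _); apply: eq_bigr => a _; apply: eq_bigr => b _.
  rewrite (partial_gss nu dw) eqxx mul1r !Om_ti mul0r mulr0 addr0 mulr0 subr0.
  by rewrite !mulr_suml; apply: eq_bigr => c _; ring.
under eq_bigr do rewrite exchange_big.
rewrite exchange_big mulr_sumr; apply: eq_bigr => c _ /=.
under eq_bigr do rewrite -mulr_sumr -omegaE.
by rewrite -mulr_suml -mulr_sumr -omegaE; field.
Qed.

Lemma partial_quadratic_si y (v : 'rV[R]_(1 + n)) c :
  2^-1 * \sum_i \sum_j partial (fun y => g y i j) (si c) y * v 0 i * v 0 j =
  - (w 0 (tau y) * omega y v 0 * \sum_a Om (si c) a * v 0 (si a)).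
Proof.
rewrite sum_ti_si sum_ti_si (partial_gtt w dnu) si_ti big1 ?addr0 => [|b _]; last first.
  by rewrite partial_gts !mul0r.
rewrite mul0r oppr0 !mul0r add0r.
under eq_bigr do rewrite sum_ti_si partial_gst !mul0r add0r.
pose W := omega y v 0; pose O := \sum_a Om (si c) a * v 0 (si a).
transitivity (2^-1 * \sum_a \sum_b - (w 0 (tau y) *
   ((Om (si c) a * v 0 (si a)) * (coframe (space y) 0 b * v 0 (si b)) +
    (coframe (space y) 0 a * v 0 (si a)) * (Om (si c) b * v 0 (si b))))).
  congr (_ * _); apply: eq_bigr => a _; apply: eq_bigr => b _.
  by rewrite (partial_gss nu dw) si_ti mul0r; ring.
have -> : \sum_a \sum_b - (w 0 (tau y) *
   ((Om (si c) a * v 0 (si a)) * (coframe (space y) 0 b * v 0 (si b)) +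
    (coframe (space y) 0 a * v 0 (si a)) * (Om (si c) b * v 0 (si b)))) =
   - (w 0 (tau y) * (O * W + W * O)).
  rewrite /W /O omegaE mulr_suml (mulr_suml (index_enum 'I_n) xpredT) -big_split mulr_sumr -sumrN.
  apply: eq_bigr => a _ /=; rewrite !mulr_sumr -big_split mulr_sumr -sumrN.
  by apply: eq_bigr => b _.
by rewrite -/W -/O; field.
Qed.

Lemma sum_Om (c : 'I_n) (F : 'I_n -> R) r :
  [/\ \sum_a Om (si 0) a * F a = 0, \sum_a Om (si (even_ix r)) a * F a = 0 &
      \sum_a Om (si (odd_ix r)) a * F a = F (even_ix r)].
Proof.
split; [by apply: big1 => a _; rewrite Om_0l mul0r|by apply: big1 => a _; rewrite Om_el mul0r|].
rewrite sum_pairs Om_0r mul0r add0r (bigD1 r) //= big1 => [|s sr].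
  by rewrite Om_or Om_oe eqxx mul0r mul1r add0r addr0.
by rewrite Om_or Om_oe eq_sym (negPf sr) !mul0r addr0.
Qed.

Lemma is_derive_x x s i : C2_at x s -> is_derive s 1 (fun t => x t 0 i) (derive1 x s 0 i).
Proof. by move=> xC; have /is_derive_mxP/(_ 0 i) := C2_at_is_derive xC. Qed.

(** Coordinate momenta and frame momenta agree up to the sign of the time component, except for the
    even ones: there the coordinate momentum is [mom x (even_ix r)] minus x_{2r-1} times the central
    momentum, and differentiating this correction accounts for the force on the even component. *)
Lemma geodesic_momentum_eqs x s : C2_at x s ->
  geodesic_eq g x s <-> momentum_eqs x s.
Proof.
move=> xC.
have gC i j : Ck 1 setT (fun y => g y i j) by exact: gmetric_Ck.
have gS y : (g y)^T = g y by exact: gmetric_tr.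
have gU y : g y \in unitmx by exact: gmetric_unit.
apply: iff_trans (geodesic_lagrange gC gS gU xC) _.
have mom_ti : momentum g x ti = fun t => - time_mom x t.
  by apply/funext => t; exact: momentum_ti.
have mom_0 : momentum g x (si 0) = mom x 0.
  by apply/funext => t; rewrite momentum_si sum_coframe_0.
have mom_o r : momentum g x (si (odd_ix r)) = mom x (odd_ix r).
  by apply/funext => t; rewrite momentum_si sum_coframe_odd.
have mom_e r : momentum g x (si (even_ix r)) =
    fun t => mom x (even_ix r) t - x t 0 (si (odd_ix r)) * mom x 0 t.
  by apply/funext => t; rewrite momentum_si sum_coframe_even.
split=> [lag|[dt d0 do_ de] l].
  have d0 : is_derive s 1 (mom x 0) 0.
    rewrite -mom_0; apply: is_derive_eq (lag (si 0)) _.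
    rewrite partial_quadratic_si big1 ?mulr0 ?oppr0 // => a _.
    by rewrite Om_0l mul0r.
  split=> //.
  - have := lag ti; rewrite partial_quadratic_ti mom_ti => dt.
    rewrite (_ : time_mom x = fun t => - (- time_mom x t)).
      by apply: is_derive_eq; rewrite opprD opprK.
    by apply/funext => t; rewrite opprK.
  - move=> r; rewrite -mom_o; apply: is_derive_eq (lag _) _.
    have [_ _ e] := sum_Om 0 (fun a => derive1 x s 0 (si a)) r.
    by rewrite partial_quadratic_si e mulNr.
  - move=> r; have := lag (si (even_ix r)); rewrite mom_e partial_quadratic_si => de.
    have xd := is_derive_x (si (odd_ix r)) xC.
    rewrite (_ : mom x (even_ix r) = fun t => (mom x (even_ix r) t - x t 0 (si (odd_ix r)) * mom x 0 t)
       + x t 0 (si (odd_ix r)) * mom x 0 t); last by apply/funext => t; rewrite subrK.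
    have [_ e _] := sum_Om 0 (fun a => derive1 x s 0 (si a)) r.
    by apply: is_derive_eq; rewrite e /GRing.scale /=; ring.
have [->|[a ->]] := ti_or_si l.
  rewrite mom_ti partial_quadratic_ti; apply: is_derive_eq; rewrite opprD opprK //.
rewrite partial_quadratic_si.
have [->|[r [->|->]]] := ix_cases a.
- have := d0; rewrite mom_0 => d0'; apply: is_derive_eq d0' _.
  by rewrite big1 ?mulr0 ?oppr0 // => b _; rewrite Om_0l mul0r.
- rewrite mom_o; apply: is_derive_eq (do_ r) _.
  by have [_ _ ->] := sum_Om 0 (fun a => derive1 x s 0 (si a)) r; rewrite mulNr.
- have [_ -> _] := sum_Om 0 (fun a => derive1 x s 0 (si a)) r.
  have xd := is_derive_x (si (odd_ix r)) xC; have de' := de r.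
  by rewrite mom_e; apply: is_derive_eq; rewrite /GRing.scale /=; ring.
Qed.

End momentum_equations.

Section primitive_from.
Context {R : realType}.

Lemma primitive_from (f : R -> R) (t0 c : R) :
  (forall t, t0 <= t -> {for t, continuous f}) ->
  exists F, F t0 = c /\ forall t : R, t0 <= t -> is_derive t 1 F (f t).
Proof.
move=> fc; have clampc : continuous (fun t => f (Order.max t t0)).
  move=> t; apply: (@continuous_comp _ _ _ (fun t => Order.max t t0) f).
    by apply: continuous_max => //; exact: cst_continuous.
  by apply: fc; rewrite le_max lexx orbT.
have [F [F0 Fd]] := primitive_exists t0 clampc.
exists (fun t => c + F t); split; first by rewrite F0 addr0.
move=> t tt; have := Fd t tt; rewrite (max_idPl tt) => ?.
by apply: is_derive_eq; rewrite /GRing.scale /=; ring.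
Qed.

Lemma is_derive_near_eq (V : normedModType R) (f g : R -> V) (s : R) (df : V) :
  (\forall t \near s, f t = g t) -> is_derive s 1 f df -> is_derive s 1 g df.
Proof.
move=> fg [fd fE]; have fg' : {near s, f =1 g} by [].
split; first exact: (near_eq_derivable fg' fd).
by rewrite -fE; apply/esym; apply: near_eq_derive.
Qed.

End primitive_from.

(** * Geodesics as a momentum flow in the time variable *)

Section euclidean_norm.
Context {R : realType} (I : finType).
Implicit Types (z : I -> R) (e : R).

Definition enorm e z := Num.sqrt (e + \sum_i z i ^+ 2).

Lemma enorm2 e z : 0 <= e -> enorm e z ^+ 2 = e + \sum_i z i ^+ 2.
Proof. by move=> e0; rewrite sqr_sqrtr // addr_ge0 // sumr_ge0 // => i _; exact: sqr_ge0. Qed.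

Lemma enorm_ge0 e z : 0 <= enorm e z. Proof. exact: sqrtr_ge0. Qed.

Lemma coord_le_enorm e z i : 0 <= e -> `|z i| <= enorm e z.
Proof.
move=> e0; rewrite -(ler_pXn2r (n := 2)) ?nnegrE ?enorm_ge0 // enorm2 // real_normK ?num_real //.
rewrite (bigD1 i) //= addrCA lerDl addr_ge0 // sumr_ge0 // => j _; exact: sqr_ge0.
Qed.

Lemma enorm_lip e z z' : 0 <= e -> 0 < enorm e z ->
  `|enorm e z - enorm e z'| <= \sum_i `|z i - z' i|.
Proof.
move=> e0 z0; have s0 : 0 < enorm e z + enorm e z' by rewrite ltr_pwDl ?enorm_ge0.
rewrite -(ler_pM2r s0) -{1}(ger0_norm (ltW s0)) -normrM.
have -> : (enorm e z - enorm e z') * (enorm e z + enorm e z') =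
   \sum_i (z i - z' i) * (z i + z' i).
  rewrite -subr_sqr !enorm2 // opprD addrACA subrr add0r -sumrB.
  by apply: eq_bigr => i _; rewrite subr_sqr.
rewrite (le_trans (ler_norm_sum _ _ _)) // mulr_suml ler_sum // => i _.
rewrite normrM ler_wpM2l // (le_trans (ler_normD _ _)) // lerD //; exact: coord_le_enorm.
Qed.

(** Normalisation is Lipschitz away from the zeros of the norm, with a constant inversely
    proportional to the lower bound [c]. *)
Lemma quotient_lip e z z' c i : 0 <= e -> 0 < c -> c <= enorm e z -> c <= enorm e z' ->
  `|z i / enorm e z - z' i / enorm e z'| <= (`|z i - z' i| + \sum_j `|z j - z' j|) / c.
Proof.
move=> e0 c0 cz cz'; have z0 := lt_le_trans c0 cz; have z'0 := lt_le_trans c0 cz'.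
have -> : z i / enorm e z - z' i / enorm e z' = (z i - z' i) / enorm e z' +
    z i / enorm e z * (enorm e z' - enorm e z) / enorm e z'.
  by field; rewrite !gt_eqF.
rewrite (le_trans (ler_normD _ _)) // [leRHS]mulrDl; apply: lerD.
  rewrite normrM ler_wpM2l // normfV gtr0_norm // lef_pV2 ?posrE //.
rewrite !normrM !normfV !(gtr0_norm z0, gtr0_norm z'0).
apply: ler_pM; rewrite ?mulr_ge0 ?invr_ge0 ?enorm_ge0 //; last by rewrite lef_pV2 ?posrE.
rewrite -[leRHS]mul1r; apply: ler_pM; rewrite ?mulr_ge0 ?invr_ge0 ?enorm_ge0 //.
  by rewrite ler_pdivrMr // mul1r coord_le_enorm.
by rewrite distrC enorm_lip.
Qed.

End euclidean_norm.

Section rotation_sums.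
Context {R : realType} {m : nat}.
Local Notation n := (m.*2.+1).
Variables X Y : 'I_m -> R.

Lemma rot_0 : \sum_(s < m) (((0 : 'I_n) == even_ix s)%:R * X s - ((0 : 'I_n) == odd_ix s)%:R * Y s) = 0.
Proof.
rewrite big1 // => r _; rewrite [0 == _]eq_sym even_ix_neq0.
by rewrite [0 == _]eq_sym odd_ix_neq0 !mul0r subrr.
Qed.

Lemma rot_odd r :
  \sum_(s < m) ((odd_ix r == even_ix s)%:R * X s - (odd_ix r == odd_ix s)%:R * Y s) = - Y r.
Proof.
rewrite (bigD1 r) //= big1 => [|s sr].
  by rewrite odd_even_ix eqxx mul0r mul1r sub0r addr0.
by rewrite odd_even_ix (inj_eq (@odd_ix_inj m)) eq_sym (negPf sr) !mul0r subrr.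
Qed.

Lemma rot_even r :
  \sum_(s < m) ((even_ix r == even_ix s)%:R * X s - (even_ix r == odd_ix s)%:R * Y s) = X r.
Proof.
rewrite (bigD1 r) //= big1 => [|s sr].
  by rewrite even_odd_ix eqxx mul0r mul1r subr0 addr0.
by rewrite even_odd_ix (inj_eq (@even_ix_inj m)) eq_sym (negPf sr) !mul0r subrr.
Qed.

End rotation_sums.

Section momentum_flow.
Context {R : realType} {m : nat}.
Local Notation n := (m.*2.+1).
Variables (nu : R -> R) (w : 'I_n -> R -> R).
Hypothesis nu_gt0 : forall t, 0 < nu t.
Hypothesis w_gt0 : forall a t, 0 < w a t.
Variables (L : R -> R) (H : 'I_n -> R -> R).
Hypothesis dnu : forall t : R, is_derive t 1 nu (2 * L t * nu t).
Hypothesis dw : forall a (t : R), is_derive t 1 (w a) (2 * H a t * w a t).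

Definition lap t := Num.sqrt (nu t).
Definition scl a t := Num.sqrt (w a t).

Lemma lap_gt0 t : 0 < lap t. Proof. by rewrite sqrtr_gt0. Qed.
Lemma scl_gt0 a t : 0 < scl a t. Proof. by rewrite sqrtr_gt0. Qed.
Lemma lap_ge0 t : 0 <= lap t. Proof. exact: sqrtr_ge0. Qed.
Lemma scl_ge0 a t : 0 <= scl a t. Proof. exact: sqrtr_ge0. Qed.
Lemma lap2 t : lap t ^+ 2 = nu t. Proof. by rewrite sqr_sqrtr // ltW. Qed.
Lemma scl2 a t : scl a t ^+ 2 = w a t. Proof. by rewrite sqr_sqrtr // ltW. Qed.

Lemma is_derive_sqrt_comp (f : R -> R) (h t : R) : 0 < f t ->
  is_derive t 1 f (2 * h * f t) -> is_derive t 1 (fun t => Num.sqrt (f t)) (h * Num.sqrt (f t)).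
Proof.
move=> f0 fd; apply: is_derive_eq (is_derive_comp_real fd (is_derive1_sqrt f0)) _.
have s0 : Num.sqrt (f t) != 0 by rewrite gt_eqF // sqrtr_gt0.
by rewrite -{2}(sqr_sqrtr (ltW f0)); field.
Qed.

Lemma is_derive_lap (t : R) : is_derive t 1 lap (L t * lap t).
Proof. exact: is_derive_sqrt_comp. Qed.

Lemma is_derive_scl a (t : R) : is_derive t 1 (scl a) (H a t * scl a t).
Proof. exact: is_derive_sqrt_comp. Qed.

Lemma lap_cont : continuous lap.
Proof. by move=> t; exact: is_derive_continuous (is_derive_lap t). Qed.
Lemma scl_cont a : continuous (scl a).
Proof. by move=> t; exact: is_derive_continuous (is_derive_scl a t). Qed.
Lemma w_cont a : continuous (w a).
Proof. by move=> t; exact: is_derive_continuous (dw a t). Qed.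
Lemma sclV_cont a : continuous (fun t => (scl a t)^-1).
Proof.
by move=> t; apply: continuousV; [rewrite gt_eqF // scl_gt0|exact: scl_cont].
Qed.

Variables (eps P0 : R).
Hypothesis eps_ge0 : 0 <= eps.

(* The momentum along omega^0 is the constant [P0]; the entry [P 0 0] is ignored. *)
Definition znorm (t : R) (P : 'rV[R]_n) (a : 'I_n) :=
  (if a == 0 then P0 else P 0 a) / scl a t.

(** On the mass shell with squared mass [eps] this is N dtau/ds, the energy of the geodesic with
    respect to the slices. *)
Definition nrg t P := enorm eps (znorm t P).

(** The rotation of the horizontal momenta, divided by dtau/ds = E / N with E the energy [nrg]. *)
Definition flow (t : R) (P : 'rV[R]_n) : 'rV[R]_n :=
  \row_a ((\sum_(r < m) ((a == even_ix r)%:R * (P0 * P 0 (odd_ix r) / w (odd_ix r) t)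
     - (a == odd_ix r)%:R * (P0 * P 0 (even_ix r) / w (even_ix r) t)))
     * (lap t / nrg t P)).

Lemma flow_0 t P : flow t P 0 0 = 0.
Proof. by rewrite mxE rot_0 mul0r. Qed.

Lemma flow_odd t P r : flow t P 0 (odd_ix r) =
  - (P0 * P 0 (even_ix r) / w (even_ix r) t) * (lap t / nrg t P).
Proof. by rewrite mxE rot_odd. Qed.

Lemma flow_even t P r : flow t P 0 (even_ix r) =
  P0 * P 0 (odd_ix r) / w (odd_ix r) t * (lap t / nrg t P).
Proof. by rewrite mxE rot_even. Qed.

Lemma flow_P0 t P : P0 = 0 -> flow t P = 0.
Proof.
move=> P00; apply/rowP => a; rewrite !mxE big1 ?mul0r // => r _.
by rewrite P00 !mul0r !mulr0 subrr.
Qed.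

Lemma znorm_0 t P : znorm t P 0 = P0 / scl 0 t. Proof. by rewrite /znorm eqxx. Qed.
Lemma znorm_i t P a : a != 0 -> znorm t P a = P 0 a / scl a t.
Proof. by rewrite /znorm => /negPf ->. Qed.

Lemma nrg_ge_P0 t P : `|P0| / scl 0 t <= nrg t P.
Proof.
have := @coord_le_enorm R _ eps (znorm t P) 0 eps_ge0.
by rewrite znorm_0 normrM normfV (gtr0_norm (scl_gt0 0 t)).
Qed.

Lemma nrg_gt0 t P : P0 != 0 -> 0 < nrg t P.
Proof.
by move=> P00; apply: lt_le_trans (nrg_ge_P0 t P); rewrite divr_gt0 ?normr_gt0 ?scl_gt0.
Qed.

Lemma znorm_dist t P Q a : `|znorm t P a - znorm t Q a| <= `|P - Q| / scl a t.
Proof.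
have [->|a0] := eqVneq a 0.
  by rewrite !znorm_0 subrr normr0 divr_ge0 // ltW // scl_gt0.
rewrite !znorm_i // -mulrBl normrM normfV (gtr0_norm (scl_gt0 a t)).
rewrite ler_wpM2r ?invr_ge0 ?scl_ge0 //.
by have := mx_norm_coord (P - Q) 0 a; rewrite !mxE.
Qed.

Definition flow_lip t := lap t * scl 0 t * \sum_a (scl a t)^-1 * ((scl a t)^-1 + \sum_b (scl b t)^-1).

Lemma flow_lip_ge t a : lap t * scl 0 t * ((scl a t)^-1 * ((scl a t)^-1 + \sum_b (scl b t)^-1))
  <= flow_lip t.
Proof.
have s0 b : 0 <= (scl b t)^-1 by rewrite invr_ge0 ltW // scl_gt0.
have ss : 0 <= \sum_b (scl b t)^-1 by rewrite sumr_ge0.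
rewrite /flow_lip ler_wpM2l // ?mulr_ge0 ?lap_ge0 ?scl_ge0 // [leRHS](bigD1 a) //= lerDl.
by rewrite sumr_ge0 // => b _; rewrite mulr_ge0 // addr_ge0.
Qed.

Lemma flow_lip_ge0 t : 0 <= flow_lip t.
Proof.
rewrite /flow_lip !mulr_ge0 ?lap_ge0 ?scl_ge0 // sumr_ge0 // => a _.
by rewrite mulr_ge0 ?addr_ge0 ?sumr_ge0 ?invr_ge0 ?scl_ge0 // => b _; rewrite invr_ge0 scl_ge0.
Qed.

(** The energy is at least |P0| / a_0, so [quotient_lip] costs a factor a_0 / |P0|; the factor P0 of
    the flow cancels it. The resulting constant is independent of P0 and of the mass, and for P0 = 0
    the flow vanishes. *)
Lemma flow_lipschitz t P Q : `|flow t P - flow t Q| <= flow_lip t * `|P - Q|.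
Proof.
have s0 b : 0 < (scl b t)^-1 by rewrite invr_gt0 scl_gt0.
have lip0 : 0 <= flow_lip t * `|P - Q|.
  by rewrite mulr_ge0 // flow_lip_ge0.
have [P00|P00] := eqVneq P0 0.
  by rewrite !flow_P0 // subrr normr0.
have c0 : 0 < `|P0| / scl 0 t by rewrite divr_gt0 ?normr_gt0 ?scl_gt0.
have key (a : 'I_n) : a != 0 -> `|P0 * P 0 a / w a t * (lap t / nrg t P)
     - P0 * Q 0 a / w a t * (lap t / nrg t Q)| <= flow_lip t * `|P - Q|.
  move=> a0; have e (S : 'rV[R]_n) : P0 * S 0 a / w a t * (lap t / nrg t S) =
      P0 * lap t / scl a t * (znorm t S a / nrg t S).
    rewrite znorm_i // -scl2; field.
    by rewrite !gt_eqF ?nrg_gt0 ?scl_gt0.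
  rewrite !e -mulrBr normrM.
  have := @quotient_lip R _ eps (znorm t P) (znorm t Q) _ a eps_ge0 c0
    (nrg_ge_P0 t P) (nrg_ge_P0 t Q).
  rewrite -/(nrg t P) -/(nrg t Q) => q.
  rewrite (le_trans (ler_wpM2l (normr_ge0 _) q)) //.
  apply: le_trans (ler_wpM2r (normr_ge0 _) (flow_lip_ge t a)).
  have d : `|znorm t P a - znorm t Q a| + \sum_j `|znorm t P j - znorm t Q j| <=
      ((scl a t)^-1 + \sum_b (scl b t)^-1) * `|P - Q|.
    rewrite mulrDl lerD // ?[_^-1 * _]mulrC ?znorm_dist // mulr_suml ler_sum // => b _.
    by rewrite mulrC znorm_dist.
  have -> : `|P0 * lap t / scl a t| = `|P0| * lap t / scl a t.
    by rewrite !normrM normfV (gtr0_norm (scl_gt0 a t)) (gtr0_norm (lap_gt0 t)).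
  set X := _ + \sum_j _ in d *.
  have -> : `|P0| * lap t / scl a t * (X / (`|P0| / scl 0 t)) =
     lap t * scl 0 t * (scl a t)^-1 * X.
    by field; rewrite ?normr_eq0 ?P00 ?gt_eqF ?scl_gt0.
  rewrite (le_trans (ler_wpM2l _ d)) //.
    by rewrite !mulr_ge0 ?invr_ge0 ?lap_ge0 ?scl_ge0.
  by rewrite !mulrA.
apply: (mx_norm_leP lip0) => i a; rewrite ord1 {i}.
have [->|[r [->|->]]] := ix_cases a; rewrite [X in `|X|]mxE [X in _ + X]mxE.
- by rewrite !flow_0 subrr normr0 lip0.
- by rewrite !flow_odd !mulNr opprK addrC distrC key // even_ix_neq0.
- by rewrite !flow_even key // odd_ix_neq0.
Qed.

Lemma cont_sum (I : Type) (r : seq I) (F : I -> R -> R) (t : R) :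
  (forall i, {for t, continuous (F i)}) -> {for t, continuous (fun t => \sum_(i <- r) F i t)}.
Proof. by move=> Fc; apply: cvg_sumr => i _; exact: Fc. Qed.

Lemma flow_lip_cont : continuous flow_lip.
Proof.
move=> t.
have c1 : {for t, continuous (fun t => lap t * scl 0 t)}.
  by apply: continuousM; [exact: lap_cont|exact: scl_cont].
have c2 : {for t, continuous (fun t => \sum_a (scl a t)^-1 * ((scl a t)^-1 + \sum_b (scl b t)^-1))}.
  apply: cont_sum => a; apply: continuousM; first exact: sclV_cont.
  by apply: continuousD; [exact: sclV_cont|apply: cont_sum => b; exact: sclV_cont].
exact: (continuousM c1 c2).
Qed.

Lemma znorm_cont (P : R -> 'rV[R]_n) (t : R) a : (forall a, {for t, continuous (fun t => P t 0 a)}) ->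
  {for t, continuous (fun t => znorm t (P t) a)}.
Proof.
move=> Pc; rewrite /znorm; case: (a == 0).
  by apply: continuousM; [exact: cst_continuous|exact: sclV_cont].
by apply: continuousM; [exact: Pc|exact: sclV_cont].
Qed.

Lemma nrg_cont (P : R -> 'rV[R]_n) (t : R) : (forall a, {for t, continuous (fun t => P t 0 a)}) ->
  {for t, continuous (fun t => nrg t (P t))}.
Proof.
move=> Pc; apply: (@continuous_comp _ _ _ (fun t => eps + \sum_a znorm t (P t) a ^+ 2) (@Num.sqrt R)).
  apply: continuousD; first exact: cst_continuous.
  apply: cont_sum => a; have zc : {for t, continuous (fun t => znorm t (P t) a)} by exact: znorm_cont.
  have -> : (fun t => znorm t (P t) a ^+ 2) = (fun t => znorm t (P t) a) \* (fun t => znorm t (P t) a).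
    by apply/funext => u; rewrite expr2.
  exact: (continuousM zc zc).
exact: sqrt_continuous.
Qed.

Lemma flow_cont (P : R -> 'rV[R]_n) : continuous P -> continuous (fun t => flow t (P t)).
Proof.
move=> Pc; have [P00|P00] := eqVneq P0 0.
  rewrite (_ : (fun _ => _) = fun=> 0); first exact: cst_continuous.
  by apply/funext => t; exact: flow_P0.
move=> t; apply/(@cvg_mxP _ _ _ (nbhs_filter t)) => i a; rewrite ord1 {i}.
have Pca b : {for t, continuous (fun t => P t 0 b)} by exact: coord_cont.
have Nc : {for t, continuous (fun t => lap t / nrg t (P t))}.
  apply: continuousM; first exact: lap_cont.
  by apply: continuousV; [rewrite gt_eqF // nrg_gt0|exact: nrg_cont].
have Qc b : {for t, continuous (fun t => P0 * P t 0 b / w b t)}.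
  apply: continuousM; first by apply: continuousM; [exact: cst_continuous|exact: Pca].
  by apply: continuousV; [rewrite gt_eqF|exact: w_cont].
have [->|[r [->|->]]] := ix_cases a.
- rewrite (_ : (fun _ => _) = fun=> 0); last by apply/funext => u; rewrite flow_0.
  by rewrite flow_0; exact: cst_continuous.
- rewrite flow_odd (_ : (fun _ => _) = fun t => - (P0 * P t 0 (even_ix r) / w (even_ix r) t) * (lap t / nrg t (P t))).
    by have := continuousM (continuousN (Qc (even_ix r))) Nc.
  by apply/funext => u; rewrite flow_odd.
- rewrite flow_even (_ : (fun _ => _) = fun t => (P0 * P t 0 (odd_ix r) / w (odd_ix r) t) * (lap t / nrg t (P t))).
    by have := continuousM (Qc (odd_ix r)) Nc.
  by apply/funext => u; rewrite flow_even.
Qed.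

Definition flow_line t0 (P : R -> 'rV[R]_n) := forall t : R, t0 <= t ->
  0 < nrg t (P t) /\ forall a, is_derive t 1 (fun t => P t 0 a) (flow t (P t) 0 a).

Lemma flow_line_exists t0 (Pi : 'rV[R]_n) : 0 < nrg t0 Pi ->
  exists2 P, P t0 = Pi & flow_line t0 P.
Proof.
move=> n0; have lip T : exists2 K, 0 < K & forall t x y, t0 <= t <= T -> `|flow t x - flow t y| <= K * `|x - y|.
  have [t0T|Tt0] := leP t0 T; last first.
    by exists 1 => // t x y /andP[a b]; have := le_trans a b; rewrite leNgt Tt0.
  have [c _ cM] : exists2 c, c \in `[t0, T] & forall t, t \in `[t0, T] -> flow_lip t <= flow_lip c.
    by apply: EVT_max t0T _; apply: continuous_subspaceT; exact: flow_lip_cont.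
  exists (`|flow_lip c| + 1) => [|t x y tT]; first by rewrite ltr_wpDl.
  rewrite (le_trans (flow_lipschitz _ _ _)) // ler_wpM2r //.
  by rewrite (le_trans (cM t _)) ?in_itv // (le_trans (ler_norm _)) // lerDl.
have [P [Pt0 Pd]] := picard_exists Pi flow_cont lip.
exists P => // t t0t; split; last exact: Pd.
(* For P0 = 0 the momenta are constant. Were the energy zero at a later time, the mass and all
   momenta would vanish, contrary to the positive initial energy. *)
have [P00|] := eqVneq P0 0; last exact: nrg_gt0.
have PE : P t = Pi.
  apply/rowP => a; rewrite -Pt0; apply: (derive0_const (f := fun t => P t 0 a) t0t) => u /andP[t0u _].
  by apply: is_derive_eq (Pd u t0u a) _; rewrite flow_P0 // mxE.
have e0 s : 0 <= eps + \sum_a znorm s Pi a ^+ 2.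
  by rewrite addr_ge0 // sumr_ge0 // => a _; exact: sqr_ge0.
rewrite PE lt_neqAle enorm_ge0 andbT eq_sym; apply: contraTneq n0 => /eqP.
rewrite sqrtr_eq0 => le0; rewrite -leNgt /nrg /enorm le_eqVlt sqrtr_eq0.
suff -> : eps + \sum_a znorm t0 Pi a ^+ 2 <= 0 by [].
have ez : eps = 0 /\ forall a, znorm t Pi a ^+ 2 = 0.
  have s0 : 0 <= \sum_a znorm t Pi a ^+ 2 by apply: sumr_ge0 => a _; exact: sqr_ge0.
  have sz : \sum_a znorm t Pi a ^+ 2 = 0 by apply/eqP; rewrite eq_le s0 andbT (le_trans _ le0) // lerDr.
  split; first by apply/eqP; rewrite eq_le eps_ge0 andbT (le_trans _ le0) // lerDl.
  by move=> a; apply: (psumr_eq0P _ sz) => // b _; exact: sqr_ge0.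
have [-> z] := ez; rewrite add0r big1 // => a _.
have /eqP := z a; rewrite sqrf_eq0 /znorm mulf_eq0 invr_eq0 (gt_eqF (scl_gt0 _ _)) orbF.
by move=> /eqP ->; rewrite mul0r expr2 mul0r.
Qed.

End momentum_flow.

Lemma mul3_le (R : realDomainType) (a d f k v D K : R) :
  0 <= a -> a <= d -> 0 <= f -> f <= k * d -> 0 <= v -> 0 <= k -> d ^+ 2 <= D -> k * v <= K ->
  a * (f * v) <= K * D.
Proof.
move=> a0 ad f0 fk v0 k0 dD kK; have d0 := le_trans a0 ad.
apply: (@le_trans _ _ (d * (k * d * v))).
  by apply: ler_pM => //; [exact: mulr_ge0|exact: ler_wpM2r].
have -> : d * (k * d * v) = k * v * d ^+ 2 by ring.
by apply: ler_pM => //; [exact: mulr_ge0|exact: sqr_ge0].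
Qed.

Section geodesic_solution.
Context {R : realType} {m : nat}.
Local Notation n := (m.*2.+1).
Variables (nu : R -> R) (w : 'I_n -> R -> R).
Hypothesis nu_gt0 : forall t, 0 < nu t.
Hypothesis w_gt0 : forall a t, 0 < w a t.
Variables (L : R -> R) (H : 'I_n -> R -> R).
Hypothesis dnu : forall t : R, is_derive t 1 nu (2 * L t * nu t).
Hypothesis dw : forall a (t : R), is_derive t 1 (w a) (2 * H a t * w a t).
Local Notation g := (gmetric nu w).
Local Notation M := 'rV[R]_(1 + n).
Local Notation lap := (lap nu).
Local Notation scl := (scl w).
Local Notation nrg := (nrg w).
Local Notation flow := (flow nu w).
Implicit Types x : R -> M.

Lemma nrg2 eps (P0 : R) t (P : 'rV[R]_n) : 0 <= eps -> P 0 0 = P0 ->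
  nrg eps P0 t P ^+ 2 = eps + \sum_a P 0 a ^+ 2 / w a t.
Proof.
move=> e0 P00; rewrite /nrg enorm2 //; congr (_ + _); apply: eq_bigr => a _.
rewrite /znorm exprMn exprVn scl2 //.
by have [->|a0] := eqVneq a 0; rewrite ?eqxx ?P00 // (negPf a0).
Qed.

Definition geo_on x (s : R) :=
  [/\ C2_at x s, momentum_eqs nu w L H x s & 0 < derive1 x s 0 ti].

Definition mom_row x (s : R) : 'rV[R]_n := \row_a mom w x a s.

(* The squared length of the velocity, with the sign of a squared mass. *)
Definition mass x (s : R) := time_mom nu x s ^+ 2 / nu (tau (x s))
   - \sum_a mom w x a s ^+ 2 / w a (tau (x s)).

Lemma massE x s : mass x s = - pairing (g (x s)) (derive1 x s) (derive1 x s).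
Proof.
rewrite pairing_gmetric /mass /time_mom /mom opprD; congr (_ + _).
  by field; rewrite gt_eqF.
by congr (- _); apply: eq_bigr => a _; field; rewrite gt_eqF.
Qed.

Lemma is_derive_tau_x x s : C2_at x s ->
  is_derive s 1 (fun t => tau (x t)) (derive1 x s 0 ti).
Proof.
move=> xC; rewrite (_ : (fun _ => _) = fun t => x t 0 ti); first exact: is_derive_x.
by apply/funext => t; rewrite tauE.
Qed.

Lemma is_derive_tau_comp x s (f : R -> R) df : C2_at x s ->
  is_derive (tau (x s)) 1 f df ->
  is_derive s 1 (fun t => f (tau (x t))) (df * derive1 x s 0 ti).
Proof. by move=> xC; apply: (is_derive_comp_real (is_derive_tau_x xC)). Qed.

Lemma mom_omega x a s : omega (x s) (derive1 x s) a = mom w x a s / w a (tau (x s)).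
Proof. by rewrite /mom; field; rewrite gt_eqF. Qed.

Lemma momentum_flow x s : geo_on x s -> forall a,
  is_derive s 1 (mom w x a) (\sum_(r < m)
     ((a == even_ix r)%:R * (mom w x 0 s * mom w x (odd_ix r) s / w (odd_ix r) (tau (x s)))
      - (a == odd_ix r)%:R * (mom w x 0 s * mom w x (even_ix r) s / w (even_ix r) (tau (x s))))).
Proof.
move=> [xC [_ d0 do_ de] _] a; have [->|[r [->|->]]] := ix_cases a.
- by apply: is_derive_eq d0 _; rewrite rot_0.
- apply: is_derive_eq (do_ r) _.
  by rewrite rot_odd -mulrA -mom_omega omega_i ?even_ix_neq0 // mulNr.
- apply: is_derive_eq (de r) _.
  by rewrite rot_even -mulrA -mom_omega omega_i ?odd_ix_neq0.
Qed.

(** The rotation is orthogonal to the velocity, as a magnetic force does no work. *)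
Lemma sum_flow_orthogonal (F G : 'I_n -> R) (c : R) :
  \sum_a F a / G a * (\sum_(r < m)
     ((a == even_ix r)%:R * (c * F (odd_ix r) / G (odd_ix r))
      - (a == odd_ix r)%:R * (c * F (even_ix r) / G (even_ix r)))) = 0.
Proof.
rewrite sum_pairs rot_0 mulr0 add0r big1 // => r _.
by rewrite rot_odd rot_even; ring.
Qed.

Lemma is_derive_mass x s : geo_on x s -> is_derive s 1 (mass x) 0.
Proof.
move=> gx; have [xC [dt _ _ _] _] := gx; have dm := momentum_flow gx.
have dnu' := is_derive_tau_comp xC (dnu (tau (x s))).
have nu0 : nu (tau (x s)) != 0 by rewrite gt_eqF.
have d1 : is_derive s 1 (fun t => time_mom nu x t ^+ 2 / nu (tau (x t)))
    (- 2 * derive1 x s 0 ti * \sum_a H a (tau (x s)) * w a (tau (x s)) * omega (x s) (derive1 x s) a ^+ 2).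
  apply: is_derive_eq; rewrite /time_mom /GRing.scale /=; set S := \sum_a _.
  by field.
have d2 a : is_derive s 1 (fun t => mom w x a t ^+ 2 / w a (tau (x t)))
    (2 * (mom w x a s / w a (tau (x s)) * (\sum_(r < m)
     ((a == even_ix r)%:R * (mom w x 0 s * mom w x (odd_ix r) s / w (odd_ix r) (tau (x s)))
      - (a == odd_ix r)%:R * (mom w x 0 s * mom w x (even_ix r) s / w (even_ix r) (tau (x s))))))
     - 2 * derive1 x s 0 ti * (H a (tau (x s)) * w a (tau (x s)) * omega (x s) (derive1 x s) a ^+ 2)).
  have w0 : w a (tau (x s)) != 0 by rewrite gt_eqF.
  have dw' := is_derive_tau_comp xC (dw a (tau (x s))).
  have dma := dm a; rewrite mom_omega; move: dma; set S := \sum_(r < m) _ => dma.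
  by apply: is_derive_eq; rewrite /GRing.scale /=; field.
have d3 := is_derive_sum (index_enum 'I_n) d2.
rewrite /mass; apply: is_derive_eq.
rewrite sumrB -!mulr_sumr sum_flow_orthogonal mulr0 sub0r opprK; ring.
Qed.

Section solution.
Variables (x0 v0 : M) (s0 : R).
Hypothesis v0_gt0 : 0 < v0 0 ti.
Hypothesis v0_causal : pairing (g x0) v0 v0 <= 0.
Let t0 := tau x0.
Let eps := - pairing (g x0) v0 v0.
Let Pi : 'rV[R]_n := \row_a (w a t0 * omega x0 v0 a).
Let P0 := w 0 t0 * omega x0 v0 0.

Hypothesis growth : forall P : R -> 'rV[R]_n, flow_line nu w eps P0 t0 P ->
  exists2 C, 0 < C & forall t, t0 <= t -> nrg eps P0 t (P t) <= C * lap t.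

Lemma eps_ge0 : 0 <= eps. Proof. by rewrite oppr_ge0. Qed.

Lemma nrg_init : nrg eps P0 t0 Pi = lap t0 * v0 0 ti.
Proof.
apply/eqP; rewrite -(eqrXn2 (n := 2)) ?enorm_ge0 ?mulr_ge0 ?lap_ge0 ?(ltW v0_gt0) //.
rewrite nrg2 ?eps_ge0 ?mxE // exprMn lap2 // /eps pairing_gmetric opprD -addrA.
apply/eqP; rewrite [X in _ + X](_ : _ = 0); first by rewrite addr0 /t0; ring.
rewrite addrC -sumrB big1 // => a _; rewrite mxE -/t0.
by field; rewrite gt_eqF.
Qed.

Variable P : R -> 'rV[R]_n.
Hypothesis Pt0 : P t0 = Pi.
Hypothesis PF : flow_line nu w eps P0 t0 P.

Let E (t : R) : R := nrg eps P0 t (P t).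

Let E_gt0 t : t0 <= t -> 0 < E t. Proof. by move=> tt; case: (PF tt). Qed.

Let Pd t : t0 <= t -> forall a, is_derive t 1 (fun t => P t 0 a) (flow eps P0 t (P t) 0 a).
Proof. by move=> tt; case: (PF tt). Qed.

Lemma flow_line_P0 t : t0 <= t -> P t 0 0 = P0.
Proof.
move=> tt; transitivity (P t0 0 0); last by rewrite Pt0 mxE.
apply: (derive0_const (f := fun t => P t 0 0) tt) => u /andP[t0u _].
by apply: is_derive_eq (Pd t0u 0) _; exact: flow_0.
Qed.

Lemma znormE t a : t0 <= t -> znorm w P0 t (P t) a = P t 0 a / scl a t.
Proof. by move=> tt; rewrite /znorm; have [->|//] := eqVneq a 0; rewrite flow_line_P0. Qed.

Lemma is_derive_znorm t a : t0 <= t ->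
  is_derive t 1 (fun t => znorm w P0 t (P t) a)
    (flow eps P0 t (P t) 0 a / scl a t - H a t * znorm w P0 t (P t) a).
Proof.
move=> tt; have sd := is_derive_scl w_gt0 dw a t; have s0' : scl a t != 0 by rewrite gt_eqF // scl_gt0.
rewrite /znorm; have [->|a0] := eqVneq a 0.
  have sd0 := is_derive_scl w_gt0 dw 0 t; have s00 : scl 0 t != 0 by rewrite gt_eqF // scl_gt0.
  by rewrite flow_0; apply: is_derive_eq; rewrite /GRing.scale /=; field.
have pd := Pd tt a; move: pd; set fl := flow _ _ _ _ _ _ => pd.
by apply: is_derive_eq; rewrite /GRing.scale /=; field.
Qed.

Lemma flow_orthogonal t : t0 <= t ->
  \sum_a znorm w P0 t (P t) a * (flow eps P0 t (P t) 0 a / scl a t) = 0.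
Proof.
move=> tt; transitivity ((\sum_a P t 0 a / w a t * (\sum_(r < m)
     ((a == even_ix r)%:R * (P0 * P t 0 (odd_ix r) / w (odd_ix r) t)
      - (a == odd_ix r)%:R * (P0 * P t 0 (even_ix r) / w (even_ix r) t)))) * (lap t / E t)).
  rewrite mulr_suml; apply: eq_bigr => a _; rewrite znormE // mxE -(scl2 w_gt0 a t).
  by rewrite -/(E t); set S := \sum_r _; field; rewrite !gt_eqF ?E_gt0 ?scl_gt0.
by rewrite sum_flow_orthogonal mul0r.
Qed.

(** The rotation drops out by orthogonality, and only the redshift due to the scale factors
    remains. *)
Lemma is_derive_E t : t0 <= t ->
  is_derive t 1 E (- (\sum_a H a t * znorm w P0 t (P t) a ^+ 2) / E t).
Proof.
move=> tt; have En := E_gt0 tt; have E0 : E t != 0 by rewrite gt_eqF.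
have zd a : is_derive t 1 (fun t => znorm w P0 t (P t) a ^+ 2)
   (2 * (znorm w P0 t (P t) a * (flow eps P0 t (P t) 0 a / scl a t)) - 2 * (H a t * znorm w P0 t (P t) a ^+ 2)).
  have zd := is_derive_znorm a tt.
  by apply: is_derive_eq; rewrite /GRing.scale /=; ring.
have sd := is_derive_sum (index_enum 'I_n) zd.
have rd : is_derive t 1 (fun t => eps + \sum_a znorm w P0 t (P t) a ^+ 2)
    (- 2 * \sum_a H a t * znorm w P0 t (P t) a ^+ 2).
  apply: is_derive_eq; rewrite sumrB -!mulr_sumr flow_orthogonal // mulr0 add0r sub0r mulNr.
  by rewrite mul1r.
have e0 : 0 < eps + \sum_a znorm w P0 t (P t) a ^+ 2 by rewrite -sqrtr_gt0.
have := is_derive_comp_real rd (is_derive1_sqrt e0).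
rewrite -[Num.sqrt (eps + _)]/(E t) => Ed; apply: is_derive_eq Ed _.
by field.
Qed.

Let E_cont t : t0 <= t -> {for t, continuous E}.
Proof. by move=> tt; exact: is_derive_continuous (is_derive_E tt). Qed.

(** This is ds/dtau, the affine parameter gained per unit of tau. *)
Let rate (t : R) : R := lap t / E t.

Let rate_gt0 t : t0 <= t -> 0 < rate t.
Proof. by move=> tt; apply: divr_gt0; [exact: lap_gt0|exact: E_gt0]. Qed.

Let rate_cont t : t0 <= t -> {for t, continuous rate}.
Proof.
move=> tt; apply: continuousM; first exact: (lap_cont nu_gt0 dnu).
by apply: continuousV; [rewrite gt_eqF // E_gt0|exact: E_cont].
Qed.

Let vel a (t : R) : R := P t 0 a / w a t.

Let vel_cont a t : t0 <= t -> {for t, continuous (vel a)}.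
Proof.
move=> tt; apply: continuousM; first exact: is_derive_continuous (Pd tt a).
by apply: continuousV; [rewrite gt_eqF|exact: (w_cont dw)].
Qed.

(** All coordinates are obtained by quadrature. The central one comes last, since dx_0 = omega^0 +
    sum_r x_{2r-1} dx_{2r} involves the odd coordinates. *)
Lemma solution_coords : exists sig yy, [/\ sig t0 = s0,
    forall t : R, t0 <= t -> is_derive t 1 sig (rate t),
    forall a, yy a t0 = x0 0 (si a) &
    forall t : R, t0 <= t -> forall a, is_derive t 1 (yy a)
      ((vel a t + (a == 0)%:R * \sum_(r < m) yy (odd_ix r) t * vel (even_ix r) t) * rate t)].
Proof.
have [sig [sig0 sigd]] := primitive_from s0 rate_cont.
have hc a t : t0 <= t -> {for t, continuous (fun t => vel a t * rate t)}.
  by move=> tt; apply: continuousM; [exact: vel_cont|exact: rate_cont].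
have [yh yhP] := choice (fun a => primitive_from (x0 0 (si a)) (hc a)).
have c0 t : t0 <= t -> {for t, continuous
    (fun t => (vel 0 t + \sum_(r < m) yh (odd_ix r) t * vel (even_ix r) t) * rate t)}.
  move=> tt; have c1 : {for t, continuous (fun t => \sum_(r < m) yh (odd_ix r) t * vel (even_ix r) t)}.
    apply: cont_sum => r; have [_ yd] := yhP (odd_ix r).
    by apply: continuousM; [exact: is_derive_continuous (yd t tt)|exact: vel_cont].
  apply: continuousM; last exact: rate_cont.
  by apply: continuousD => //; exact: vel_cont.
have [y0 [y00 y0d]] := primitive_from (x0 0 (si 0)) c0.
exists sig, (fun a => if a == 0 then y0 else yh a); split => //.
- by move=> a; have [->|_] := eqVneq a 0; [|case: (yhP a)].
- move=> t tt a; have [->|a0] := eqVneq a 0.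
    apply: is_derive_eq (y0d t tt) _; rewrite mul1r; congr ((_ + _) * _).
    by apply: eq_bigr => r _; rewrite odd_ix_neq0.
  by have [_ yd] := yhP a; apply: is_derive_eq (yd t tt) _; rewrite mul0r addr0.
Qed.

Variables (sig : R -> R) (yy : 'I_n -> R -> R).
Hypothesis sig0 : sig t0 = s0.
Hypothesis sigd : forall t : R, t0 <= t -> is_derive t 1 sig (rate t).
Hypothesis yy0 : forall a, yy a t0 = x0 0 (si a).
Hypothesis yyd : forall t : R, t0 <= t -> forall a, is_derive t 1 (yy a)
      ((vel a t + (a == 0)%:R * \sum_(r < m) yy (odd_ix r) t * vel (even_ix r) t) * rate t).

Lemma sig_unbounded M' : exists2 t, t0 <= t & M' <= sig t.
Proof.
have [C C0 EC] := growth PF.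
have lb t : t0 <= t -> s0 + (t - t0) / C <= sig t.
  move=> tt; suff : sig t0 - (t0 - t0) / C <= sig t - (t - t0) / C by rewrite sig0 subrr mul0r subr0; lra.
  apply: (derive_ge0_nondecreasing (f := fun t => sig t - (t - t0) / C) (df := fun t => rate t - C^-1) tt).
    move=> u /andP[t0u _]; have := sigd t0u => ?.
    by apply: is_derive_eq; rewrite /GRing.scale /=; ring.
  move=> u /andP[t0u _]; rewrite subr_ge0 /rate ler_pdivlMr ?E_gt0 // mulrC ler_pdivrMr // mulrC.
  exact: EC.
exists (t0 + C * `|M' - s0|); first by rewrite lerDl mulr_ge0 // ltW.
apply: le_trans (lb _ _); last by rewrite lerDl mulr_ge0 // ltW.
have -> : (t0 + C * `|M' - s0| - t0) / C = `|M' - s0| by field; rewrite gt_eqF.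
by have := ler_norm (M' - s0); lra.
Qed.

Variable th : R -> R.
Hypothesis thK : forall s, s0 <= s -> t0 <= th s /\ sig (th s) = s.
Hypothesis sigK : forall t, t0 <= t -> th (sig t) = t.
Hypothesis thd : forall s : R, s0 < s -> t0 < th s /\ is_derive s 1 th (rate (th s))^-1.

Definition sol (s : R) : M := row_mx (const_mx (th s)) (\row_a yy a (th s)).

Definition sol_vel (s : R) : M := row_mx (const_mx (rate (th s))^-1)
  (\row_a (vel a (th s) + (a == 0)%:R * \sum_(r < m) yy (odd_ix r) (th s) * vel (even_ix r) (th s))).

Lemma sol_ti s : sol s 0 ti = th s. Proof. by rewrite /sol row_mxEl mxE. Qed.
Lemma sol_si s a : sol s 0 (si a) = yy a (th s). Proof. by rewrite /sol row_mxEr mxE. Qed.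
Lemma sol_vel_ti s : sol_vel s 0 ti = (rate (th s))^-1. Proof. by rewrite /sol_vel row_mxEl mxE. Qed.
Lemma sol_vel_si s a : sol_vel s 0 (si a) = vel a (th s) +
  (a == 0)%:R * \sum_(r < m) yy (odd_ix r) (th s) * vel (even_ix r) (th s).
Proof. by rewrite /sol_vel row_mxEr mxE. Qed.

Lemma is_derive_sol (s : R) : s0 < s -> is_derive s 1 sol (sol_vel s).
Proof.
move=> ss; have [tt thd'] := thd ss; apply/is_derive_mxP => i j; rewrite ord1 {i}.
have [->|[a ->]] := ti_or_si j.
  rewrite sol_vel_ti (_ : (fun _ => _) = th) //.
  by apply/funext => u; rewrite sol_ti.
rewrite sol_vel_si (_ : (fun _ => _) = fun s => yy a (th s)).
  apply: is_derive_eq (is_derive_comp_real thd' (yyd (ltW tt) a)) _.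
  by rewrite mulfK // gt_eqF // rate_gt0 // ltW.
by apply/funext => u; rewrite sol_si.
Qed.

Lemma derive1_sol (s : R) : s0 < s -> derive1 sol s = sol_vel s.
Proof. by move=> ss; rewrite derive1E; case: (is_derive_sol ss). Qed.

Lemma near_gt (s : R) : s0 < s -> \forall u \near s, s0 < u.
Proof. exact: lt_nbhsr. Qed.

Lemma is_derive_rateV (s : R) : s0 < s -> exists d, is_derive s 1 (fun s => (rate (th s))^-1) d.
Proof.
move=> ss; have [tt thd'] := thd ss; have tt' := ltW tt.
have Ed := is_derive_E tt'; have ld := is_derive_lap nu_gt0 dnu (th s).
have l0 : lap (th s) != 0 by rewrite gt_eqF // lap_gt0.
have E0 : E (th s) != 0 by rewrite gt_eqF // E_gt0.
have r0 : rate (th s) != 0 by rewrite gt_eqF // rate_gt0.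
have rd : exists d, is_derive (th s) 1 rate d by eexists; rewrite /rate; apply: is_derive_eq.
have [d rd'] := rd.
have td : exists d, is_derive (th s) 1 (fun t => (rate t)^-1) d.
  by eexists; apply: is_derive_eq.
have [d' td'] := td; eexists; exact: is_derive_comp_real thd' td'.
Qed.

Lemma C2_at_sol (s : R) : s0 < s -> C2_at sol s.
Proof.
move=> ss; split.
  by apply: filterS (near_gt ss) => u su; case: (is_derive_sol su).
have [tt thd'] := thd ss; have tt' := ltW tt.
suff [d vd] : exists d, is_derive s 1 sol_vel d.
  have [] : is_derive s 1 (derive1 sol) d; last by [].
  apply: is_derive_near_eq vd.
  by apply: filterS (near_gt ss) => u su; rewrite derive1_sol.
suff : forall j, exists d, is_derive s 1 (fun s => sol_vel s 0 j) d.
  move=> /choice[d dP]; exists (\row_j d j); apply/is_derive_mxP => i j; rewrite ord1 mxE.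
  exact: dP.
have velc a : exists d, is_derive (th s) 1 (vel a) d.
  have w0 : w a (th s) != 0 by rewrite gt_eqF.
  have pd := Pd tt' a; have wd := dw a (th s).
  by eexists; rewrite /vel; apply: is_derive_eq.
move=> j; have [->|[a ->]] := ti_or_si j.
  have [d dP] := is_derive_rateV ss; exists d.
  rewrite (_ : (fun _ => _) = (fun s => (rate (th s))^-1)) //.
  by apply/funext => u; rewrite sol_vel_ti.
have [dv dvP] := velc a.
have [de deP] := choice (fun r => velc (even_ix r)).
have [S SP] : exists d, is_derive (th s) 1 (fun t => \sum_(r < m) yy (odd_ix r) t * vel (even_ix r) t) d.
  eexists; apply: is_derive_sum => r; have yd := yyd tt' (odd_ix r); have ed := deP r.
  by apply: is_derive_eq.
have [D DP] : exists d, is_derive (th s) 1 (fun t => vel a t + (a == 0)%:R *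
   \sum_(r < m) yy (odd_ix r) t * vel (even_ix r) t) d.
  by eexists; apply: is_derive_eq.
eexists; rewrite (_ : (fun _ => _) = (fun s => (fun t => vel a t + (a == 0)%:R *
   \sum_(r < m) yy (odd_ix r) t * vel (even_ix r) t) (th s))).
  exact: is_derive_comp_real thd' DP.
by apply/funext => u; rewrite sol_vel_si.
Qed.

Lemma tau_sol s : tau (sol s) = th s. Proof. by rewrite tauE sol_ti. Qed.

Lemma omega_sol s a : s0 < s -> omega (sol s) (derive1 sol s) a = vel a (th s).
Proof.
move=> ss; rewrite derive1_sol // /omega sol_vel_si; under [X in _ - _ * X]eq_bigr.
  move=> r _; rewrite sol_si sol_vel_si even_ix_neq0 mul0r addr0; over.
by rewrite addrK.
Qed.

Lemma mom_sol s a : s0 < s -> mom w sol a s = P (th s) 0 a.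
Proof. by move=> ss; rewrite /mom omega_sol // tau_sol /vel mulrC divfK // gt_eqF. Qed.

Lemma momentum_eqs_sol (s : R) : s0 < s -> momentum_eqs nu w L H sol s.
Proof.
move=> ss; have [tt thd'] := thd ss; have tt' := ltW tt.
have l0 : lap (th s) != 0 by rewrite gt_eqF // lap_gt0.
have E0 : E (th s) != 0 by rewrite gt_eqF // E_gt0.
have md a : is_derive s 1 (mom w sol a) (flow eps P0 (th s) (P (th s)) 0 a / rate (th s)).
  apply: (@is_derive_near_eq _ _ (fun s => P (th s) 0 a)).
    by apply: filterS (near_gt ss) => u su; rewrite mom_sol.
  exact: (is_derive_comp_real thd' (Pd tt' a)).
have r0 : lap (th s) / E (th s) != 0 by rewrite mulf_neq0 // invr_eq0.
split.
- rewrite tau_sol derive1_sol // sol_vel_ti.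
  apply: (@is_derive_near_eq _ _ (fun s => lap (th s) * E (th s))).
    apply: filterS (near_gt ss) => u su; have [tu _] := thd su.
    rewrite /time_mom tau_sol derive1_sol // sol_vel_ti /rate -(lap2 nu_gt0 (th u)).
    have Eu : E (th u) != 0 by rewrite gt_eqF // E_gt0 // ltW.
    have lu : lap (th u) != 0 by rewrite gt_eqF // lap_gt0.
    by field; rewrite lu Eu.
  have Ed := is_derive_E tt'; have ld := is_derive_lap nu_gt0 dnu (th s).
  have lE : is_derive (th s) 1 (fun t => lap t * E t)
     (L (th s) * lap (th s) * E (th s) - lap (th s) * ((\sum_a H a (th s) * znorm w P0 (th s) (P (th s)) a ^+ 2) / E (th s))).
    by apply: is_derive_eq; rewrite /GRing.scale /=; ring.
  apply: is_derive_eq (is_derive_comp_real thd' lE) _; rewrite /rate -(lap2 nu_gt0 (th s)).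
  have -> : \sum_a H a (th s) * w a (th s) * omega (sol s) (sol_vel s) a ^+ 2 =
      \sum_a H a (th s) * znorm w P0 (th s) (P (th s)) a ^+ 2.
    apply: eq_bigr => a _; rewrite -derive1_sol // omega_sol // znormE // /vel -(scl2 w_gt0 a (th s)).
    by field; rewrite gt_eqF // scl_gt0.
  by set S := \sum_a _; field; rewrite l0 E0.
- by apply: is_derive_eq (md 0) _; rewrite flow_0 mul0r.
- move=> r; apply: is_derive_eq (md (odd_ix r)) _.
  rewrite flow_odd mom_sol // flow_line_P0 // derive1_sol // sol_vel_si even_ix_neq0 mul0r addr0.
  by rewrite -/(E (th s)) -/(rate (th s)) mulfK // /vel mulNr mulrA.
- move=> r; apply: is_derive_eq (md (even_ix r)) _.
  rewrite flow_even mom_sol // flow_line_P0 // derive1_sol // sol_vel_si odd_ix_neq0 mul0r addr0.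
  by rewrite -/(E (th s)) -/(rate (th s)) mulfK // /vel mulrA.
Qed.

Section uniqueness.
Variables (x : R -> M) (s1 : R).
Hypothesis s01 : s0 <= s1.
Hypothesis xg : forall s, s0 <= s <= s1 -> geo_on x s.
Hypothesis xs0 : x s0 = x0.
Hypothesis vs0 : derive1 x s0 = v0.

Let x_C2 s : s0 <= s <= s1 -> C2_at x s. Proof. by move=> /xg []. Qed.

Let tau_mono s u : s0 <= s -> s <= u -> u <= s1 -> tau (x s) <= tau (x u).
Proof.
move=> ss su us; apply: (derive_ge0_nondecreasing (f := fun s => tau (x s)) (df := fun s => derive1 x s 0 ti) su).
  by move=> v /andP[sv vu]; apply/is_derive_tau_x/x_C2; rewrite (le_trans ss sv) (le_trans vu us).
move=> v /andP[sv vu]; have [_ _] : geo_on x v by apply: xg; rewrite (le_trans ss sv) (le_trans vu us).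
exact: ltW.
Qed.

Let tau_ge s : s0 <= s <= s1 -> t0 <= tau (x s).
Proof. by move=> /andP[ss su]; rewrite /t0 -xs0 tau_mono. Qed.

Lemma mass_const s : s0 <= s <= s1 -> mass x s = eps.
Proof.
move=> /andP[ss su]; transitivity (mass x s0); last by rewrite massE xs0 vs0.
apply: (derive0_const (f := mass x) ss) => v /andP[sv vs].
by apply/is_derive_mass/xg; rewrite sv (le_trans vs su).
Qed.

Lemma mom0_const s : s0 <= s <= s1 -> mom w x 0 s = P0.
Proof.
move=> /andP[ss su]; transitivity (mom w x 0 s0); last by rewrite /mom xs0 vs0.
apply: (derive0_const (f := mom w x 0) ss) => v /andP[sv vs].
by have [_ []] : geo_on x v by apply: xg; rewrite sv (le_trans vs su).
Qed.

Lemma nrg_mom s : s0 <= s <= s1 ->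
  nrg eps P0 (tau (x s)) (mom_row x s) = lap (tau (x s)) * derive1 x s 0 ti.
Proof.
move=> ss; have [_ _ v_gt0] := xg ss.
apply/eqP; rewrite -(eqrXn2 (n := 2)) ?enorm_ge0 ?mulr_ge0 ?lap_ge0 ?(ltW v_gt0) //.
rewrite nrg2 ?eps_ge0 ?mxE ?mom0_const // -(mass_const ss) exprMn lap2 //; apply/eqP.
under eq_bigr do rewrite mxE.
by rewrite /mass subrK /time_mom; field; rewrite gt_eqF.
Qed.

Lemma is_derive_mom s a : s0 <= s <= s1 -> is_derive s 1 (mom w x a)
  (flow eps P0 (tau (x s)) (mom_row x s) 0 a * derive1 x s 0 ti).
Proof.
move=> ss; have gx := xg ss; have [_ _ v_gt0] := gx.
apply: is_derive_eq (momentum_flow gx a) _; rewrite mxE nrg_mom //.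
rewrite -mulrA; have -> : lap (tau (x s)) / (lap (tau (x s)) * derive1 x s 0 ti) * derive1 x s 0 ti = 1.
  by field; rewrite !gt_eqF ?lap_gt0.
by rewrite mulr1; apply: eq_bigr => r _; rewrite mom0_const // !mxE.
Qed.

(** Gronwall's inequality for the sum of squares of the differences, in the affine parameter. The
    coefficient [flow_lip] times dtau/ds is continuous, hence bounded on the compact interval,
    although no bound on dtau/ds is known beforehand. *)
Lemma mom_unique s : s0 <= s <= s1 -> mom_row x s = P (tau (x s)).
Proof.
move=> /andP[ss su].
pose D u := \sum_a (mom w x a u - P (tau (x u)) 0 a) ^+ 2.
have seg u : s0 <= u <= s -> s0 <= u <= s1 by move=> /andP[-> us]; exact: le_trans us su.
have cx1 u : s0 <= u <= s1 -> {for u, continuous (fun u => derive1 x u 0 ti)}.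
  move=> us; have /is_derive_mxP/(_ 0 ti) := C2_at_is_derive2 (x_C2 us).
  exact: is_derive_continuous.
have ctau u : s0 <= u <= s1 -> {for u, continuous (fun u => tau (x u))}.
  by move=> us; exact: is_derive_continuous (is_derive_tau_x (x_C2 us)).
have [c cI cM] : exists2 c, c \in `[s0, s] & forall u, u \in `[s0, s] ->
    flow_lip nu w (tau (x u)) * derive1 x u 0 ti <= flow_lip nu w (tau (x c)) * derive1 x c 0 ti.
  apply: EVT_max ss _; apply: continuous_in_subspaceT => u /set_mem; rewrite /= in_itv /= => us.
  have c1 : {for u, continuous (fun u => flow_lip nu w (tau (x u)))}.
    apply: (@continuous_comp _ _ _ (fun u => tau (x u)) (flow_lip nu w)); first exact/ctau/seg.
    exact: (flow_lip_cont nu_gt0 w_gt0 dnu dw).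
  exact: (continuousM c1 (cx1 _ (seg _ us))).
pose K := flow_lip nu w (tau (x c)) * derive1 x c 0 ti.
pose dD u := \sum_a 2 * ((mom w x a u - P (tau (x u)) 0 a) *
  ((flow eps P0 (tau (x u)) (mom_row x u) 0 a - flow eps P0 (tau (x u)) (P (tau (x u))) 0 a) * derive1 x u 0 ti)).
have Dd u : s0 <= u <= s -> is_derive u 1 D (dD u).
  move=> /seg us; apply: is_derive_sum => a.
  have md := is_derive_mom a us.
  have pd := is_derive_tau_comp (x_C2 us) (Pd (tau_ge us) a).
  by apply: is_derive_eq; rewrite /GRing.scale /=; ring.
have DK u : s0 <= u <= s -> dD u <= (2 * K * n%:R) * D u.
  move=> us; have [_ _ v_gt0] := xg (seg u us).
  set d := mom_row x u - P (tau (x u)).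
  have dE a : mom w x a u - P (tau (x u)) 0 a = d 0 a by rewrite !mxE.
  have d2 : `|d| ^+ 2 <= D u.
    have D0 : 0 <= D u by apply: sumr_ge0 => a _; exact: sqr_ge0.
    rewrite -(sqr_sqrtr D0) ler_pXn2r ?nnegrE ?sqrtr_ge0 //.
    apply: mx_norm_leP (sqrtr_ge0 _) _ => i a; rewrite ord1 -dE.
    rewrite -sqrtr_sqr ler_wsqrtr // /D (bigD1 a) //= lerDl sumr_ge0 // => b _.
    exact: sqr_ge0.
  have K0 : 0 <= K.
    apply: le_trans (cM u _); last by rewrite in_itv.
    by rewrite mulr_ge0 ?flow_lip_ge0 // ltW.
  have -> : 2 * K * n%:R * D u = \sum_(a < n) 2 * (K * D u).
    by rewrite sumr_const card_ord -mulr_natr; ring.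
  apply: ler_sum => a _; rewrite ler_pM2l // dE.
  apply: le_trans (ler_norm _) _; rewrite !normrM (gtr0_norm v_gt0).
  have f1 := flow_lipschitz nu_gt0 w_gt0 P0 eps_ge0 (tau (x u)) (mom_row x u) (P (tau (x u))).
  have f2 := mx_norm_coord (flow eps P0 (tau (x u)) (mom_row x u) - flow eps P0 (tau (x u)) (P (tau (x u)))) 0 a.
  rewrite mxE [X in _ + X]mxE in f2.
  have b1 := mx_norm_coord d 0 a.
  have uI : u \in `[s0, s] by rewrite in_itv.
  exact: (mul3_le (normr_ge0 _) b1 (normr_ge0 _) (le_trans f2 f1) (ltW v_gt0)
    (flow_lip_ge0 _ _ _) d2 (cM u uI)).
have D0 : D s0 <= 0.
  rewrite /D big1 // => a _; rewrite /mom xs0 vs0 -/t0 Pt0 mxE subrr expr2 mul0r //.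
have Ds := gronwall0 ss Dd DK D0.
apply/rowP => a; apply/eqP; rewrite -subr_eq0 -sqrf_eq0 mxE -normr_le0 ger0_norm ?sqr_ge0 //.
apply: le_trans Ds; rewrite /D (bigD1 a) //= lerDl sumr_ge0 // => b _; exact: sqr_ge0.
Qed.

Lemma nrg_unique s : s0 <= s <= s1 -> rate (tau (x s)) * derive1 x s 0 ti = 1.
Proof.
move=> ss; have [_ _ v_gt0] := xg ss.
rewrite /rate /E -mom_unique // nrg_mom //.
by field; rewrite !gt_eqF ?lap_gt0.
Qed.

Lemma sig_tau s : s0 <= s <= s1 -> sig (tau (x s)) = s.
Proof.
move=> /andP[ss su]; apply/eqP; rewrite -subr_eq0; apply/eqP.
transitivity (sig (tau (x s0)) - s0); last by rewrite xs0 -/t0 sig0 subrr.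
apply: (derive0_const (f := fun s => sig (tau (x s)) - s) ss) => u /andP[su' us].
have us1 : s0 <= u <= s1 by rewrite su' (le_trans us su).
have sd := is_derive_tau_comp (x_C2 us1) (sigd (tau_ge us1)).
by apply: is_derive_eq; rewrite nrg_unique // subrr.
Qed.

Lemma coord_unique s a : s0 <= s <= s1 -> x s 0 (si a) = yy a (tau (x s)).
Proof.
have main b u : s0 <= u <= s1 -> (forall v, s0 <= v <= s1 -> omega (x v) (derive1 x v) b =
    derive1 x v 0 (si b) - (b == 0)%:R * \sum_(r < m) yy (odd_ix r) (tau (x v)) * vel (even_ix r) (tau (x v))) ->
    x u 0 (si b) = yy b (tau (x u)).
  move=> /andP[ss us] om; apply/eqP; rewrite -subr_eq0; apply/eqP.
  transitivity (x s0 0 (si b) - yy b (tau (x s0))); last by rewrite xs0 -/t0 yy0 subrr.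
  apply: (derive0_const (f := fun s => x s 0 (si b) - yy b (tau (x s))) ss) => v /andP[sv vu].
  have vs1 : s0 <= v <= s1 by rewrite sv (le_trans vu us).
  have xd := is_derive_x (si b) (x_C2 vs1).
  have yd := is_derive_tau_comp (x_C2 vs1) (yyd (tau_ge vs1) b).
  apply: is_derive_eq; rewrite -mulrA nrg_unique // mulr1.
  have -> : vel b (tau (x v)) = omega (x v) (derive1 x v) b.
    by rewrite mom_omega /vel -mom_unique // mxE.
  by rewrite om // subrK subrr.
move=> ss; have [->|a0] := eqVneq a 0; last first.
  by apply: main => // v _; rewrite omega_i // (negPf a0) mul0r subr0.
apply: (main) => // v vs; rewrite /omega; congr (_ - _ * _); apply: eq_bigr => r _.
rewrite (main (odd_ix r) v vs) => [|u us]; last by rewrite omega_i ?odd_ix_neq0 // mul0r subr0.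
congr (_ * _); rewrite -[LHS](omega_i (x v)) ?even_ix_neq0 // mom_omega /vel -mom_unique //.
by rewrite mxE.
Qed.

Lemma sol_unique s : s0 <= s <= s1 -> x s = sol s.
Proof.
move=> ss; have sE := sig_tau ss; have tE : th s = tau (x s) by rewrite -{1}sE sigK // tau_ge.
apply/rowP => i; have [->|[a ->]] := ti_or_si i.
  by rewrite sol_ti tE tauE.
by rewrite sol_si tE coord_unique.
Qed.

End uniqueness.
End solution.

(** The equations are claimed only for s > s0, where the inverse of the affine parameter has a
    two-sided derivative. This suffices to prolong a given geodesic, because the two agree after s0
    and can be glued at a later parameter. *)
Lemma geodesic_solution (x0 v0 : M) (s0 : R) :
  0 < v0 0 ti -> pairing (g x0) v0 v0 <= 0 ->
  (forall eps (P0 t0 : R) P, 0 <= eps -> flow_line nu w eps P0 t0 P ->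
    exists2 C, 0 < C & forall t, t0 <= t -> nrg eps P0 t (P t) <= C * lap t) ->
  exists X : R -> M,
    (forall s, s0 < s -> C2_at X s /\ momentum_eqs nu w L H X s) /\
    forall x s1, s0 <= s1 -> (forall s, s0 <= s <= s1 -> geo_on x s) -> x s0 = x0 ->
      derive1 x s0 = v0 -> forall s, s0 <= s <= s1 -> x s = X s.
Proof.
move=> v_gt0 v_c growth.
have e0 := eps_ge0 v_c; have n0 := nrg_init v_gt0 v_c.
have [|P Pt0 PF] := flow_line_exists nu_gt0 w_gt0 dnu dw e0 (t0 := tau x0)
   (P0 := w 0 (tau x0) * omega x0 v0 0) (Pi := \row_a (w a (tau x0) * omega x0 v0 a)).
  by rewrite n0 mulr_gt0 // lap_gt0.
have [sig [yy [sig0 sigd yy0 yyd]]] := solution_coords s0 Pt0 PF.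
have gr := fun P => growth _ (w 0 (tau x0) * omega x0 v0 0) (tau x0) P e0.
have rate_gt0 t : tau x0 <= t -> 0 < lap t / nrg (- pairing (g x0) v0 v0) (w 0 (tau x0) * omega x0 v0 0) t (P t).
  by move=> tt; apply: divr_gt0; [exact: lap_gt0|case: (PF t tt)].
have [th [thK sigK thd]] := inverse_exists sigd rate_gt0 (sig_unbounded gr PF sig0 sigd).
rewrite sig0 in thK thd.
exists (sol yy th); split=> [s ss|x s1 s01 xg xs0 vs0 s ss].
  by split; [exact: (C2_at_sol Pt0 PF yyd thd)|exact: (momentum_eqs_sol Pt0 PF yyd thd)].
exact: (sol_unique v_c Pt0 PF sig0 sigd yy0 yyd sigK xg xs0 vs0 ss).
Qed.

End geodesic_solution.

(** * Growth of the energy *)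

Section bounce_growth.
Context {R : realType} {m : nat}.
Local Notation n := (m.*2.+1).
Variables (A p : 'I_n -> R).
Hypothesis A_gt0 : forall a, 0 < A a.
Hypothesis chi_gt0 : forall r : 'I_m, 0 < chi p r.
Variable q : R.
Hypothesis sum_p : \sum_a p a = 1.
Hypothesis sum_p2 : (\sum_a p a ^+ 2) + q ^+ 2 = 1.

(** An exponent p_a <= -1 would exhaust the quadratic relation, so all other exponents would vanish
    and their sum would be p_a instead of 1. *)
Lemma exponent_gtN1 a : 0 < 1 + p a.
Proof.
rewrite ltNge; apply/negP => pa.
have pa1 : p a <= - 1 by lra.
have rest0 : \sum_(b | b != a) p b ^+ 2 <= 0.
  have := sum_p2; rewrite (bigD1 a) //=; set S := \sum_(b | _) _ => e.
  have : 0 <= q ^+ 2 by exact: sqr_ge0.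
  by nra.
have z b : b != a -> p b = 0.
  move=> ba; apply/eqP; rewrite -sqrf_eq0; apply/eqP.
  apply: (psumr_eq0P (P := fun b => b != a) (F := fun b => p b ^+ 2)) => // [c _|].
    exact: sqr_ge0.
  by apply/eqP; rewrite eq_le rest0 sumr_ge0 // => c _; exact: sqr_ge0.
have := sum_p; rewrite (bigD1 a) //= big1 // addr0 => e.
by lra.
Qed.

Lemma flog_ge0 r t : 0 <= flog A p r t.
Proof.
rewrite /flog mulr_ge0 ?mulr_ge0 ?(ltW (chi_gt0 r)) // subr_ge0.
by rewrite invf_le1 ?bounce_gt0 // bounce_ge1.
Qed.

Lemma LS_ge1 t : 1 <= LS A p t.
Proof. by rewrite lerDl mulr_ge0 ?invr_ge0 // sumr_ge0 // => r _; exact: flog_ge0. Qed.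

Lemma HS_ge a t : a != 0 -> p a <= HS A p a t.
Proof.
move=> /negPf a0; rewrite /HS a0 lerDl mulr_ge0 ?invr_ge0 // sumr_ge0 // => r _; exact: flog_ge0.
Qed.

Local Notation nu := (nuS A p).
Local Notation w := (wS A p).

Lemma expR_le_from (c t0 t : R) : 0 < c -> t0 <= t -> expR (c * t0) <= expR (c * t).
Proof. by move=> c0 tt; rewrite ler_expR ler_pM2l. Qed.

Lemma nu_lower t0 t : t0 <= t -> expR (2 * t0) <= nu t.
Proof.
move=> tt; apply: (le_trans (expR_le_from _ tt)) => //.
rewrite /nuS ler_peMr ?expR_ge0 //.
apply: (big_ind (fun x => 1 <= x)) => // [x y x1 y1|r _].
  by rewrite -[1]mulr1 ler_pM.
exact: bounce_ge1.
Qed.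

(** All F_r cancel in N a_0. The product increases because p_0 > -1, so the central energy |P0| /
    a_0 is at most a constant times N. *)
Lemma nu_w0 t : nu t * w 0 t = A 0 ^+ 2 * expR (2 * (1 + p 0) * t).
Proof.
rewrite /nuS wS_0.
have pE : \prod_r bounce A p r t * \prod_r (bounce A p r t)^-1 = 1.
  by rewrite -big_split big1 // => s _ /=; rewrite divff // bounce_neq0.
have -> : expR (2 * (1 + p 0) * t) = expR (2 * t) * expR (2 * p 0 * t).
  by rewrite -expRD; congr expR; ring.
transitivity ((\prod_r bounce A p r t * \prod_r (bounce A p r t)^-1) *
  (A 0 ^+ 2 * (expR (2 * t) * expR (2 * p 0 * t)))); first by ring.
by rewrite pE mul1r.
Qed.

(** Only the exponential term of F_r is kept; multiplied by the bare exponentials of the pair it has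
    the exponent 1 + p_0 + chi_r > 0. *)
Lemma pair_lower r t0 : exists2 c, 0 < c &
  forall t, t0 <= t -> c <= scl w (odd_ix r) t * scl w (even_ix r) t.
Proof.
pose c0 := A (odd_ix r) * A (even_ix r) * (kappa A r ^+ 2 / (4 * chi p r ^+ 2)).
have k0 : 0 < kappa A r by rewrite divr_gt0 // mulr_gt0.
have k1 : 0 < kappa A r ^+ 2 / (4 * chi p r ^+ 2).
  by rewrite divr_gt0 ?exprn_gt0 // mulr_gt0 // exprn_gt0.
have c00 : 0 < c0 by rewrite mulr_gt0 // mulr_gt0.
have e0 : 0 < 1 + p 0 + chi p r by rewrite addr_gt0 // exponent_gtN1.
exists (c0 * expR ((1 + p 0 + chi p r) * t0)); first by rewrite mulr_gt0 ?expR_gt0.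
move=> t tt.
have -> : scl w (odd_ix r) t * scl w (even_ix r) t =
    A (odd_ix r) * A (even_ix r) * (expR (p (odd_ix r) * t) * expR (p (even_ix r) * t)) * bounce A p r t.
  have g0 : 0 <= A (odd_ix r) * A (even_ix r) * (expR (p (odd_ix r) * t) * expR (p (even_ix r) * t)) * bounce A p r t.
    by rewrite !mulr_ge0 ?expR_ge0 ?ltW ?bounce_gt0.
  rewrite /scl -sqrtrM ?ltW ?wS_gt0 //; rewrite -[RHS]ger0_norm // -sqrtr_sqr; congr Num.sqrt.
  by rewrite wS_odd wS_even -!sqr_expR; ring.
apply: (@le_trans _ _ (c0 * expR ((1 + p 0 + chi p r) * t))).
  by rewrite ler_pM2l // expR_le_from.
have -> : (1 + p 0 + chi p r) * t = p (odd_ix r) * t + p (even_ix r) * t + 2 * chi p r * t.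
  by rewrite /chi; ring.
rewrite !expRD /bounce /c0.
have -> : A (odd_ix r) * A (even_ix r) * (kappa A r ^+ 2 / (4 * chi p r ^+ 2)) *
   (expR (p (odd_ix r) * t) * expR (p (even_ix r) * t) * expR (2 * chi p r * t)) =
   A (odd_ix r) * A (even_ix r) * (expR (p (odd_ix r) * t) * expR (p (even_ix r) * t)) *
   (kappa A r ^+ 2 / (4 * chi p r ^+ 2) * expR (2 * chi p r * t)) by ring.
by rewrite ler_wpM2l ?lerDr // !mulr_ge0 ?expR_ge0 // ltW.
Qed.

(** Since |P_b| / a_b is at most the energy, |dP_a/dtau| <= |P0| N / a_b <= |P0| N a_a / c. The
    comparison function C N a_a has a logarithmic derivative of at least 1 + p_a > 0 and therefore
    outgrows P_a. *)
Lemma horizontal_growth eps P0 t0 (P : R -> 'rV[R]_n) (a b : 'I_n) c (sgn : R) : 0 <= eps ->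
  a != 0 -> b != 0 -> 0 < c -> `|sgn| <= 1 ->
  (forall t, t0 <= t -> c <= scl w a t * scl w b t) ->
  flow_line nu w eps P0 t0 P ->
  (forall t, t0 <= t -> flow nu w eps P0 t (P t) 0 a =
     sgn * (P0 * P t 0 b / w b t * (lap nu t / nrg w eps P0 t (P t)))) ->
  exists2 C, 0 <= C & forall t, t0 <= t -> `|P t 0 a| <= C * (lap nu t * scl w a t).
Proof.
move=> e0 a0 b0 c0 sgn1 cab PF fE.
have nu0 := nuS_gt0 A p; have w0 := wS_gt0 p A_gt0.
have pa := exponent_gtN1 a.
have l0 t := lap_gt0 nu0 t.
have s0 d t := scl_gt0 w0 d t.
(* The first summand takes care of the initial value, the second one of the derivative. *)
pose C := `|P t0 0 a| / (lap nu t0 * scl w a t0) + `|P0| / (c * (1 + p a)).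
have C0 : 0 <= C by rewrite addr_ge0 // divr_ge0 // ltW // mulr_gt0.
exists C => // t tt.
apply: (derive_norm_le (u := fun t => P t 0 a) (v := fun t => C * (lap nu t * scl w a t))
  (du := fun t => flow nu w eps P0 t (P t) 0 a)
  (dv := fun t => C * ((LS A p t + HS A p a t) * (lap nu t * scl w a t))) tt).
- by move=> u /andP[t0u _]; case: (PF u t0u).
- move=> u _; have ld := is_derive_lap nu0 (is_derive_nuS A p) u.
  have sd := is_derive_scl w0 (is_derive_wS A p) a u.
  by apply: is_derive_eq; rewrite /GRing.scale /=; ring.
- move=> u /andP[t0u _]; rewrite fE //; have [E0 _] := PF u t0u.
  have zb := coord_le_enorm (znorm w P0 u (P u)) b e0.
  rewrite znorm_i // normrM normfV (gtr0_norm (s0 b u)) ler_pdivrMr // in zb.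
  rewrite -/(nrg w eps P0 u (P u)) in zb.
  apply: (@le_trans _ _ (`|P0| / scl w b u * lap nu u)).
    rewrite normrM -[leRHS]mul1r; apply: ler_pM => //.
    rewrite -(scl2 w0 b u) !normrM !normfV normrX (gtr0_norm (s0 b u)) (gtr0_norm (l0 u)) (gtr0_norm E0).
    have -> : `|P0| * `|P u 0 b| / scl w b u ^+ 2 * (lap nu u / nrg w eps P0 u (P u)) =
      (`|P0| / scl w b u * lap nu u) * (`|P u 0 b| / (nrg w eps P0 u (P u) * scl w b u)).
      by field; rewrite !gt_eqF.
    apply: ler_piMr; first by rewrite !mulr_ge0 ?invr_ge0 ?scl_ge0 ?lap_ge0.
    by rewrite ler_pdivrMr ?mul1r // mulr_gt0.
  have C1 : `|P0| / (c * (1 + p a)) <= C by rewrite lerDr divr_ge0 // ltW // mulr_gt0.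
  have Cs : `|P0| / scl w b u <= `|P0| / (c * (1 + p a)) * ((1 + p a) * scl w a u).
    have -> : `|P0| / (c * (1 + p a)) * ((1 + p a) * scl w a u) = `|P0| * (scl w a u / c).
      by field; rewrite !gt_eqF.
    rewrite ler_wpM2l // -div1r ler_pdivrMr // mulrAC ler_pdivlMr // mul1r.
    exact: cab.
  have LH : 1 + p a <= LS A p u + HS A p a u by rewrite lerD ?LS_ge1 ?HS_ge.
  have -> : C * ((LS A p u + HS A p a u) * (lap nu u * scl w a u)) =
     C * ((LS A p u + HS A p a u) * scl w a u) * lap nu u by ring.
  rewrite ler_wpM2r ?(ltW (l0 u)) // (le_trans Cs) //.
  apply: ler_pM => //.
  + by rewrite divr_ge0 // ltW // mulr_gt0.
  + by rewrite ltW // mulr_gt0.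
  + by rewrite ler_wpM2r // ltW.
- have -> : `|P t0 0 a| = `|P t0 0 a| / (lap nu t0 * scl w a t0) * (lap nu t0 * scl w a t0).
    by rewrite divfK // gt_eqF // mulr_gt0.
  by rewrite ler_wpM2r ?lerDl ?divr_ge0 // ltW // mulr_gt0.
Qed.

Lemma bounce_growth eps P0 t0 (P : R -> 'rV[R]_n) : 0 <= eps ->
  flow_line nu w eps P0 t0 P ->
  exists2 C, 0 < C & forall t, t0 <= t -> nrg w eps P0 t (P t) <= C * lap nu t.
Proof.
move=> e0 PF.
have nu0 := nuS_gt0 A p; have w0 := wS_gt0 p A_gt0.
have hz a : exists2 C, 0 <= C & forall t, t0 <= t -> znorm w P0 t (P t) a ^+ 2 <= C * nu t.
  have horiz b : b != 0 -> (exists2 C, 0 <= C & forall t, t0 <= t -> `|P t 0 b| <= C * (lap nu t * scl w b t)) ->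
      exists2 C, 0 <= C & forall t, t0 <= t -> znorm w P0 t (P t) b ^+ 2 <= C * nu t.
    move=> b0 [C C0 CP]; exists (C ^+ 2) => [|t tt]; first exact: sqr_ge0.
    have s0 := scl_gt0 w0 b t.
    rewrite znorm_i // -(lap2 nu0 t) -exprMn -[leLHS]real_normK ?num_real //.
    rewrite ler_pXn2r ?nnegrE ?mulr_ge0 ?lap_ge0 // normrM normfV (gtr0_norm s0).
    by rewrite ler_pdivrMr // -mulrA; exact: CP.
  have [->|[r [->|->]]] := ix_cases a.
  - exists (P0 ^+ 2 / (A 0 ^+ 2 * expR (2 * (1 + p 0) * t0))).
      by rewrite divr_ge0 ?sqr_ge0 // mulr_ge0 ?sqr_ge0 ?expR_ge0.
    move=> t tt; rewrite znorm_0 exprMn exprVn scl2 //.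
    have k0 : 0 < A 0 ^+ 2 * expR (2 * (1 + p 0) * t0) by rewrite mulr_gt0 ?expR_gt0 ?exprn_gt0.
    rewrite ler_pdivrMr //.
    have -> : P0 ^+ 2 / (A 0 ^+ 2 * expR (2 * (1 + p 0) * t0)) * nu t * w 0 t =
      P0 ^+ 2 * (nu t * w 0 t / (A 0 ^+ 2 * expR (2 * (1 + p 0) * t0))) by ring.
    rewrite ler_peMr ?sqr_ge0 // ler_pdivlMr // mul1r nu_w0 ler_wpM2l ?sqr_ge0 //.
    by rewrite expR_le_from // mulr_gt0 // exponent_gtN1.
  - apply: horiz; first by rewrite odd_ix_neq0.
    have [c c0 cP] := pair_lower r t0.
    apply: (@horizontal_growth eps P0 t0 P _ (even_ix r) c (-1)) => //.
    + by rewrite odd_ix_neq0.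
    + by rewrite even_ix_neq0.
    + by rewrite normrN normr1.
    + by move=> t tt; rewrite flow_odd mulN1r mulNr.
  - apply: horiz; first by rewrite even_ix_neq0.
    have [c c0 cP] := pair_lower r t0.
    apply: (@horizontal_growth eps P0 t0 P _ (odd_ix r) c 1) => //.
    + by rewrite even_ix_neq0.
    + by rewrite odd_ix_neq0.
    + by rewrite normr1.
    + by move=> t tt; rewrite mulrC cP.
    + by move=> t tt; rewrite flow_even mul1r.
have hz' a : exists C : R, 0 <= C /\ forall t, t0 <= t -> znorm w P0 t (P t) a ^+ 2 <= C * nu t.
  by have [C C0 CP] := hz a; exists C.
have [C CP'] := choice hz'.
have C0 a : 0 <= C a by case: (CP' a).
have CP a := (CP' a).2.
(* The mass is absorbed by N^2 >= e^{2 t0}. *)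
pose K := eps / expR (2 * t0) + \sum_a C a.
have K0 : 0 <= K by rewrite addr_ge0 ?divr_ge0 ?expR_ge0 // sumr_ge0.
exists (Num.sqrt K + 1); first by rewrite ltr_wpDl ?sqrtr_ge0.
move=> t tt; apply: (@le_trans _ _ (Num.sqrt K * lap nu t)); last first.
  by rewrite ler_wpM2r ?lap_ge0 // lerDl.
rewrite /lap -sqrtrM // /nrg /enorm ler_wsqrtr // mulrDl lerD //.
  rewrite mulrAC ler_pdivlMr ?expR_gt0 // ler_wpM2l //; exact: nu_lower.
by rewrite mulr_suml ler_sum // => a _; exact: CP.
Qed.

End bounce_growth.

Local Notation patch := Pilot.Defs.patch.
Local Notation coord := Pilot.Defs.coord.
Local Notation orbit := Pilot.Defs.orbit.

(** * Quotients *)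

Section left_action.
Context {R : realType} {m : nat}.
Local Notation n := (m.*2.+1).
Local Notation M := 'rV[R]_(1 + n).
Local Notation H := (heisenberg R m).
Implicit Types (x y u v : M) (a b : H).

Lemma act_ti a x : act a x 0 ti = x 0 ti.
Proof. by rewrite /act row_mxEl mxE; congr (x _ _); apply/val_inj; rewrite /= ord1. Qed.

Lemma act_si a x c : act a x 0 (si c) = (a : 'rV[R]_n) 0 c + x 0 (si c)
  + (c == 0)%:R * \sum_(r < m) (a : 'rV[R]_n) 0 (odd_ix r) * x 0 (si (even_ix r)).
Proof.
rewrite /act row_mxEr -[(a * space x)%g]/(heis_mul a (space x)) /heis_mul !mxE ?spaceE.
congr (_ + _); rewrite eqxx /= mulrC; congr (_ * _).
by apply: eq_bigr => r _; rewrite spaceE.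
Qed.

Lemma tau_act a x : tau (act a x) = tau x.
Proof. by rewrite !tauE act_ti. Qed.

Lemma actM a b x : act a (act b x) = act (a * b)%g x.
Proof.
rewrite /act row_mxKl; congr row_mx.
by rewrite -[space _]/(rsubmx _) row_mxKr mulgA.
Qed.

Lemma act1 x : act 1%g x = x.
Proof. by rewrite /act mul1g /space hsubmxK. Qed.

Lemma actK a : cancel (act a) (act a^-1%g).
Proof. by move=> x; rewrite actM mulVg act1. Qed.

Lemma actVK a : cancel (act a^-1%g) (act a).
Proof. by move=> x; rewrite actM mulgV act1. Qed.

Lemma rV_ti_si x y : x 0 ti = y 0 ti -> (forall c, x 0 (si c) = y 0 (si c)) -> x = y.
Proof. by move=> xt xs; apply/rowP => i; have [->|[c ->]] := ti_or_si i. Qed.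

(** The differential of [act a]; it is the same at every point because the action is affine in these
    coordinates. *)
Definition dact a v : M := v + (\sum_(r < m) (a : 'rV[R]_n) 0 (odd_ix r) * v 0 (si (even_ix r)))
  *: delta_mx 0 (si 0).

Lemma dact_ti a v : dact a v 0 ti = v 0 ti.
Proof. by rewrite /dact !mxE ti_si andbF mulr0 addr0. Qed.

Lemma dact_si a v c : dact a v 0 (si c) = v 0 (si c)
  + (c == 0)%:R * \sum_(r < m) (a : 'rV[R]_n) 0 (odd_ix r) * v 0 (si (even_ix r)).
Proof. by rewrite /dact !mxE si_si mulrC. Qed.

Lemma act_affine a x v : act a (x + v) = act a x + dact a v.
Proof.
apply: rV_ti_si; first by rewrite act_ti [LHS]mxE [RHS]mxE act_ti dact_ti.
have addE k : (x + v) 0 k = x 0 k + v 0 k by rewrite mxE.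
move=> c; rewrite [RHS]mxE !act_si dact_si addE.
under [X in _ + _ * X = _]eq_bigr do rewrite addE mulrDr.
by rewrite big_split /=; ring.
Qed.

Lemma act_continuous a : continuous (act a : M -> M).
Proof.
move=> x; apply/(@cvg_mxP _ _ _ (nbhs_filter x)) => i j; rewrite ord1.
have cc k : {for x, continuous (fun y : M => y 0 k)} by exact: coord_continuous.
have [->|[c ->]] := ti_or_si j.
  by rewrite act_ti (_ : (fun _ => _) = fun y : M => y 0 ti);
    [exact: cc|apply/funext => y; rewrite act_ti].
rewrite act_si (_ : (fun _ => _) = fun y : M => (a : 'rV[R]_n) 0 c + y 0 (si c)
  + (c == 0)%:R * \sum_(r < m) (a : 'rV[R]_n) 0 (odd_ix r) * y 0 (si (even_ix r))); last first.
  by apply/funext => y; rewrite act_si.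
have c1 : {for x, continuous (fun y : M => (a : 'rV[R]_n) 0 c + y 0 (si c))}.
  by apply: continuousD; [exact: cst_continuous|exact: cc].
have c2 : {for x, continuous (fun y : M => (c == 0)%:R *
    \sum_(r < m) (a : 'rV[R]_n) 0 (odd_ix r) * y 0 (si (even_ix r)))}.
  apply: continuousM; first exact: cst_continuous.
  by apply: (@cvg_sumr _ _ _ (nbhs_filter x)) => r _; apply: continuousM; [exact: cst_continuous|exact: cc].
exact: (continuousD c1 c2).
Qed.

Lemma omega_act a x v c : omega (act a x) (dact a v) c = omega x v c.
Proof.
rewrite /omega dact_si; have [->|c0] := eqVneq c 0; last by rewrite /= !mul0r addr0.
rewrite /= !mul1r.
under [X in _ - X = _]eq_bigr do rewrite act_si dact_si odd_ix_neq0 even_ix_neq0 !mul0r !addr0 mulrDl.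
by rewrite big_split /=; ring.
Qed.

Lemma is_derive_act a (x : R -> M) (s : R) v : is_derive s 1 x v ->
  is_derive s 1 (fun t => act a (x t)) (dact a v).
Proof.
move=> /is_derive_mxP xd; apply/is_derive_mxP => i j; rewrite ord1 {i}.
have xd' k := xd 0 k.
have [->|[c ->]] := ti_or_si j.
  rewrite dact_ti (_ : (fun _ => _) = fun t => x t 0 ti) //.
  by apply/funext => t; rewrite act_ti.
rewrite dact_si (_ : (fun _ => _) = fun t => (a : 'rV[R]_n) 0 c + x t 0 (si c)
  + (c == 0)%:R * \sum_(r < m) (a : 'rV[R]_n) 0 (odd_ix r) * x t 0 (si (even_ix r))); last first.
  by apply/funext => t; rewrite act_si.
have sd : is_derive s 1 (fun t => \sum_(r < m) (a : 'rV[R]_n) 0 (odd_ix r) * x t 0 (si (even_ix r)))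
  (\sum_(r < m) (a : 'rV[R]_n) 0 (odd_ix r) * v 0 (si (even_ix r))).
  apply: is_derive_sum => r; have xr := xd' (si (even_ix r)).
  by apply: is_derive_eq; rewrite /GRing.scale /=; ring.
Qed.

Lemma C2_at_act a (x : R -> M) s : C2_at x s -> C2_at (fun t => act a (x t)) s.
Proof.
move=> xC; have [xd _] := xC; split.
  apply: filterS xd => t xt; have [] // := is_derive_act a (derivable_is_derive1 xt).
have x2 := C2_at_is_derive2 xC.
have [d dd] : exists d, is_derive s 1 (fun t => dact a (derive1 x t)) d.
  exists (dact a (derive1 (derive1 x) s)).
  have e t : dact a (derive1 x t) = act a (derive1 x t) - act a 0.
    by rewrite -[X in act a X]add0r act_affine addrAC subrr add0r.
  rewrite (_ : (fun _ => _) = fun t => act a (derive1 x t) - act a 0); last by apply/funext.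
  have ad := is_derive_act a x2.
  have cd : is_derive s 1 (fun=> act a (0 : M)) 0 by exact: is_derive_cst.
  by apply: is_derive_eq; rewrite subr0.
have [] : is_derive s 1 (derive1 (fun t => act a (x t))) d; last by [].
apply: is_derive_near_eq dd; apply: filterS xd => t xt.
by have [_ e'] := is_derive_act a (derivable_is_derive1 xt); rewrite [RHS]derive1E e'.
Qed.

Lemma derive1_act a (x : R -> M) s : derivable x s 1 ->
  derive1 (fun t => act a (x t)) s = dact a (derive1 x s).
Proof.
by move=> /derivable_is_derive1 xd; have [_ e] := is_derive_act a xd; rewrite derive1E.
Qed.

Section invariance.
Variables (nu : R -> R) (w : 'I_n -> R -> R) (L : R -> R) (Hb : 'I_n -> R -> R).

Lemma pairing_act a x u v : pairing (gmetric nu w (act a x)) (dact a u) (dact a v) =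
  pairing (gmetric nu w x) u v.
Proof.
rewrite !pairing_gmetric tau_act !dact_ti; congr (_ + _).
by apply: eq_bigr => c _; rewrite !omega_act.
Qed.

Lemma momentum_eqs_act a (x : R -> M) s : C2_at x s ->
  momentum_eqs nu w L Hb x s -> momentum_eqs nu w L Hb (fun t => act a (x t)) s.
Proof.
move=> xC [dt d0 do_ de]; have [xd _] := xC; have xds := nbhs_singleton xd.
have nt : \forall t \near s, time_mom nu x t = time_mom nu (fun t => act a (x t)) t.
  by apply: filterS xd => t xt; rewrite /time_mom tau_act derive1_act // dact_ti.
have nm c : \forall t \near s, mom w x c t = mom w (fun t => act a (x t)) c t.
  by apply: filterS xd => t xt; rewrite /mom tau_act derive1_act // omega_act.
have e := nbhs_singleton (nm 0).
split.
- rewrite tau_act (derive1_act _ xds) dact_ti; under eq_bigr do rewrite omega_act.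
  exact: is_derive_near_eq nt dt.
- exact: is_derive_near_eq (nm 0) d0.
- move=> r; rewrite -e (derive1_act _ xds) dact_si even_ix_neq0 mul0r addr0.
  exact: is_derive_near_eq (nm _) (do_ r).
- move=> r; rewrite -e (derive1_act _ xds) dact_si odd_ix_neq0 mul0r addr0.
  exact: is_derive_near_eq (nm _) (de r).
Qed.

End invariance.
End left_action.

Section quotient_charts.
Context {R : realType} {m : nat}.
Local Notation n := (m.*2.+1).
Local Notation M := 'rV[R]_(1 + n).
Local Notation H := (heisenberg R m).
Variable G : set H.
Hypothesis Gd : discrete_subgroup G.
Local Notation X := (left_quotient G).
Local Notation pr := (@to_orbit R m G : M -> X).

Lemma G1 : G 1%g. Proof. by case: Gd. Qed.
Lemma GM a b : G a -> G b -> G (a * b)%g. Proof. by case: Gd => _ + _ _; exact. Qed.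
Lemma GV a : G a -> G a^-1%g. Proof. by case: Gd => _ _ + _; exact. Qed.

Lemma orbit_act a x : G a -> orbit G (act a x) = orbit G x.
Proof.
move=> Ga; apply/seteqP; split=> _ [b Gb <-].
  by exists (b * a)%g; [exact: GM|rewrite actM].
by exists (b * a^-1)%g; [exact/GM/GV|rewrite actM -mulgA mulVg mulg1].
Qed.

Lemma pr_act a x : G a -> pr (act a x) = pr x.
Proof.
move=> Ga; apply/eqmodP; apply/asboolP; exact: orbit_act.
Qed.

Lemma pr_eq x y : pr x = pr y -> exists2 a, G a & y = act a x.
Proof.
move=> /eqmodP/asboolP xy.
have : orbit G y y by exists 1%g; [exact: G1|rewrite act1].
by rewrite -xy => -[a Ga ax]; exists a.
Qed.

Lemma pr_continuous : continuous pr.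
Proof. exact: pi_continuous. Qed.

Lemma coordP (c : chart X) p : patch c p -> sval c (coord c p) /\ pr (coord c p) = p.
Proof.
by move=> [x cx xp]; have := @xgetPex _ 0 [set x | sval c x /\ pr x = p]; apply; exists x.
Qed.

Lemma chart_inj (c : chart X) x y : sval c x -> sval c y -> pr x = pr y -> x = y.
Proof. by case: c => U [Uo Ui] /= Ux Uy; apply: Ui; rewrite inE. Qed.

Lemma chart_open (c : chart X) : open (sval c).
Proof. by case: c => U []. Qed.

Lemma coordK (c : chart X) x : sval c x -> coord c (pr x) = x.
Proof.
move=> cx; have [|c1 c2] := @coordP c (pr x); first by exists x.
exact: chart_inj c1 cx c2.
Qed.

(** The preimage of a patch in R x H is the union of the translates of the chart domain by the
    group. *)
Lemma patch_open (c : chart X) : open (patch c).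
Proof.
rewrite /open /= /quotient_open.
rewrite (_ : _ @^-1` _ = \bigcup_(a in G) (act a @^-1` sval c)).
  apply: bigcup_open => a _.
  by have /continuousP := @act_continuous R m a; apply; exact: chart_open.
apply/seteqP; split=> [x /= [y cy yx]|x /= [a Ga ax]].
  have [a Ga ->] := pr_eq yx; exists a^-1%g; first exact: GV.
  by rewrite /= actK.
by exists (act a x) => //; exact: pr_act.
Qed.

Lemma patch_lift (c : chart X) x : patch c (pr x) -> exists2 a, G a & sval c (act a x).
Proof. by move=> [y cy yx]; have [a Ga ya] := pr_eq (esym yx); exists a => //; rewrite -ya. Qed.

Lemma heis_near1 : exists2 e : R, 0 < e & forall a, G a -> `|(a : 'rV[R]_n)| < e -> a = 1%g.
Proof.
have [_ _ _ /(_ _ G1) [_ [U Un UG]]] := Gd.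
have : nbhs (0 : 'rV[R]_n) U by [].
move=> /nbhs_ballP[e /= e0 eU]; exists e => // a Ga ae.
have : (U `&` G) a by split => //; apply: eU; rewrite -ball_normE /= sub0r normrN.
by rewrite UG.
Qed.

(** If [a] carries a point of a small ball to another one, its horizontal coordinates are
    differences of coordinates of the two points and its central coordinate is such a difference up
    to a bilinear correction. So [a] is close to the unit, hence equal to it, and the projection is
    injective on the ball. *)
Lemma chart_at (x : M) : exists c : chart X, sval c x.
Proof.
have [e e0 eG] := heis_near1.
(* Bounds the central coordinate: 1 for the difference itself and |x| + 1 for each of the m terms of
   the correction. *)
pose C := 1 + m%:R * (`|x| + 1).
have C1 : 1 <= C by rewrite lerDl mulr_ge0 // addr_ge0.
have C0 := lt_le_trans ltr01 C1.
pose d := Order.min 1 (e / (4 * C)).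
have d0 : 0 < d by rewrite lt_min ltr01 divr_gt0 // mulr_gt0.
have d1 : d <= 1 by rewrite ge_min lexx.
have dC : 2 * d * C <= e / 2.
  have -> : e / 2 = 2 * (e / (4 * C)) * C by field; rewrite gt_eqF.
  by rewrite ler_pM2r // ler_pM2l // ge_min lexx orbT.
have inj : {in (ball x d : set M) &, injective pr}.
  move=> u v; rewrite !inE -!ball_normE /ball_ /= => xu xv uv.
  have [a Ga va] := pr_eq uv.
  have diff k : `|v 0 k - u 0 k| <= 2 * d.
    have -> : v 0 k - u 0 k = (x 0 k - u 0 k) - (x 0 k - v 0 k) by ring.
    rewrite mulr2n mulrDl mul1r (le_trans (ler_normB _ _)) // lerD //.
      by have := mx_norm_coord (x - u) 0 k; rewrite !mxE => /le_trans -> //; exact: ltW.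
    by have := mx_norm_coord (x - v) 0 k; rewrite !mxE => /le_trans -> //; exact: ltW.
  have ai (c : 'I_n) : c != 0 -> (a : 'rV[R]_n) 0 c = v 0 (si c) - u 0 (si c).
    by move=> /negPf c0; rewrite va act_si c0 mul0r addr0 addrK.
  have uk k : `|u 0 k| <= `|x| + 1.
    have -> : u 0 k = x 0 k - (x 0 k - u 0 k) by ring.
    rewrite (le_trans (ler_normB _ _)) // lerD ?mx_norm_coord //.
    have := mx_norm_coord (x - u) 0 k; rewrite !mxE => /le_trans -> //.
    by rewrite (le_trans (ltW xu)).
  have a0 : (a : 'rV[R]_n) 0 0 = v 0 (si 0) - u 0 (si 0) -
      \sum_(r < m) (v 0 (si (odd_ix r)) - u 0 (si (odd_ix r))) * u 0 (si (even_ix r)).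
    rewrite {1}va act_si eqxx mul1r.
    under [X in _ - X]eq_bigr do rewrite -ai ?odd_ix_neq0 //.
    by ring.
  have d20 : 0 <= 2 * d by rewrite mulr_ge0 // ltW.
  have aC (c : 'I_n) : `|(a : 'rV[R]_n) 0 c| <= 2 * d * C.
    have [->|c0] := eqVneq c 0; last by rewrite ai // (le_trans (diff _)) // ler_peMr.
    rewrite a0 (le_trans (ler_normB _ _)) // /C mulrDr mulr1 lerD //.
    rewrite (le_trans (ler_norm_sum _ _ _)) //.
    apply: (@le_trans _ _ (\sum_(r < m) 2 * d * (`|x| + 1))).
      by apply: ler_sum => r _; rewrite normrM ler_pM.
    by rewrite sumr_const card_ord -[X in X <= _]mulr_natl mulrCA.
  have a1 : a = 1%g.
    apply: eG => //; apply: (@le_lt_trans _ _ (e / 2)); last by rewrite gtr_pMr // invf_lt1 // ltr1n.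
    by apply: mx_norm_leP => [|i c]; [rewrite divr_ge0 // ltW|rewrite ord1 (le_trans (aC _))].
  by rewrite va a1 act1.
have bo : open (ball x d : set M) by exact: ball_open.
by exists (exist _ (ball x d : set M) (conj bo inj)); exact: ballxx.
Qed.

End quotient_charts.

Section continuity_germs.
Variables (T U : topologicalType).
Implicit Types f g : T -> U.

Lemma near_open f x (A : set U) : {for x, continuous f} -> open A -> A (f x) ->
  \forall y \near x, A (f y).
Proof. by move=> fc Ao Ax; apply: fc; apply: open_nbhs_nbhs; split. Qed.

Lemma continuous_germ f g x : (\forall y \near x, f y = g y) ->
  {for x, continuous f} -> {for x, continuous g}.
Proof.
move=> fg fc; have e := nbhs_singleton fg.
move: fc; rewrite /prop_for /continuous_at e => fc.
by apply: cvg_trans fc; exact: near_eq_cvg.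
Qed.

End continuity_germs.

Section curve_germs.
Context {R : realType} {d : nat}.
Implicit Types x y : R -> 'rV[R]_d.

Lemma near_derive1 x y (s : R) : (\forall u \near s, x u = y u) ->
  \forall u \near s, derive1 x u = derive1 y u.
Proof.
move=> /near_join; apply: filterS => u xy.
by rewrite !derive1E; apply: near_eq_derive.
Qed.

Lemma C2_at_germ x y (s : R) : (\forall u \near s, x u = y u) -> C2_at x s -> C2_at y s.
Proof.
move=> xy [xd xdd]; split; last exact: near_eq_derivable (near_derive1 xy) xdd.
move/near_join: xy => xy; apply: filterS2 xy xd => u xy.
exact: near_eq_derivable.
Qed.

Lemma geodesic_eq_germ (g : 'rV[R]_d -> 'M[R]_d) x y (s : R) :
  (\forall u \near s, x u = y u) -> geodesic_eq g x s -> geodesic_eq g y s.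
Proof.
move=> xy geo k; have e1 := near_derive1 xy; have e2 := near_derive1 e1.
by rewrite -(nbhs_singleton e2) -(nbhs_singleton e1) -(nbhs_singleton xy).
Qed.

End curve_germs.

(** * Completeness *)

Section lifting.
Context {R : realType} {m : nat}.
Local Notation n := (m.*2.+1).
Local Notation M := 'rV[R]_(1 + n).
Local Notation H := (heisenberg R m).
Variable G : set H.
Hypothesis Gd : discrete_subgroup G.
Local Notation X := (left_quotient G).
Local Notation pr := (@to_orbit R m G : M -> X).
Implicit Types (gam : R -> X) (x : R -> M).

(** Asks more than [pr (x u) = gam u] near [s]: [x] is a fixed translate of a chart expression of
    [gam], and so inherits the regularity that the geodesic has in charts. *)
Definition lifts x gam (s : R) := exists a (c : chart X),
  [/\ G a, patch c (gam s) & \forall u \near s, patch c (gam u) /\ x u = act a (coord c (gam u))].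

Definition charted gam (s : R) := {for s, continuous gam} /\
  forall c : chart X, patch c (gam s) -> {for s, continuous (coord c \o gam)}.

Lemma near_patch gam (c : chart X) s : {for s, continuous gam} -> patch c (gam s) ->
  \forall u \near s, patch c (gam u).
Proof. by move=> gc gs; apply: (@near_open _ _ gam s (patch c) gc _ gs); exact: patch_open. Qed.

Lemma lifts_pr x gam s : lifts x gam s -> pr (x s) = gam s.
Proof.
move=> [a [c [Ga _ /nbhs_singleton [cs ->]]]].
by rewrite (pr_act Gd) //; case: (coordP cs).
Qed.

Lemma lifts_cont x gam s : charted gam s -> lifts x gam s -> {for s, continuous x}.
Proof.
move=> [_ cc] [a [c [Ga cs xs]]].
have ac : {for s, continuous (fun u => act a (coord c (gam u)))}.
  by apply: (@continuous_comp _ _ _ (coord c \o gam) (act a)); [exact: cc|exact: act_continuous].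
by apply: continuous_germ ac; apply: filterS xs => u [_ ->].
Qed.

Lemma lifts_germ x y gam s : (\forall u \near s, x u = y u) -> lifts x gam s -> lifts y gam s.
Proof.
move=> xy [a [c [Ga cs xs]]]; exists a, c; split => //.
by apply: filterS2 xy xs => u <-.
Qed.

(** Near [s] both curves, translated back by [b], stay in the chart domain, where the projection is
    injective. *)
Lemma lifts_unique x b (c : chart X) gam s : charted gam s -> lifts x gam s -> G b ->
  patch c (gam s) -> x s = act b (coord c (gam s)) ->
  \forall u \near s, x u = act b (coord c (gam u)).
Proof.
move=> gs xl Gb cs xs.
have xc := lifts_cont gs xl.
have yc : {for s, continuous (fun u => act b^-1%g (x u))}.
  by apply: (@continuous_comp _ _ _ x (act b^-1%g)); [exact: xc|exact: act_continuous].
have ys : sval c (act b^-1%g (x s)) by rewrite xs actK; case: (coordP cs).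
have near1 : \forall u \near s, sval c (act b^-1%g (x u)).
  by apply: (@near_open _ _ (fun u => act b^-1%g (x u)) s (sval c) yc _ ys); exact: chart_open.
have near2 := near_patch gs.1 cs.
have [a [c' [Ga c's xs']]] := xl.
apply: filterS3 near1 near2 xs' => u y1 p1 [p2 xu].
have pxu : pr (x u) = gam u by rewrite xu (pr_act Gd) //; case: (coordP p2).
have [k1 k2] := coordP p1.
rewrite -[LHS](actVK b); congr act; apply: chart_inj y1 k1 _.
by rewrite (pr_act Gd) ?k2 //; exact: GV.
Qed.

(** A supremum argument: a chart around the last point reached provides a local lift, and a group
    element makes it agree with the lift already found at an earlier time. *)
Lemma path_lift gam (s0 s1 : R) (c0 : chart X) : s0 <= s1 ->
  (forall s, s0 <= s <= s1 -> charted gam s) ->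
  (forall s, exists c : chart X, patch c (gam s)) ->
  patch c0 (gam s0) ->
  exists x, (\forall u \near s0, x u = coord c0 (gam u)) /\
    forall s, s0 <= s <= s1 -> lifts x gam s.
Proof.
move=> s01 gc ch c0s.
pose P t := exists x, (\forall u \near s0, x u = coord c0 (gam u)) /\
    forall s, s0 <= s <= t -> lifts x gam s.
pose S : set R := [set t | s0 <= t <= s1 /\ P t].
have Ss0 : S s0.
  split; first by rewrite lexx.
  exists (fun u => coord c0 (gam u)); split; first exact: filterE.
  move=> s ss; have -> : s = s0 by apply/le_anti; rewrite andbC.
  exists 1%g, c0; split => //; first exact: G1.
  have [g0 _] := gc s0 (introT andP (conj (lexx _) s01)).
  by apply: filterS (near_patch g0 c0s) => u pu; rewrite act1.
have supS : has_sup S by split; [exists s0|exists s1 => t [/andP[]]].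
pose t0 := sup S.
have t0s : s0 <= t0 <= s1.
  apply/andP; split; first exact: ub_le_sup supS.2 _ Ss0.
  by apply: ge_sup => [|t [/andP[]]]; [exists s0|].
have [c ct] := ch t0.
have [e e0 eP] : exists2 e, 0 < e & forall u, `|t0 - u| < e -> patch c (gam u).
  have [g0 _] := gc t0 t0s.
  have /nbhs_ballP[e /= e0 eP] := near_patch g0 ct.
  by exists e => // u ue; apply: eP; rewrite -ball_normE.
have [t [tI [x [x0 xl]]] te] := sup_adherent e0 supS.
have tt0 : t <= t0 by apply: (ub_le_sup supS.2); split => //; exists x.
(* A lift up to [t'] contradicts the choice of the supremum unless [t'] is [s1]. *)
pose t' := Order.min s1 (t0 + e / 2).
have tt' : t <= t'.
  by case/andP: tI => _ ts; rewrite le_min ts (le_trans tt0) // lerDl divr_ge0 // ltW.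
have t's : s0 <= t' <= s1.
  by rewrite ge_min lexx andbT (le_trans _ tt') //; case/andP: tI.
have near_c u : t <= u <= t' -> patch c (gam u).
  move=> /andP[tu ut']; apply: eP; rewrite ltr_norml; apply/andP; split.
    have : u <= t0 + e / 2 by rewrite (le_trans ut') // ge_min lexx orbT.
    have : e / 2 < e by rewrite gtr_pMr // invf_lt1 // ltr1n.
    lra.
  have : t0 - e < u by rewrite (lt_le_trans te).
  lra.
have ctt : patch c (gam t) by apply: near_c; rewrite lexx.
have xlt : lifts x gam t by apply: xl; rewrite lexx andbT; case/andP: tI.
have [b Gb xb] : exists2 b, G b & x t = act b (coord c (gam t)).
  by apply: (pr_eq Gd); rewrite (lifts_pr xlt); case: (coordP ctt).
have xnear := lifts_unique (gc t tI) xlt Gb ctt xb.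
pose y u := if u <= t then x u else act b (coord c (gam u)).
have yx u : (\forall v \near u, v <= t) \/ u = t -> \forall v \near u, x v = y v.
  move=> [ut|->]; first by apply: filterS ut => v vt; rewrite /y vt.
  by apply: filterS xnear => v xv; rewrite /y; case: ifP.
have yl s : s0 <= s <= t' -> lifts y gam s.
  move=> /andP[ss st']; have [st|ts|st] := ltgtP s t.
  - apply: lifts_germ (xl s _); last by rewrite ss ltW.
    by apply: yx; left; apply: filterS (lt_nbhsl st) => v /ltW.
  - exists b, c; have cs : patch c (gam s) by apply: near_c; rewrite ltW.
    have s01' : s0 <= s <= s1 by rewrite ss (le_trans st') //; case/andP: t's.
    split => //; apply: filterS2 (near_patch (gc s s01').1 cs) (lt_nbhsr ts) => v pv tv.
    by rewrite /y leNgt tv.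
  - by apply: lifts_germ (xl s _); [apply: yx; right|rewrite ss st lexx].
have y0 : \forall u \near s0, y u = coord c0 (gam u).
  have : \forall u \near s0, x u = y u.
    apply: yx; case/andP: tI; rewrite le_eqVlt => /orP[/eqP -> _|st _]; [by right|left].
    by apply: filterS (lt_nbhsl st) => v /ltW.
  by apply: filterS2 x0 => u -> ->.
have St' : S t' by split => //; exists y.
have t't0 : t' <= t0 by apply: (ub_le_sup supS.2).
have t's1 : t' = s1.
  apply/eqP; move: t't0; rewrite /t' /Order.min; case: ifP => // _.
  have e2 : 0 < e / 2 by rewrite divr_gt0.
  lra.
by exists y; split => // s ss; apply: yl; rewrite t's1.
Qed.

End lifting.

Section completeness.
Context {R : realType} {m : nat}.
Local Notation n := (m.*2.+1).
Local Notation M := 'rV[R]_(1 + n).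
Local Notation H := (heisenberg R m).
Variable G : set H.
Hypothesis Gd : discrete_subgroup G.
Local Notation X := (left_quotient G).
Local Notation pr := (@to_orbit R m G : M -> X).
Variables (nu : R -> R) (w : 'I_n -> R -> R).
Hypothesis nuC : forall k, Ck k setT (fun x : M => nu (tau x)).
Hypothesis wC : forall k a, Ck k setT (fun x : M => w a (tau x)).
Hypothesis nu_gt0 : forall t, 0 < nu t.
Hypothesis w_gt0 : forall a t, 0 < w a t.
Variables (L : R -> R) (Hb : 'I_n -> R -> R).
Hypothesis dnu : forall t : R, is_derive t 1 nu (2 * L t * nu t).
Hypothesis dw : forall a (t : R), is_derive t 1 (w a) (2 * Hb a t * w a t).
Hypothesis growth : forall eps (P0 t0 : R) P, 0 <= eps -> flow_line nu w eps P0 t0 P ->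
    exists2 C, 0 < C & forall t, t0 <= t -> nrg w eps P0 t (P t) <= C * lap nu t.
Local Notation g := (gmetric nu w).

Definition geodesic_at (gam : R -> X) (s : R) := {for s, continuous gam} /\
  forall c : chart X, patch c (gam s) ->
    C2_at (coord c \o gam) s /\ geodesic_eq g (coord c \o gam) s.

Lemma geodesicE (I : set R) (gam : R -> X) :
  geodesic (descend G g) I gam <-> forall s, I s -> geodesic_at gam s.
Proof.
split=> geo s Is.
  have [gc gp] := geo s Is; split => // c cs; have [d1 d2 e] := gp c cs.
  by split => //; split.
have [gc gp] := geo s Is; split => // c cs; have [[d1 d2] e] := gp c cs.
by split.
Qed.

Lemma geodesic_at_germ gam gam' s : (\forall u \near s, gam u = gam' u) ->
  geodesic_at gam s -> geodesic_at gam' s.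
Proof.
move=> e [gc gp]; have es := nbhs_singleton e; split.
  exact: continuous_germ e gc.
move=> c cs; rewrite -es in cs; have [C2 ge] := gp c cs.
have ec : \forall u \near s, (coord c \o gam) u = (coord c \o gam') u.
  by apply: filterS e => u /= ->.
by split; [exact: C2_at_germ ec C2|exact: geodesic_eq_germ ec ge].
Qed.

Lemma C2_at_cont (x : R -> M) s : C2_at x s -> {for s, continuous x}.
Proof.
move=> /C2_at_is_derive /is_derive_mxP xd; apply/(@cvg_mxP _ _ _ (nbhs_filter s)) => i j.
exact: is_derive_continuous (xd i j).
Qed.

Lemma geodesic_at_pr (x : R -> M) s : C2_at x s -> momentum_eqs nu w L Hb x s ->
  geodesic_at (pr \o x) s.
Proof.
move=> xC xm; have xc := C2_at_cont xC; split.
  by apply: (continuous_comp xc); exact: pr_continuous.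
move=> c cs; have [a Ga ca] := patch_lift Gd cs.
have ac : {for s, continuous (fun u => act a (x u))}.
  by apply: (@continuous_comp _ _ _ x (act a)); [exact: xc|exact: act_continuous].
have e : \forall u \near s, act a (x u) = (coord c \o (pr \o x)) u.
  have : \forall u \near s, sval c (act a (x u)).
    by apply: (@near_open _ _ (fun u => act a (x u)) s (sval c) ac _ ca); exact: chart_open.
  by apply: filterS => u cu; rewrite -[LHS](coordK cu); congr (coord c _); exact: pr_act.
have aC := C2_at_act a xC.
split; first exact: C2_at_germ e aC.
apply: geodesic_eq_germ e _.
apply/(geodesic_momentum_eqs nuC wC nu_gt0 w_gt0 dnu dw aC).
exact: momentum_eqs_act.
Qed.

Lemma pairing_time_field (y v : M) : pairing (g y) v time_field = - nu (tau y) * v 0 ti.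
Proof.
have t1 : (time_field : M) 0 ti = 1 by rewrite /time_field row_mxEl mxE.
have s0 a : (time_field : M) 0 (si a) = 0 by rewrite /time_field row_mxEr mxE.
rewrite pairing_gmetric t1 mulr1 big1 ?addr0 // => a _.
rewrite [omega y time_field a](_ : _ = 0) ?mulr0 //.
rewrite /omega s0 big1 ?mulr0 ?subr0 // => r _.
by rewrite s0 mulr0.
Qed.

(** From a midpoint [s0] on, the geodesic lifts to R x H. By uniqueness the lift is the global
    solution with the same initial data, whose projection prolongs the geodesic. *)
Lemma complete_for (causal : set R -> (R -> X) -> Prop) :
  (forall I gam, causal I gam -> velocity_prop (descend G g)
     (fun G v => pairing G v v <= 0) I gam) ->
  future_complete_for (descend G g) (quotient_time_field G) causal.
Proof.
move=> causal_le a b gam ab geo /causal_le cau fut.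
pose s0 := (a + b) / 2.
have as0 : a < s0 by rewrite /s0; lra.
have s0b : s0 < b by rewrite /s0; lra.
have geo' s : a < s < b -> geodesic_at gam s.
  by move=> sab; move/geodesicE: geo; apply; rewrite /= in_itv.
have chg s : exists c : chart X, patch c (gam s).
  have [x <-] : exists x, pr x = gam s by exists (repr (gam s)); rewrite /to_orbit reprK.
  by have [c cx] := chart_at Gd x; exists c, x.
have [c0 c0s] := chg s0.
have ab0 : a < s0 < b by rewrite as0.
have in_ab s : a < s < b -> `]a, b[%classic s by rewrite /= in_itv.
pose x0 := coord c0 (gam s0); pose v0 := derive1 (coord c0 \o gam) s0.
have vgt (c : chart X) s : a < s < b -> patch c (gam s) -> 0 < derive1 (coord c \o gam) s 0 ti.
  move=> sab cs; have := fut s (in_ab s sab) c cs.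
  by rewrite /= /quotient_time_field /descend pairing_time_field mulNr oppr_lt0 pmulr_rgt0.
have v0_gt0 : 0 < v0 0 ti by exact: vgt.
have v0_c : pairing (g x0) v0 v0 <= 0 by exact: (cau s0 (in_ab s0 ab0) c0 c0s).
have [Y [Ygeo Yuniq]] := geodesic_solution nu_gt0 w_gt0 dnu dw s0 v0_gt0 v0_c growth.
have gamY s : s0 <= s < b -> gam s = pr (Y s).
  move=> /andP[ss sb].
  have seg u : s0 <= u <= s -> a < u < b.
    by move=> /andP[su us]; rewrite (lt_le_trans as0) // (le_lt_trans us).
  have gch u : s0 <= u <= s -> charted gam u.
    move=> /seg uab; have [gc gp] := geo' u uab.
    split; first exact: gc.
    by move=> c cu; have [C2 _] := gp c cu; exact: C2_at_cont C2.
  have [x [x0E xl]] := path_lift Gd ss gch chg c0s.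
  have xgeo u : s0 <= u <= s -> geo_on nu w L Hb x u.
    move=> su; have [b' [c [Gb cu xE]]] := xl u su.
    have [C2 ge] := (geo' u (seg u su)).2 c cu.
    have e : \forall v \near u, act b' ((coord c \o gam) v) = x v by apply: filterS xE => v [_ ->].
    have aC := C2_at_act b' C2.
    have xC := C2_at_germ e aC.
    split; first exact: xC.
    - apply/(geodesic_momentum_eqs nuC wC nu_gt0 w_gt0 dnu dw xC).
      apply: geodesic_eq_germ e _.
      apply/(geodesic_momentum_eqs nuC wC nu_gt0 w_gt0 dnu dw aC).
      apply: (momentum_eqs_act _ C2); exact/(geodesic_momentum_eqs nuC wC nu_gt0 w_gt0 dnu dw C2).
    - rewrite -(nbhs_singleton (near_derive1 e)) derive1_act; last exact: nbhs_singleton C2.1.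
      by rewrite dact_ti; apply: vgt (seg u su) cu.
  have e0 : \forall u \near s0, x u = (coord c0 \o gam) u by apply: filterS x0E.
  have xs0 : x s0 = x0 by exact: nbhs_singleton e0.
  have vs0 : derive1 x s0 = v0 by exact: nbhs_singleton (near_derive1 e0).
  have slast : s0 <= s <= s by rewrite ss lexx.
  by rewrite -(Yuniq x s ss xgeo xs0 vs0 s slast) (lifts_pr Gd (xl s slast)).
(* The gluing takes place at [s1] and not at [s0]: the projected solution is known to be a geodesic
   only after [s0], and the two curves agree on a whole neighbourhood of [s1]. *)
pose s1 := (s0 + b) / 2.
have s01 : s0 < s1 by rewrite /s1; lra.
have s1b : s1 < b by rewrite /s1; lra.
exists (fun s => if s < s1 then gam s else pr (Y s)); last first.
  move=> s /=; rewrite in_itv /= => /andP[as_ sb]; case: ltP => // s1s.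
  by rewrite gamY // sb andbT (le_trans _ s1s) // ltW.
apply/geodesicE => s; rewrite /= in_itv /= andbT => as_.
have [ss1|s1s] := ltP s s1.
  apply: (@geodesic_at_germ gam); last by apply: geo'; rewrite as_ (lt_trans ss1).
  by apply: filterS (lt_nbhsl ss1) => u ->.
have s0s : s0 < s by exact: lt_le_trans s01 s1s.
have [YC Ym] := Ygeo s s0s.
apply: (@geodesic_at_germ (pr \o Y)); last exact: geodesic_at_pr.
apply: filterS (lt_nbhsr s0s) => u s0u /=; case: ltP => // us1.
by rewrite gamY // (ltW s0u) (lt_trans us1).
Qed.

Lemma timelike_null_complete :
  future_timelike_null_complete (descend G g) (quotient_time_field G).
Proof.
split; apply: complete_for => I gam cau s Is c cs.
  by have := cau s Is c cs; rewrite /= => /ltW.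
by move=> /=; have [_ e] := cau s Is c cs; rewrite e.
Qed.

End completeness.

Lemma bounce_complete (R : realType) (m : nat) (A p : 'I_(m.*2.+1) -> R) (q : R) :
  (forall a, 0 < A a) -> \sum_a p a = 1 -> (\sum_a p a ^+ 2) + q ^+ 2 = 1 ->
  (forall r : 'I_m, 0 < chi p r) ->
  forall G : set (heisenberg R m), discrete_subgroup G ->
  future_timelike_null_complete (descend G (Defs.metric A p)) (quotient_time_field G).
Proof.
move=> A0 p1 p2 chi0 G Gd; rewrite metric_gmetric.
apply: (timelike_null_complete Gd (nuS_Ck A p) (wS_Ck A p) (nuS_gt0 A p) (wS_gt0 p A0)
  (is_derive_nuS A p) (is_derive_wS A p)).
by move=> eps P0 t0 P; exact: (bounce_growth A0 chi0 p1 p2).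
Qed.

(** * Local inverses and path lifting *)

Section segment_induction.
Context {R : realType}.

(** Real induction. The local condition passes [P] between any two points near [t], in both
    directions, and thus combines openness and closedness. *)
Lemma segment_ind (P : R -> Prop) (a b : R) : a <= b -> P a ->
  (forall t, a <= t <= b -> exists2 e, 0 < e & forall u v, a <= u <= b -> a <= v <= b ->
     `|t - u| < e -> `|t - v| < e -> P u -> P v) ->
  forall t, a <= t <= b -> P t.
Proof.
move=> ab Pa loc.
pose S : set R := [set t | a <= t <= b /\ forall u, a <= u <= t -> P u].
have Sa : S a.
  split; first by rewrite lexx.
  by move=> u ua; have -> : u = a by apply/le_anti; rewrite andbC.
have supS : has_sup S by split; [exists a|exists b => t [/andP[]]].
have ac : a <= sup S by exact: ub_le_sup supS.2 _ Sa.
have cb : sup S <= b by apply: ge_sup; [exists a|move=> t [/andP[]]].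
have [e e0 eP] := loc (sup S) (introT andP (conj ac cb)).
have [t [/andP[at_ tb] tP] tc] := sup_adherent e0 supS.
have tc' : t <= sup S by apply: ub_le_sup supS.2 _ _; split; rewrite ?at_.
have Pt : P t by apply: tP; rewrite at_ lexx.
have Pv v : a <= v <= b -> v < sup S + e -> P v.
  move=> /andP[av vb] ve; have [vt|tv] := leP v t; first by apply: tP; rewrite av.
  by apply: (eP t) => //; rewrite ?at_ ?av // ltr_distlC ?ve ?(lt_trans tc tv) //
    (le_lt_trans tc') ?ltrDl ?tc.
move=> v /andP[av vb]; apply: (Pv v); rewrite ?av //.
rewrite ltNge; apply/negP => ev.
have : S (sup S + e / 2).
  split; first by apply/andP; split; lra.
  move=> u /andP[au ue]; apply: Pv; first by apply/andP; split=> //; lra.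
  lra.
by move=> /(ub_le_sup supS.2); lra.
Qed.

Lemma continuous_epsP (V W : normedModType R) (f : V -> W) (x : V) :
  {for x, continuous f} <-> forall e : R, 0 < e -> exists2 d : R, 0 < d &
    forall y, `|y - x| < d -> `|f y - f x| < e.
Proof.
split=> [fc e e0|fe].
  have /cvgrPdist_lt /(_ e e0) /nbhs_ballP[d /= d0 dP] := fc.
  exists d => // y yx; rewrite -normrN opprB; apply: dP.
  by rewrite -ball_normE /= -normrN opprB.
apply/cvgrPdist_lt => e e0; have [d d0 dP] := fe e e0.
apply/nbhs_ballP; exists d => // y; rewrite -ball_normE /= -normrN opprB => yx.
by rewrite -normrN opprB; exact: dP.
Qed.

Lemma is_derive_epsP (V : normedModType R) (f : R -> V) (s : R) (v : V) :
  is_derive s 1 f v <-> forall e : R, 0 < e -> exists2 d, 0 < d &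
    forall h, `|h| < d -> `|f (s + h) - f s - h *: v| <= e * `|h|.
Proof.
split=> [fd e e0|fe].
  have /cvgrPdist_le /(_ e e0) : (fun h => h^-1 *: (f (h *: 1 + s) - f s)) @ 0^' --> v.
    by case: fd => fd <-; exact: fd.
  rewrite near_withinE => -/nbhs_ballP[d /= d0 dP]; exists d => // h hd.
  have [->|h0] := eqVneq h 0; first by rewrite addr0 scale0r subr0 subrr !normr0 mulr0.
  have := dP h; rewrite /ball /= sub0r normrN => /(_ hd h0).
  rewrite -(ler_pM2r (_ : 0 < `|h|)) ?normr_gt0 // => /(le_trans _); apply.
  rewrite mulrC -normrZ scalerBr scalerA mulfV // scale1r.
  by rewrite -opprB normrN [_ *: 1]mulr1 [h + s]addrC.
have c : (fun h => h^-1 *: (f (h *: 1 + s) - f s)) @ 0^' --> v.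
  apply/cvgrPdist_le => e e0; have [d d0 dP] := fe e e0.
  rewrite near_withinE; apply/nbhs_ballP; exists d => //= h; rewrite /ball /= sub0r normrN => hd h0.
  have := dP h hd; rewrite -(ler_pM2r (_ : 0 < `|h|^-1)) ?invr_gt0 ?normr_gt0 //.
  rewrite mulfK ?normr_eq0 // => /(le_trans _); apply.
  rewrite mulrC -normfV -normrZ !scalerBr scalerA mulVf // scale1r.
  by rewrite [leRHS]distrC [_ *: 1]mulr1 [h + s]addrC.
by split; [apply: cvgP c|apply: cvg_lim c].
Qed.

End segment_induction.

Section strict_differentiability.
Context {R : realType} {k : nat}.
Local Notation V := 'rV[R]_k.
Implicit Types (f : V -> V) (J : 'M[R]_k).

(** Strict differentiability, a condition at one point that already yields the inverse function
    theorem. [J] acts on row vectors from the right. *)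
Definition strict_diff f J (x : V) := forall e : R, 0 < e -> exists2 d, 0 < d &
  forall y z, `|y - x| < d -> `|z - x| < d -> `|f y - f z - (y - z) *m J| <= e * `|y - z|.

Lemma mulmx_bound l (A : 'M[R]_(k, l)) : exists2 N, 0 < N & forall v : V, `|v *m A| <= N * `|v|.
Proof.
exists (1 + \sum_i \sum_j `|A i j|).
  by rewrite ltr_pwDl // sumr_ge0 // => i _; rewrite sumr_ge0.
move=> v; apply: mx_norm_leP => [|i j].
  by rewrite mulr_ge0 // addr_ge0 // sumr_ge0 // => i _; rewrite sumr_ge0.
rewrite mxE ord1 (le_trans (ler_norm_sum _ _ _)) // mulrDl mul1r ler_wpDl // mulr_suml.
apply: ler_sum => a _; rewrite normrM mulrC ler_pM ?mx_norm_coord //.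
by rewrite (bigD1 j) //= lerDl sumr_ge0.
Qed.

Lemma strict_diff_continuous f J x : strict_diff f J x -> {for x, continuous f}.
Proof.
move=> fJ; have [N N0 NP] := mulmx_bound J; have [d d0 dP] := fJ 1 ltr01.
apply/continuous_epsP => e e0.
exists (Num.min d (e / (1 + N))) => /=; first by rewrite lt_min d0 divr_gt0 // addr_gt0.
move=> y; rewrite -normrN opprB lt_min -[X in _ -> X < _]normrN opprB => /andP[yd ye].
have := dP x y; rewrite subrr normr0 -[`|y - x|]normrN opprB => /(_ d0 yd).
rewrite mul1r => H; have {H} : `|f x - f y| <= (1 + N) * `|x - y|.
  rewrite mulrDl mul1r; have := ler_normD (f x - f y - (x - y) *m J) ((x - y) *m J).
  by rewrite subrK => /le_trans; apply; rewrite lerD.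
by move=> /le_lt_trans; apply; rewrite -ltr_pdivlMl ?addr_gt0 // mulrC.
Qed.

Lemma strict_diff_curve f J (x : R -> V) (s : R) v :
  strict_diff f J (x s) -> is_derive s 1 x v -> is_derive s 1 (fun t => f (x t)) (v *m J).
Proof.
move=> fJ xd; apply/is_derive_epsP => e e0; have [N N0 NP] := mulmx_bound J.
pose c := `|v| + 1; have c0 : 0 < c by rewrite ltr_wpDl.
have [d d0 dP] := fJ (e / 2 / c) (divr_gt0 (divr_gt0 e0 (ltr0Sn R 1)) c0).
have xd' := proj1 (is_derive_epsP _ _ _) xd.
have [d1 d10 d1P] := xd' 1 ltr01.
have [d2 d20 d2P] := xd' (e / 2 / N) (divr_gt0 (divr_gt0 e0 (ltr0Sn R 1)) N0).
exists (Num.min (Num.min d1 d2) (d / c)); first by rewrite !lt_min d10 d20 divr_gt0.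
move=> h; rewrite !lt_min => /andP[/andP[h1 h2] h3].
have xh : `|x (s + h) - x s| <= c * `|h|.
  have := ler_normD (x (s + h) - x s - h *: v) (h *: v).
  rewrite subrK => /le_trans; apply.
  by have := d1P h h1; rewrite normrZ /c; lra.
have xhd : `|x (s + h) - x s| < d.
  by apply: le_lt_trans xh _; rewrite mulrC -ltr_pdivlMr.
have := dP _ (x s) xhd; rewrite subrr normr0 => /(_ d0) H1.
have := ler_normD (f (x (s + h)) - f (x s) - (x (s + h) - x s) *m J) ((x (s + h) - x s - h *: v) *m J).
rewrite [(_ - h *: v) *m J]mulmxBl -scalemxAl addrA subrK => /le_trans; apply.
have H2 := d2P h h2; have H3 := NP (x (s + h) - x s - h *: v).
rewrite mulmxBl -scalemxAl in H3.
have H4 : e / 2 / c * `|x (s + h) - x s| <= e / 2 * `|h|.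
  by rewrite -mulrA ler_wpM2l ?divr_ge0 ?(ltW e0) // mulrC ler_pdivrMr // mulrC.
have H5 : N * `|x (s + h) - x s - h *: v| <= e / 2 * `|h|.
  by rewrite mulrC -ler_pdivlMr // mulrAC.
by lra.
Qed.

(** If N bounds the inverse of J and the error is at most |y - z| / (2N), then |y - z| <= N |f y - f
    z| + |y - z| / 2. *)
Lemma strict_diff_lower f J x : J \in unitmx -> strict_diff f J x ->
  exists2 N, 0 < N & exists2 d, 0 < d & forall y z, `|y - x| < d -> `|z - x| < d ->
    `|f y - f z - (y - z) *m J| <= (2 * N)^-1 * `|y - z| /\
    [/\ `|y - z| <= 2 * N * `|f y - f z| & forall v : V, `|v *m invmx J| <= N * `|v|].
Proof.
move=> Ju fJ; have [N N0 NP] := mulmx_bound (invmx J); exists N => //.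
have e0 : 0 < (2 * N)^-1 by rewrite invr_gt0 mulr_gt0.
have [d d0 dP] := fJ _ e0; exists d => // y z yd zd; have H := dP y z yd zd.
split=> //; split=> //.
have H1 := NP ((y - z) *m J); rewrite mulmxK // in H1.
have H2 : `|(y - z) *m J| <= `|f y - f z| + (2 * N)^-1 * `|y - z|.
  have := ler_normB (f y - f z) (f y - f z - (y - z) *m J).
  by rewrite opprB addrCA subrr addr0 => /le_trans; apply; rewrite lerD.
have H3 : N * `|(y - z) *m J| <= N * (`|f y - f z| + (2 * N)^-1 * `|y - z|) by rewrite ler_wpM2l // ltW.
have H4 : N * ((2 * N)^-1 * `|y - z|) = `|y - z| / 2 by field; rewrite lt0r_neq0.
by move: H3; rewrite mulrDr H4; lra.
Qed.

Lemma strict_diff_lift f J (x : R -> V) (s : R) v : J \in unitmx -> strict_diff f J (x s) ->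
  {for s, continuous x} -> is_derive s 1 (fun t => f (x t)) v -> is_derive s 1 x (v *m invmx J).
Proof.
move=> Ju fJ xc fxd; apply/is_derive_epsP => e e0.
have [N N0 [d d0 dP]] := strict_diff_lower Ju fJ.
pose c := `|v| + 1; have c0 : 0 < c by rewrite ltr_wpDl.
have Nc0 : 0 < 4 * N * N * c by rewrite !mulr_gt0.
have [d' d'0 d'P] := fJ (e / (4 * N * N * c)) (divr_gt0 e0 Nc0).
have fxd' := proj1 (is_derive_epsP _ _ _) fxd.
have [d1 d10 d1P] := fxd' 1 ltr01.
have [d2 d20 d2P] := fxd' (e / (2 * N)) (divr_gt0 e0 (mulr_gt0 (ltr0Sn R 1) N0)).
have dd0 : 0 < Num.min d d' by rewrite lt_min d0.
have [d3 d30 d3P] := proj1 (continuous_epsP _ _) xc _ dd0.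
exists (Num.min (Num.min d1 d2) d3); first by rewrite !lt_min d10 d20.
move=> h; rewrite !lt_min => /andP[/andP[h1 h2] h3].
have : `|(s + h) - s| < d3 by rewrite addrAC subrr add0r.
move=> /d3P; rewrite lt_min => /andP[xd xd'].
have ss a : 0 < a -> `|x s - x s| < a by rewrite subrr normr0.
have [_ [H1 H2]] := dP _ _ xd (ss d d0).
have H3 := d'P _ _ xd' (ss d' d'0).
have H4 : `|f (x (s + h)) - f (x s)| <= c * `|h|.
  have := ler_normD (f (x (s + h)) - f (x s) - h *: v) (h *: v).
  rewrite subrK => /le_trans; apply.
  by have := d1P h h1; rewrite normrZ /c; lra.
have H5 := d2P h h2.
set D := x (s + h) - x s in H1 H3 *; set F := f (x (s + h)) - f (x s) in H1 H3 H4 H5.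
have -> : D - h *: (v *m invmx J) = (F - h *: v) *m invmx J - (F - D *m J) *m invmx J.
  rewrite [(F - h *: v) *m _]mulmxBl [(F - D *m J) *m _]mulmxBl mulmxK // -scalemxAl.
  by rewrite opprB [RHS]addrC addrA subrK.
apply: le_trans (ler_normB _ _) _.
have H6 := H2 (F - h *: v); have H7 := H2 (F - D *m J).
have H8 : N * `|F - h *: v| <= e / 2 * `|h|.
  rewrite (le_trans (ler_wpM2l (ltW N0) H5)) // le_eqVlt; apply/orP; left; apply/eqP.
  by field; rewrite lt0r_neq0.
have H9 : N * `|F - D *m J| <= e / 2 * `|h|.
  have E0 : 0 <= e / (4 * N * N * c) by rewrite divr_ge0 // ltW.
  rewrite (le_trans (ler_wpM2l (ltW N0) (le_trans H3 (ler_wpM2l E0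
    (le_trans H1 (ler_wpM2l (ltW (mulr_gt0 (ltr0Sn R 1) N0)) H4)))))) //.
  rewrite le_eqVlt; apply/orP; left; apply/eqP.
  by field; rewrite !lt0r_neq0.
by lra.
Qed.

End strict_differentiability.

(* The library lacks the join of the complete and the normed structure of matrices. *)
HB.instance Definition _ (R : realType) k := Complete.on 'rV[R]_k.

Section inverse_function.
Context {R : realType} {k : nat}.
Local Notation V := 'rV[R]_k.
Variables (f : V -> V) (J : 'M[R]_k) (a : V).
Hypothesis Ju : J \in unitmx.
Hypothesis fJ : strict_diff f J a.

(** Banach's fixed point theorem for the Newton map with frozen derivative; the inverse is
    continuous by the lower Lipschitz bound for [f]. *)
Lemma local_inverse (d0 : R) : 0 < d0 -> exists2 d : R, 0 < d <= d0 & exists2 b : R, 0 < b &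
  (forall y z, `|y - a| < d -> `|z - a| < d -> f y = f z -> y = z) /\
  exists2 S : V -> V, forall z, `|z - f a| < b -> `|S z - a| < d /\ f (S z) = z &
    forall z, `|z - f a| < b -> {for z, continuous S}.
Proof.
move=> d00; have [N N0 [d1 d10 dP]] := strict_diff_lower Ju fJ.
pose d := Num.min d0 d1; have d_gt0 : 0 < d by rewrite lt_min d00.
have dd1 : d <= d1 by rewrite ge_min lexx orbT.
have dlow y z : `|y - a| < d -> `|z - a| < d -> `|y - z| <= 2 * N * `|f y - f z|.
  by move=> yd zd; have [_ []] := dP _ _ (lt_le_trans yd dd1) (lt_le_trans zd dd1).
exists d; first by rewrite d_gt0 ge_min lexx.
exists (d / (4 * N)); first by rewrite divr_gt0 // mulr_gt0.
split=> [y z yd zd fyz|].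
  by have := dlow y z yd zd; rewrite fyz subrr normr0 mulr0 normr_le0 subr_eq0 => /eqP.
have ex z : exists x : V, `|z - f a| < d / (4 * N) -> `|x - a| < d /\ f x = z.
  have [zb|] := boolP (`|z - f a| < d / (4 * N)); last by exists 0.
  pose U : set V := [set x | `|x - a| <= d / 2].
  have Ud x : U x -> `|x - a| < d1 by rewrite /U /= => xU; apply: lt_le_trans dd1; lra.
  (* The fixed points solve f x = z. This map contracts by 1/2 and moves the centre by at most d /
     4, hence preserves the closed ball of radius d / 2. *)
  pose T x := x + (z - f x) *m invmx J.
  have Tsub x y : U x -> U y -> `|T x - T y| <= 2^-1 * `|x - y|.
    move=> /Ud xU /Ud yU; have [H1 [_ H2]] := dP x y xU yU.
    have -> : T x - T y = - ((f x - f y - (x - y) *m J) *m invmx J).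
      rewrite [(f x - f y - _) *m _]mulmxBl mulmxK // /T.
      rewrite opprB opprD addrACA -mulmxBl.
      have -> : z - f x - (z - f y) = - (f x - f y) by rewrite !opprB addrC addrA subrK.
      by rewrite mulNmx.
    rewrite normrN (le_trans (H2 _)) // (le_trans (ler_wpM2l (ltW N0) H1)) //.
    rewrite le_eqVlt; apply/orP; left; apply/eqP.
    by field; rewrite lt0r_neq0.
  have aU : U a by rewrite /U /= subrr normr0 divr_ge0 // ltW.
  have TU : {homo T : x / U x}.
    move=> x xU; have H := Tsub x a xU aU; rewrite /U /= in xU *.
    have [_ [_ H2]] := dP a a (Ud a aU) (Ud a aU).
    have H3 : `|T a - a| <= d / 4.
      rewrite /T addrAC subrr add0r (le_trans (H2 _)) // mulrC -ler_pdivlMr //.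
      by apply: ltW; apply: lt_le_trans zb _; rewrite le_eqVlt; apply/orP; left; apply/eqP;
        field; rewrite lt0r_neq0.
    have := ler_normD (T x - T a) (T a - a); rewrite addrA subrK => /le_trans; apply.
    by lra.
  have [|||x xU xE] := @banach_fixed_point R V U (mkfun_fun TU).
  - exists 2^-1%:nng; split; first by rewrite /= invf_lt1 // ltr1n.
    by move=> [x y] [xU yU]; exact: Tsub.
  - rewrite (_ : U = (fun x => `|x - a|) @^-1` [set r | r <= d / 2]) //.
    apply: closed_comp; last exact: closed_le.
    move=> x _; apply: (@continuous_comp _ _ _ (fun x => x - a) (fun x => `|x|)).
      apply/continuous_epsP => e e0; exists e => // y.
      by have -> : y - a - (x - a) = y - x by rewrite opprB addrA subrK.
    exact: norm_continuous.
  - by exists a.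
  exists x => _; split; first by rewrite /U /= in xU; lra.
  move: xE; rewrite /= /mkfun /T => /eqP; rewrite -subr_eq0 opprD addrA subrr add0r oppr_eq0 => /eqP xE.
  have : (z - f x) *m invmx J *m J = 0 by rewrite xE mul0mx.
  by rewrite mulmxKV // => /eqP; rewrite subr_eq0 => /eqP.
have [S SP] := choice ex; exists S => // z zb.
apply/continuous_epsP => e e0.
pose g := d / (4 * N) - `|z - f a|.
exists (Num.min g (e / (4 * N))); first by rewrite lt_min /g subr_gt0 zb divr_gt0 // mulr_gt0.
move=> y; rewrite lt_min /g => /andP[y1 y2].
have yb : `|y - f a| < d / (4 * N).
  by have := ler_normD (y - z) (z - f a); rewrite addrA subrK; lra.
have [Sy fSy] := SP y yb; have [Sz fSz] := SP z zb.
apply: le_lt_trans (dlow _ _ Sy Sz) _; rewrite fSy fSz.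
rewrite mulrC -ltr_pdivlMr ?mulr_gt0 //; apply: lt_le_trans y2 _.
by rewrite ler_pM2l // lef_pV2 ?posrE ?mulr_gt0 // ler_pM2r // ler_nat.
Qed.

End inverse_function.

Section path_lifting.
Context {R : realType} {k : nat}.
Local Notation V := 'rV[R]_k.
Variables (f : V -> V) (J : V -> 'M[R]_k) (B : set V).
Hypothesis openB : open B.
Hypothesis fJ : forall x, B x -> strict_diff f (J x) x.
Hypothesis Ju : forall x, B x -> J x \in unitmx.

Lemma segment_const (P : R -> Prop) (a b : R) : a <= b ->
  (forall t, a <= t <= b -> exists2 e, 0 < e & forall u v, a <= u <= b -> a <= v <= b ->
     `|t - u| < e -> `|t - v| < e -> P u -> P v) ->
  forall s t, a <= s <= b -> a <= t <= b -> P s -> P t.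
Proof.
move=> ab loc.
have H t : a <= t <= b -> (P a <-> P t).
  apply: (segment_ind (P := fun t => P a <-> P t)) => // {}t tab.
  have [e e0 eP] := loc t tab; exists e => // u v uab vab ut vt -> .
  by split; apply: eP.
by move=> s t sab tab /(H s sab)/(H t tab).
Qed.

Lemma open_ball_sub x : B x -> exists2 d : R, 0 < d & forall y, `|y - x| < d -> B y.
Proof.
move=> Bx; have /nbhs_ballP[d /= d0 dP] : nbhs x B by exact: open_nbhs_nbhs.
by exists d => // y yx; apply: dP; rewrite -ball_normE /= distrC.
Qed.

Lemma local_section x : B x -> exists2 d : R, 0 < d & exists2 b : R, 0 < b &
  exists2 S : V -> V, [/\ forall y, `|y - x| < d -> B y,
    forall y, `|y - x| < d -> `|f y - f x| < b -> S (f y) = y &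
    forall z, `|z - f x| < b -> `|S z - x| < d /\ f (S z) = z] &
    forall z, `|z - f x| < b -> {for z, continuous S}.
Proof.
move=> Bx; have [d0 d00 d0P] := open_ball_sub Bx.
have [d /andP[dgt0 dd0] [b b0 [inj [S SP Sc]]]] := local_inverse (Ju Bx) (fJ Bx) d00.
exists d => //; exists b => //; exists S => //; split=> // [y yx|y yx yb].
  exact: d0P (lt_le_trans yx dd0).
by have [S1 S2] := SP _ yb; apply: inj.
Qed.

Lemma continuous_curve (x : R -> V) (t : R) : {for t, continuous x} -> B (x t) ->
  {for t, continuous (fun t => f (x t))}.
Proof.
move=> xc Bx; apply: (@continuous_comp _ _ _ x f); first exact: xc.
exact: strict_diff_continuous (fJ Bx).
Qed.

Definition lift_on (a b : R) (x : R -> V) :=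
  forall t, a <= t <= b -> {for t, continuous x} /\ B (x t).

Lemma lift_unique (a b s : R) (x y : R -> V) : a <= s <= b -> lift_on a b x -> lift_on a b y ->
  (forall t, a <= t <= b -> f (x t) = f (y t)) -> x s = y s -> forall t, a <= t <= b -> x t = y t.
Proof.
move=> sab xl yl fxy xys t tab.
have ab : a <= b by case/andP: tab => at_ tb; exact: le_trans at_ tb.
apply: (segment_const (P := fun t => x t = y t) ab _ sab tab xys) => {t tab xys s sab} t tab.
have [xc Bx] := xl t tab; have [yc By] := yl t tab.
have [xy|xy] := eqVneq (x t) (y t).
  have [d d0 [b0 b00 [S [_ SP _] _]]] := local_section Bx.
  have fc := continuous_curve xc Bx.
  have [e1 e10 e1P] := proj1 (continuous_epsP _ _) xc d d0.
  have [e2 e20 e2P] := proj1 (continuous_epsP _ _) yc d d0.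
  have [e3 e30 e3P] := proj1 (continuous_epsP _ _) fc b0 b00.
  exists (Num.min (Num.min e1 e2) e3); first by rewrite !lt_min e10 e20.
  move=> u v uab vab _; rewrite !lt_min distrC => /andP[/andP[v1 v2] v3] _.
  have Sy : S (f (y v)) = y v.
    apply: SP; first by rewrite xy; exact: e2P.
    by rewrite -fxy //; exact: e3P.
  have Sx : S (f (x v)) = x v by apply: SP; [exact: e1P|exact: e3P].
  by rewrite -Sx fxy.
pose e := `|x t - y t| / 2; have e0 : 0 < e by rewrite divr_gt0 // normr_gt0 subr_eq0.
have [e1 e10 e1P] := proj1 (continuous_epsP _ _) xc e e0.
have [e2 e20 e2P] := proj1 (continuous_epsP _ _) yc e e0.
exists (Num.min e1 e2); first by rewrite !lt_min e10 e20.
move=> u v uab vab; rewrite !lt_min distrC => /andP[u1 u2] _ xyu.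
have := e1P u u1; have := e2P u u2; rewrite xyu => H1 H2; exfalso.
have := ler_normD (x t - y u) (y u - y t); rewrite addrA subrK.
by rewrite distrC in H2; rewrite /e in H1 H2; lra.
Qed.

(** Continuous dependence of a lift on its path and its starting point, propagated along the
    segment: near each time both lifts are given by the same local section. *)
Lemma lift_close (a b : R) (x : R -> V) : a <= b -> lift_on a b x ->
  forall t, a <= t <= b -> forall e : R, 0 < e -> exists2 d : R, 0 < d &
    forall y, lift_on a b y -> `|y a - x a| < d ->
      (forall t, a <= t <= b -> `|f (y t) - f (x t)| < d) -> `|y t - x t| < e.
Proof.
move=> ab xl; apply: segment_ind => // [e e0|t tab]; first by exists e.
have [xc Bx] := xl t tab.
have [d d0 [b0 b00 [S [SB SP Sb] Sc]]] := local_section Bx.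
have fc := continuous_curve xc Bx.
have d20 : 0 < d / 2 by rewrite divr_gt0.
have b20 : 0 < b0 / 2 by rewrite divr_gt0.
have [e1 e10 e1P] := proj1 (continuous_epsP _ _) xc _ d20.
have [e2 e20 e2P] := proj1 (continuous_epsP _ _) fc _ b20.
exists (Num.min e1 e2); first by rewrite !lt_min e10 e20.
move=> u v uab vab; rewrite ![`|t - _|]distrC !lt_min => /andP[u1 u2] /andP[v1 v2] Pu e e0.
have [d1 d10 d1P] := Pu _ d20.
have fv := e2P v v2; have fu := e2P u u2; have xv := e1P v v1; have xu := e1P u u1.
have fvb : `|f (x v) - f (x t)| < b0 by lra.
have [d3 d30 d3P] := proj1 (continuous_epsP _ _) (Sc _ fvb) e e0.
exists (Num.min (Num.min d1 (b0 / 2)) d3); first by rewrite !lt_min d10 b20.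
move=> y yl y0 fyx.
have {}fyx s : a <= s <= b -> [/\ `|f (y s) - f (x s)| < d1, `|f (y s) - f (x s)| < b0 / 2 &
    `|f (y s) - f (x s)| < d3].
  by move=> /fyx; rewrite !lt_min => /andP[/andP[]].
have yu : `|y u - x u| < d / 2.
  apply: d1P => //; first by move: y0; rewrite !lt_min => /andP[/andP[]].
  by move=> s /fyx[].
have near_fy s : `|s - t| < e2 -> a <= s <= b -> `|f (y s) - f (x t)| < b0.
  move=> st sab; have := e2P s st; have [_ + _] := fyx s sab.
  by have := ler_normD (f (y s) - f (x s)) (f (x s) - f (x t)); rewrite addrA subrK; lra.
have ySu : S (f (y u)) = y u.
  apply: SP; last exact: near_fy.
  by have := ler_normD (y u - x u) (x u - x t); rewrite addrA subrK; lra.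
(* That the second lift agrees with the section at [u] is carried over to [v] by uniqueness of lifts
   between the two times, whichever comes first. *)
pose c0 := Num.min u v; pose c1 := Num.max u v.
have cP s : c0 <= s <= c1 -> `|s - t| < e2 /\ a <= s <= b.
  move: uab vab u2 v2; rewrite /c0 /c1 !ltr_distl => /andP[au ub] /andP[av vb] /andP[u21 u22] /andP[v21 v22].
  case: (leP u v) => uv /andP[s1 s2].
    by rewrite (lt_le_trans u21 s1) (le_lt_trans s2 v22) (le_trans au s1) (le_trans s2 vb).
  by rewrite (lt_le_trans v21 s1) (le_lt_trans s2 u22) (le_trans av s1) (le_trans s2 ub).
have cu : c0 <= u <= c1 by rewrite /c0 /c1 ge_min le_max !lexx.
have cv : c0 <= v <= c1 by rewrite /c0 /c1 ge_min le_max !lexx !orbT.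
have ySv : S (f (y v)) = y v.
  apply: (@lift_unique c0 c1 u (fun s => S (f (y s))) y cu) ySu _ cv => s /cP[s1 s2].
  - have sb := near_fy s s1 s2; have [yc By] := yl s s2; split.
      apply: (@continuous_comp _ _ _ (fun s => f (y s)) S); first exact: continuous_curve.
      exact: Sc.
    by apply: SB; case: (Sb _ sb).
  - exact: yl.
  - by case: (Sb _ (near_fy s s1 s2)).
rewrite -ySv -[x v](SP (x v)) //; last by lra.
by apply: d3P; case: (fyx v vab).
Qed.

Section straight_path.
Variables (x0 w : V).
Hypothesis Bx0 : B x0.

(** The ray rests at its origin for t <= 0, so that lifts live on open half-lines and are continuous
    in the two-sided sense at 0. *)
Definition ray_at (t : R) := f x0 + Num.max 0 t *: w.

Definition ray_lift (c : R) (x : R -> V) :=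
  (forall t, t < c -> [/\ {for t, continuous x}, B (x t) & f (x t) = ray_at t]) /\
  forall t, t <= 0 -> x t = x0.

Definition left_lim (x : R -> V) (c : R) (l : V) := forall e : R, 0 < e ->
  exists2 d : R, 0 < d & forall t, c - d < t < c -> `|x t - l| < e.

Lemma ray_at_continuous : continuous ray_at.
Proof.
move=> t; apply: cvgD; first exact: cvg_cst.
apply: cvgZr_tmp; apply: (@continuous_max _ _ (fun=> 0) id t); first exact: cst_continuous.
exact: cvg_id.
Qed.

Lemma ray_at0 t : t <= 0 -> ray_at t = f x0.
Proof. by move=> t0; rewrite /ray_at (max_idPl t0) scale0r addr0. Qed.

Lemma ray_lift_unique c c' x y t : ray_lift c x -> ray_lift c' y -> t < c -> t < c' -> x t = y t.
Proof.
move=> [xP x0E] [yP y0E] tc tc'.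
have [t0|t0] := leP t 0; first by rewrite x0E // y0E.
apply: (@lift_unique 0 t 0 x y); [by rewrite lexx ltW| | | | |by rewrite lexx ltW].
- by move=> s /andP[s0 st]; have [] := xP s (le_lt_trans st tc).
- by move=> s /andP[s0 st]; have [] := yP s (le_lt_trans st tc').
- move=> s /andP[s0 st]; have [_ _ ->] := xP s (le_lt_trans st tc).
  by have [_ _ ->] := yP s (le_lt_trans st tc').
by rewrite x0E // y0E.
Qed.

Lemma ray_lift_extend c x l : 0 <= c -> ray_lift c x -> B l -> left_lim x c l ->
  exists c' y, c < c' /\ ray_lift c' y.
Proof.
move=> c0 [xP x0E] Bl xl.
have [d d0 [b b0 [S [SB SP Sb] Sc]]] := local_section Bl.
have fl : f l = ray_at c.
  apply/eqP; rewrite -subr_eq0 -normr_le0; apply/ler_addgt0Pl => e e0; rewrite addr0.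
  have e20 : 0 < e / 2 by rewrite divr_gt0.
  have [d1 d10 d1P] := proj1 (continuous_epsP _ _) (strict_diff_continuous (fJ Bl)) _ e20.
  have [d2 d20 d2P] := xl _ d10.
  have [d3 d30 d3P] := proj1 (continuous_epsP _ _) (@ray_at_continuous c) _ e20.
  pose t := c - Num.min d2 d3 / 2.
  have m0 : 0 < Num.min d2 d3 by rewrite lt_min d20.
  have m2 : Num.min d2 d3 <= d2 by rewrite ge_min lexx.
  have m3 : Num.min d2 d3 <= d3 by rewrite ge_min lexx orbT.
  have tc : t < c by rewrite /t; lra.
  have := d1P _ (d2P t _); rewrite tc andbT => /(_ ltac:(rewrite /t; lra)).
  have [_ _ ->] := xP t tc.
  have := d3P t; have -> : `|t - c| = Num.min d2 d3 / 2.
    by rewrite /t addrAC subrr add0r normrN ger0_norm // divr_ge0 // ltW.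
  move=> /(_ ltac:(lra)).
  by have := ler_normD (f l - ray_at t) (ray_at t - ray_at c); rewrite addrA subrK [`|f l - _|]distrC; lra.
have [e1 e10 e1P] := xl _ d0.
have [e2 e20 e2P] := proj1 (continuous_epsP _ _) (@ray_at_continuous c) _ b0.
rewrite -fl in e2P.
pose e := Num.min e1 e2; have e0 : 0 < e by rewrite lt_min e10.
have ee1 : e <= e1 by rewrite ge_min lexx.
have ee2 : e <= e2 by rewrite ge_min lexx orbT.
have zb t : c - e < t < c + e -> `|ray_at t - f l| < b.
  by move=> /andP[t1 t2]; apply: e2P; rewrite ltr_distl; apply/andP; split; lra.
have Sx t : c - e < t < c -> S (ray_at t) = x t.
  move=> /andP[t1 t2]; have [xc Bx fx] := xP t t2; rewrite -fx; apply: SP.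
    by apply: e1P; apply/andP; split; lra.
  by rewrite fx; apply: zb; apply/andP; split; lra.
have Sl : S (f l) = l by apply: SP; rewrite subrr normr0.
pose y t := if t < c then x t else S (ray_at t).
have yS t : c - e < t -> y t = S (ray_at t).
  by move=> te; rewrite /y; case: ifP => // tc; rewrite Sx // te.
exists (c + e), y; split; first by lra.
split=> t => [te|t0]; last first.
  rewrite /y; case: ltP => [tc|ct]; first exact: x0E.
  have E : t = 0 by apply/le_anti; rewrite t0 (le_trans c0 ct).
  have cE : c = 0 by apply/le_anti; rewrite c0 -E ct.
  rewrite E -cE -fl Sl; apply/eqP; rewrite -subr_eq0 -normr_le0; apply/ler_addgt0Pl => e' e'0.
  rewrite addr0; have [d' d'0 d'P] := xl _ e'0.
  have := d'P (c - d' / 2); rewrite x0E; last by rewrite cE; lra.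
  by rewrite distrC => H; apply: ltW; apply: H; apply/andP; split; lra.
have [tc|ct] := leP t (c - e).
  have [xc Bx fx] := xP t ltac:(lra); have tc' : t < c by lra.
  rewrite /y tc'; split; [|exact: Bx|exact: fx]; apply: (continuous_germ _ xc); near=> u.
  by rewrite (_ : u < c) //; near: u; exact: lt_nbhsl.
have tz : `|ray_at t - f l| < b by apply: zb; rewrite ct.
have [S1 S2] := Sb _ tz.
rewrite (yS t ct); split; [|exact: SB|exact: S2].
apply: (@continuous_germ _ _ (fun t => S (ray_at t))).
  by near=> u; rewrite yS //; near: u; exact: lt_nbhsr.
apply: (@continuous_comp _ _ _ ray_at S); first exact: ray_at_continuous.
exact: Sc.
Unshelve. all: by end_near. Qed.

(** Lifts on different half-lines agree where both are defined and glue to a maximal one. If it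
    stops at c <= 1, it has no left limit in [B], for otherwise a local section would continue
    it. *)
Lemma ray_lift_or_escape : (exists c x, 1 < c /\ ray_lift c x) \/
  exists c x, [/\ 0 < c <= 1, ray_lift c x & forall l, B l -> ~ left_lim x c l].
Proof.
have [|nfull] := pselect (exists c x, 1 < c /\ ray_lift c x); first by left.
right.
pose A : set R := [set c | 0 <= c /\ exists x, ray_lift c x].
have Aub c : A c -> c <= 1.
  by move=> [_ [x xc]]; rewrite leNgt; apply/negP => c1; apply: nfull; exists c, x.
have A0 : A 0.
  split; [exact: lexx|exists (fun=> x0); split=> [t t0|t _]; last by []].
  split; [exact: cst_continuous|by []|by rewrite ray_at0 // ltW].
have supA : has_sup A by split; [exists 0|exists 1].
have lifts_ex c : exists x, A c -> ray_lift c x.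
  by have [[_ [x xc]]|nA] := pselect (A c); [exists x|exists (fun=> 0)].
have [X XP] := choice lifts_ex.
have A_near t : t < sup A -> exists2 c, A c & t < c.
  move=> ts; have d0 : 0 < sup A - t by rewrite subr_gt0.
  by have [c Ac tc] := sup_adherent d0 supA; exists c => //; move: tc; rewrite opprB addrC subrK.
have ex t : exists c, t < sup A -> A c /\ t < c.
  have [ts|] := boolP (t < sup A); last by exists 0.
  by have [c Ac tc] := A_near t ts; exists c.
have [C CP] := choice ex.
pose x t := X (C t) t.
have xX c t : A c -> t < c -> t < sup A -> x t = X c t.
  move=> Ac tc ts; have [ACt tCt] := CP t ts.
  exact: (ray_lift_unique (XP _ ACt) (XP _ Ac)).
have sup0 : 0 <= sup A by exact: ub_le_sup supA.2 _ A0.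
have xl : ray_lift (sup A) (fun t => if t <= 0 then x0 else x t).
  split=> [t ts|t ->]; last by [].
  have [c Ac tc] := A_near t ts; have [Xc X0] := XP c Ac.
  have [Xct BX fX] := Xc t tc.
  have E u : u < c -> u < sup A -> (if u <= 0 then x0 else x u) = X c u.
    by move=> uc us; case: ifP => [u0|_]; [rewrite X0|exact: xX].
  rewrite (E t tc ts); split; [|exact: BX|exact: fX]; apply: (continuous_germ _ Xct); near=> u.
  by rewrite E //; near: u; exact: lt_nbhsl.
have step l : B l -> ~ left_lim (fun t => if t <= 0 then x0 else x t) (sup A) l.
  move=> Bl /(ray_lift_extend sup0 xl Bl) [c' [y [sc' yl]]].
  have : A c' by split; [exact: le_trans sup0 (ltW sc')|exists y].
  by move=> /(ub_le_sup supA.2); rewrite leNgt sc'.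
exists (sup A), (fun t => if t <= 0 then x0 else x t); split=> //.
apply/andP; split; last by apply: ge_sup => //; exists 0.
(* A maximal lift stopping at 0 would be constant and have the left limit [x0] in [B]. *)
rewrite lt_neqAle sup0 andbT; apply/eqP => E.
apply: (step x0) => // e e0; exists 1 => // t; rewrite -E => /andP[_ t0].
by rewrite (ltW t0) subrr normr0.
Unshelve. all: by end_near. Qed.

End straight_path.
End path_lifting.

(** * Boxes of an extension *)

Section escape_estimates.
Context {R : realType}.

Lemma mean_value_le (f df : R -> R) (a b K : R) : a <= b ->
  (forall t, a <= t <= b -> {for t, continuous f}) ->
  (forall t : R, a < t < b -> is_derive t 1 f (df t)) ->
  (forall t : R, a < t < b -> `|df t| <= K) -> `|f b - f a| <= K * (b - a).
Proof.
rewrite le_eqVlt => /orP[/eqP -> _ _ _|ab fc fd dfK]; first by rewrite !subrr normr0 mulr0.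
have fd' t : t \in `]a, b[ -> is_derive t 1 f (df t) by rewrite in_itv /=; exact: fd.
have fc' : {within `[a, b], continuous f}.
  by apply: continuous_in_subspaceT => t /set_mem; rewrite /= in_itv /= => tab; exact: fc.
have [c] := MVT ab fd' fc'; rewrite in_itv /= => cab ->; have ba : 0 <= b - a by rewrite subr_ge0 ltW.
rewrite normrM (ger0_norm ba).
by apply: ler_wpM2r; [rewrite subr_ge0 ltW|exact: dfK].
Qed.

Lemma left_limP (V : normedModType R) (f : R -> V) (c : R) (l : V) :
  f @ at_left c --> l <-> forall e : R, 0 < e ->
    exists2 d : R, 0 < d & forall t, c - d < t < c -> `|f t - l| < e.
Proof.
split=> [fl e e0|fl].
  have /cvgrPdist_lt /(_ e e0) := fl; rewrite near_withinE => /nbhs_ballP[d /= d0 dP].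
  exists d => // t /andP[t1 t2]; rewrite distrC; apply: dP => //.
  by rewrite -ball_normE /= ger0_norm; lra.
apply/cvgrPdist_lt => e e0; have [d d0 dP] := fl e e0.
rewrite near_withinE; apply/nbhs_ballP; exists d => // t.
rewrite -ball_normE /= => ct t1; rewrite distrC; apply: dP; rewrite t1 andbT.
by move: ct; rewrite ltr_distl; lra.
Qed.

Lemma monotone_left_lim (g : R -> R) (c0 c H : R) : c0 < c ->
  (forall s t, c0 < s -> s <= t -> t < c -> g s <= g t) ->
  (forall t, c0 < t < c -> g t <= H) -> exists l : R, g @ at_left c --> l.
Proof.
move=> c0c mono bd; pose A := [set g t | t in `]c0, c[%classic].
have mid : c0 < (c0 + c) / 2 < c by apply/andP; split; lra.
have Ub : has_ubound A by exists H => _ [t + <-]; rewrite /= in_itv /=; exact: bd.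
have supA : has_sup A by split=> //; exists (g ((c0 + c) / 2)), ((c0 + c) / 2).
exists (sup A); apply/left_limP => e e0.
have [_ [s + <-] ge] := sup_adherent e0 supA; rewrite /= in_itv /= => /andP[s1 s2].
exists (c - s); first by rewrite subr_gt0.
move=> t /andP[t1 t2]; have st : s <= t by lra.
have gA : g t <= sup A.
  by apply: ub_le_sup Ub _ _; exists t => //=; rewrite in_itv /= t2 andbT; lra.
rewrite ler0_norm ?subr_le0 //; have := mono s t s1 st t2; lra.
Qed.

(** Both K h and f + K h are nondecreasing and bounded, so f is a difference of two functions with
    left limits. *)
Lemma dominated_left_lim (f df h dh : R -> R) (c0 c K H : R) : c0 < c -> 0 <= K ->
  (forall t : R, c0 < t < c -> is_derive t 1 f (df t)) ->
  (forall t : R, c0 < t < c -> is_derive t 1 h (dh t)) ->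
  (forall t : R, c0 < t < c -> 0 <= dh t) ->
  (forall t : R, c0 < t < c -> `|df t| <= K * dh t) ->
  (forall t, c0 < t < c -> h t <= H) ->
  (exists l : R, f @ at_left c --> l) /\
  forall c1, c0 < c1 < c -> exists X, 0 <= X /\ forall t, c1 <= t < c -> `|f t| <= X.
Proof.
move=> c0c K0 fd hd dh0 fh hH.
have inI s t u : c0 < s -> t < c -> s <= u <= t -> c0 < u < c.
  by move=> s1 t2 /andP[su ut]; rewrite (lt_le_trans s1 su) (le_lt_trans ut t2).
have hmono s t : c0 < s -> s <= t -> t < c -> h s <= h t.
  move=> s1 st t2; apply: (derive_ge0_nondecreasing st) => u ust.
    exact: hd (inI _ _ _ s1 t2 ust).
  exact: dh0 (inI _ _ _ s1 t2 ust).
have dist s t : c0 < s -> s <= t -> t < c -> `|f t - f s| <= K * (h t - h s).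
  move=> s1 st t2.
  apply: (derive_norm_le (u := fun t => f t - f s) (v := fun t => K * (h t - h s))
      (du := df) (dv := fun t => K * dh t) st) => [u ust|u ust|u ust|].
  - by have := fd u (inI _ _ _ s1 t2 ust) => ?; apply: is_derive_eq; rewrite subr0.
  - by have := hd u (inI _ _ _ s1 t2 ust) => ?; apply: is_derive_eq; rewrite /GRing.scale /=; ring.
  - exact: fh (inI _ _ _ s1 t2 ust).
  - by rewrite !subrr mulr0 normr0.
have bdd c1 : c0 < c1 < c -> exists X, 0 <= X /\ forall t, c1 <= t < c -> `|f t| <= X.
  move=> /andP[c01 c1c]; have hc1 : h c1 <= H by apply: hH; rewrite c01.
  exists (`|f c1| + K * (H - h c1)); split; first by rewrite addr_ge0 // mulr_ge0 // subr_ge0.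
  move=> t /andP[t1 t2]; have := dist c1 t c01 t1 t2.
  have : K * (h t - h c1) <= K * (H - h c1).
    by rewrite ler_wpM2l // lerB // hH // (lt_le_trans c01 t1).
  by have := ler_normD (f t - f c1) (f c1); rewrite subrK; lra.
split=> //.
have mid : c0 < (c0 + c) / 2 < c by apply/andP; split; lra.
have [X [X0 XP]] := bdd _ mid.
pose c1 := (c0 + c) / 2; have c1c : c1 < c by case/andP: mid.
have c01 : c0 < c1 by case/andP: mid.
have [l1 l1P] : exists l : R, (fun t => K * h t) @ at_left c --> l.
  apply: (@monotone_left_lim _ c1 c (K * H)) => // [s t s1 st t2|t /andP[t1 t2]].
    by rewrite ler_wpM2l // hmono // (lt_trans c01).
  by rewrite ler_wpM2l // hH // (lt_trans c01).
have [l2 l2P] : exists l : R, (fun t => f t + K * h t) @ at_left c --> l.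
  apply: (@monotone_left_lim _ c1 c (X + K * H)) => // [s t s1 st t2|t /andP[t1 t2]].
    have := dist s t (lt_trans c01 s1) st t2; rewrite ler_norml; lra.
  have := XP t; rewrite (ltW t1) t2 => /(_ isT).
  have : K * h t <= K * H by rewrite ler_wpM2l // hH // (lt_trans c01).
  by rewrite ler_norml; lra.
exists (l2 - l1); rewrite (_ : f = fun t => (f t + K * h t) - K * h t).
  exact: cvgB l2P l1P.
by apply/funext => t; rewrite addrK.
Qed.

End escape_estimates.

Section spacetime_curves.
Context {R : realType} {m : nat}.
Local Notation n := (m.*2.+1).
Local Notation M := 'rV[R]_(1 + n).

Lemma rnorm_le (y : M) : `|rsubmx y| <= `|y|.
Proof.
apply: mx_norm_leP => // i j; by rewrite mxE mx_norm_coord.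
Qed.

Lemma norm_split (y : M) (r : R) : `|y 0 ti| <= r -> `|rsubmx y| <= r -> `|y| <= r.
Proof.
move=> yt ys; have r0 : 0 <= r by exact: le_trans (normr_ge0 _) yt.
apply: mx_norm_leP => // i j; rewrite ord1; have [->//|[a ->]] := ti_or_si j.
by have := mx_norm_coord (rsubmx y) 0 a; rewrite mxE => /le_trans; apply.
Qed.

Lemma rsubB (y z : M) : rsubmx (y - z) = rsubmx y - rsubmx z.
Proof. by apply/rowP => i; rewrite !mxE. Qed.

(** Serves for points of R x H, where [t] is tau, and for points of a box of the extension, where
    [t] is its time coordinate. *)
Definition tspt (t : R) (e : 'rV[R]_n) : M := row_mx (const_mx t) e.

Lemma tspt_ti t e : tspt t e 0 ti = t. Proof. by rewrite /tspt row_mxEl mxE. Qed.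
Lemma tspt_s t e : rsubmx (tspt t e) = e. Proof. by rewrite row_mxKr. Qed.
Lemma tsptE (y : M) : tspt (y 0 ti) (rsubmx y) = y.
Proof. by apply: rV_ti_si => [|a]; rewrite ?tspt_ti // /tspt row_mxEr mxE. Qed.
Lemma tspt_inj (y z : M) : y 0 ti = z 0 ti -> rsubmx y = rsubmx z -> y = z.
Proof. by move=> yt ys; rewrite -(tsptE y) yt ys tsptE. Qed.

Lemma tsptD (a t t' : R) e e' : tspt t e + a *: tspt t' e' = tspt (t + a * t') (e + a *: e').
Proof.
apply: rV_ti_si => [|j]; first by rewrite [in LHS]mxE [X in _ + X]mxE !tspt_ti.
by rewrite [in LHS]mxE [X in _ + X]mxE /tspt !row_mxEr !mxE.
Qed.

(* The frame components of the velocity control the coordinates, the central one only after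
   the horizontal ones have been bounded. *)
Lemma curve_left_lim (x v : R -> M) (h dh : R -> R) (c0 c K H : R) : c0 < c -> 0 <= K ->
  (forall t : R, c0 < t < c -> is_derive t 1 x (v t)) ->
  (forall t : R, c0 < t < c -> is_derive t 1 h (dh t)) ->
  (forall t : R, c0 < t < c -> 0 <= dh t) ->
  (forall t : R, c0 < t < c -> `|v t 0 ti| <= K * dh t) ->
  (forall t a, c0 < t < c -> `|omega (x t) (v t) a| <= K * dh t) ->
  (forall t, c0 < t < c -> h t <= H) -> exists l : M, x @ at_left c --> l.
Proof.
move=> c0c K0 xd hd dh0 vt vs hH.
have xd' j (t : R) : c0 < t < c -> is_derive t 1 (fun t => x t 0 j) (v t 0 j).
  by move=> /xd /is_derive_mxP.
have horiz a : a != 0 -> (exists l : R, (fun t => x t 0 (si a)) @ at_left c --> l) /\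
  forall c1, c0 < c1 < c -> exists X, 0 <= X /\ forall t, c1 <= t < c -> `|x t 0 (si a)| <= X.
  move=> a0; apply: (dominated_left_lim (df := fun t => v t 0 (si a)) (dh := dh) (K := K)
    (h := h) (H := H)) => //.
  by move=> t tc; have := vs t a tc; rewrite omega_i.
have [lt ltP] : exists l : R, (fun t => x t 0 ti) @ at_left c --> l.
  by have [] := @dominated_left_lim R (fun t => x t 0 ti) (fun t => v t 0 ti) h dh c0 c K H
    c0c K0 (xd' ti) hd dh0 vt hH.
pose c1 := (c0 + c) / 2; have c01 : c0 < c1 < c by apply/andP; split; rewrite /c1; lra.
have bd r : exists X, 0 <= X /\ forall t, c1 <= t < c -> `|x t 0 (si (odd_ix r))| <= X.
  by apply: (horiz _ _).2 => //; rewrite odd_ix_neq0.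
have [X XP] := choice bd.
have [l0 l0P] : exists l : R, (fun t => x t 0 (si 0)) @ at_left c --> l.
  have wide_c t : c1 < t < c -> c0 < t < c.
    by move=> /andP[t1 t2]; rewrite t2 andbT (lt_trans _ t1) //; case/andP: c01.
  have vt0 t : c1 < t < c -> `|v t 0 (si 0)| <= (K + \sum_r X r * K) * dh t.
    move=> /[dup] /wide_c tc /andP[t1 t2].
    have -> : v t 0 (si 0) = omega (x t) (v t) 0
      + \sum_(r < m) x t 0 (si (odd_ix r)) * v t 0 (si (even_ix r)).
      by rewrite /omega eqxx mul1r subrK.
    apply: le_trans (ler_normD _ _) _; rewrite mulrDl lerD ?vs // mulr_suml.
    apply: le_trans (ler_norm_sum _ _ _) _; apply: ler_sum => r _; rewrite normrM -mulrA.
    apply: ler_pM => //; first by case: (XP r) => _; apply; rewrite t2 (ltW t1).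
    by rewrite -(omega_i (x t)) ?even_ix_neq0 //; exact: vs.
  have K1 : 0 <= K + \sum_r X r * K.
    by rewrite addr_ge0 // sumr_ge0 // => r _; rewrite mulr_ge0 //; case: (XP r).
  have c1c : c1 < c by case/andP: c01.
  by have [] := @dominated_left_lim R (fun t => x t 0 (si 0)) (fun t => v t 0 (si 0)) h dh c1 c
    _ H c1c K1 (fun t tc => xd' _ t (wide_c t tc)) (fun t tc => hd t (wide_c t tc))
    (fun t tc => dh0 t (wide_c t tc)) vt0 (fun t tc => hH t (wide_c t tc)).
have ex a : exists l : R, (fun t => x t 0 (si a)) @ at_left c --> l.
  by have [->|a0] := eqVneq a 0; [exists l0|case: (horiz a a0)].
have [l lP] := choice ex.
exists (tspt lt (\row_a l a)); apply/cvg_mxP => i j; rewrite ord1.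
have [->|[a ->]] := ti_or_si j; first by rewrite tspt_ti.
by rewrite /tspt row_mxEr mxE; exact: lP.
Qed.

Lemma unitmx_inj k (A : 'M[R]_k) : (forall v : 'rV_k, v *m A = 0 -> v = 0) -> A \in unitmx.
Proof. by move=> Ai; rewrite -row_free_unit; exact: inj_row_free. Qed.

End spacetime_curves.

Section translations.
Context {R : realType} {m : nat}.
Local Notation n := (m.*2.+1).
Local Notation M := 'rV[R]_(1 + n).
Variable i : 'I_n.
Hypothesis i0 : i != 0.

Definition tr (h : R) : heisenberg R m := h *: (delta_mx 0 i : 'rV[R]_n).

Lemma tr_coord h c : (tr h : 'rV[R]_n) 0 c = h * (c == i)%:R.
Proof. by rewrite /tr !mxE eqxx. Qed.

Lemma act_tr_i h (x : M) : act (tr h) x 0 (si i) = h + x 0 (si i).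
Proof. by rewrite act_si tr_coord eqxx mulr1 (negPf i0) mul0r addr0. Qed.

Lemma act_tr0 (x : M) : act (tr 0) x = x.
Proof. by rewrite -[RHS]act1; congr act; rewrite /tr scale0r. Qed.

(** Multiples of one horizontal basis vector commute: the cocycle pairs odd with even coordinates,
    and only one coordinate is non-zero. *)
Lemma act_trD (a b : R) (x : M) : act (tr a) (act (tr b) x) = act (tr (a + b)) x.
Proof.
rewrite actM; congr act; rewrite -[(tr a * tr b)%g]/(heis_mul (tr a) (tr b)) /heis_mul.
rewrite /heis_cocycle big1 ?scale0r ?addr0 => [|r _]; first by rewrite /tr scalerDl.
rewrite !tr_coord; have [oi|] := eqVneq (odd_ix r) i; last by rewrite mulr0 mul0r.
by rewrite -oi even_odd_ix !mulr0.
Qed.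

Lemma act_tr_cont h (x : M) (e : R) : 0 < e -> exists2 d : R, 0 < d &
  forall h' x', `|h' - h| < d -> `|x' - x| < d -> `|act (tr h') x' - act (tr h) x| < e.
Proof.
move=> e0; pose F (p : R * M) : M := act (tr p.1) p.2.
have cj j : {for (h, x), continuous (fun p : R * M => p.2 0 j)}.
  apply: (@continuous_comp _ _ _ snd (fun M : 'rV[R]_(1 + n) => M 0 j)); first exact: cvg_snd.
  exact: coord_continuous.
have ch : {for (h, x), continuous (fun p : R * M => p.1)} by exact: cvg_fst.
have Fc : {for (h, x), continuous F}.
  apply/(@cvg_mxP _ _ _ (nbhs_filter (h, x))) => a j; rewrite ord1.
  have [->|[c ->]] := ti_or_si j.
    have FE : (fun p => F p 0 ti) = fun p : R * M => p.2 0 ti.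
      by apply/funext => p; rewrite /F act_ti.
    suff : {for (h, x), continuous (fun p => F p 0 ti)} by [].
    by rewrite FE; exact: cj.
  have FE : (fun p => F p 0 (si c)) = fun p : R * M => p.1 * (c == i)%:R + p.2 0 (si c)
    + (c == 0)%:R * \sum_(r < m) p.1 * (odd_ix r == i)%:R * p.2 0 (si (even_ix r)).
    apply/funext => p; rewrite /F act_si tr_coord; congr (_ + _ * _).
    by apply: eq_bigr => r _; rewrite tr_coord.
  suff : {for (h, x), continuous (fun p => F p 0 (si c))} by [].
  rewrite FE; apply: cvgD.
    by apply: cvgD; [apply: cvgM; [exact: ch|exact: cvg_cst]|exact: cj].
  apply: cvgM; first exact: cvg_cst.
  apply: (@cvg_sumr _ _ _ (nbhs_filter (h, x))) => r _.
  apply: cvgM; last exact: cj.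
  by apply: cvgM; [exact: ch|exact: cvg_cst].
have /cvgrPdist_lt /(_ e e0) /nbhs_ballP[d /= d0 dP] := Fc.
exists d => // h' x' hh xx; rewrite distrC; apply: (dP (h', x')).
by split; rewrite /= -ball_normE /= distrC.
Qed.

End translations.

Section ray_derivative.
Context {R : realType} {k : nat}.
Local Notation V := 'rV[R]_k.
Variables (f : V -> V) (J : V -> 'M[R]_k) (B : set V).
Hypothesis fJ : forall x, B x -> strict_diff f (J x) x.
Hypothesis Ju : forall x, B x -> J x \in unitmx.

Lemma lift_derive (x : R -> V) (s : R) v : B (x s) -> {for s, continuous x} ->
  is_derive s 1 (fun t => f (x t)) v ->
  is_derive s 1 x (v *m invmx (J (x s))) /\ v *m invmx (J (x s)) *m J (x s) = v.
Proof.
by move=> Bx xc fx; split; [exact: (strict_diff_lift (Ju Bx) (fJ Bx))|rewrite mulmxKV ?Ju].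
Qed.

Lemma is_derive_affine (z w : V) (s : R) : is_derive s 1 (fun t : R => z + t *: w) w.
Proof.
apply/is_derive_mxP => i j; rewrite (_ : (fun _ => _) = fun t : R => z i j + t * w i j).
  by apply: is_derive_eq; rewrite /GRing.scale /=; ring.
by apply/funext => t; rewrite !mxE.
Qed.

Lemma ray_lift_derive x0 w c x (s : R) : ray_lift f B x0 w c x -> 0 < s < c ->
  is_derive s 1 x (w *m invmx (J (x s))) /\ w *m invmx (J (x s)) *m J (x s) = w.
Proof.
move=> [xP _] /andP[s0 sc]; have [xc Bx _] := xP s sc; apply: lift_derive => //.
apply: (@is_derive_near_eq _ _ (fun t : R => f x0 + t *: w)); last exact: is_derive_affine.
near=> t; have tc : t < c by near: t; exact: lt_nbhsl.
have t0 : 0 < t by near: t; exact: lt_nbhsr.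
by have [_ _ ->] := xP t tc; rewrite /ray_at (max_idPr (ltW t0)).
Unshelve. all: by end_near. Qed.

End ray_derivative.

Section boxes.
Context {R : realType} {m : nat}.
Local Notation n := (m.*2.+1).
Local Notation M := 'rV[R]_(1 + n).
Variables (nu : R -> R) (w : 'I_n -> R -> R).
Hypothesis w_gt0 : forall a t, 0 < w a t.

Definition sqn (x u : M) := pairing (gmetric nu w x) u u.

Lemma sqnE x u : sqn x u = - nu (tau x) * u 0 ti ^+ 2 + \sum_a w a (tau x) * omega x u a ^+ 2.
Proof.
rewrite /sqn pairing_gmetric -mulrA -expr2; congr (_ + _); apply: eq_bigr => a _.
by rewrite -mulrA -expr2.
Qed.

Lemma sqn_slice (x u : M) a : u 0 ti = 0 -> w a (tau x) * omega x u a ^+ 2 <= sqn x u.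
Proof.
move=> u0; rewrite sqnE u0 expr0n mulr0 add0r (bigD1 a) //= lerDl sumr_ge0 // => b _.
by rewrite mulr_ge0 ?sqr_ge0 // ltW.
Qed.

Lemma sqn_slice_ge0 (x u : M) : u 0 ti = 0 -> 0 <= sqn x u.
Proof.
by move=> u0; apply: le_trans (sqn_slice x 0 u0); rewrite mulr_ge0 ?sqr_ge0 // ltW.
Qed.

(** [f] is the map into the extension read in box coordinates, and [B] is an open part of the
    spacetime lying over the box. [T] is the vertical coordinate and [E] the others. [closedB] keeps
    limits of curves inside [B] as long as their images stay in a smaller ball; [wide] and [steep]
    describe the light cones; [sgn] tells whether T grows with tau or against it. *)
Variables (f : M -> M) (J : M -> 'M[R]_(1 + n)) (B : set M) (L C rho sgn : R).
Local Notation T x := (f x 0 ti).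
Local Notation E x := (rsubmx (f x)).
Local Notation dT x u := ((u *m J x) 0 ti).
Local Notation dE x u := (rsubmx (u *m J x)).
Hypothesis openB : open B.
Hypothesis fJ : forall x, B x -> strict_diff f (J x) x.
Hypothesis Ju : forall x, B x -> J x \in unitmx.
Hypothesis L_ge1 : 1 <= L.
Hypothesis C_ge0 : 0 <= C.
Hypothesis closedB : forall r, r < rho -> closed (B `&` [set x | `|f x| <= r]).
Hypothesis wide : forall x u, B x -> sqn x u <= 0 -> `|dE x u| <= L * `|dT x u|.
Hypothesis steep : forall x u, B x -> 0 <= sqn x u -> `|dT x u| <= L * `|dE x u|.
Hypothesis bounded_by : forall x u, B x -> sqn x u <= C ^+ 2 * `|dE x u| ^+ 2.
Hypothesis oriented : forall x u, B x -> sqn x u < 0 -> 0 < sgn * u 0 ti -> 0 < dT x u.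

(* The first entry is tau: the sets where it is constant are the slices. *)
Definition fs (x : M) : M := tspt (x 0 ti) (rsubmx (f x)).
Definition Js (x : M) : 'M[R]_(1 + n) := row_mx (col_mx 1%:M 0) (rsubmx (J x)).

Lemma mul_Js (u x : M) : u *m Js x = tspt (u 0 ti) (dE x u).
Proof.
rewrite /Js mul_mx_row /tspt; congr row_mx; last first.
  by apply/rowP => a; rewrite !mxE; apply: eq_bigr => i _; rewrite !mxE.
rewrite -[u]hsubmxK mul_row_col mulmx1 mulmx0 addr0.
by rewrite hsubmxK; apply/rowP => i; rewrite !mxE !ord1.
Qed.

(** Slices are graphs over E: a vector tangent to a slice is not timelike, so dE = 0 forces dT = 0
    by [steep], and then the vector vanishes. *)
Lemma Js_unit x : B x -> Js x \in unitmx.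
Proof.
move=> Bx; apply: unitmx_inj => u; rewrite mul_Js => u0.
have ut : u 0 ti = 0 by rewrite -(tspt_ti (u 0 ti) (dE x u)) u0 mxE.
have ue : dE x u = 0 by rewrite -(tspt_s (u 0 ti) (dE x u)) u0; apply/rowP => a; rewrite !mxE.
have := steep Bx (sqn_slice_ge0 x ut); rewrite ue normr0 mulr0 normr_le0 => /eqP uT.
have : u *m J x = 0.
  by apply: tspt_inj; rewrite ?uT ?ue; [rewrite mxE|apply/rowP => a; rewrite !mxE].
by move=> /(congr1 (mulmx^~ (invmx (J x)))); rewrite mulmxK ?Ju // mul0mx.
Qed.

Lemma fs_strict x : B x -> strict_diff fs (Js x) x.
Proof.
move=> Bx e e0; have [d d0 dP] := fJ Bx e0; exists d => // y z yd zd.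
rewrite mul_Js; apply: norm_split.
  set a := fs y; set b := fs z; set c := tspt _ _.
  have -> : (a - b - c) 0 ti = a 0 ti - b 0 ti - c 0 ti by rewrite !mxE.
  by rewrite !tspt_ti !mxE subrr normr0 mulr_ge0 // ltW.
rewrite /fs; have -> : rsubmx (tspt (y 0 ti) (E y) - tspt (z 0 ti) (E z)
   - tspt ((y - z) 0 ti) (dE x (y - z))) = rsubmx (f y - f z - (y - z) *m J x).
  rewrite (rsubB _ (tspt _ _)) (rsubB (tspt _ _)) !tspt_s.
  by rewrite mulmxBl !rsubB.
exact: le_trans (rnorm_le _) (dP y z yd zd).
Qed.

Lemma slice_velocity (x u : M) e : B x -> u *m Js x = tspt 0 e ->
  [/\ u 0 ti = 0, `|dT x u| <= L * `|e| &
    forall a, `|omega x u a| <= C * `|e| / scl w a (tau x)].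
Proof.
rewrite mul_Js => Bx ue.
have ut : u 0 ti = 0 by rewrite -(tspt_ti (u 0 ti) (dE x u)) ue tspt_ti.
have uE : dE x u = e by rewrite -(tspt_s (u 0 ti) (dE x u)) ue tspt_s.
split=> //; first by have := steep Bx (sqn_slice_ge0 x ut); rewrite uE.
move=> a; rewrite ler_pdivlMr ?scl_gt0 //.
have H := le_trans (sqn_slice x a ut) (bounded_by u Bx).
rewrite -(ler_pXn2r (ltn0Sn 1)) ?nnegrE ?mulr_ge0 ?scl_ge0 //.
by rewrite !exprMn scl2 // mulrC real_normK ?num_real // -uE.
Qed.

Lemma timelike_vertical (x u : M) : B x -> u 0 ti != 0 -> dE x u = 0 -> sqn x u < 0.
Proof.
move=> Bx ut ue; rewrite ltNge; apply/negP => /(steep Bx).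
rewrite ue normr0 mulr0 normr_le0 => /eqP uT.
have uJ : u *m J x = 0.
  by apply: tspt_inj; rewrite ?uT ?ue; [rewrite mxE|apply/rowP => a; rewrite !mxE].
have : u = 0 by rewrite -(mulmxK (Ju Bx) u) uJ mul0mx.
by move=> u0; rewrite u0 mxE eqxx in ut.
Qed.

Lemma curve_T (x : R -> M) (s : R) v : B (x s) -> is_derive s 1 x v ->
  is_derive s 1 (fun t => T (x t)) (dT (x s) v).
Proof. by move=> Bx xd; have /is_derive_mxP := strict_diff_curve (fJ Bx) xd. Qed.

(** Along the slice the scale factors are constant, so the frame velocity of the lifted segment is
    bounded. An escaping lift would converge, and its limit would lie in [B] because T and E stay in
    the closed ball of radius [r1]. *)
Lemma slice_lift x0 e r1 : B x0 -> r1 < rho -> `|T x0| + L * `|e| <= r1 ->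
  `|E x0| + `|e| <= r1 -> exists c x, 1 < c /\ ray_lift fs B x0 (tspt 0 e) c x.
Proof.
move=> Bx0 r1rho Tr Er.
case: (ray_lift_or_escape openB fs_strict Js_unit (tspt 0 e) Bx0) => // -[c [x [/andP[c0 c1] xl nl]]].
exfalso.
have [xP x00] := xl.
have xt t : t < c -> x t 0 ti = x0 0 ti /\ E (x t) = E x0 + Num.max 0 t *: e.
  move=> /xP[_ _]; rewrite /ray_at /fs tsptD mulr0 addr0 => fx.
  by split; [rewrite -(tspt_ti (x t 0 ti) (E (x t))) fx tspt_ti|
    rewrite -(tspt_s (x t 0 ti) (E (x t))) fx tspt_s].
have xd (t : R) (tc : 0 < t < c) := ray_lift_derive fs_strict Js_unit xl tc.
pose v t := tspt 0 e *m invmx (Js (x t)).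
have vP t : 0 < t < c -> [/\ v t 0 ti = 0, `|dT (x t) (v t)| <= L * `|e| &
    forall a, `|omega (x t) (v t) a| <= C * `|e| / scl w a (tau x0)].
  move=> tc; have [_ vJ] := xd t tc; have [_ Bx _] := xP t (andP tc).2.
  have [v1 v2 v3] := slice_velocity Bx vJ; split=> // a.
  by have := v3 a; rewrite !tauE (xt t (andP tc).2).1.
pose K := \sum_a C * `|e| / scl w a (tau x0).
have Ka a : 0 <= C * `|e| / scl w a (tau x0) by rewrite divr_ge0 ?mulr_ge0 ?scl_ge0.
have K0 : 0 <= K by exact: sumr_ge0.
have KK a : C * `|e| / scl w a (tau x0) <= K by rewrite /K (bigD1 a) //= lerDl sumr_ge0.
have [l ll] : exists l : M, x @ at_left c --> l.
  apply: (@curve_left_lim R m x v id (fun=> 1) 0 c K c c0 K0) => //.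
  - by move=> t tc; case: (xd t tc).
  - by move=> t tc; rewrite mulr1; have [-> _ _] := vP t tc; rewrite normr0.
  - by move=> t a tc; rewrite mulr1; have [_ _ v3] := vP t tc; exact: le_trans (v3 a) (KK a).
  - by move=> t /andP[_ /ltW].
apply: (nl l); last exact/left_limP.
suff [] : (B `&` [set x | `|f x| <= r1]) l by [].
apply: (@closed_cvg _ _ _ _ x _ (closedB r1rho) _ l ll); near=> t.
have tc : t < c by near: t; exact: nbhs_left_lt.
have t0 : 0 < t by near: t; exact: nbhs_left_gt.
have [xc Bx _] := xP t tc; split=> //=; apply: norm_split; last first.
  rewrite (xt t tc).2 (max_idPr (ltW t0)); apply: le_trans (ler_normD _ _) (le_trans _ Er).
  by rewrite lerD2l normrZ ger0_norm ?(ltW t0) // ler_piMl // (le_trans (ltW tc)).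
have H : `|T (x t) - T (x 0)| <= L * `|e| * t.
  rewrite -[X in _ * X]subr0.
  apply: (@mean_value_le R (fun t => T (x t)) (fun t => dT (x t) (v t)) 0 t) => [|u ut|u ut|u ut].
  - exact: ltW.
  - have [|uc Bu _] := xP u; first by case/andP: ut => _ /le_lt_trans; apply.
    apply: (@continuous_comp _ _ _ (fun t => f (x t)) (fun M : 'rV[R]_(1 + n) => M 0 ti)).
      exact: (continuous_curve fJ uc Bu).
    exact: coord_continuous.
  - have uc : 0 < u < c by case/andP: ut => -> /= /lt_trans; apply.
    by have [_ Bu _] := xP u (andP uc).2; apply: curve_T => //; case: (xd u uc).
  - have uc : 0 < u < c by case/andP: ut => -> /= /lt_trans; apply.
    by case: (vP u uc).
rewrite (x00 0 (lexx 0)) in H.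
have H2 : L * `|e| * t <= L * `|e|.
  by apply: ler_piMr; [rewrite mulr_ge0 // (le_trans ler01)|exact: le_trans (ltW tc) c1].
have := ler_normD (T (x t) - T x0) (T x0); rewrite subrK.
move: Tr H H2; set A1 := L * `|e|; lra.
Unshelve. all: by end_near. Qed.

Lemma cone (x v : R -> M) (a b : R) : a <= b ->
  (forall t : R, a <= t <= b -> is_derive t 1 x (v t)) ->
  (forall t, a <= t <= b -> B (x t)) ->
  (forall t, a <= t <= b -> sqn (x t) (v t) < 0 /\ 0 < sgn * v t 0 ti) ->
  `|E (x b) - E (x a)| <= L * (T (x b) - T (x a)).
Proof.
move=> ab xd Bx vt.
have fd (t : R) i : a <= t <= b -> is_derive t 1 (fun t => f (x t) 0 i) ((v t *m J (x t)) 0 i).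
  by move=> tab; have /is_derive_mxP := strict_diff_curve (fJ (Bx t tab)) (xd t tab).
have Td t : a <= t <= b -> 0 < dT (x t) (v t).
  by move=> tab; have [v1 v2] := vt t tab; exact: oriented (Bx t tab) v1 v2.
apply: mx_norm_leP => [|i j].
  apply: mulr_ge0; [exact: le_trans ler01 L_ge1|rewrite subr_ge0].
  apply: (derive_ge0_nondecreasing (f := fun t => T (x t)) (df := fun t => dT (x t) (v t)) ab).
  by move=> t /Td /ltW.
rewrite !mxE ord1 -![rshift _ _]/(si _).
apply: (derive_norm_le (u := fun t => f (x t) 0 (si j) - f (x a) 0 (si j))
  (v := fun t => L * (T (x t) - T (x a))) (du := fun t => (v t *m J (x t)) 0 (si j))
  (dv := fun t => L * dT (x t) (v t)) ab) => [t tab|t tab|t tab|].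
- by have := fd t (si j) tab => ?; apply: is_derive_eq; rewrite subr0.
- by have := fd t ti tab => ?; apply: is_derive_eq; rewrite /GRing.scale /=; ring.
- have [v1 v2] := vt t tab; rewrite -[X in L * X](gtr0_norm (Td t tab)).
  apply: le_trans (wide (Bx t tab) (ltW v1)).
  by have := mx_norm_coord (dE (x t) (v t)) 0 j; rewrite mxE.
- by rewrite !subrr mulr0 normr0.
Qed.

(** A homotopy of timelike curves with controlled endpoints stays in the box if its initial curve
    does. While a curve is in the box, its cone bounds improve |E| < r2 to |E| <= r3 < r2; hence
    staying inside is both an open and a closed condition on [h]. *)
Lemma confinement (G v : R -> R -> M) (U a b tlo thi r0 r2 r1 : R) :
  0 <= U -> a <= b -> r1 < rho -> r2 <= r1 -> - r1 <= tlo -> thi <= r1 ->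
  r0 + L * (thi - tlo) / 2 < r2 ->
  (forall h k, 0 <= h <= U -> a <= k <= b -> forall e, 0 < e -> exists2 d, 0 < d &
    forall h' k', 0 <= h' <= U -> a <= k' <= b -> `|h' - h| < d -> `|k' - k| < d ->
      `|G h' k' - G h k| < e) ->
  (forall h (k : R), 0 <= h <= U -> a <= k <= b -> is_derive k 1 (G h) (v h k)) ->
  (forall h k, 0 <= h <= U -> a <= k <= b -> sqn (G h k) (v h k) < 0 /\ 0 < sgn * v h k 0 ti) ->
  (forall h, 0 <= h <= U -> [/\ B (G h a), `|E (G h a)| <= r0 & tlo <= T (G h a)]) ->
  (forall h, 0 <= h <= U -> [/\ B (G h b), `|E (G h b)| <= r0 & T (G h b) <= thi]) ->
  (forall k, a <= k <= b -> B (G 0 k) /\ `|E (G 0 k)| < r2) ->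
  forall h, 0 <= h <= U -> `|E (G h b) - E (G h a)| <= L * (T (G h b) - T (G h a)).
Proof.
move=> U0 ab r1rho r21 tlor thir small Gc Gd Gt Ga Gb G0.
pose good h := forall k, a <= k <= b -> B (G h k) /\ `|E (G h k)| < r2.
(* The average of the cone bounds from the lower and from the upper endpoint. *)
pose r3 := r0 + L * (thi - tlo) / 2.
suff main : forall h, 0 <= h <= U -> good h.
  move=> h hU; apply: (cone (v := v h)) => // t tab.
  - exact: Gd.
  - by case: (main h hU t tab).
  - exact: Gt.
have goodZ h : 0 <= h <= U -> good h -> forall k, a <= k <= b ->
    [/\ B (G h k), `|f (G h k)| <= r1 & `|E (G h k)| <= r3].
  move=> hU gh k /andP[ak kb]; have [Bk Ek] := gh k (introT andP (conj ak kb)).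
  have c1 : `|E (G h k) - E (G h a)| <= L * (T (G h k) - T (G h a)).
    apply: (cone (v := v h)) => // t /andP[t1 t2]; have tab : a <= t <= b by rewrite t1 (le_trans t2).
    - exact: Gd.
    - by case: (gh t tab).
    - exact: Gt.
  have c2 : `|E (G h b) - E (G h k)| <= L * (T (G h b) - T (G h k)).
    apply: (cone (v := v h)) => // t /andP[t1 t2]; have tab : a <= t <= b by rewrite t2 (le_trans ak).
    - exact: Gd.
    - by case: (gh t tab).
    - exact: Gt.
  have [Ba Ea Ta] := Ga h hU; have [Bb Eb Tb] := Gb h hU.
  have L0 : 0 < L by exact: lt_le_trans ltr01 L_ge1.
  have T1 : T (G h a) <= T (G h k).
    by rewrite -subr_ge0 -(pmulr_rge0 _ L0); exact: le_trans (normr_ge0 _) c1.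
  have T2 : T (G h k) <= T (G h b).
    by rewrite -subr_ge0 -(pmulr_rge0 _ L0); exact: le_trans (normr_ge0 _) c2.
  have Ek3 : `|E (G h k)| <= r3.
    have e1 := ler_normD (E (G h k) - E (G h a)) (E (G h a)); rewrite subrK in e1.
    have e2 := ler_normB (E (G h b)) (E (G h b) - E (G h k)); rewrite opprB addrC subrK in e2.
    have : L * (T (G h b) - T (G h a)) <= L * (thi - tlo) by rewrite ler_wpM2l ?(ltW L0) // lerB.
    move: e1 e2 c1 c2; rewrite /r3 !mulrBr; lra.
  split=> //; apply: norm_split.
    by rewrite ler_norml; apply/andP; split; lra.
  by apply: le_trans Ek3 (le_trans (ltW small) r21).
apply: (segment_ind (P := good) U0 G0).
move=> h hU; have [gh|ngh] := pselect (good h).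
  have [d d0 dP] : exists2 d, 0 < d & forall h', 0 <= h' <= U -> `|h' - h| < d -> good h'.
    pose Q k := exists2 d, 0 < d & forall h', 0 <= h' <= U -> `|h' - h| < d ->
      forall k', a <= k' <= k -> k' <= b -> B (G h' k') /\ `|E (G h' k')| < r2.
    have loc k : a <= k <= b -> exists2 d, 0 < d & forall h' k', 0 <= h' <= U -> a <= k' <= b ->
        `|h' - h| < d -> `|k' - k| < d -> B (G h' k') /\ `|E (G h' k')| < r2.
      move=> kab; have [Bk Ek] := gh k kab.
      have [d1 d10 d1P] := open_ball_sub openB Bk.
      have e0 : 0 < r2 - `|E (G h k)| by rewrite subr_gt0.
      have [d2 d20 d2P] := proj1 (continuous_epsP _ _) (strict_diff_continuous (fJ Bk)) _ e0.
      have m0 : 0 < Num.min d1 d2 by rewrite lt_min d10.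
      have [d d0 dP] := Gc h k hU kab _ m0; exists d => // h' k' hU' kab' h1 k1.
      have := dP h' k' hU' kab' h1 k1; rewrite lt_min => /andP[g1 g2]; split; first exact: d1P.
      have H1 := d2P _ g2; have H2 := rnorm_le (f (G h' k') - f (G h k)); rewrite rsubB in H2.
      by have := ler_normD (E (G h' k') - E (G h k)) (E (G h k)); rewrite subrK; lra.
    have [d d0 dP] : Q b.
      apply: (segment_ind (P := Q) ab _ _ (introT andP (conj ab (lexx _)))).
        have [d d0 dP] := loc a (introT andP (conj (lexx _) ab)).
        exists d => // h' hU' h1 k' /andP[k1 k2] k3; apply: dP => //; first by rewrite k1.
        by have -> : k' = a by [apply/le_anti; rewrite k1 k2]; rewrite subrr normr0.
      move=> k kab; have [d d0 dP] := loc k kab; exists d => // u u' uab uab' ku ku' [d' d'0 d'P].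
      exists (Num.min d d'); first by rewrite lt_min d0.
      move=> h' hU'; rewrite lt_min => /andP[h1 h2] k' /andP[k1 k2] k3.
      have [k'u|uk'] := leP k' u; first by apply: d'P => //; rewrite k1.
      apply: dP => //; first by rewrite k1.
      by move: ku ku'; rewrite !(distrC k) !ltr_distl; lra.
    by exists d => // h' hU' h1 k' /andP[k1 k2]; apply: dP => //; rewrite k1.
  exists d => // u u' _ uU' _ hu' _; apply: dP => //; first by rewrite distrC.
have [k kab nk] : exists2 k, a <= k <= b & ~ (B (G h k) /\ `|E (G h k)| < r2).
  apply: contrapT => nex; apply: ngh => k kab; apply: contrapT => nk; apply: nex; exists k => //.
(* The improved bounds define a closed condition, so their failure at one point [(h, k)] persists
   for all nearby [h]. *)
have nZ : ~ ((B `&` [set x | `|f x| <= r1]) (G h k) /\ `|E (G h k)| <= r3).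
  by move=> [[Bk _] Ek]; apply: nk; split=> //; exact: le_lt_trans Ek small.
suff [d d0 dP] : exists2 d, 0 < d & forall h', 0 <= h' <= U -> `|h' - h| < d -> ~ good h'.
  by exists d => // u u' uU _ hu _ gu; exfalso; apply: (dP u uU _ gu); rewrite distrC.
have [ZB|nZB] := pselect ((B `&` [set x | `|f x| <= r1]) (G h k)).
  have [Bk _] := ZB.
  have e0 : 0 < `|E (G h k)| - r3 by rewrite subr_gt0 ltNge; apply/negP => Ek; exact: nZ.
  have [d2 d20 d2P] := proj1 (continuous_epsP _ _) (strict_diff_continuous (fJ Bk)) _ e0.
  have [d d0 dP] := Gc h k hU kab _ d20; exists d => // h' hU' h1 gh'.
  have [_ _ E3] := goodZ h' hU' gh' k kab.
  have := d2P _ (dP h' k hU' kab h1 _); rewrite subrr normr0 => /(_ d0) H1.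
  have H2 := rnorm_le (f (G h' k) - f (G h k)); rewrite rsubB in H2.
  have := ler_normB (E (G h' k)) (E (G h' k) - E (G h k)); rewrite opprB addrC subrK; lra.
have oZ : open (~` (B `&` [set x | `|f x| <= r1])) by exact: closed_openC (closedB r1rho).
have [d1 d10 d1P] := open_ball_sub oZ nZB.
have [d d0 dP] := Gc h k hU kab _ d10; exists d => // h' hU' h1 gh'.
have [B3 f3 _] := goodZ h' hU' gh' k kab.
by apply: (d1P (G h' k)); [apply: dP => //; rewrite subrr normr0|split].
Qed.

Section axis.
(** [c] is the lift of the vertical axis of the box, parametrised by T. It approaches the place
    where the lift escapes as s increases to 0. *)
Variables (c vc : R -> M) (sa r r1 : R).
Hypothesis r1rho : r1 < rho.
Hypothesis r_gt0 : 0 < r.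
Hypothesis small : - sa + L * r <= r1.
Hypothesis Bc : forall s, sa <= s < 0 -> B (c s).
Hypothesis f_axis : forall s, sa <= s < 0 -> f (c s) = tspt s 0.
Hypothesis dc : forall s : R, sa <= s < 0 -> is_derive s 1 c (vc s).
Hypothesis c_future : forall s, sa <= s < 0 -> 0 < sgn * vc s 0 ti.

Lemma axis_cont s : sa <= s < 0 -> {for s, continuous c}.
Proof.
move=> ss; have /is_derive_mxP cd := dc ss.
by apply: (vec_continuous (df := vc s)) => j; exact: cd.
Qed.

(* [S s e] lies over [e] on the slice of [c s]; it is the end of the lift of the segment from 0 to [e],
   which cannot escape because slices are complete. *)
Lemma slices_exist : exists S : R -> 'rV[R]_n -> M, forall s e, sa <= s < 0 -> `|e| < r ->
  [/\ B (S s e), fs (S s e) = tspt (c s 0 ti) e, S s 0 = c s &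
    forall eps, 0 < eps -> exists2 d, 0 < d & forall s' e', sa <= s' < 0 -> `|e'| < r ->
      `|s' - s| < d -> `|e' - e| < d -> `|S s' e' - S s e| < eps].
Proof.
have ex (p : R * 'rV[R]_n) : exists x : R -> M, sa <= p.1 < 0 -> `|p.2| < r ->
    exists2 c1, 1 < c1 & ray_lift fs B (c p.1) (tspt 0 p.2) c1 x.
  case: p => s e /=; have [sP|] := pselect (sa <= s < 0 /\ `|e| < r); last first.
    by move=> nsP; exists (fun=> 0) => s1 e1; exfalso; apply: nsP.
  case: sP => ss er; have er1 : L * `|e| <= L * r.
    by apply: ler_wpM2l; [exact: le_trans ler01 L_ge1|exact: ltW].
  have rr : r <= L * r by rewrite ler_peMl // ltW.
  have Tr : `|T (c s)| + L * `|e| <= r1.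
    rewrite f_axis // tspt_ti ltr0_norm; last by case/andP: ss.
    by case/andP: ss => s1 s2; move: er1 small s1; set A1 := L * `|e|; set A2 := L * r; lra.
  have Er : `|E (c s)| + `|e| <= r1.
    rewrite f_axis // tspt_s normr0 add0r; move: small; set A2 := L * r in rr *.
    by case/andP: ss => s1 s2; lra.
  have [c1 [x [c11 xl]]] := slice_lift (Bc ss) r1rho Tr Er.
  by exists x => _ _; exists c1.
have [X XP] := choice ex.
have Xl s e : sa <= s < 0 -> `|e| < r -> [/\ lift_on B 0 1 (X (s, e)), X (s, e) 0 = c s &
    forall t, 0 <= t <= 1 -> fs (X (s, e) t) = tspt (c s 0 ti) (t *: e)].
  move=> ss er; have [c1 c11 [xP x0]] := XP (s, e) ss er; split; last 2 first.
  - exact: x0.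
  - move=> t /andP[t0 t1]; have [_ _ ->] := xP t (le_lt_trans t1 c11).
    rewrite /ray_at (max_idPr t0) /fs /= f_axis // tspt_s tsptD.
    by rewrite mulr0 addr0 add0r.
  - by move=> t /andP[t0 t1]; have [xc Bx _] := xP t (le_lt_trans t1 c11).
exists (fun s e => X (s, e) 1) => s e ss er.
have one : 0 <= (1 : R) <= 1 by rewrite ler01 lexx.
have [xl x0 fx] := Xl s e ss er; split.
- by case: (xl 1 one).
- by rewrite fx // scale1r.
- have r0' : `|0 : 'rV[R]_n| < r by rewrite normr0.
  have [c1 c11 zl] := XP (s, 0) ss r0'.
  have kl : ray_lift fs B (c s) (tspt 0 0) c1 (fun=> c s).
    split=> [t _|t _]; last by [].
    split; [exact: cst_continuous|exact: Bc|].
    by rewrite /ray_at /fs tsptD mulr0 scaler0 !addr0.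
  exact: (ray_lift_unique openB fs_strict Js_unit zl kl c11 c11).
- move=> eps eps0.
  have [d d0 dP] := lift_close openB fs_strict Js_unit ler01 xl one eps0.
  have [d1 d10 d1P] := proj1 (continuous_epsP _ _) (axis_cont ss) _ d0.
  exists (Num.min d d1); first by rewrite lt_min d0.
  move=> s' e' ss' er'; rewrite !lt_min => /andP[_ s1] /andP[e1 _].
  have [xl' x0' fx'] := Xl s' e' ss' er'.
  have cc := d1P s' s1.
  apply: dP => // [|t t01]; first by rewrite x0 x0'.
  rewrite fx // fx' //.
  have -> : tspt (c s' 0 ti) (t *: e') - tspt (c s 0 ti) (t *: e)
      = tspt ((c s' - c s) 0 ti) (t *: (e' - e)).
    rewrite -[X in _ - X]scale1r -scaleNr tsptD scalerBr scaleN1r mulN1r.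
    by congr (tspt _ _); rewrite !mxE.
  case/andP: t01 => t0 t1.
  apply: (@le_lt_trans _ _ (Num.max `|c s' - c s| `|e' - e|)); last by rewrite gt_max cc e1.
  apply: norm_split; rewrite le_max ?tspt_ti ?tspt_s; apply/orP; [left|right].
    exact: mx_norm_coord.
  by rewrite normrZ ger0_norm // ler_piMl.
Qed.

Variable S : R -> 'rV[R]_n -> M.
Hypothesis SP : forall s e, sa <= s < 0 -> `|e| < r ->
  [/\ B (S s e), fs (S s e) = tspt (c s 0 ti) e, S s 0 = c s &
    forall eps, 0 < eps -> exists2 d, 0 < d & forall s' e', sa <= s' < 0 -> `|e'| < r ->
      `|s' - s| < d -> `|e' - e| < d -> `|S s' e' - S s e| < eps].

Lemma slice_point s e : sa <= s < 0 -> `|e| < r ->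
  [/\ B (S s e), S s e 0 ti = c s 0 ti & E (S s e) = e].
Proof.
move=> ss er; have [BS fS _ _] := SP ss er; split=> //.
  by rewrite -(tspt_ti (S s e 0 ti) (E (S s e))) -/(fs _) fS tspt_ti.
by rewrite -(tspt_s (S s e 0 ti) (E (S s e))) -/(fs _) fS tspt_s.
Qed.

(** The lift of the straight segment from [e] to [e'] stays in the slice, and the bounds on its
    velocity are integrated. *)
Lemma slice_segment s e e' : sa <= s < 0 -> `|e| < r -> `|e'| < r ->
  `|T (S s e') - T (S s e)| <= L * `|e' - e| /\
  forall a, a != 0 ->
    `|S s e' 0 (si a) - S s e 0 (si a)| <= C * `|e' - e| / scl w a (c s 0 ti).
Proof.
move=> ss er er'; pose y t := e + t *: (e' - e); pose x t := S s (y t).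
have yr t : 0 <= t <= 1 -> `|y t| < r.
  move=> /andP[t0 t1].
  have -> : y t = (1 - t) *: e + t *: e'.
    by rewrite /y scalerBr scalerBl scale1r addrA addrAC.
  apply: le_lt_trans (ler_normD _ _) _; rewrite !normrZ !ger0_norm ?subr_ge0 //.
  pose q := Num.max `|e| `|e'|; have qr : q < r by rewrite gt_max er.
  apply: le_lt_trans qr; have e1 : `|e| <= q by rewrite le_max lexx.
  have e2 : `|e'| <= q by rewrite le_max lexx orbT.
  have H1 : (1 - t) * `|e| <= (1 - t) * q by rewrite ler_wpM2l // subr_ge0.
  have H2 : t * `|e'| <= t * q by rewrite ler_wpM2l.
  by apply: le_trans (lerD H1 H2) _; rewrite -mulrDl subrK mul1r.
pose N := `|e' - e| + 1; have N0 : 0 < N by rewrite ltr_wpDl.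
have ydist t t' d : 0 < d -> `|t' - t| < d / N -> `|y t' - y t| < d.
  move=> d0 td; have -> : y t' - y t = (t' - t) *: (e' - e).
    by rewrite /y opprD addrACA subrr add0r -scalerBl.
  rewrite normrZ; apply: (@le_lt_trans _ _ (`|t' - t| * N)); last by rewrite -ltr_pdivlMr.
  by rewrite ler_wpM2l // lerDl.
have ynear (t : R) : 0 <= t <= 1 -> \forall t' \near t, `|y t'| < r.
  move=> /yr yt; have g0 : 0 < r - `|y t| by rewrite subr_gt0.
  apply/nbhs_ballP; exists ((r - `|y t|) / N); first by rewrite /= divr_gt0.
  move=> t'; rewrite -ball_normE /= distrC => /(ydist _ _ _ g0) H.
  by have := ler_normD (y t' - y t) (y t); rewrite subrK; lra.
have xc t : 0 <= t <= 1 -> {for t, continuous x}.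
  move=> t01; have [_ _ _ Sc] := SP ss (yr t t01); apply/continuous_epsP => eps eps0.
  have [d d0 dP] := Sc eps eps0.
  have /nbhs_ballP[d1 /= d10 d1P] := ynear t t01.
  exists (Num.min d1 (d / N)); first by rewrite lt_min d10 divr_gt0.
  move=> t'; rewrite lt_min => /andP[t1 t2]; apply: dP => //.
  - by apply: d1P; rewrite -ball_normE /= distrC.
  - by rewrite subrr normr0.
  - exact: ydist.
pose v t := tspt 0 (e' - e) *m invmx (Js (x t)).
have xB t : 0 <= t <= 1 -> [/\ B (x t), x t 0 ti = c s 0 ti & E (x t) = y t].
  by move=> t01; exact: slice_point ss (yr t t01).
have xd (t : R) : 0 <= t <= 1 -> is_derive t 1 x (v t) /\ v t *m Js (x t) = tspt 0 (e' - e).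
  move=> t01; have [Bx _ _] := xB t t01.
  apply: (lift_derive fs_strict Js_unit Bx (xc t t01)).
  apply: (@is_derive_near_eq _ _ (fun t : R => tspt (c s 0 ti) e + t *: tspt 0 (e' - e))).
    have := ynear t t01; apply: filterS => t' t'r; rewrite tsptD mulr0 addr0.
    by have [_ fS _ _] := SP ss t'r; rewrite fS.
  exact: is_derive_affine.
have vP t : 0 <= t <= 1 -> [/\ v t 0 ti = 0, `|dT (x t) (v t)| <= L * `|e' - e| &
    forall a, `|omega (x t) (v t) a| <= C * `|e' - e| / scl w a (c s 0 ti)].
  move=> t01; have [Bx xt _] := xB t t01; have [_ vJ] := xd t t01.
  have [v1 v2 v3] := slice_velocity Bx vJ; split=> // a.
  by have := v3 a; rewrite tauE xt.
have x1 : x 1 = S s e' by rewrite /x /y scale1r addrC subrK.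
have x0 : x 0 = S s e by rewrite /x /y scale0r addr0.
have oc t : 0 < t < 1 -> 0 <= t <= 1 by move=> /andP[t0 t1]; rewrite !ltW.
rewrite -x1 -x0; split=> [|a a0].
  rewrite -[leRHS]mulr1 -{2}[1](subr0 (1 : R)).
  apply: (@mean_value_le R (fun t => T (x t)) (fun t => dT (x t) (v t))) => //.
  - move=> t t01; have [Bx _ _] := xB t t01.
    apply: (@continuous_comp _ _ _ (fun t => f (x t)) (fun M : 'rV[R]_(1 + n) => M 0 ti)).
      exact: (continuous_curve fJ (xc t t01) Bx).
    exact: coord_continuous.
  - move=> t /oc t01; have [Bx _ _] := xB t t01; apply: curve_T => //.
    by case: (xd t t01).
  - by move=> t /oc t01; case: (vP t t01).
rewrite -[leRHS]mulr1 -{2}[1](subr0 (1 : R)).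
apply: (@mean_value_le R (fun t => x t 0 (si a)) (fun t => v t 0 (si a))) => //.
- move=> t t01; apply: (@continuous_comp _ _ _ x (fun M : 'rV[R]_(1 + n) => M 0 (si a))).
    exact: xc.
  exact: coord_continuous.
- by move=> t /oc t01; have [/is_derive_mxP] := xd t t01.
- by move=> t /oc t01; have [_ _ /(_ a)] := vP t t01; rewrite omega_i.
Qed.

(** Moving through the slices over a fixed [e] gives dE = 0 with tau varying, which [steep] allows
    only for timelike vectors. *)
Lemma slice_vertical s e : sa < s < 0 -> `|e| < r -> exists v, [/\ is_derive s 1 (S^~ e) v,
  sqn (S s e) v < 0 & 0 < sgn * v 0 ti].
Proof.
move=> ss er; have ss' : sa <= s < 0 by case/andP: ss => /ltW -> ->.
have [BS fS _ Sc] := SP ss' er.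
have near_s : \forall t \near (s : R), sa <= t < 0.
  by near=> t; apply/andP; split; [apply: ltW|]; near: t; [apply: lt_nbhsr|apply: lt_nbhsl];
    case/andP: ss.
have xc : {for s, continuous (S^~ e)}.
  apply/continuous_epsP => eps eps0; have [d d0 dP] := Sc eps eps0.
  have /nbhs_ballP[d1 /= d10 d1P] := near_s.
  exists (Num.min d1 d); first by rewrite lt_min d10.
  move=> t; rewrite lt_min => /andP[t1 t2]; apply: dP => //; last by rewrite subrr normr0.
  by apply: d1P; rewrite -ball_normE /= distrC.
have [|vd vJ] := @lift_derive R _ fs Js B fs_strict Js_unit (S^~ e) s (tspt (vc s 0 ti) 0) BS xc.
  apply: (@is_derive_near_eq _ _ (fun t : R => tspt (c t 0 ti) e)).
    by apply: filterS near_s => t tt; have [_ -> _ _] := SP tt er.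
  apply/is_derive_mxP => i j; rewrite ord1; have [->|[a ->]] := ti_or_si j.
    rewrite tspt_ti (_ : (fun _ => _) = fun t => c t 0 ti); last first.
      by apply/funext => t; rewrite tspt_ti.
    by have /is_derive_mxP := dc ss'.
  rewrite (_ : (fun _ => _) = fun=> e 0 a); last first.
    by apply/funext => t; rewrite /tspt row_mxEr.
  by rewrite /tspt row_mxEr mxE; exact: is_derive_cst.
set v := _ *m invmx _ in vd vJ *; exists v; rewrite mul_Js in vJ.
have vt : v 0 ti = vc s 0 ti by rewrite -(tspt_ti (v 0 ti) (dE (S s e) v)) vJ tspt_ti.
have vE : dE (S s e) v = 0 by rewrite -(tspt_s (v 0 ti) (dE (S s e) v)) vJ tspt_s.
have vF := c_future ss'; split=> //; last by rewrite vt.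
apply: timelike_vertical => //; rewrite vt.
by apply/eqP => v0; rewrite v0 mulr0 ltxx in vF.
Unshelve. all: by end_near. Qed.

Section orbits.
Variable i : 'I_n.
Hypothesis i0 : i != 0.

(* The translates of [c s] by [h] in the direction [i] leave the disc of radius [q] in the slice of
   [c s] at [h = u], over the point [e]. *)
Definition leaves_at (q s u : R) (e : 'rV[R]_n) := [/\ 0 <= u, u <= C * q / scl w i (c s 0 ti),
  forall h, 0 <= h <= u -> exists2 e', `|e'| <= q & act (tr i h) (c s) = S s e',
  `|e| = q & act (tr i u) (c s) = S s e].

(** The orbit of [c s] stays in its slice and raises x_i by h, while x_i varies by at most C q / a_i
    over the compact disc. So there is a last [u] up to which the orbit stays over the disc. *)
Lemma orbit_leaves q s : sa <= s < 0 -> 0 < q < r -> exists u e, leaves_at q s u e.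
Proof.
move=> ss /andP[q0 qr]; have le_r (e : 'rV[R]_n) : `|e| <= q -> `|e| < r by move=> /le_lt_trans; apply.
pose Z : set M := S s @` [set e | `|e| <= q].
have Sc (e : 'rV[R]_n) : `|e| <= q -> {for e, continuous (S s)}.
  move=> eq; have [_ _ _ Sc] := SP ss (le_r e eq); apply/continuous_epsP => eps eps0.
  have [d d0 dP] := Sc eps eps0; have g0 : 0 < r - `|e| by rewrite subr_gt0 le_r.
  exists (Num.min d (r - `|e|)); first by rewrite lt_min d0.
  move=> e'; rewrite lt_min => /andP[e1 e2]; apply: dP => //; last by rewrite subrr normr0.
  by have := ler_normD (e' - e) e; rewrite subrK; lra.
have closedZ : closed Z.
  apply: compact_closed; first exact: norm_hausdorff.
  apply: continuous_compact; first by apply: continuous_in_subspaceT => e /set_mem; exact: Sc.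
  apply: bounded_closed_compact.
    by exists q; split; [exact: num_real|move=> y qy e /= /le_trans; apply; exact: ltW].
  rewrite (_ : [set _ | _] = (fun e : 'rV[R]_n => `|e|) @^-1` [set t | t <= q]) //.
  by apply: closed_comp; [move=> e _; exact: norm_continuous|exact: closed_le].
pose sig h := act (tr i h) (c s).
pose A : set R := [set u | 0 <= u /\ forall h, 0 <= h <= u -> Z (sig h)].
have S0 : S s 0 = c s by have [] := SP ss (le_r 0 ltac:(by rewrite normr0 ltW)).
have Z0 : Z (sig 0) by exists 0; rewrite /= ?normr0 ?(ltW q0) // S0 /sig act_tr0.
have A0 : A 0.
  by split=> // h /andP[h0 h1]; have -> : h = 0 by apply/le_anti; rewrite h0 h1.
have Ab h : A h -> h <= C * q / scl w i (c s 0 ti).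
  move=> [h0 hZ]; have [e /= eq eE] := hZ h (introT andP (conj h0 (lexx h))).
  have [_ /(_ i i0)] := slice_segment ss (le_r 0 ltac:(by rewrite normr0 ltW)) (le_r e eq).
  rewrite eE S0 /sig act_tr_i // addrK subr0 => H; apply: le_trans (ler_norm _) (le_trans H _).
  by rewrite ler_wpM2r ?invr_ge0 ?scl_ge0 // ler_wpM2l.
have supA : has_sup A by split; [exists 0|exists (C * q / scl w i (c s 0 ti))].
set u := sup A.
have u0 : 0 <= u by exact: ub_le_sup supA.2 _ A0.
have Zlt h : 0 <= h < u -> Z (sig h).
  move=> /andP[h0 hu]; have d0 : 0 < u - h by rewrite subr_gt0.
  have [h' [_ h'Z] hh] := sup_adherent d0 supA; apply: h'Z; rewrite h0 /=.
  by move: hh; rewrite -/u; lra.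
have sig_cont h eps : 0 < eps -> exists2 d : R, 0 < d & forall h', `|h' - h| < d ->
    `|sig h' - sig h| < eps.
  move=> eps0; have [d d0 dP] := act_tr_cont i h (c s) eps0; exists d => // h' hh.
  by apply: dP => //; rewrite subrr normr0.
have Zu : Z (sig u).
  apply: contrapT => nZ; have oZ : open (~` Z) by exact: closed_openC.
  have [d d0 dP] := open_ball_sub oZ nZ.
  have [d1 d10 d1P] := sig_cont u d d0.
  have [uE|un0] := eqVneq u 0; first by apply: nZ; rewrite uE.
  have up : 0 < u by rewrite lt_neqAle eq_sym un0.
  pose h := Num.max 0 (u - d1 / 2).
  have hu : 0 <= h < u by rewrite /h le_max lexx gt_max up; lra.
  apply: (dP (sig h)); last exact: Zlt.
  apply: d1P; rewrite distrC ger0_norm; last by case/andP: hu => _ /ltW; rewrite subr_ge0.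
  have hh : u - d1 / 2 <= h by rewrite /h le_max lexx orbT.
  by clearbody h; lra.
have Zle h : 0 <= h <= u -> Z (sig h).
  move=> /andP[h0]; rewrite le_eqVlt => /orP[/eqP -> //|hu]; apply: Zlt.
  by rewrite h0.
have Au : A u by split.
have [e /= eq eE] := Zu; exists u, e; split=> //.
- exact: Ab.
- by move=> h /Zle [e' /= e'q e'E]; exists e' => //; exact: esym.
(* At an interior point of the disc the local section of [fs] would identify a longer piece of the
   orbit with points of the slice. *)
apply/eqP; rewrite eq_le eq leNgt; apply/negP => eq'.
have [BS Sti ES] := slice_point ss (le_r e eq).
have [d d0 [b b0 [Q [_ QP _] _]]] := local_section openB fs_strict Js_unit BS.
have fc := strict_diff_continuous (fs_strict BS).
have [d1 d10 d1P] := proj1 (continuous_epsP _ _) (Sc e eq) _ d0.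
have m0 : 0 < Num.min (Num.min b (q - `|e|)) d1 by rewrite !lt_min b0 d10 subr_gt0 eq'.
have [d2 d20 d2P] := proj1 (continuous_epsP _ _) fc _ m0.
have m1 : 0 < Num.min d d2 by rewrite lt_min d0.
have [d3 d30 d3P] := sig_cont u _ m1.
have good h : `|h - u| < d3 -> Z (sig h).
  move=> /d3P; rewrite -eE lt_min => /andP[h1 h2].
  have := d2P _ h2; rewrite !lt_min => /andP[/andP[h3 h4] h5].
  have Ed : `|E (sig h) - e| <= `|fs (sig h) - fs (S s e)|.
    by have := rnorm_le (fs (sig h) - fs (S s e)); rewrite rsubB !tspt_s ES.
  have Eq : `|E (sig h)| <= q.
    by have := ler_normD (E (sig h) - e) e; rewrite subrK; lra.
  exists (E (sig h)) => //; have er := le_r _ Eq.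
  have [_ fS _ _] := SP ss er.
  have fE : fs (S s (E (sig h))) = fs (sig h).
    by rewrite fS /fs /sig act_ti.
  rewrite -(QP (S s (E (sig h)))) ?fE //; first by rewrite QP.
  by apply: d1P; exact: le_lt_trans Ed h5.
have : A (u + d3 / 2).
  split=> [|h /andP[h0 h1]]; first by lra.
  have [hu|uh] := leP h u; first by apply: Zle; rewrite h0.
  by apply: good; rewrite ger0_norm; lra.
by move=> /(ub_le_sup supA.2); rewrite -/u; lra.
Qed.

Variable q : R.
Hypothesis q_gt0 : 0 < q.
Hypothesis qr : r = 2 * q.
Hypothesis qr1 : 4 * L ^+ 2 * q <= r1.
Hypothesis sa_lt0 : sa < 0.
Hypothesis sa_small : - sa <= q / (8 * L).
Hypothesis c_timelike : forall s, sa <= s < 0 -> sqn (c s) (vc s) < 0.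
Hypothesis shrinking : forall d, 0 < d -> exists2 s0, s0 < 0 &
  forall s, sa <= s < 0 -> s0 < s -> C * q / scl w i (c s 0 ti) < d.

(** The error allowed at the ends of the translated curves. With [sa_small] the losses eps, L eps
    and L |sa| are at most q/16, q/16 and q/8, so a timelike curve that spans the horizontal
    distance q still climbs by 3/4 of q / L. *)
Let eps := q / (16 * L).

Let L_gt0 : 0 < L. Proof. exact: lt_le_trans ltr01 L_ge1. Qed.

Let q_le_r (e : 'rV[R]_n) : `|e| <= q -> `|e| < r.
Proof. by rewrite qr => eq; rewrite (le_lt_trans eq) // ltr_pMl // ltr1n. Qed.

Let slice_T s e : sa <= s < 0 -> `|e| <= q -> `|T (S s e) - s| <= L * q.
Proof.
move=> ss eq; have z0 : `|0 : 'rV[R]_n| < r by rewrite normr0.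
have [+ _] := slice_segment ss z0 (q_le_r eq).
have [_ _ -> _] := SP ss z0; rewrite f_axis // tspt_ti subr0 => /le_trans; apply.
by rewrite ler_wpM2l // ltW.
Qed.

Let sizes : [/\ 0 < eps, 16 * (L * eps) = q, L * (q / L) = q & q <= L * q].
Proof.
split; first by rewrite divr_gt0 // mulr_gt0.
- by rewrite /eps; field; rewrite lt0r_neq0.
- by field; rewrite lt0r_neq0.
- by rewrite ler_peMl // ltW.
Qed.

Let sizes' : [/\ L * q <= L * (L * q), 4 * (L * (L * q)) <= r1, eps <= L * eps,
  L * - sa <= q / 8 & - sa <= L * - sa].
Proof.
have [eps0 epsE LqL qLq] := sizes; split.
- by rewrite ler_wpM2l // ltW.
- by rewrite (_ : 4 * _ = 4 * L ^+ 2 * q) //; ring.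
- by rewrite ler_peMl // ltW.
- by rewrite -ler_pdivlMl // (le_trans sa_small) // le_eqVlt; apply/orP; left; apply/eqP;
    field; rewrite lt0r_neq0.
- by rewrite ler_peMl // oppr_ge0 ltW.
Qed.

Let translate_cont h0 (g : R -> M) (I : set R) :
  (forall k, I k -> forall e, 0 < e -> exists2 d, 0 < d & forall k', I k' -> `|k' - k| < d ->
    `|g k' - g k| < e) ->
  forall h k, I k -> forall e, 0 < e -> exists2 d, 0 < d & forall h' k', I k' ->
    `|h' - h| < d -> `|k' - k| < d ->
    `|act (tr i (h0 * h')) (g k') - act (tr i (h0 * h)) (g k)| < e.
Proof.
move=> gc h k Ik e e0; have [d d0 dP] := act_tr_cont i (h0 * h) (g k) e0.
have [d' d'0 d'P] := gc k Ik d d0.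
have N0 : 0 < `|h0| + 1 by rewrite ltr_wpDl.
exists (Num.min (d / (`|h0| + 1)) d'); first by rewrite lt_min d'0 divr_gt0.
move=> h' k' Ik'; rewrite !lt_min => /andP[h1 _] /andP[_ k1].
apply: dP; last exact: d'P.
rewrite -mulrBr normrM; apply: (@le_lt_trans _ _ ((`|h0| + 1) * `|h' - h|)).
  by rewrite ler_wpM2r // lerDl.
by rewrite mulrC -ltr_pdivlMr.
Qed.

Let sqn_act h x v : sqn (act (tr i h) x) (dact (tr i h) v) = sqn x v.
Proof. by rewrite /sqn pairing_act. Qed.

(* The translate by [u] of the axis is timelike from near [c sa] to the exit point over [e], hence
   ascends by at least |e| / L. *)
Lemma leaves_high : exists2 s0, s0 < 0 & forall s u e, sa < s < 0 -> s0 < s ->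
  leaves_at q s u e -> 3 / 4 * (q / L) <= T (S s e).
Proof.
have [eps0 epsE LqL qLq] := sizes.
have saI : sa <= sa < 0 by rewrite lexx.
have Bsa := Bc saI.
have [d1 d10 d1P] := open_ball_sub openB Bsa.
have [d2 d20 d2P] := proj1 (continuous_epsP _ _) (strict_diff_continuous (fJ Bsa)) _ eps0.
have m0 : 0 < Num.min d1 d2 by rewrite lt_min d10.
have [d d0 dP] := act_tr_cont i 0 (c sa) m0.
have [s0 s00 s0P] := shrinking d0.
exists s0 => // s u e /andP[sas s_lt0] s0s [u0 uC uS eq uE].
have ss : sa <= s < 0 by rewrite (ltW sas).
have eqle : `|e| <= q by rewrite eq.
have near_sa h : 0 <= h <= u -> B (act (tr i h) (c sa)) /\
    `|f (act (tr i h) (c sa)) - f (c sa)| < eps.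
  move=> /andP[h0 hu]; have hd : `|h - 0| < d.
    by rewrite subr0 ger0_norm // (le_lt_trans (le_trans hu uC)) // s0P.
  have := dP h (c sa) hd; rewrite subrr normr0 act_tr0 lt_min => /(_ d0) /andP[g1 g2].
  by split; [exact: d1P|exact: d2P].
have sub k : sa <= k <= s -> sa <= k < 0 by move=> /andP[-> /le_lt_trans]; apply.
suff H : `|E (act (tr i u) (c s)) - E (act (tr i u) (c sa))|
    <= L * (T (act (tr i u) (c s)) - T (act (tr i u) (c sa))).
  have [_ n2] := near_sa u (introT andP (conj u0 (lexx u))).
  rewrite uE in H; have [_ _ ES] := slice_point ss (q_le_r eqle).
  have ET := mx_norm_coord (f (act (tr i u) (c sa)) - f (c sa)) 0 ti.
  have EE := rnorm_le (f (act (tr i u) (c sa)) - f (c sa)).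
  rewrite rsubB in EE; rewrite mxE [X in _ + X]mxE in ET.
  rewrite !(f_axis saI) tspt_s tspt_ti subr0 in EE ET n2.
  rewrite ES in H.
  have H1 := ler_normD (e - E (act (tr i u) (c sa))) (E (act (tr i u) (c sa))); rewrite subrK eq in H1.
  have H2 : q - eps <= L * (T (S s e) - (sa - eps)).
    have : L * (T (S s e) - T (act (tr i u) (c sa))) <= L * (T (S s e) - (sa - eps)).
      rewrite ler_pM2l // lerB //; move: ET; rewrite ler_norml; lra.
    by lra.
  rewrite -(ler_pM2l L_gt0) mulrCA LqL.
  have [_ _ H4 H3 _] := sizes'.
  move: H2 H3 H4 epsE; rewrite !mulrBr mulrN; set A1 := L * T (S s e); set A2 := L * eps; set A3 := L * sa.
  lra.
(* The homotopy moves the axis to its translate by [u]: the lower ends stay within eps of [c sa],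
   and the upper ends run over the disc in the slice of [c s], where |T| <= L q up to the height of
   the axis. *)
apply: (@confinement (fun h k => act (tr i h) (c k)) (fun h k => dact (tr i h) (vc k))
  u sa s (sa - eps) (L * q) q r1 r1 u0 (ltW sas) r1rho (lexx r1)) => //.
- have [H1 H2 H3 H4 H5] := sizes'; move: H1 H2 H3 H4 H5 epsE qLq.
  by set A := L * (L * q); set A1 := L * q; set A2 := L * eps; set A3 := L * - sa; lra.
- have [H1 H2 _ _ _] := sizes'; apply: le_trans (le_trans H1 _) H2.
  by rewrite ler_peMl ?mulr_ge0 ?(ltW q_gt0) ?(ltW L_gt0) // ler1n.
- have [H1 H2 H3 H4 H5] := sizes'; move: H1 H2 H3 H4 H5 epsE qLq; rewrite !mulrBr mulrN.
  by set A := L * (L * q); set A1 := L * q; set A2 := L * eps; set A3 := L * sa; lra.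
- move=> h k hU kI e1 e10.
  have [k'|d3 d30 d3P] := @translate_cont 1 c [set k | sa <= k <= s] _ h k kI e1 e10.
    move=> /sub kI' e2 e20; have [d3 d30 d3P] := proj1 (continuous_epsP _ _) (axis_cont kI') _ e20.
    by exists d3 => // k'' _; exact: d3P.
  by exists d3 => // h' k' _ kI' h1 k1; have := d3P h' k' kI' h1 k1; rewrite !mul1r.
- by move=> h k _ kI; apply: is_derive_act; exact: dc (sub k kI).
- by move=> h k _ kI; rewrite sqn_act dact_ti; split; [apply: c_timelike|apply: c_future]; exact: sub.
- move=> h hU; have [Bh fh] := near_sa h hU; rewrite f_axis // in fh; split=> //.
    have EE := rnorm_le (f (act (tr i h) (c sa)) - tspt sa 0).
    rewrite rsubB tspt_s subr0 in EE; have [_ _ H3 _ _] := sizes'; move: epsE H3.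
    by set A2 := L * eps; lra.
  have ET := mx_norm_coord (f (act (tr i h) (c sa)) - tspt sa 0) 0 ti.
  rewrite mxE [X in _ + X]mxE tspt_ti in ET; move: (le_lt_trans ET fh).
  by rewrite ltr_norml; lra.
- move=> h /uS[e' e'q ->]; have [BS _ ES] := slice_point ss (q_le_r e'q).
  rewrite ES; split=> //; have := slice_T ss e'q; rewrite ler_norml.
  by set A1 := L * q; lra.
- move=> k kI; rewrite act_tr0 f_axis ?sub // tspt_s normr0; split; first exact: Bc (sub k kI).
  by have [_ H2 _ _ _] := sizes'; apply: lt_le_trans H2; rewrite !mulr_gt0.
- by rewrite u0 lexx.
Qed.

(* Translating back by [u] the vertical curve over [e] gives a timelike curve ending at [c s], at
   distance about |e| from its starting point near the slice of [c b]. *)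
Lemma leaves_low b eb : sa < b < 0 -> `|eb| <= q -> exists2 d, 0 < d &
  exists2 s0, s0 < 0 & forall s u e, b < s < 0 -> s0 < s -> leaves_at q s u e -> `|e - eb| < d ->
    T (S b e) <= - (3 / 4 * (q / L)).
Proof.
move=> /andP[sab b0] ebq; have [eps0 epsE LqL qLq] := sizes.
have bI : sa <= b < 0 by rewrite ltW.
have [Bb _ _ Sbc] := SP bI (q_le_r ebq).
have [d1 d10 d1P] := open_ball_sub openB Bb.
have eps20 : 0 < eps / 2 by rewrite divr_gt0.
have [d2 d20 d2P] := proj1 (continuous_epsP _ _) (strict_diff_continuous (fJ Bb)) _ eps20.
have m0 : 0 < Num.min d1 d2 by rewrite lt_min d10.
have [d d0 dP] := act_tr_cont i 0 (S b eb) m0.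
have [d3 d30 d3P] := Sbc d d0.
have [s0 s00 s0P] := shrinking d0.
exists d3 => //; exists s0 => // s u e /andP[bs s_lt0] s0s [u0 uC uS eq uE] eeb.
have ss : sa <= s < 0 by rewrite (ltW (lt_trans sab bs)).
have eqle : `|e| <= q by rewrite eq.
have er := q_le_r eqle.
have close_e : `|S b e - S b eb| < d.
  by apply: d3P => //; rewrite subrr normr0.
have near_b h : 0 <= h <= u -> B (act (tr i (- h)) (S b e)) /\
    `|f (act (tr i (- h)) (S b e)) - f (S b e)| < eps.
  move=> /andP[h0 hu]; have hd : `|- h - 0| < d.
    by rewrite subr0 normrN ger0_norm // (le_lt_trans (le_trans hu uC)) // s0P.
  have := dP (- h) (S b e) hd close_e; rewrite act_tr0 lt_min => /andP[g1 g2].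
  have := dP 0 (S b e); rewrite subrr normr0 !act_tr0 lt_min => /(_ d0 close_e) /andP[_ g3].
  split; first exact: d1P.
  have := d2P _ g2; have := d2P _ g3; rewrite distrC.
  have := ler_normD (f (act (tr i (- h)) (S b e)) - f (S b eb)) (f (S b eb) - f (S b e)).
  by rewrite addrA subrK; lra.
have sub k : b <= k <= s -> sa < k < 0.
  by move=> /andP[bk ks]; rewrite (lt_le_trans sab bk) (le_lt_trans ks).
have sub' k : b <= k <= s -> sa <= k < 0 by move=> /sub /andP[/ltW -> ->].
have [BSb _ ESb] := slice_point bI er.
have Tb := slice_T bI eqle.
suff H : `|E (act (tr i (- u)) (S s e)) - E (act (tr i (- u)) (S b e))|
    <= L * (T (act (tr i (- u)) (S s e)) - T (act (tr i (- u)) (S b e))).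
  have [_ n2] := near_b u (introT andP (conj u0 (lexx u))).
  rewrite -uE act_trD addNr act_tr0 (f_axis ss) tspt_s tspt_ti sub0r normrN in H.
  have ET := mx_norm_coord (f (act (tr i (- u)) (S b e)) - f (S b e)) 0 ti.
  have EE := rnorm_le (f (act (tr i (- u)) (S b e)) - f (S b e)).
  rewrite rsubB ESb in EE; rewrite mxE [X in _ + X]mxE in ET.
  have H1 := ler_normB (E (act (tr i (- u)) (S b e))) (E (act (tr i (- u)) (S b e)) - e).
  rewrite opprB addrC subrK eq in H1.
  have H2 : q - eps <= L * (eps - T (S b e)).
    have : L * (s - T (act (tr i (- u)) (S b e))) <= L * (eps - T (S b e)).
      by rewrite ler_pM2l //; move: (le_lt_trans ET n2); rewrite ltr_norml; lra.
    by lra.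
  rewrite -(ler_pM2l L_gt0) mulrN mulrCA LqL.
  have [_ _ H4 _ _] := sizes'.
  by move: H2 H4 epsE; rewrite !mulrBr; set A1 := L * T (S b e); set A2 := L * eps; lra.
have vex k : exists v, b <= k <= s -> [/\ is_derive k 1 (S^~ e) v, sqn (S k e) v < 0 &
    0 < sgn * v 0 ti].
  have [kI|] := boolP (b <= k <= s); last by exists 0.
  by have [v vP] := slice_vertical (sub k kI) er; exists v.
have [v vP] := choice vex.
(* The homotopy moves the vertical curve over [e] back by [u]. Its upper ends run backwards along
   the orbit to [c s], and its lower ends stay near [S b e], at horizontal distance at most q + eps
   <= 2q. *)
apply: (@confinement (fun h k => act (tr i (- h)) (S k e)) (fun h k => dact (tr i (- h)) (v k))
  u b s (sa - L * q - eps) (L * q) (2 * q) r1 r1 u0 (ltW bs) r1rho (lexx r1)).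
- have [H1 H2 H3 H4 H5] := sizes'; move: H1 H2 H3 H4 H5 epsE qLq.
  by set A := L * (L * q); set A1 := L * q; set A2 := L * eps; set A3 := L * - sa; lra.
- have [H1 H2 _ _ _] := sizes'; apply: le_trans (le_trans H1 _) H2.
  by rewrite ler_peMl ?mulr_ge0 ?(ltW q_gt0) ?(ltW L_gt0) // ler1n.
- have [H1 H2 H3 H4 H5] := sizes'; move: H1 H2 H3 H4 H5 epsE qLq; rewrite !mulrBr mulrN.
  by set A := L * (L * q); set A1 := L * q; set A2 := L * eps; set A3 := L * sa; lra.
- move=> h k hU kI e1 e10.
  have [k'|d4 d40 d4P] := @translate_cont (-1) (S^~ e) [set k | b <= k <= s] _ h k kI e1 e10.
    move=> kI' e2 e20; have [_ _ _ /(_ e2 e20) [d4 d40 d4P]] := SP (sub' _ kI') er.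
    by exists d4 => // k'' kI'' kk; apply: d4P => //; [exact: sub'|rewrite subrr normr0].
  by exists d4 => // h' k' _ kI' h1 k1; have := d4P h' k' kI' h1 k1; rewrite !mulN1r.
- by move=> h k _ kI; apply: is_derive_act; case: (vP k kI).
- by move=> h k _ kI; rewrite sqn_act dact_ti; case: (vP k kI).
- move=> h hU; have [Bh fh] := near_b h hU; split=> //.
    have EE := rnorm_le (f (act (tr i (- h)) (S b e)) - f (S b e)).
    rewrite rsubB ESb in EE.
    have EN := ler_normD (E (act (tr i (- h)) (S b e)) - e) e; rewrite subrK eq in EN.
    have [_ _ H3 _ _] := sizes'; move: epsE H3.
    by set A2 := L * eps; lra.
  have ET := mx_norm_coord (f (act (tr i (- h)) (S b e)) - f (S b e)) 0 ti.
  rewrite mxE [X in _ + X]mxE in ET; move: (le_lt_trans ET fh) Tb.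
  by rewrite ltr_norml ler_norml; set A1 := L * q; lra.
- move=> h /andP[h0 hu]; rewrite -uE act_trD.
  have [|e' e'q ->] := uS (- h + u).
    by rewrite addrC subr_ge0 hu gerBl h0.
  have [BS _ ES] := slice_point ss (q_le_r e'q).
  rewrite ES; split=> //; first by rewrite (le_trans e'q) // ler_peMl ?ler1n // ltW.
  by have := slice_T ss e'q; rewrite ler_norml; set A1 := L * q; lra.
- move=> k kI; rewrite oppr0 act_tr0; have [BS _ ES] := slice_point (sub' k kI) er.
  rewrite ES eq; split=> //.
  have [H1 H2 _ _ _] := sizes'; move: H1 H2 qLq q_gt0.
  by set A := L * (L * q); set A1 := L * q; lra.
- by rewrite u0 lexx.
Qed.

(** Two exit points close to a cluster point lie within 2 rad of each other, yet over them the slice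
    of [c b] has heights at least 3/4 and at most - 3/4 of q / L. *)
Lemma no_axis : False.
Proof.
have [eps0 epsE LqL qLq] := sizes.
have ex s : exists p : R * 'rV[R]_n, sa <= s < 0 -> leaves_at q s p.1 p.2.
  have [ss|] := boolP (sa <= s < 0); last by exists (0, 0).
  have qI : 0 < q < r by rewrite q_gt0 qr ltr_pMl // ltr1n.
  by have [u [e uP]] := orbit_leaves ss qI; exists (u, e).
have [P PP] := choice ex; pose W s := (P s).2.
have Wq s : sa <= s < 0 -> `|W s| = q by move=> /PP[].
pose D : set 'rV[R]_n := [set e | `|e| <= q].
have Dc : compact D.
  apply: bounded_closed_compact.
    by exists q; split; [exact: num_real|move=> y qy e /= /le_trans; apply; exact: ltW].
  rewrite /D (_ : [set _ | _] = (fun e : 'rV[R]_n => `|e|) @^-1` [set t | t <= q]) //.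
  by apply: closed_comp; [move=> e _; exact: norm_continuous|exact: closed_le].
have tail t : t < 0 -> \forall s \near at_left (0 : R), t < s < 0.
  by move=> t0; near=> s; apply/andP; split; near: s; [exact: nbhs_left_gt|exact: nbhs_left_lt].
have WD : (W @ at_left (0 : R)) D.
  by apply: filterS (tail sa sa_lt0) => s /andP[/ltW s1 s2]; rewrite /= /D /= Wq ?s1.
have [eb [ebD clu]] := Dc _ _ WD.
have [s0 s00 s0P] := leaves_high.
(* On a distance 2 rad a slice rises by at most L (2 rad) = q / (2 L), less than the gap 3 q / (2
   L). *)
pose rad := q / (4 * L ^+ 2).
have rad0 : 0 < rad by rewrite divr_gt0 // mulr_gt0 // exprn_gt0.
have pick t d : t < 0 -> 0 < d -> exists2 s, t < s < 0 & `|W s - eb| < d.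
  move=> t0 d0; have FA : (W @ at_left (0 : R)) (W @` [set s | t < s < 0]).
    by apply: filterS (tail t t0) => s st; exists s.
  have NB : nbhs eb (ball eb d) by exact: nbhsx_ballx.
  have [_ [[s /= st <-]]] := clu _ _ FA NB; rewrite -ball_normE /= distrC => sb.
  by exists s.
have m0 : Num.max s0 sa < 0 by rewrite gt_max s00.
have [b bI bW] := pick _ _ m0 rad0.
have {bI} [sab bs0 b0] : [/\ sa < b, s0 < b & b < 0].
  by move: bI; rewrite gt_max => /andP[/andP[]].
have bI : sa <= b < 0 by rewrite (ltW sab).
have high : 3 / 4 * (q / L) <= T (S b (W b)).
  by apply: (s0P b (P b).1) => //; [rewrite sab|exact: PP].
(* The bound from above holds near the cluster point within a distance depending on [b], so [s] is
   chosen only after [b]. *)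
have [d d0 [s1 s10 low]] := leaves_low (introT andP (conj sab b0)) ebD.
have m1 : Num.max s1 b < 0 by rewrite gt_max s10.
have dm : 0 < Num.min d rad by rewrite lt_min d0.
have [s sI] := pick _ _ m1 dm; rewrite lt_min => /andP[sd srad].
have {sI} [s1s bs s_lt0] : [/\ s1 < s, b < s & s < 0].
  by move: sI; rewrite gt_max => /andP[/andP[]].
have ss : sa <= s < 0 by rewrite (ltW (lt_trans sab bs)).
have {low} low : T (S b (W s)) <= - (3 / 4 * (q / L)).
  by apply: (low s (P s).1) => //; [rewrite bs|exact: PP].
have Wb : `|W b| <= q by rewrite Wq.
have Ws : `|W s| <= q by rewrite Wq.
have [lip _] := slice_segment bI (q_le_r Ws) (q_le_r Wb).
have dist : `|W b - W s| <= 2 * rad.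
  have := ler_normD (W b - eb) (eb - W s); rewrite addrA subrK [`|eb - _|]distrC; lra.
have Lrad : L * (2 * rad) = q / L / 2 by rewrite /rad; field; rewrite lt0r_neq0.
have : L * `|W b - W s| <= q / L / 2 by rewrite -Lrad ler_pM2l.
have qL0 : 0 < q / L by rewrite divr_gt0.
by move: lip qL0 high low; rewrite ler_norml; set A := L * _; set A1 := q / L; lra.
Unshelve. all: by end_near. Qed.

End orbits.

End axis.
End boxes.

(** * Vertical segments leading out of the image *)

Section exits.
Context {R : realType} {m : nat}.
Local Notation n := (m.*2.+1).
Local Notation M := 'rV[R]_(1 + n).
Variables (nu : R -> R) (w : 'I_n -> R -> R).
Hypothesis nu_gt0 : forall t, 0 < nu t.
Hypothesis w_gt0 : forall a t, 0 < w a t.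
Hypothesis nu_cont : continuous nu.
Hypothesis w_cont : forall a, continuous (w a).
Variables (f : M -> M) (J : M -> 'M[R]_(1 + n)) (B : set M) (L C rho sgn : R).
Local Notation dT x u := ((u *m J x) 0 ti).
Local Notation dE x u := (rsubmx (u *m J x)).
Hypothesis openB : open B.
Hypothesis fJ : forall x, B x -> strict_diff f (J x) x.
Hypothesis Ju : forall x, B x -> J x \in unitmx.
Hypothesis L_ge1 : 1 <= L.
Hypothesis C_ge0 : 0 <= C.
Hypothesis rho_gt0 : 0 < rho.
Hypothesis closedB : forall z r, `|z| + r < rho -> closed (B `&` [set x | `|f x - z| <= r]).
Hypothesis wide : forall x u, B x -> sqn nu w x u <= 0 -> `|dE x u| <= L * `|dT x u|.
Hypothesis steep : forall x u, B x -> 0 <= sqn nu w x u -> `|dT x u| <= L * `|dE x u|.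
Hypothesis bounded_by : forall x u, B x -> sqn nu w x u <= C ^+ 2 * `|dE x u| ^+ 2.
Hypothesis oriented : forall x u, B x -> sqn nu w x u < 0 -> 0 < sgn * u 0 ti -> 0 < dT x u.
Hypothesis sgn1 : sgn = 1 \/ sgn = -1.
Variable i : 'I_n.
Hypothesis i0 : i != 0.
Hypothesis growing : forall K, exists T, forall t, T <= sgn * t -> K <= w i t.

Lemma sqnN x (u : M) : sqn nu w x (- u) = sqn nu w x u.
Proof. by rewrite /sqn /pairing linearN /= !mulNmx mulmxN opprK. Qed.

Lemma sqn_lt0_ti x (u : M) : sqn nu w x u < 0 -> u 0 ti != 0.
Proof.
by move=> u0; apply/eqP => ui; have := sqn_slice_ge0 nu w_gt0 x ui; rewrite leNgt u0.
Qed.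

Lemma timelike_omega x (u : M) a : sqn nu w x u < 0 ->
  omega x u a ^+ 2 <= nu (tau x) / w a (tau x) * u 0 ti ^+ 2.
Proof.
move=> u0; rewrite mulrAC ler_pdivlMr // mulrC.
have : w a (tau x) * omega x u a ^+ 2 <= \sum_b w b (tau x) * omega x u b ^+ 2.
  rewrite (bigD1 a) //= lerDl sumr_ge0 // => b _.
  by rewrite mulr_ge0 ?sqr_ge0 // ltW.
by move: u0; rewrite sqnE; lra.
Qed.

Lemma ratio_bounded (a b : R) : a <= b -> exists2 K, 0 < K &
  forall t j, a <= t <= b -> nu t / w j t <= K ^+ 2.
Proof.
move=> ab; have ex j : exists K, forall t, a <= t <= b -> nu t / w j t <= K.
  have rc : {within `[a, b], continuous (fun t => nu t / w j t)}.
    apply: continuous_in_subspaceT => t _; apply: cvgM; first exact: nu_cont.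
    by apply: cvgV; [rewrite lt0r_neq0|exact: w_cont].
  have [t tI tP] := EVT_max ab rc.
  by exists (nu t / w j t) => s sI; apply: tP; rewrite in_itv.
have [K KP] := choice ex.
have r0 j t : 0 <= nu t / w j t by rewrite divr_ge0 // ltW.
have K0 j : 0 <= K j by apply: le_trans (r0 j a) (KP j a _); rewrite lexx.
have S0 : 0 <= \sum_j K j by exact: sumr_ge0.
exists (1 + \sum_j K j); first by rewrite ltr_wpDr.
move=> t j /KP H; apply: le_trans (H j) _.
have Kj : K j <= \sum_j K j by rewrite (bigD1 j) //= lerDl sumr_ge0.
apply: le_trans Kj _; set X := \sum_j K j in S0 *.
by rewrite sqrrD expr1n mul1r; have := sqr_ge0 X; lra.
Qed.

(** The lift of the vertical segment cannot reach its end and escapes at some height. With the box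
    recentred there, the lift is an axis as excluded by [no_axis], provided the scale factor a_i
    tends to infinity along it. *)
Lemma no_exit (x0 z0 : M) (h : R) : B x0 -> f x0 = z0 -> 0 < h ->
  `|z0| < rho / 2 -> `|z0 + tspt h 0| < rho / 2 ->
  ~ (forall x, B x -> f x <> z0 + tspt h 0).
Proof.
move=> Bx0 fx0 h0 z0r z1r nz.
case: (ray_lift_or_escape openB fJ Ju (tspt h 0) Bx0) => [[c [x [c1 [xP _]]]]|].
  have [_ Bx fx] := xP 1 c1; apply: (nz (x 1) Bx).
  by rewrite fx /ray_at fx0 (max_idPr ler01) scale1r.
move=> [c [x [/andP[c0 c1] [xP x00] nl]]].
pose zc := z0 + c *: tspt h 0.
have zcr : `|zc| < rho / 2.
  have -> : zc = (1 - c) *: z0 + c *: (z0 + tspt h 0).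
    by rewrite /zc scalerDr addrA scalerBl scale1r subrK.
  apply: le_lt_trans (ler_normD _ _) _; rewrite !normrZ !ger0_norm ?subr_ge0 // ?(ltW c0) //.
  pose q := Num.max `|z0| `|z0 + tspt h 0|; have qr : q < rho / 2 by rewrite gt_max z0r.
  apply: le_lt_trans qr; have e1 : `|z0| <= q by rewrite le_max lexx.
  have e2 : `|z0 + tspt h 0| <= q by rewrite le_max lexx orbT.
  have H1 : (1 - c) * `|z0| <= (1 - c) * q by rewrite ler_wpM2l // subr_ge0.
  have H2 : c * `|z0 + tspt h 0| <= c * q by rewrite ler_wpM2l // ltW.
  by apply: le_trans (lerD H1 H2) _; rewrite -mulrDl subrK mul1r.
(* Puts the escape point at the origin and makes T the parameter, which runs from - c h to 0. *)
pose g y := f y - zc; pose ax s := x (c + s / h).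
have gJ y : B y -> strict_diff g (J y) y.
  move=> By e e0; have [d d0 dP] := fJ By e0; exists d => // y1 y2 h1 h2.
  have -> : g y1 - g y2 = f y1 - f y2 by rewrite /g opprB addrA subrK.
  exact: dP.
have axI (s : R) : - (c * h) < s < 0 -> 0 < c + s / h < c.
  move=> /andP[s1 s2]; have sh : s / h < 0 by rewrite pmulr_llt0 // invr_gt0.
  have sh' : - c < s / h by rewrite ltr_pdivlMr // mulNr.
  by apply/andP; split; lra.
have axP (s : R) : - (c * h) < s < 0 -> [/\ {for s, continuous ax}, B (ax s) & g (ax s) = tspt s 0].
  move=> /axI /andP[s1 s2]; have [xc Bx fx] := xP _ s2; split; [|exact: Bx|].
    apply: (@continuous_comp R R M (fun s : R => c + s / h) x s); last exact: xc.
    by apply: cvgD; [exact: cvg_cst|apply: cvgM; [exact: cvg_id|exact: cvg_cst]].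
  rewrite /g fx /ray_at fx0 (max_idPr (ltW s1)) /zc opprD addrACA subrr add0r.
  rewrite -scalerBl addrAC subrr add0r -[LHS]add0r -[X in X + _](_ : tspt 0 0 = 0).
    by rewrite tsptD add0r scaler0 addr0 divfK // lt0r_neq0.
  by apply: tspt_inj; rewrite ?tspt_ti ?tspt_s; [rewrite mxE|apply/rowP => a; rewrite !mxE].
pose v s := tspt 1 0 *m invmx (J (ax s)).
have vP (s : R) : - (c * h) < s < 0 -> is_derive s 1 ax (v s) /\ v s *m J (ax s) = tspt 1 0.
  move=> sI; have [ac Ba ga] := axP s sI.
  apply: (lift_derive gJ Ju Ba ac).
  apply: (@is_derive_near_eq _ _ (fun t : R => tspt 0 0 + t *: tspt 1 0)).
    near=> t; have [|_ _ ->] := axP t; last by rewrite tsptD add0r mulr1 scaler0 addr0.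
    by apply/andP; split; near: t; [apply: lt_nbhsr|apply: lt_nbhsl]; case/andP: sI.
  exact: is_derive_affine.
have vtl s : - (c * h) < s < 0 -> sqn nu w (ax s) (v s) < 0 /\ 0 < sgn * v s 0 ti.
  move=> sI; have [_ Ba _] := axP s sI; have [_ vJ] := vP s sI.
  have tl : sqn nu w (ax s) (v s) < 0.
    rewrite ltNge; apply/negP => /(steep Ba); rewrite vJ tspt_ti tspt_s normr0 mulr0.
    by rewrite normr1 leNgt ltr01.
  split=> //; have v0 := sqn_lt0_ti tl.
  have sn0 : sgn * v s 0 ti != 0 by rewrite mulf_neq0 //; case: sgn1 => ->; rewrite ?oppr_eq0 oner_neq0.
  rewrite lt_neqAle eq_sym sn0 leNgt; apply/negP => vn.
  have := oriented Ba (u := - v s); rewrite sqnN => /(_ tl).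
  rewrite mulNmx vJ; have -> : (- tspt 1 0 : M) 0 ti = -1 by rewrite mxE tspt_ti.
  have -> : (- v s) 0 ti = - v s 0 ti by rewrite mxE.
  by rewrite mulrN oppr_gt0 => /(_ vn); rewrite ltr0N1.
have ch0 : 0 < c * h by rewrite mulr_gt0.
pose ht s := sgn * ax s 0 ti.
have htd (s : R) : - (c * h) < s < 0 -> is_derive s 1 ht (sgn * v s 0 ti).
  move=> sI; have [/is_derive_mxP ad _] := vP s sI; have := ad 0 ti => ?.
  by apply: is_derive_eq; rewrite /GRing.scale /=; ring.
have htmono s t : - (c * h) < s -> s <= t -> t < 0 -> ht s <= ht t.
  move=> s1 st t2; apply: (derive_ge0_nondecreasing (df := fun s => sgn * v s 0 ti) st) => u /andP[u1 u2].
    by apply: htd; rewrite (lt_le_trans s1 u1) (le_lt_trans u2 t2).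
  by apply: ltW; case: (vtl u) => //; rewrite (lt_le_trans s1 u1) (le_lt_trans u2 t2).
have absht s : `|v s 0 ti| = `|sgn * v s 0 ti|.
  by rewrite normrM; case: sgn1 => ->; rewrite ?normrN normr1 mul1r.
(* With tau bounded, the frame velocities of a timelike curve are dominated by the growth of tau.
   The curve would converge, by [closedB] to a point of [B], and the lift would not escape. *)
have unbounded H : exists2 s, - (c * h) < s < 0 & H < ht s.
  apply: contrapT => nex.
  have bd s : - (c * h) < s < 0 -> ht s <= H.
    by move=> sI; rewrite leNgt; apply/negP => Hs; apply: nex; exists s.
  pose s1 := - (c * h) / 2; have s1I : - (c * h) < s1 < 0 by rewrite /s1; apply/andP; split; lra.
  have sub s : s1 < s < 0 -> - (c * h) < s < 0.
    by move=> /andP[a1 a2]; rewrite a2 andbT; case/andP: s1I => /lt_trans + _; apply.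
  have hH : ht s1 <= H by exact: bd.
  pose lo := Num.min (ht s1) (- H); pose hi := Num.max H (- ht s1).
  have lohi : lo <= hi by rewrite ge_min !le_max hH.
  have [K K0 KP] := ratio_bounded lohi.
  have tI s : s1 < s < 0 -> lo <= tau (ax s) <= hi.
    move=> sI; have H1 : ht s1 <= ht s by apply: htmono; [case/andP: s1I|case/andP: sI => /ltW|case/andP: sI].
    have H2 := bd s (sub s sI); rewrite tauE; move: H1 H2.
    rewrite /lo /hi ge_min le_max /ht; case: sgn1 => ->; rewrite ?mul1r ?mulN1r => H1 H2.
      by rewrite H1 H2.
    by rewrite opprK [- H <= _]lerNl H2 orbT -[_ <= ax s1 0 ti]lerN2 H1 orbT.
  have [l ll] : exists l : M, ax @ at_left (0 : R) --> l.
    have s10 : s1 < 0 by case/andP: s1I.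
    apply: (@curve_left_lim R m ax v ht (fun s => sgn * v s 0 ti) s1 0 (1 + K) H s10).
    - by rewrite addr_ge0 // ltW.
    - by move=> s /sub sI; case: (vP s sI).
    - by move=> s /sub; exact: htd.
    - by move=> s /sub /vtl[_ /ltW].
    - move=> s /sub /vtl[_ vs]; rewrite absht gtr0_norm // ler_peMl ?(ltW vs) // lerDl ltW //.
    - move=> s a sI; have [tl vs] := vtl s (sub s sI).
      have H1 := timelike_omega a tl; have H2 := KP _ a (tI s sI).
      have H3 : omega (ax s) (v s) a ^+ 2 <= (K * `|v s 0 ti|) ^+ 2.
        apply: le_trans H1 _; rewrite exprMn real_normK ?num_real // ler_wpM2r ?sqr_ge0 //.
      rewrite -real_normK ?num_real // ler_pXn2r ?nnegrE ?mulr_ge0 ?(ltW K0) // in H3.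
      rewrite -[X in _ * X](gtr0_norm vs) -absht; apply: le_trans H3 _.
      by rewrite ler_wpM2r // lerDr.
    - by move=> s /sub; exact: bd.
  have Bl : B l.
    suff [] : (B `&` [set y | `|f y - zc| <= rho / 4]) l by [].
    have r4 : rho / 4 < rho / 2 by move: rho_gt0; lra.
    have zr : `|zc| + rho / 4 < rho by rewrite [ltRHS]splitr; exact: ltrD.
    apply: (@closed_cvg _ _ _ _ ax _ (closedB zr) _ l ll); near=> s.
    have sI : - (c * h) < s < 0.
      by apply/andP; split; near: s; [apply: nbhs_left_gt; lra|exact: nbhs_left_lt].
    have [_ Ba ga] := axP s sI; split=> //=; rewrite -/(g _) ga.
    apply: norm_split; rewrite ?tspt_ti ?tspt_s ?normr0; last by rewrite divr_ge0 // ltW.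
    have s0 : s < 0 by case/andP: sI.
    rewrite ltr0_norm //.
    suff : - (rho / 4) < s by lra.
    by near: s; apply: nbhs_left_gt; rewrite oppr_lt0 divr_gt0.
  apply: (nl l Bl); move=> e e0.
  have [d d0 dP] := proj1 (left_limP _ _ _) ll e e0.
  exists (d / h); first by rewrite divr_gt0.
  move=> t /andP[t1 t2].
  have tE : x t = ax ((t - c) * h) by rewrite /ax mulfK ?lt0r_neq0 // addrC subrK.
  rewrite tE; apply: dP; apply/andP; split.
    rewrite sub0r -(opprK ((t - c) * h)) ltrN2 -mulNr opprB -ltr_pdivlMr //; lra.
  by rewrite pmulr_llt0 // subr_lt0.
(* Recentring leaves a ball of radius rho / 2, of which half is used; [q] gives equality in the size
   condition 4 L^2 q <= r1. *)
pose r1 := rho / 4; pose q := r1 / (4 * L ^+ 2).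
have L0 : 0 < L by exact: lt_le_trans ltr01 L_ge1.
have r10 : 0 < r1 by rewrite divr_gt0.
have q0 : 0 < q by rewrite divr_gt0 // mulr_gt0 // exprn_gt0.
(* The second bound keeps the axis within the lifted part of the segment. *)
pose sa := - Num.min (q / (8 * L)) (c * h / 2).
have qL0 : 0 < q / (8 * L) by rewrite divr_gt0 // mulr_gt0.
have saq : - sa <= q / (8 * L) by rewrite opprK ge_min lexx.
have sac : - (c * h) < sa.
  by rewrite ltrN2 gt_min; apply/orP; right; lra.
have sa0 : sa < 0 by rewrite oppr_lt0 lt_min qL0 divr_gt0.
have saI s : sa <= s < 0 -> - (c * h) < s < 0.
  by move=> /andP[a1 ->]; rewrite andbT; exact: lt_le_trans sac a1.
have closedG r : r < rho / 2 -> closed (B `&` [set y | `|g y| <= r]).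
  by move=> rr; apply: closedB; rewrite [ltRHS]splitr; exact: ltrD.
have r1rho : r1 < rho / 2 by rewrite /r1; move: rho_gt0; lra.
have qE : 4 * L ^+ 2 * q = r1 by rewrite /q; field; rewrite lt0r_neq0.
have small : - sa + L * (2 * q) <= r1.
  have H1 : q / (8 * L) <= q by rewrite ler_pdivrMr ?mulr_gt0 // ler_peMr ?(ltW q0) //; move: L_ge1; lra.
  have H2 : q <= L * q by rewrite ler_peMl // ltW.
  have H3 : L * q <= L ^+ 2 * q by rewrite expr2 -mulrA ler_peMl // mulr_ge0 // ltW.
  have H4 : - sa <= L ^+ 2 * q := le_trans saq (le_trans H1 (le_trans H2 H3)).
  rewrite -qE -mulrA (mulrCA L); move: H4 H2 H3 q0.
  by move: (- sa) (L ^+ 2 * q) (L * q) (q) => s A2 A1 q'; lra.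
have r0 : 0 < 2 * q by rewrite mulr_gt0.
have Bc s : sa <= s < 0 -> B (ax s) by move=> /saI /axP[].
have fa s : sa <= s < 0 -> g (ax s) = tspt s 0 by move=> /saI /axP[].
have da (s : R) : sa <= s < 0 -> is_derive s 1 ax (v s) by move=> /saI /vP[].
have fut s : sa <= s < 0 -> 0 < sgn * v s 0 ti by move=> /saI /vtl[].
have [S SP] := slices_exist w_gt0 openB gJ Ju L_ge1 C_ge0 closedG steep bounded_by r1rho r0 small Bc fa da.
apply: (no_axis w_gt0 openB gJ Ju L_ge1 C_ge0 closedG wide steep bounded_by oriented
  r1rho r0 Bc fa da fut SP i0 q0 _ _ sa0 saq) => //.
- by rewrite qE.
- by move=> s /saI /vtl[].
move=> d d0.
have [T0 TP] := growing ((C * q / d + 1) ^+ 2).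
have [s1 s1I s1T] := unbounded T0; exists s1; first by case/andP: s1I.
move=> s ss s1s; have sI := saI s ss.
have hs : T0 <= sgn * ax s 0 ti.
  apply: le_trans (ltW s1T) _; apply: htmono; [by case/andP: s1I|exact: ltW|by case/andP: sI].
have wK := TP _ hs.
have Cq : 0 <= C * q / d by apply: divr_ge0 (ltW d0); apply: mulr_ge0 C_ge0 (ltW q0).
have sK : C * q / d + 1 <= scl w i (ax s 0 ti).
  rewrite -(ler_pXn2r (ltn0Sn 1)) ?nnegrE ?scl_ge0 ?addr_ge0 //.
  by rewrite scl2.
rewrite ltr_pdivrMr ?scl_gt0 // [d * _]mulrC -ltr_pdivrMr //.
by apply: lt_le_trans sK; rewrite ltrDl.
Unshelve. all: by end_near. Qed.

End exits.

(** * Inextendibility *)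

Section continuously_differentiable.
Context {R : realType} {k : nat}.
Local Notation V := 'rV[R]_k.
Variables (U : set V) (f : V -> V).
Hypothesis openU : open U.
Hypothesis fC : Ck 1 U f.

Lemma C1_coord x j : U x -> differentiable (fun y => f y 0 j) x /\
  forall h, 'd (fun y => f y 0 j) x h = \sum_i h 0 i * partial f i x 0 j.
Proof.
move=> Ux; have [_ fP] := fC.
have fd y i : U y -> derivable f y (delta_mx 0 i) by move=> Uy; case: (fP i) => + _; apply.
have pE y i : U y -> partial (fun y => f y 0 j) i y = partial f i y 0 j.
  by move=> Uy; rewrite /partial derive_mx ?mxE //; exact: fd.
have nU : \forall y \near x, U y by exact: open_nbhs_nbhs.
have [||dif dE] := @C1_is_diff R k (fun y => f y 0 j) x.
- apply: filterS nU => y Uy i; have := fd y i Uy => /derivable_mxP; exact.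
- move=> i; have [_ [pc _]] := fP i.
  apply: (@continuous_germ _ _ (fun y => partial f i y 0 j)).
    by apply: filterS nU => y Uy; rewrite pE.
  apply: (@continuous_comp _ _ _ (partial f i) (fun M : V => M 0 j)); first exact: pc.
  exact: coord_continuous.
split=> // h; rewrite dE; apply: eq_bigr => i _; by rewrite pE.
Qed.

Lemma C1_jacobian x : U x -> jacobian f x = \matrix_(i, j) partial f i x 0 j.
Proof.
move=> Ux; have df : differentiable f x.
  by apply/differentiable_mxP => a j; rewrite ord1; case: (C1_coord j Ux).
apply/matrixP => i j; rewrite [RHS]mxE /partial deriveEjacobian //.
by rewrite -rowE [RHS]mxE.
Qed.

Lemma C1_strict x : U x -> strict_diff f (jacobian f x) x.
Proof.
move=> Ux e e0; have [_ fP] := fC; rewrite C1_jacobian //.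
have e10 : 0 < e / k.+1%:R by rewrite divr_gt0.
have /nbhs_ballP[d /= d0 dP] : \forall y \near x, U y /\
    forall i, `|partial f i x - partial f i y| < e / k.+1%:R.
  apply: filterI; first exact: open_nbhs_nbhs.
  apply: (@filter_forall _ _ _ (nbhs x) (nbhs_filter x)) => i.
  have [_ [pc _]] := fP i.
  by have /cvgrPdist_lt/(_ _ e10) := pc x Ux.
(* Then the whole segment from [z] to [y] lies within distance d of [x]. *)
exists (d / 3); first by rewrite divr_gt0.
move=> y z yd zd; apply: mx_norm_leP => [|a j]; first by rewrite mulr_ge0 // ltW.
rewrite ord1 {a}.
have inb (t : R) : `|t| <= `|1 : R| -> ball x d (t *: (y - z) + z).
  rewrite normr1 -ball_normE /= distrC => t1.
  have H1 := ler_normD (t *: (y - z)) (z - x); rewrite normrZ in H1.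
  have H2 := ler_normB (y - x) (z - x).
  rewrite (_ : y - x - (z - x) = y - z) in H2; last by rewrite opprB addrA subrK.
  have H3 : `|t| * `|y - z| <= `|y - z| by rewrite ler_piMl.
  by rewrite -addrA; move: H1 H2 H3 yd zd; lra.
have [t t1|c c1] := @MVT_line R V (fun y => f y 0 j) z (y - z) 1.
  have [Ut _] := dP _ (inb t t1); have [dif _] := C1_coord j Ut.
  exact: diff_derivable.
rewrite scale1r subrK mul1r => fE.
have [Uc pc] := dP _ (inb c c1); have [dif dE] := C1_coord j Uc.
rewrite deriveE // dE in fE.
have -> : (f y - f z - (y - z) *m \matrix_(i, j) partial f i x 0 j) 0 j
    = (f y 0 j - f z 0 j) - \sum_i (y - z) 0 i * partial f i x 0 j.
  rewrite [in LHS]mxE [X in _ + X]mxE [X in X + _]mxE [X in _ + X + _]mxE; congr (_ - _).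
  by rewrite mxE; apply: eq_bigr => i _; rewrite [X in _ * X]mxE.
rewrite fE -sumrB; apply: le_trans (ler_norm_sum _ _ _) _.
apply: (@le_trans _ _ (\sum_(i < k) e / k.+1%:R * `|y - z|)).
  apply: ler_sum => i _; rewrite -mulrBr normrM mulrC; apply: ler_pM => //.
    have := mx_norm_coord (partial f i (c *: (y - z) + z) - partial f i x) 0 j.
    rewrite mxE [X in _ + X]mxE => /le_trans; apply.
    by rewrite distrC ltW.
  exact: mx_norm_coord.
rewrite sumr_const card_ord -mulrnAl ler_wpM2r //.
rewrite -[e / _ *+ _]mulr_natr mulrAC -mulrA ler_piMr ?(ltW e0) //.
by rewrite ler_pdivrMr // mul1r ler_nat.
Qed.

Lemma C1_jacobian_cont x i j : U x -> {for x, continuous (fun y => jacobian f y i j)}.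
Proof.
move=> Ux; have [_ fP] := fC; have [_ [pc _]] := fP i.
apply: (@continuous_germ _ _ (fun y => partial f i y 0 j)).
  have nU : \forall y \near x, U y by exact: open_nbhs_nbhs.
  by apply: filterS nU => y Uy; rewrite C1_jacobian // mxE.
apply: (@continuous_comp _ _ _ (partial f i) (fun M : V => M 0 j)); first exact: pc.
exact: coord_continuous.
Qed.

End continuously_differentiable.

(** * Light cones of metrics close to Minkowski's *)

Section cones.
Context {R : realType} {m : nat}.
Local Notation n := (m.*2.+1).
Local Notation M := 'rV[R]_(1 + n).

(** The Euclidean square; the norm of row vectors is the maximum norm, and the comparison of the two
    puts the dimension into the slope of the cones. *)
Definition ssq (e : 'rV[R]_n) := \sum_j e 0 j ^+ 2.

Lemma ssq_ge0 (e : 'rV[R]_n) : 0 <= ssq e. Proof. by apply: sumr_ge0 => j _; exact: sqr_ge0. Qed.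

Lemma ssq_coord (e : 'rV[R]_n) j : e 0 j ^+ 2 <= ssq e.
Proof. by rewrite /ssq (bigD1 j) //= lerDl sumr_ge0 // => a _; exact: sqr_ge0. Qed.

Lemma ssq_norm (e : 'rV[R]_n) : ssq e <= n%:R * `|e| ^+ 2.
Proof.
rewrite mulr_natl -[X in _ *+ X](card_ord n) -sumr_const; apply: ler_sum => j _.
by rewrite -real_normK ?num_real // ler_pXn2r ?nnegrE // mx_norm_coord.
Qed.

Lemma norm_ssq (e : 'rV[R]_n) (a : R) : 0 <= a -> ssq e <= a ^+ 2 -> `|e| <= a.
Proof.
move=> a0 ea; apply: mx_norm_leP => // i j; rewrite ord1.
rewrite -(ler_pXn2r (ltn0Sn 1)) ?nnegrE // real_normK ?num_real //.
exact: le_trans (ssq_coord e j) ea.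
Qed.

Lemma pairing_bound k (D : 'M[R]_k) (y : 'rV[R]_k) (d : R) : `|D| <= d ->
  `|pairing D y y| <= k%:R * k%:R * d * `|y| ^+ 2.
Proof.
move=> Dd; rewrite /pairing mxE; apply: le_trans (ler_norm_sum _ _ _) _.
have -> : k%:R * k%:R * d * `|y| ^+ 2 = \sum_(i < k) k%:R * d * `|y| ^+ 2.
  by rewrite sumr_const card_ord -[RHS]mulr_natl !mulrA.
apply: ler_sum => i _; rewrite [_^T _ _]mxE normrM mxE expr2 mulrA.
apply: ler_pM => //; last exact: mx_norm_coord.
apply: le_trans (ler_norm_sum _ _ _) _.
have -> : k%:R * d * `|y| = \sum_(j < k) `|y| * d.
  by rewrite sumr_const card_ord -[RHS]mulr_natl -mulrA [d * _]mulrC.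
apply: ler_sum => j _; rewrite normrM; apply: ler_pM => //; first exact: mx_norm_coord.
exact: le_trans (mx_norm_coord _ _ _) Dd.
Qed.

Lemma pairing_minkowski (z : M) :
  pairing Defs.minkowski z z = - z 0 ti ^+ 2 + ssq (rsubmx z).
Proof.
rewrite /pairing mxE sum_ti_si /Defs.minkowski; congr (_ + _).
  by rewrite mul_mx_diag !mxE /= mulrN1 mulNr -expr2.
apply: eq_bigr => j _; rewrite mul_mx_diag !mxE /= mulr1 -expr2.
by rewrite -/(si j).
Qed.

(* [y = (t, e)] are the sheared coordinates [t = +- z_0], [e = z_e - t v]. *)
Lemma sheared_cone (t Q : R) (e ze v : 'rV[R]_n) :
  ze = e + t *: v -> ssq v <= 1 / 12 ->
  `|Q - (- t ^+ 2 + ssq ze)| <= (t ^+ 2 + ssq ze) / 16 ->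
  [/\ Q <= 0 -> `|e| <= 2 * n%:R * `|t|, 0 <= Q -> `|t| <= 2 * n%:R * `|e| &
    Q <= (2 * n%:R) ^+ 2 * `|e| ^+ 2].
Proof.
move=> zeE v12 QP.
have up : ssq ze <= 2 * ssq e + 2 * t ^+ 2 * ssq v.
  rewrite /ssq !mulr_sumr -big_split /=; apply: ler_sum => j _.
  by rewrite zeE !mxE; have := sqr_ge0 (e 0 j - t * v 0 j); nra.
have lo : ssq e <= 2 * ssq ze + 2 * t ^+ 2 * ssq v.
  rewrite /ssq !mulr_sumr -big_split /=; apply: ler_sum => j _.
  by rewrite zeE !mxE; have := sqr_ge0 (e 0 j + 2 * (t * v 0 j)); nra.
have tv : t ^+ 2 * ssq v <= t ^+ 2 * (1 / 12) by rewrite ler_wpM2l ?sqr_ge0.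
have nn := ssq_norm e; have n1 : 1 <= n%:R :> R by rewrite ler1n.
have e0 := ssq_ge0 e; have z0 := ssq_ge0 ze; have t0 := sqr_ge0 t.
move: QP; rewrite ler_norml => /andP[Q1 Q2].
rewrite -mulrA in up lo.
set X := ssq e in up lo nn e0 *; set Y := ssq ze in up lo Q1 Q2 z0.
set Z := t ^+ 2 * ssq v in up lo tv; set T := t ^+ 2 in up lo tv Q1 Q2 t0.
have nge : n%:R <= n%:R ^+ 2 :> R by rewrite expr2 ler_peMl // ler0n.
have Xn : X <= n%:R ^+ 2 * `|e| ^+ 2.
  by apply: le_trans nn _; rewrite ler_wpM2r ?sqr_ge0.
split.
- move=> QN; apply: norm_ssq; first by rewrite !mulr_ge0 ?ler0n.
  rewrite -/X !exprMn real_normK ?num_real // -/T.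
  have XT : X <= 4 * T by lra.
  apply: le_trans XT _; rewrite (_ : 2 ^+ 2 = 4 :> R); last by ring.
  by rewrite ler_wpM2r // ler_peMr // (le_trans n1).
- move=> QP; rewrite -(ler_pXn2r (ltn0Sn 1)) ?nnegrE ?mulr_ge0 ?ler0n //.
  rewrite real_normK ?num_real // -/T !exprMn -mulrA (_ : 2 ^+ 2 = 4 :> R); last by ring.
  by move: Xn; set Z' := n%:R ^+ 2 * _; lra.
- rewrite !exprMn -mulrA (_ : 2 ^+ 2 = 4 :> R); last by ring.
  by move: Xn; set Z' := n%:R ^+ 2 * _; lra.
Qed.

End cones.

Section affine_maps.
Context {R : realType}.

Lemma affine_continuous k (a : 'rV[R]_k) (A : 'M[R]_k) : continuous (fun y : 'rV[R]_k => (y - a) *m A).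
Proof.
move=> y; apply/continuous_epsP => e e0; have [N N0 NP] := mulmx_bound A.
exists (e / N); first by rewrite divr_gt0.
move=> y' yy; rewrite -mulmxBl; have -> : y' - a - (y - a) = y' - y by rewrite opprB addrA subrK.
by apply: le_lt_trans (NP _) _; rewrite mulrC -ltr_pdivlMr.
Qed.

Lemma affine_ball_compact k (a z : 'rV[R]_k) (A : 'M[R]_k) (r : R) : A \in unitmx ->
  compact [set y : 'rV[R]_k | `|(y - a) *m A - z| <= r].
Proof.
move=> Au; apply: bounded_closed_compact.
  have [N N0 NP] := mulmx_bound (invmx A).
  exists (N * (r + `|z|) + `|a|); split; [exact: num_real|move=> b bb y /= yr].
  apply: le_trans (ltW bb).
  have -> : y = ((y - a) *m A) *m invmx A + a by rewrite mulmxK // subrK.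
  apply: le_trans (ler_normD _ _) _; rewrite lerD2r; apply: le_trans (NP _) _.
  rewrite ler_wpM2l ?(ltW N0) //.
  by have := ler_normD ((y - a) *m A - z) z; rewrite subrK; lra.
rewrite (_ : [set _ | _] = (fun y : 'rV[R]_k => `|(y - a) *m A - z|) @^-1` [set t | t <= r]) //.
apply: closed_comp; last exact: closed_le.
move=> y _; apply: (@continuous_comp _ _ _ (fun y : 'rV[R]_k => (y - a) *m A - z) (fun v => `|v|)).
  apply/continuous_epsP => e e0.
  have [d d0 dP] := proj1 (continuous_epsP _ _) (@affine_continuous k a A y) e e0.
  by exists d => // y' /dP; rewrite opprB addrA subrK.
exact: norm_continuous.
Qed.

End affine_maps.

(** * Boxes around a boundary point *)

Section extension.
Context {R : realType} {m : nat}.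
Local Notation n := (m.*2.+1).
Local Notation M := 'rV[R]_(1 + n).
Local Notation H := (heisenberg R m).
Variables (nu : R -> R) (w : 'I_n -> R -> R).
Hypothesis nu_gt0 : forall t, 0 < nu t.
Hypothesis w_gt0 : forall a t, 0 < w a t.
Hypothesis nu_cont : continuous nu.
Hypothesis w_cont : forall a, continuous (w a).
Hypothesis growing : forall sgn : R, sgn = 1 \/ sgn = -1 ->
  exists2 i, i != 0 & forall K, exists T, forall t, T <= sgn * t -> K <= w i t.
Variable G : set H.
Hypothesis Gd : discrete_subgroup G.
Local Notation X := (left_quotient G).
Local Notation pr := (@to_orbit R m G : M -> X).
Local Notation g := (gmetric nu w).
Variables (Y : atlas R (1 + n)) (h : metric_on Y) (F0 : X -> Y).
Hypothesis Ysm : smooth_manifold Y.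
Hypothesis hL : continuous_lorentzian_metric h.
Hypothesis F0s : smooth_map F0.
Hypothesis iso : isometric (descend G g) h F0.

(** The map from the cover R x H; it is a local isometry, and not injective when the group is
    non-trivial. *)
Definition dev_map (x : M) : Y := F0 (pr x).

Lemma dev_map_continuous : continuous dev_map.
Proof.
move=> x; apply: (@continuous_comp _ _ _ pr F0); first exact: pr_continuous.
by case: F0s => Fc _; exact: Fc.
Qed.

Lemma pr_surj (q : X) : exists x, pr x = q.
Proof. by exists (repr q); rewrite /to_orbit reprK. Qed.

Lemma chart_of (c' : chart Y) : [/\ open (dom c'), forall x, dom c' x -> coord c' (par c' x) = x,
  forall x, dom c' x -> {for x, continuous (par c')} &
  forall U, open U -> U `<=` dom c' -> open (par c' @` U)].
Proof. by case: Ysm => _ _ _ + _; apply. Qed.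

Definition chart_map (c' : chart Y) (x : M) : M := coord c' (dev_map x).

(** Charts of the quotient are restrictions of the projection, so the expression of [F0] in charts
    is [chart_map c'] itself. *)
Lemma local_form (c' : chart Y) x : patch c' (dev_map x) -> exists U, [/\ open U, U x,
  Ck 1 U (chart_map c') &
  g x = jacobian (chart_map c') x *m h c' (chart_map c' x) *m (jacobian (chart_map c') x)^T].
Proof.
move=> Fx; have [c cx] := chart_at Gd x.
exists (dom c `&` [set x | patch c' (dev_map x)]); split; [|by split| |].
- apply: openI; first exact: chart_open.
  have [od _ _ oi] := chart_of c'.
  have op : open (patch c') by exact: oi.
  by apply: open_comp => // y _; exact: dev_map_continuous.
- by case: F0s => _ /(_ c c' 1%N).
- exact: (iso (c := c) (c' := c') cx Fx).
Qed.

Lemma boundary_point : connected [set: Y] -> open (range F0) -> range F0 <> setT ->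
  exists2 y0, closure (range F0) y0 & ~ range F0 y0.
Proof.
move=> Yc ro rn; apply: contrapT => nex; apply: rn; apply: Yc.
- by exists (F0 (pr 0)), (pr 0).
- by exists (range F0); rewrite ?setTI.
- exists (range F0); rewrite ?setTI // => y yc.
  by apply: contrapT => ny; apply: nex; exists y.
Qed.

Section box.
Variables (c' : chart Y) (xh : M) (A : 'M[R]_(1 + n)) (mu : R).
Hypothesis Au : A \in unitmx.
Hypothesis mu_gt0 : 0 < mu.
Local Notation pt z := (xh + z *m invmx A).
Hypothesis box_dom : forall z, `|z| < mu -> dom c' (pt z).
Hypothesis box_cone : forall z, `|z| < mu -> forall u,
  `|pairing (h c' (pt z)) u u - (- (u *m A) 0 ti ^+ 2 + ssq (rsubmx (u *m A)))|
    <= ((u *m A) 0 ti ^+ 2 + ssq (rsubmx (u *m A))) / 16.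
Variables (sg : R) (v : 'rV[R]_n).
Hypothesis sg1 : sg = 1 \/ sg = -1.
Hypothesis v_small : ssq v <= 1 / 12.
Hypothesis v_le1 : `|v| <= 1.

(** [sg] reverses time if necessary and [v] tilts the vertical direction, so that a prescribed
    nearly vertical segment becomes vertical and is run through upwards. With |v|^2 <= 1/12 in the
    Euclidean sense the slope bounds survive. *)
Definition shear_mx : 'M[R]_(1 + n) := block_mx sg%:M (- (sg *: v)) 0 1%:M.

Lemma mul_shear (z : M) : z *m shear_mx = tspt (sg * z 0 ti) (rsubmx z - (sg * z 0 ti) *: v).
Proof.
rewrite -[z in LHS]hsubmxK /shear_mx mul_row_block mulmx0 addr0 mulmx1 mul_mx_scalar.
rewrite /tspt; congr row_mx.
  by apply/rowP => i; rewrite !mxE !ord1.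
rewrite addrC; congr (_ + _); rewrite mulmxN; congr (- _).
apply/rowP => i; rewrite mxE big_ord1 !mxE; ring.
Qed.

Lemma sg2 : sg * sg = 1. Proof. by case: sg1 => ->; rewrite ?mulrNN mulr1. Qed.

Lemma shear_mx_unit : shear_mx \in unitmx.
Proof.
rewrite unitmxE /shear_mx det_ublock det1 mulr1 det_scalar1 unitfE.
by case: sg1 => ->; rewrite ?oppr_eq0 oner_neq0.
Qed.

Local Notation bcoord := (chart_map c').
Definition bmap (x : M) : M := (bcoord x - xh) *m (A *m shear_mx).
Definition bjac (x : M) : 'M[R]_(1 + n) := jacobian bcoord x *m (A *m shear_mx).
(** The part of the spacetime over the box, the box being measured in the coordinates before the
    shear. *)
Definition bdom (x : M) : Prop := exists2 z, `|z| < mu & dev_map x = par c' (pt z).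

Lemma bdom_coord x : bdom x -> exists z, [/\ `|z| < mu, dev_map x = par c' (pt z), bcoord x = pt z,
  bmap x = z *m shear_mx & patch c' (dev_map x)].
Proof.
move=> [z zmu Fx]; have [_ co _ _] := chart_of c'; have dz := box_dom zmu.
have bE : bcoord x = pt z by rewrite /chart_map Fx co.
exists z; split=> //; last by exists (pt z).
by rewrite /bmap bE addrC addKr mulmxA mulmxKV.
Qed.

Lemma bdom_open : open bdom.
Proof.
have [_ _ _ oi] := chart_of c'.
pose U : set M := [set y | `|(y - xh) *m A| < mu].
have US : U `<=` dom c'.
  move=> y yU; have -> : y = pt ((y - xh) *m A) by rewrite mulmxK // addrC subrK.
  exact: box_dom.
have Uo : open U.
  rewrite (_ : U = (fun y : M => `|(y - xh) *m A|) @^-1` [set t | t < mu]) //.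
  apply: open_comp; last exact: open_lt.
  move=> y _; apply: (@continuous_comp _ _ _ (fun y : M => (y - xh) *m A) (fun v => `|v|)).
    exact: affine_continuous.
  exact: norm_continuous.
rewrite (_ : bdom = dev_map @^-1` (par c' @` U)); first by apply: open_comp => [y _|]; [exact: dev_map_continuous|exact: oi].
apply/seteqP; split=> x.
  move=> [z zmu Fx]; exists (pt z) => //.
  by rewrite /U /= addrC addKr mulmxKV.
move=> [y yU Fx]; exists ((y - xh) *m A) => //.
by rewrite mulmxK // addrC subrK.
Qed.

Lemma bsqn x u : bdom x ->
  [/\ sqn nu w x u <= 0 -> `|rsubmx (u *m bjac x)| <= 2 * n%:R * `|(u *m bjac x) 0 ti|,
    0 <= sqn nu w x u -> `|(u *m bjac x) 0 ti| <= 2 * n%:R * `|rsubmx (u *m bjac x)| &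
    sqn nu w x u <= (2 * n%:R) ^+ 2 * `|rsubmx (u *m bjac x)| ^+ 2].
Proof.
move=> /bdom_coord[z [zmu Fx bE _ px]]; have [U [_ _ _ gE]] := local_form px.
pose u' := u *m jacobian bcoord x; pose zz := u' *m A.
have sE : sqn nu w x u = pairing (h c' (pt z)) u' u'.
  by rewrite /sqn gE /pairing bE trmx_mul !mulmxA.
have -> : u *m bjac x = tspt (sg * zz 0 ti) (rsubmx zz - (sg * zz 0 ti) *: v).
  by rewrite -mul_shear /bjac !mulmxA.
rewrite tspt_ti tspt_s sE; apply: (@sheared_cone _ _ _ _ _ (rsubmx zz) v) => //.
  by rewrite subrK.
have -> : (sg * zz 0 ti) ^+ 2 = zz 0 ti ^+ 2 by rewrite exprMn [sg ^+ 2]sg2 mul1r.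
exact: box_cone.
Qed.

Lemma bjac_unit x : bdom x -> bjac x \in unitmx.
Proof.
move=> /bdom_coord[z [_ _ _ _ px]]; have [U [_ _ _ gE]] := local_form px.
have := gmetric_unit nu_gt0 w_gt0 x; rewrite gE !unitmx_mul => /andP[/andP[Ju _] _].
by rewrite Ju Au shear_mx_unit.
Qed.

Lemma bmap_strict x : bdom x -> strict_diff bmap (bjac x) x.
Proof.
move=> /bdom_coord[z [_ _ _ _ px]]; have [U [Uo Ux UC _]] := local_form px.
move=> e e0; have [N N0 NP] := mulmx_bound (A *m shear_mx).
have [d d0 dP] := C1_strict Uo UC Ux (divr_gt0 e0 N0).
exists d => // y y' yd yd'; have H1 := dP y y' yd yd'.
have E1 : bmap y - bmap y' = (bcoord y - bcoord y') *m (A *m shear_mx).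
  by rewrite /bmap -mulmxBl; congr (_ *m _); rewrite opprB addrA subrK.
have E2 : (y - y') *m bjac x = ((y - y') *m jacobian bcoord x) *m (A *m shear_mx).
  exact: mulmxA.
rewrite E1 E2 -mulmxBl.
apply: le_trans (NP _) _; rewrite -ler_pdivlMl // mulrC mulrAC; exact: H1.
Qed.

Lemma bjac_time_cont x : bdom x -> {for x, continuous (fun y => (time_field *m bjac y) 0 ti)}.
Proof.
move=> /bdom_coord[z [_ _ _ _ px]]; have [U [Uo Ux UC _]] := local_form px.
rewrite (_ : (fun _ => _) = fun y => \sum_l (\sum_k (time_field : M) 0 k * jacobian bcoord y k l)
    * (A *m shear_mx) l ti); last first.
  apply/funext => y; rewrite /bjac mulmxA mxE; apply: eq_bigr => l _; by rewrite mxE.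
apply: (@cvg_sumr _ _ _ (nbhs_filter x)) => l _; apply: cvgM; last exact: cvg_cst.
apply: (@cvg_sumr _ _ _ (nbhs_filter x)) => k _; apply: cvgM; first exact: cvg_cst.
exact: (C1_jacobian_cont Uo UC).
Qed.

(** A closed ball in sheared coordinates is compact in the chart, so its image in the Hausdorff
    space Y is closed and so is its preimage. The radius mu / 2 leaves room for the shear, which at
    most doubles the norm because |v| <= 1. *)
Lemma bclosed (zc : M) (r : R) : `|zc| + r < mu / 2 -> closed (bdom `&` [set x | `|bmap x - zc| <= r]).
Proof.
move=> zr; pose K : set M := [set y | `|(y - xh) *m (A *m shear_mx) - zc| <= r].
have [_ co pc _] := chart_of c'.
have Kz y : K y -> `|(y - xh) *m A| < mu.
  rewrite /K /= mulmxA; set z := (y - xh) *m A => Ky.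
  have zs : `|z *m shear_mx| < mu / 2.
    by have := ler_normD (z *m shear_mx - zc) zc; rewrite subrK; lra.
  rewrite mul_shear in zs; set t := sg * z 0 ti in zs.
  have t1 : `|t| < mu / 2.
    by apply: le_lt_trans zs; rewrite -{1}(tspt_ti t (rsubmx z - t *: v)) mx_norm_coord.
  have e1 : `|rsubmx z - t *: v| < mu / 2.
    by apply: le_lt_trans zs; rewrite -{1}(tspt_s t (rsubmx z - t *: v)) rnorm_le.
  apply: (@le_lt_trans _ _ (`|t| + `|rsubmx z - t *: v|)); last by lra.
  apply: norm_split.
    have -> : `|z 0 ti| = `|t| by rewrite /t normrM; case: sg1 => ->; rewrite ?normrN normr1 mul1r.
    by rewrite lerDl.
  have := ler_normD (rsubmx z - t *: v) (t *: v); rewrite subrK normrZ.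
  have : `|t| * `|v| <= `|t| by rewrite ler_piMr.
  by lra.
have Kd y : K y -> dom c' y.
  move=> /Kz yz; have -> : y = pt ((y - xh) *m A) by rewrite mulmxK // addrC subrK.
  exact: box_dom.
rewrite (_ : _ `&` _ = dev_map @^-1` (par c' @` K)).
  apply: closed_comp; first by move=> y _; exact: dev_map_continuous.
  apply: compact_closed; first by case: Ysm.
  apply: continuous_compact.
    by apply: continuous_in_subspaceT => y /set_mem /Kd; exact: pc.
  by apply: affine_ball_compact; rewrite unitmx_mul Au shear_mx_unit.
apply/seteqP; split=> x.
  move=> [Dx /= xr]; have [z [zmu Fx bE bm _]] := bdom_coord Dx.
  by exists (pt z) => //; rewrite /K /= -bE.
move=> [y Ky Fx]; split.
  by exists ((y - xh) *m A); [exact: Kz|rewrite mulmxK // addrC subrK].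
by rewrite /= /bmap /chart_map -Fx co //; exact: Kd.
Qed.

(** The sign of dT on d/dtau may differ between pieces of the spacetime lying over the box. As
    d/dtau is timelike, dT does not vanish on it; the part with the sign of [p0] is thus open and
    relatively closed in [bdom], and on it the orientation is uniform. *)
Lemma no_box_exit (p0 : M) (hh : R) : bdom p0 -> 0 < hh -> `|bmap p0| < mu / 4 ->
  `|bmap p0 + tspt hh 0| < mu / 4 ->
  ~ (forall x, bdom x -> bmap x <> bmap p0 + tspt hh 0).
Proof.
move=> Dp hh0 b1 b2 nh.
pose o (x : M) := (time_field *m bjac x) 0 ti.
have tf_ti : (time_field : M) 0 ti = 1 by rewrite /time_field row_mxEl mxE.
have tf_om x a : omega x time_field a = 0.
  rewrite /omega /time_field row_mxEr mxE sub0r big1 ?mulr0 ?oppr0 // => r _.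
  by rewrite row_mxEr mxE mulr0.
have zero x u : bdom x -> sqn nu w x u < 0 -> (u *m bjac x) 0 ti != 0.
  move=> Dx u0; apply/eqP => uT; have [H1 _ _] := bsqn u Dx.
  have := H1 (ltW u0); rewrite uT normr0 mulr0 normr_le0 => /eqP uE.
  have uJ : u *m bjac x = 0.
    by apply: tspt_inj; rewrite ?uT ?uE; [rewrite mxE|apply/rowP => a; rewrite !mxE].
  have ue : u = 0 by rewrite -(mulmxK (bjac_unit Dx) u) uJ mul0mx.
  have : sqn nu w x u = 0 by rewrite ue /sqn /pairing !mul0mx mxE.
  by move=> s0; rewrite s0 ltxx in u0.
have tfs x : sqn nu w x time_field < 0.
  rewrite sqnE tf_ti expr1n mulr1 big1 ?addr0 ?oppr_lt0 // => a _.
  by rewrite tf_om expr0n mulr0.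
have o0 x : bdom x -> o x != 0 by move=> Dx; exact: zero (tfs x).
pose sgn := Num.sg (o p0).
have sgn1 : sgn = 1 \/ sgn = -1.
  by rewrite /sgn; case: sgrP (o0 p0 Dp) => // _ _; [left|right].
have sgn2 : sgn * sgn = 1 by case: sgn1 => ->; rewrite ?mulrNN mulr1.
pose B s := bdom `&` [set x | 0 < s * o x].
have Bo s : open (B s).
  rewrite openE => x [Dx ox]; rewrite /interior.
  have nD : \forall y \near x, bdom y by apply: open_nbhs_nbhs; split=> //; exact: bdom_open.
  have oc : {for x, continuous (fun y => s * o y)}.
    have c1 : {for x, continuous (fun _ : M => s)} by exact: cst_continuous.
    exact: (continuousM c1 (bjac_time_cont Dx)).
  have no : \forall y \near x, 0 < s * o y.
    exact: (near_open oc (@open_gt R 0) ox).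
  by apply: filterI.
have Bcl zc r : `|zc| + r < mu / 2 -> closed (B sgn `&` [set x | `|bmap x - zc| <= r]).
  move=> zr; have -> : B sgn `&` [set x | `|bmap x - zc| <= r] =
      (bdom `&` [set x | `|bmap x - zc| <= r]) `&` ~` B (- sgn).
    apply/seteqP; split=> x.
      move=> [[Dx ox] xr]; split=> // -[_ /=].
      by rewrite mulNr oppr_gt0 ltNge (ltW ox).
    move=> [[Dx xr] nB]; split=> //; split=> //=.
    have so : sgn * o x != 0.
      by rewrite mulf_neq0 ?o0 //; case: sgn1 => ->; rewrite ?oppr_eq0 oner_neq0.
    rewrite lt_neqAle eq_sym so leNgt; apply/negP => on; apply: nB; split=> //=.
    by rewrite mulNr oppr_gt0.
  by apply: closedI; [exact: bclosed|exact: open_closedC].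
have [i i0 grow] := growing sgn1.
have n1 : 1 <= n%:R :> R by rewrite ler1n.
have L1 : 1 <= 2 * n%:R :> R by lra.
have mu2 : 0 < mu / 2 by rewrite divr_gt0.
have BD x : B sgn x -> bdom x by case.
have mu4 : mu / 2 / 2 = mu / 4 by field.
have P1 x : B sgn x -> strict_diff bmap (bjac x) x by move=> /BD; exact: bmap_strict.
have P2 x : B sgn x -> bjac x \in unitmx by move=> /BD; exact: bjac_unit.
have P3 x u : B sgn x -> sqn nu w x u <= 0 ->
  `|rsubmx (u *m bjac x)| <= 2 * n%:R * `|(u *m bjac x) 0 ti| by move=> /BD /(bsqn u)[].
have P4 x u : B sgn x -> 0 <= sqn nu w x u ->
  `|(u *m bjac x) 0 ti| <= 2 * n%:R * `|rsubmx (u *m bjac x)| by move=> /BD /(bsqn u)[].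
have P5 x u : B sgn x -> sqn nu w x u <= (2 * n%:R) ^+ 2 * `|rsubmx (u *m bjac x)| ^+ 2.
  by move=> /BD /(bsqn u)[].
have key (b3 u1 a1 : R) : 0 <= b3 * (sgn * u1) -> a1 <= 0 ->
    b3 ^+ 2 * u1 ^+ 2 <= (b3 * u1 - a1 * sgn) ^+ 2.
  by case: sgn1 => ->; nra.
have P6 x u : B sgn x -> sqn nu w x u < 0 -> 0 < sgn * u 0 ti -> 0 < (u *m bjac x) 0 ti.
  move=> [Dx /= ox] us ut; rewrite ltNge; apply/negP => a0.
  pose a := (u *m bjac x) 0 ti; pose b := sgn * o x.
  (* The combination of [u] and d/dtau with dT = 0. If [u] pointed the wrong way, subtracting would
     only enlarge the tau component, so [y] would be timelike with dT = 0, against the cone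
     bound. *)
  pose y := b *: u - (a * sgn) *: time_field.
  have yT : (y *m bjac x) 0 ti = 0.
    rewrite /y mulmxBl -!scalemxAl [LHS]mxE [X in _ + X]mxE [X in X + _]mxE [X in _ - X]mxE.
    by rewrite -/a -/(o x) /b; ring.
  have ys : sqn nu w x y < 0.
    have yc j : y 0 j = b * u 0 j - a * sgn * (time_field : M) 0 j.
      by rewrite /y [LHS]mxE [X in _ + X]mxE [X in X + _]mxE [X in _ - X]mxE.
    have yt : y 0 ti = b * u 0 ti - a * sgn by rewrite yc tf_ti mulr1.
    have ys c : y 0 (si c) = b * u 0 (si c).
      by rewrite yc /time_field row_mxEr mxE mulr0 subr0.
    have yo c : omega x y c = b * omega x u c.
      rewrite /omega ys mulrBr; congr (_ - _); rewrite mulrCA; congr (_ * _).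
      by rewrite mulr_sumr; apply: eq_bigr => r _; rewrite ys mulrCA.
    rewrite sqnE; apply: le_lt_trans (_ : b ^+ 2 * sqn nu w x u < 0); last first.
      by rewrite pmulr_rlt0 // exprn_gt0.
    rewrite sqnE mulrDr; apply: lerD; last first.
      by rewrite mulr_sumr; apply: ler_sum => c _; rewrite yo exprMn mulrCA.
    rewrite yt !mulNr mulrN lerN2 mulrCA ler_pM2l //.
    by apply: key => //; apply: mulr_ge0; exact: ltW.
  by have := zero x y Dx ys; rewrite yT eqxx.
have Bp : B sgn p0 by split=> //=; rewrite /sgn -normrEsg normr_gt0; exact: o0.
rewrite -mu4 in b1 b2.
apply: (@no_exit R m nu w nu_gt0 w_gt0 nu_cont w_cont bmap bjac (B sgn) (2 * n%:R) (2 * n%:R)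
  (mu / 2) sgn (Bo sgn) P1 P2 L1 (le_trans ler01 L1) mu2 Bcl P3 P4 P5 P6 sgn1 i i0 grow
  p0 (bmap p0) hh Bp erefl hh0 b1 b2).
by move=> x /BD; exact: nh.
Qed.

End box.

Lemma norm_sum_sq (z : M) : `|z| ^+ 2 <= z 0 ti ^+ 2 + ssq (rsubmx z).
Proof.
set S := _ + _; have S0 : 0 <= S by rewrite addr_ge0 ?sqr_ge0 ?ssq_ge0.
have zS : `|z| <= Num.sqrt S.
  apply: norm_split.
    rewrite -(ler_pXn2r (ltn0Sn 1)) ?nnegrE ?sqrtr_ge0 // sqr_sqrtr // real_normK ?num_real //.
    by rewrite lerDl ssq_ge0.
  by apply: norm_ssq; rewrite ?sqrtr_ge0 // sqr_sqrtr // lerDr sqr_ge0.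
by rewrite -(sqr_sqrtr S0) ler_pXn2r // nnegrE // sqrtr_ge0.
Qed.

(** [A] makes the metric at [xh] Minkowskian; by continuity the deviation stays below 1/16 of the
    Euclidean form in a small box. *)
Lemma cone_chart (c' : chart Y) xh : dom c' xh -> exists A : 'M[R]_(1 + n), A \in unitmx /\
  exists2 mu : R, 0 < mu & (forall z, `|z| < mu -> dom c' (xh + z *m invmx A)) /\
    forall z, `|z| < mu -> forall u,
    `|pairing (h c' (xh + z *m invmx A)) u u - (- (u *m A) 0 ti ^+ 2 + ssq (rsubmx (u *m A)))|
    <= ((u *m A) 0 ti ^+ 2 + ssq (rsubmx (u *m A))) / 16.
Proof.
move=> dx; have [hc hl _] := hL; have [P Pu hP] := hl c' xh dx.
have [od _ _ _] := chart_of c'.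
have Au : P^T \in unitmx by rewrite unitmx_tr.
exists P^T; split=> //.
have [N N0 NP] := mulmx_bound (invmx P^T).
pose K : R := (1 + n)%:R * (1 + n)%:R.
have K0 : 0 < K by rewrite mulr_gt0 // ltr0n.
(* [K] turns a bound on the entries into one on the quadratic form, and N^2 passes from |u| to |u
   A|. *)
pose eps := (16 * K * N ^+ 2)^-1.
have KN0 : 0 < 16 * K * N ^+ 2 by rewrite !mulr_gt0 // exprn_gt0.
have eps0 : 0 < eps by rewrite invr_gt0.
have [d1 d10 d1P] := proj1 (continuous_epsP _ _) (hc c' xh dx) eps eps0.
have [d2 d20 d2P] := open_ball_sub od dx.
have m0 : 0 < Num.min d1 d2 by rewrite lt_min d10.
exists (Num.min d1 d2 / N); first by rewrite divr_gt0.
have close z : `|z| < Num.min d1 d2 / N -> `|xh + z *m invmx P^T - xh| < Num.min d1 d2.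
  move=> zm; rewrite addrAC subrr add0r; apply: le_lt_trans (NP z) _.
  by rewrite mulrC -ltr_pdivlMr.
split=> [z /close|z /close]; rewrite lt_min => /andP[z1 z2]; first exact: d2P.
move=> u; set zz := u *m P^T.
have -> : - zz 0 ti ^+ 2 + ssq (rsubmx zz) = pairing (h c' xh) u u.
  by rewrite -pairing_minkowski hP /pairing /zz trmx_mul trmxK !mulmxA.
have -> : pairing (h c' (xh + z *m invmx P^T)) u u - pairing (h c' xh) u u
    = pairing (h c' (xh + z *m invmx P^T) - h c' xh) u u.
  by rewrite /pairing mulmxBr mulmxBl !mxE.
apply: le_trans (pairing_bound u (ltW (d1P _ z1))) _; rewrite -/K.
have uz : `|u| <= N * `|zz| by have := NP zz; rewrite /zz mulmxK.
have u2 : `|u| ^+ 2 <= N ^+ 2 * `|zz| ^+ 2.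
  by rewrite -exprMn ler_pXn2r // nnegrE // mulr_ge0 // ltW.
apply: le_trans (ler_wpM2l (mulr_ge0 (ltW K0) (ltW eps0)) u2) _.
rewrite mulrA (_ : K * eps * N ^+ 2 = 16^-1); last first.
  by rewrite /eps; field; rewrite !lt0r_neq0.
by rewrite mulrC ler_wpM2r ?invr_ge0 // norm_sum_sq.
Qed.

(** The centre of the box is not attained, but points arbitrarily close to it are. Whether or not
    the point at height [dl] above the centre is attained, some nearly vertical segment joins an
    attained point to one that is not. *)
Lemma not_extendible : connected [set: Y] -> open (range F0) -> range F0 <> setT -> False.
Proof.
move=> Yc ro rn; have [y0 y0c y0n] := boundary_point Yc ro rn.
have [c' [xh dx xhE]] : exists c' : chart Y, patch c' y0 by case: Ysm => _ _ + _ _; apply.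
have [A [Au [mu mu0 [bdm bcn]]]] := cone_chart dx.
pose pt z := xh + z *m invmx A.
pose hit z := exists p, dev_map p = par c' (pt z).
have nhit0 : ~ hit 0.
  by move=> [p]; rewrite /pt mul0mx addr0 xhE => Fp; apply: y0n; exists (pr p).
have hits e : 0 < e -> e <= mu -> exists2 z, `|z| < e & hit z.
  move=> e0 emu; have [_ _ _ oi] := chart_of c'.
  pose U : set M := [set y | `|(y - xh) *m A| < e].
  have US : U `<=` dom c'.
    move=> y yU; have -> : y = pt ((y - xh) *m A) by rewrite /pt mulmxK // addrC subrK.
    by apply: bdm; exact: lt_le_trans yU emu.
  have Uo : open U.
    rewrite (_ : U = (fun y : M => `|(y - xh) *m A|) @^-1` [set t | t < e]) //.
    apply: open_comp; last exact: open_lt.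
    move=> y _; apply: (@continuous_comp _ _ _ (fun y : M => (y - xh) *m A) (fun v => `|v|)).
      exact: affine_continuous.
    exact: norm_continuous.
  have nb : nbhs y0 (par c' @` U).
    apply: open_nbhs_nbhs; split; first exact: oi.
    by exists xh => //; rewrite /U /= subrr mul0mx normr0.
  have [_ [[q _ <-] [y yU yE]]] := y0c _ nb; have [p pE] := pr_surj q.
  exists ((y - xh) *m A) => //; exists p.
  by rewrite /dev_map pE -yE /pt mulmxK // [xh + _]addrC subrK.
pose dl := mu / 8; have dl0 : 0 < dl by rewrite divr_gt0.
have dmu : dl < mu / 4 by rewrite /dl; lra.
have dmu1 : dl < mu by rewrite /dl; lra.
have nz_norm (t : R) (e : 'rV[R]_n) : `|t| < mu / 4 -> `|e| < mu / 4 -> `|tspt t e| < mu / 4.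
  move=> t1 e1; apply: (@le_lt_trans _ _ (Num.max `|t| `|e|)); last by rewrite gt_max t1.
  by apply: norm_split; rewrite ?tspt_ti ?tspt_s le_max lexx // orbT.
have m40 : `|0 : 'rV[R]_n| < mu / 4 by rewrite normr0 divr_gt0.
(* If it is attained, the segment goes straight down to the centre, which time reversal turns into
   an upward one. Otherwise it goes up to this point from an attained point close to the centre,
   along a tilted direction. *)
have [hs|nhs] := pselect (hit (tspt dl 0)).
  have [p Fp] := hs.
  have sg1 : (-1 : R) = 1 \/ (-1 : R) = -1 by right.
  have v0 : ssq (0 : 'rV[R]_n) <= 1 / 12.
    by rewrite /ssq big1 ?divr_ge0 // => j _; rewrite mxE expr0n.
  have v1 : `|0 : 'rV[R]_n| <= 1 by rewrite normr0.
  have dn : `|tspt dl (0 : 'rV[R]_n)| < mu.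
    apply: lt_trans (nz_norm dl 0 _ m40) _; first by rewrite gtr0_norm.
    by rewrite ltr_pdivrMr // ltr_pMr // ltr1n.
  have Dp : bdom c' xh A mu p by exists (tspt dl 0).
  have bp : bmap c' xh A (-1) 0 p = tspt (- dl) 0.
    have [z [_ Fz bE _ _]] := bdom_coord Au bdm (-1) 0 Dp.
    have [_ co _ _] := chart_of c'.
    have bE' : chart_map c' p = pt (tspt dl 0) by rewrite /chart_map Fp co //; exact: bdm.
    rewrite /bmap bE' /pt addrC addKr mulmxA mulmxKV // mul_shear tspt_ti tspt_s.
    by rewrite scaler0 subr0 mulN1r.
  have be : bmap c' xh A (-1) 0 p + tspt dl 0 = 0.
    rewrite bp -[X in _ + X]scale1r tsptD scaler0 addr0 mul1r addNr.
    by apply: tspt_inj; rewrite ?tspt_ti ?tspt_s; [rewrite mxE|apply/rowP => a; rewrite !mxE].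
  apply: (no_box_exit Au mu0 bdm bcn sg1 v0 v1 Dp dl0).
  - by rewrite bp; apply: nz_norm => //; rewrite normrN gtr0_norm.
  - by rewrite be normr0 divr_gt0.
  move=> x Dx; rewrite be => b0; have [z [zm Fz _ bm _]] := bdom_coord Au bdm (-1) 0 Dx.
  apply: nhit0; exists x; rewrite Fz; congr (par c' (pt _)).
  by rewrite -[LHS](mulmxK (shear_mx_unit 0 sg1)) -bm b0 mul0mx.
have n0 : 0 < n%:R :> R by rewrite ltr0n.
(* As dl = 13 n e and |t| < e, the height dl - t is at least 12 n e. Hence |v| <= 1 / (12 n), and
   the Euclidean square of [v] is at most 1/12. *)
pose e := dl / (13 * n%:R).
have e0 : 0 < e by rewrite divr_gt0 // mulr_gt0.
have ed : 13 * (n%:R * e) = dl by rewrite /e; field; rewrite lt0r_neq0.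
have nge : e <= n%:R * e by apply: ler_peMl; [exact: ltW|rewrite ler1n].
have emu : e <= mu by lra.
have [z ze [p Fp]] := hits e e0 emu.
pose t := z 0 ti; have te : `|t| < e by exact: le_lt_trans (mx_norm_coord _ _ _) ze.
have ee : `|rsubmx z| < e by exact: le_lt_trans (rnorm_le _) ze.
have dt0 : 0 < dl - t by move: te; rewrite ltr_norml; lra.
(* The slope of the segment from [z] to the point at height [dl] on the axis, so that both have the
   same horizontal coordinates after the shear. *)
pose v := - (dl - t)^-1 *: rsubmx z.
have zv : rsubmx z = - (dl - t) *: v.
  by rewrite /v scalerA mulrNN mulfV ?scale1r // lt0r_neq0.
have vn : `|v| <= (12 * n%:R)^-1.
  rewrite /v normrZ normrN normfV gtr0_norm // mulrC ler_pdivrMr //.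
  rewrite ler_pdivlMl ?mulr_gt0 //.
  apply: (@le_trans _ _ (12 * n%:R * e)); first by rewrite ler_wpM2l ?mulr_ge0 // ltW.
  by move: te; rewrite ltr_norml -mulrA; lra.
have n12 : (12 * n%:R)^-1 <= 1 :> R.
  by rewrite invf_le1 ?mulr_gt0 // -natrM ler1n.
have v1 : `|v| <= 1 by exact: le_trans vn n12.
have v0 : ssq v <= 1 / 12.
  apply: le_trans (ssq_norm v) _; apply: (@le_trans _ _ (n%:R * (12 * n%:R)^-1)).
    rewrite ler_pM2l // expr2; apply: le_trans vn; exact: ler_piMl.
  by rewrite le_eqVlt; apply/orP; left; apply/eqP; field; rewrite lt0r_neq0.
have sg1 : (1 : R) = 1 \/ (1 : R) = -1 by left.
have zm : `|z| < mu by exact: lt_le_trans ze emu.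
have Dp : bdom c' xh A mu p by exists z.
have bp : bmap c' xh A 1 v p = tspt t (- (dl *: v)).
  have [_ co _ _] := chart_of c'.
  have bE' : chart_map c' p = pt z by rewrite /chart_map Fp co //; exact: bdm.
  rewrite /bmap bE' /pt addrC addKr mulmxA mulmxKV // mul_shear mul1r -/t zv.
  by rewrite -scalerBl opprB addrAC subrr add0r scaleNr.
have be : bmap c' xh A 1 v p + tspt (dl - t) 0 = tspt dl (- (dl *: v)).
  rewrite bp -[X in _ + X]scale1r tsptD scaler0 addr0 mul1r; congr (tspt _ _).
  by rewrite addrC subrK.
have dv : `|- (dl *: v)| < mu / 4.
  rewrite normrN normrZ gtr0_norm //; apply: le_lt_trans dmu; exact: ler_piMr (ltW dl0) v1.
apply: (no_box_exit Au mu0 bdm bcn sg1 v0 v1 Dp dt0).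
- by rewrite bp; apply: nz_norm => //; lra.
- by rewrite be; apply: nz_norm => //; rewrite gtr0_norm.
move=> x Dx; rewrite be => b0; have [z' [z'm Fz _ bm _]] := bdom_coord Au bdm 1 v Dx.
apply: nhs; exists x; rewrite Fz; congr (par c' (pt _)).
rewrite -[LHS](mulmxK (shear_mx_unit v sg1)) -bm b0 -[RHS](mulmxK (shear_mx_unit v sg1)).
by rewrite mul_shear tspt_ti tspt_s mul1r sub0r.
Qed.

End extension.

Lemma gmetric_C0_inextendible (R : realType) (m : nat) (nu : R -> R) (w : 'I_(m.*2.+1) -> R -> R)
    (G : set (heisenberg R m)) :
  (forall t, 0 < nu t) -> (forall a t, 0 < w a t) -> continuous nu -> (forall a, continuous (w a)) ->
  (forall sgn : R, sgn = 1 \/ sgn = -1 ->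
    exists2 i, i != 0 & forall K, exists T, forall t, T <= sgn * t -> K <= w i t) ->
  discrete_subgroup G -> C0_inextendible (descend G (gmetric nu w)).
Proof.
move=> nu0 w0 nuc wc gr Gd [Y [h [f [[Ysm Yc] hL [[_ fs _] iso] [ro rn]]]]].
exact: (not_extendible nu0 w0 nuc wc gr Gd Ysm hL fs iso Yc ro rn).
Qed.

(** * Growth of the horizontal scale factors *)

Section horizontal_growth.
Context {R : realType} {m : nat}.
Local Notation n := (m.*2.+1).
Variables (A p : 'I_n -> R).
Hypothesis m_gt0 : (0 < m)%N.
Hypothesis A_gt0 : forall a, 0 < A a.
Hypothesis chi_gt0 : forall r : 'I_m, 0 < chi p r.
Variable q : R.
Hypothesis sum_p : \sum_a p a = 1.
Hypothesis sum_p2 : (\sum_a p a ^+ 2) + q ^+ 2 = 1.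

Lemma expR_unbounded (c e K : R) : 0 < c -> 0 < e ->
  exists T, forall t, T <= t -> K <= c * expR (e * t).
Proof.
move=> c0 e0; exists (K / c / e) => t; rewrite !ler_pdivrMr // => Kt.
apply: le_trans Kt _; rewrite mulrC ler_pM2l // mulrC.
by apply: le_trans (expR_ge1Dx _); rewrite lerDr.
Qed.

Lemma wS_horizontal i : i != 0 -> exists r, forall t,
  wS A p i t = A i ^+ 2 * expR (2 * p i * t) * bounce A p r t.
Proof.
have [->|[r [->|->]]] := ix_cases i; first by rewrite eqxx.
  by exists r => t; rewrite wS_odd.
by exists r => t; rewrite wS_even.
Qed.

(** Towards tau = -oo a negative exponent p_i suffices, since F_r >= 1. Towards +oo the scale
    factors of a pair grow with the rates p_{2r-1} + chi_r and p_{2r} + chi_r, whose sum 1 + p_0 +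
    chi_r is positive, so that one of the two is positive. *)
Lemma wS_growing (sgn : R) : (exists i : 'I_n, i != 0 /\ p i < 0) -> sgn = 1 \/ sgn = -1 ->
  exists2 i, i != 0 & forall K, exists T, forall t, T <= sgn * t -> K <= wS A p i t.
Proof.
move=> [i [i0 pi]] [->|->]; last first.
  exists i => // K; have [r wE] := wS_horizontal i0.
  have e0 : 0 < - (2 * p i) by lra.
  have [T TP] := expR_unbounded K (exprn_gt0 2 (A_gt0 i)) e0.
  exists T => t; rewrite mulN1r => /TP; rewrite mulrNN wE => /le_trans; apply.
  by rewrite ler_peMr ?bounce_ge1 // mulr_ge0 ?expR_ge0 // sqr_ge0.
pose r := Ordinal m_gt0; pose k := kappa A r ^+ 2 / (4 * chi p r ^+ 2).
have k0 : 0 < k.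
  have kap0 : 0 < kappa A r by rewrite divr_gt0 // mulr_gt0.
  by rewrite divr_gt0 ?exprn_gt0 // mulr_gt0 // exprn_gt0.
have main j : (forall t, wS A p j t = A j ^+ 2 * expR (2 * p j * t) * bounce A p r t) ->
    0 < p j + chi p r -> forall K, exists T, forall t, T <= 1 * t -> K <= wS A p j t.
  move=> wE pj K; have e0 : 0 < 2 * (p j + chi p r) by rewrite mulr_gt0.
  have [T TP] := expR_unbounded K (mulr_gt0 (exprn_gt0 2 (A_gt0 j)) k0) e0.
  exists T => t; rewrite mul1r => /TP H; apply: le_trans H _; rewrite wE.
  have -> : 2 * (p j + chi p r) * t = 2 * p j * t + 2 * chi p r * t by ring.
  rewrite expRD /bounce -/k.
  have -> : A j ^+ 2 * k * (expR (2 * p j * t) * expR (2 * chi p r * t)) =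
    A j ^+ 2 * expR (2 * p j * t) * (k * expR (2 * chi p r * t)) by ring.
  by rewrite ler_wpM2l ?lerDr // mulr_ge0 ?expR_ge0 // sqr_ge0.
have p0 := exponent_gtN1 sum_p sum_p2 0.
have c0 := chi_gt0 r.
have cE : p (odd_ix r) + p (even_ix r) + chi p r = 1 + p 0 by rewrite /chi; ring.
have [po|po] := ltP 0 (p (odd_ix r) + chi p r).
  by exists (odd_ix r); [rewrite odd_ix_neq0|apply: main => // t; exact: wS_odd].
exists (even_ix r); first by rewrite even_ix_neq0.
by apply: main => [t|]; [exact: wS_even|lra].
Qed.

End horizontal_growth.

Lemma bounce_C0_inextendible (R : realType) (m : nat) (A p : 'I_(m.*2.+1) -> R) (q : R) :
  (0 < m)%N -> (forall a, 0 < A a) -> \sum_a p a = 1 -> (\sum_a p a ^+ 2) + q ^+ 2 = 1 ->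
  (forall r : 'I_m, 0 < chi p r) -> (exists i, i != 0 /\ p i < 0) ->
  forall G : set (heisenberg R m), discrete_subgroup G ->
  C0_inextendible (descend G (Defs.metric A p)).
Proof.
move=> m0 A0 p1 p2 chi0 ip G Gd; rewrite metric_gmetric.
apply: gmetric_C0_inextendible => //.
- exact: nuS_gt0.
- exact: wS_gt0.
- by move=> t; exact: is_derive_continuous (is_derive_nuS A p t).
- by move=> a t; exact: is_derive_continuous (is_derive_wS A p a t).
by move=> sgn; exact: (wS_growing m0 A0 chi0 p1 p2).
Qed.

Theorem proposition8p7 (R : realType) (m : nat) (m_gt0 : (0 < m)%N)
    (A p : 'I_(m.*2.+1) -> R) (q phi0 : R)
    (A_gt0 : forall a, 0 < A a)
    (sum_p : \sum_a p a = 1)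
    (sum_p2 : (\sum_a p a ^+ 2) + q ^+ 2 = 1)
    (chi_gt0 : forall r : 'I_m, 0 < chi p r) :
  [/\ solves_einstein_scalar (metric A p) (scalar_field q phi0),
      range (proper_time A p) = [set t%:E | t in `]0, +oo[%classic],
      forall G : set (heisenberg R m), discrete_subgroup G ->
        future_timelike_null_complete (descend G (metric A p))
          (quotient_time_field G),
      (exists i : 'I_(m.*2.+1), i != 0 /\ p i < 0) ->
        forall G : set (heisenberg R m), discrete_subgroup G ->
          C0_inextendible (descend G (metric A p))
    & q = 0 -> forall x i j, ricci (metric A p) i j x = 0].
Proof.
split.
- exact: bounce_einstein.
- exact: proper_time_range.
- exact: bounce_complete A_gt0 sum_p sum_p2 chi_gt0.
- exact: bounce_C0_inextendible m_gt0 A_gt0 sum_p sum_p2 chi_gt0.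
- by move=> q0 x i j; rewrite (bounce_ricci A_gt0 chi_gt0 sum_p sum_p2) q0 expr0n mulr0.
Qed.
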